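(* Let a non-degenerate Kasner background be given. Consider the first-order form of the wave equation, in the unknowns $(\phi,\psi)$ on $(0,\infty)\times\mathbb{T}^D$, $$t\partial_t\phi=\psi,\qquad t\partial_t\psi=\sum_{i=1}^Dt^{2-2p_i}\partial_{x^i}^2\phi,$$ and set $\varphi(t,\cdot)=\phi(t,\cdot)-\log t\cdot\psi(t,\cdot)$. (i) (Existence of the scattering operator) Let $s>\frac D2+1$. Given $(\phi_C,\psi_C)\in H^{s+1}\times H^s$, there exists a unique classical solution $(\phi,\psi)$ of this system on $(0,\infty)\times\mathbb{T}^D$ with $\phi(1,\cdot)=\phi_C$ and $\partial_t\phi(1,\cdot)=\psi_C$. There exist unique functions $\psi_\infty,\varphi_\infty\in H^s$ such that $$\psi(t,\cdot)\to\psi_\infty\ \text{ in }H^s,\qquad\varphi(t,\cdot)\to\varphi_\infty\ \text{ in }H^s\qquad\text{strongly as }t\to0.$$ Furthermore $\psi_\infty\in H^{s+\frac12}$ and $\varphi_\infty+\log(\mathcal{T}_* )\psi_\infty\in H^{s+\frac12}$. (ii) (Asymptotic completeness) Let $s>\frac D2+1$ and let $\psi_\infty,\varphi_\infty$ be functions on $\mathbb{T}^D$ with $\psi_\infty\in H^{s+\frac12}$ and $\varphi_\infty+\log(\mathcal{T}_* )\psi_\infty\in H^{s+\frac12}$. Then there exists a unique classical solution $(\phi,\psi)$ of the system on $(0,\infty)\times\mathbb{T}^D$, with $$(\phi,\psi)\in C^0((0,\infty),H^{s+1}\times H^s)\cap C^1((0,\infty),H^s\times H^{s-1}),$$ such that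 $\psi(t,\cdot)\to\psi_\infty$ and $\varphi(t,\cdot)\to\varphi_\infty$ in $H^s$ strongly as $t\to0$. (iii) (Scattering isomorphism) For $s\in\mathbb{R}$ define the Hilbert spaces $$\mathcal{H}^s_C=\{(\phi,\psi):\phi\in H^{s+1},\ \psi\in H^s\},\quad\|(\phi,\psi)\|^2_{\mathcal{H}^s_C}=\|\phi\|^2_{H^{s+1}}+\|\psi\|^2_{H^s},$$ $$\mathcal{H}^s_\infty=\{(\psi,\varphi):\psi\in H^{s+\frac12},\ \varphi+\log(\mathcal{T}_* )\psi\in H^{s+\frac12}\},\quad\|(\psi,\varphi)\|^2_{\mathcal{H}^s_\infty}=\|\psi\|^2_{H^{s+\frac12}}+\|\varphi+\log(\mathcal{T}_* )\psi\|^2_{H^{s+\frac12}}.$$ Then the map $\mathcal{S}_\downarrow:(\phi_C,\psi_C)\mapsto(\psi_\infty,\varphi_\infty)$ given by (i) may be extended to a Hilbert space isomorphism $\mathcal{S}_\downarrow:\mathcal{H}^s_C\to\mathcal{H}^s_\infty$, whose inverse $\mathcal{S}_\uparrow=\mathcal{S}_\downarrow^{-1}$ is given by (a suitable extension of) the map taking $(\psi_\infty,\varphi_\infty)$ in (ii) to $(\phi(1,\cdot),\psi(1,\cdot))$.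
   Context: Let $D$ be a positive integer and $\mathbb{T}^D=(\mathbb{R}/2\pi\mathbb{Z})^D$. A Kasner background consists of real numbers $p_1,\dots,p_D,p_\phi$ with $\sum_ip_i=1$, $\sum_ip_i^2+2p_\phi^2=1$; the metric is $-dt^2+\sum_it^{2p_i}(dx^i)^2$ on $(0,\infty)\times\mathbb{T}^D$. It is non-degenerate if it is not the case that all but one of the $p_i$ vanish (so all $p_i<1$). Fourier coefficients: $f_\lambda=(2\pi)^{-D}\int_{\mathbb{T}^D}f(x)e^{-i\lambda\cdot x}dx$, $\lambda\in\mathbb{Z}^D$. $H^s=H^s(\mathbb{T}^D)$ is the Sobolev space with $\|f\|_{H^s}^2=\sum_\lambda\langle\lambda\rangle^{2s}|f_\lambda|^2$, $\langle\lambda\rangle^2=1+|\lambda|^2$. For $\lambda\in\mathbb{Z}^D\setminus\{0\}$ let $t_{\lambda*}>0$ be the unique solution of $\sum_it_{\lambda*}^{2-2p_i}\lambda_i^2=1$, and let $t_{0*}=1$. The operator $\log(\mathcal{T}_* )$ is the Fourier multiplier $(\log(\mathcal{T}_* )f)_\lambda=\log(t_{\lambda*})f_\lambda$. A Hilbert space isomorphism here means a bounded linear bijection with bounded inverse. *)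

(* Defs.v *)
From mathcomp Require Import all_boot.
From Stdlib Require Import Reals Lra Lia ZArith.
From Stdlib Require Import FunctionalExtensionality ClassicalEpsilon.
From Coquelicot Require Import Coquelicot.

From Stdlib Require List.

Set Implicit Arguments.
Unset Strict Implicit.
Unset Printing Implicit Defensive.

Local Open Scope R_scope.

(** * Calculus of complex-valued functions on the torus

    Functions on T^D = (R/2πZ)^D are functions of [x : 'I_D -> R] that are
    2π-periodic in each coordinate.  All functions are complex-valued. *)

Definition pt (D : nat) := 'I_D -> R.

Definition upd D (x : pt D) (i : 'I_D) (h : R) : pt D :=
  fun j => if j == i then h else x j.

Definition periodic D (f : pt D -> C) : Prop :=
  forall i x, f (upd x i (x i + 2 * PI)) = f x.

(* Coquelicot's [Derive] is real-valued; this is its componentwise version, and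
   it is the derivative whenever [ex_Cderive] holds. *)
Definition CDerive (g : R -> C) (t : R) : C :=
  (Derive (fun h => Re (g h)) t, Derive (fun h => Im (g h)) t).

Definition ex_Cderive (g : R -> C) (t : R) : Prop :=
  @ex_derive R_AbsRing C_R_NormedModule g t.

Definition pd D (i : 'I_D) (f : pt D -> C) : pt D -> C :=
  fun x => CDerive (fun h => f (upd x i h)) (x i).

Definition ex_pd D (i : 'I_D) (f : pt D -> C) (x : pt D) : Prop :=
  ex_Cderive (fun h => f (upd x i h)) (x i).

Definition pds D (alpha : seq 'I_D) (f : pt D -> C) : pt D -> C :=
  foldr (@pd D) f alpha.

Definition smooth D (f : pt D -> C) : Prop :=
  forall alpha x,
    continuous (pds alpha f) x /\ forall i, ex_pd i (pds alpha f) x.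

(* Iterated integral over [0, 2π]^D; it is only ever applied to continuous
   functions.  The base point is irrelevant, as every coordinate is
   integrated out. *)
Definition tint D (f : pt D -> C) : C :=
  foldr (fun (i : 'I_D) (F : pt D -> C) (x : pt D) =>
           @RInt C_R_CompleteNormedModule (fun h => F (upd x i h)) 0 (2 * PI))
        f (enum 'I_D) (fun _ => 0).

(** * Periodic distributions *)

Record test (D : nat) := Test {
  test_fun :> pt D -> C;
  test_periodic : periodic test_fun;
  test_smooth : smooth test_fun }.

(* Continuous linear functionals on the Fréchet space C^∞(T^D). *)
Record distribution (D : nat) := Dist {
  dist_fun :> test D -> C;
  dist_linear : forall (a : C) (f g h : test D),
    (forall x, h x = (a * f x + g x)%C) ->
    dist_fun h = (a * dist_fun f + dist_fun g)%C;
  dist_cont : exists (N : nat) (K : R), forall (f : test D) (M : R),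
    (forall alpha x, (size alpha <= N)%nat -> Cmod (pds alpha f x) <= M) ->
    Cmod (dist_fun f) <= K * M }.

Notation dpair D := (distribution D * distribution D)%type.

(* [u] is the distribution defined by the continuous function [f]. *)
Definition regular D (f : pt D -> C) (u : distribution D) : Prop :=
  forall g : test D, u g = tint (fun x => (f x * g x)%C).

Lemma dist_add_linear D (u v : distribution D) (a : C) (f g h : test D) :
  (forall x, h x = (a * f x + g x)%C) ->
  (u h + v h = a * (u f + v f) + (u g + v g))%C.
Proof.
move=> e; rewrite (dist_linear u e) (dist_linear v e); ring.
Qed.

Lemma dist_add_cont D (u v : distribution D) :
  exists (N : nat) (K : R), forall (f : test D) (M : R),
    (forall alpha x, (size alpha <= N)%nat -> Cmod (pds alpha f x) <= M) ->
    Cmod (u f + v f)%C <= K * M.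
Proof.
have [N1 [K1 H1]] := dist_cont u; have [N2 [K2 H2]] := dist_cont v.
exists (maxn N1 N2), (K1 + K2) => f M HM.
have h1 : Cmod (u f) <= K1 * M.
  by apply: H1 => al x le; apply: HM; rewrite leq_max le.
have h2 : Cmod (v f) <= K2 * M.
  by apply: H2 => al x le; apply: HM; rewrite leq_max le orbT.
have := Cmod_triangle (u f) (v f); lra.
Qed.

Definition dist_add D (u v : distribution D) : distribution D :=
  Dist (@dist_add_linear D u v) (dist_add_cont u v).

Lemma dist_scal_linear D (c : C) (u : distribution D) (a : C) (f g h : test D) :
  (forall x, h x = (a * f x + g x)%C) ->
  (c * u h = a * (c * u f) + c * u g)%C.
Proof. move=> e; rewrite (dist_linear u e); ring. Qed.

Lemma dist_scal_cont D (c : C) (u : distribution D) :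
  exists (N : nat) (K : R), forall (f : test D) (M : R),
    (forall alpha x, (size alpha <= N)%nat -> Cmod (pds alpha f x) <= M) ->
    Cmod (c * u f)%C <= K * M.
Proof.
have [N [K H]] := dist_cont u.
exists N, (Cmod c * K) => f M /H h; rewrite Cmod_mult Rmult_assoc.
by apply: Rmult_le_compat_l => //; apply: Cmod_ge_0.
Qed.

Definition dist_scal D (c : C) (u : distribution D) : distribution D :=
  Dist (@dist_scal_linear D c u) (dist_scal_cont c u).

(** * Fourier coefficients *)

Definition freq (D : nat) := 'I_D -> Z.

Definition expi D (l : freq D) (x : pt D) : C :=
  let th := \big[Rplus/0]_(i < D) (IZR (l i) * x i) in (cos th, sin th).

Lemma phase_upd D (l : freq D) (x : pt D) i h :
  \big[Rplus/0]_(j < D) (IZR (l j) * upd x i h j) =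
  \big[Rplus/0]_(j < D) (IZR (l j) * x j) + IZR (l i) * (h - x i).
Proof.
have aux (s : seq 'I_D) : uniq s ->
  \big[Rplus/0]_(j <- s) (IZR (l j) * upd x i h j) =
  \big[Rplus/0]_(j <- s) (IZR (l j) * x j)
    + (if i \in s then IZR (l i) * (h - x i) else 0).
  elim: s => [|j s IH] /=; first by rewrite !big_nil; lra.
  case/andP=> nj us; rewrite !big_cons (IH us) in_cons /upd eq_sym.
  case: (i =P j) => [e|_] /=; last by case: ifP => _; lra.
  by rewrite e (negbTE nj); lra.
by rewrite (aux _ (index_enum_uniq _)) mem_index_enum.
Qed.

Lemma expi_periodic D (l : freq D) : periodic (expi l).
Proof.
move=> i x; rewrite /expi phase_upd.
set th := \big[_/_]_(_ < _) _.
have -> : th + IZR (l i) * (x i + 2 * PI - x i) = th + 2 * IZR (l i) * PI by ring.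
have per n (y : R) : cos (y + 2 * IZR n * PI) = cos y
                    /\ sin (y + 2 * IZR n * PI) = sin y.
  have [k [->|->]] : exists k, n = Z.of_nat k \/ n = Z.opp (Z.of_nat k).
  - by exists (Z.abs_nat n); lia.
  - by rewrite -INR_IZR_INZ cos_period sin_period.
  rewrite opp_IZR -INR_IZR_INZ.
  rewrite -(cos_period (y + 2 * - INR k * PI) k).
  rewrite -(sin_period (y + 2 * - INR k * PI) k).
  by have -> : y + 2 * - INR k * PI + 2 * INR k * PI = y by ring.
by case: (per (l i) th) => -> ->.
Qed.

Lemma is_derive_pair (f g : R -> R) (t a b : R) :
  is_derive f t a -> is_derive g t b ->
  @is_derive R_AbsRing C_R_NormedModule (fun h => (f h, g h)) t (a, b).
Proof.
move=> df dg.
have d1 := @is_derive_scal_l R_AbsRing C_R_NormedModule f t a (1, 0) df.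
have d2 := @is_derive_scal_l R_AbsRing C_R_NormedModule g t b (0, 1) dg.
have d := @is_derive_plus R_AbsRing C_R_NormedModule _ _ _ _ _ d1 d2.
have E (p q : R) : @plus C_R_NormedModule
    (scal (p : R_AbsRing) ((1, 0) : C_R_NormedModule))
    (scal (q : R_AbsRing) ((0, 1) : C_R_NormedModule)) = (p, q).
  by rewrite /plus /scal /= /prod_plus /prod_scal /= /plus /scal /= /mult /=;
     congr pair; ring.
rewrite -(E a b); apply: is_derive_ext d => h; exact: E.
Qed.

Lemma expi_line D (c : C) (l : freq D) i x :
  @is_derive R_AbsRing C_R_NormedModule
    (fun h => (c * expi l (upd x i h))%C) (x i)
    (c * (Ci * IZR (l i)) * expi l x)%C.
Proof.
set th := \big[Rplus/0]_(j < D) (IZR (l j) * x j).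
case: c => a b.
have -> : ((a, b) * (Ci * IZR (l i)) * expi l x)%C =
  (IZR (l i) * (- a * sin th - b * cos th),
   IZR (l i) * (a * cos th - b * sin th)).
  by rewrite /expi -/th /Cmult /=; congr pair; ring.
apply: (@is_derive_ext _ _ (fun h : R =>
   (a * cos (th + IZR (l i) * (h - x i)) - b * sin (th + IZR (l i) * (h - x i)),
    a * sin (th + IZR (l i) * (h - x i)) + b * cos (th + IZR (l i) * (h - x i))))).
  by move=> h; rewrite /expi phase_upd.
apply: is_derive_pair; auto_derive => //;
  have -> : th + IZR (l i) * (x i - x i) = th by ring.
all: try ring.
all: have -> : th + IZR (l i) * (x i + - x i) = th by ring.
all: ring.
Qed.

Lemma is_derive_Re (g : R -> C) t (l : C) :
  @is_derive R_AbsRing C_R_NormedModule g t l ->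
  is_derive (fun h => Re (g h)) t (Re l) /\ is_derive (fun h => Im (g h)) t (Im l).
Proof.
move=> dg; split.
- have := filterdiff_comp g (fun z : C_R_NormedModule => fst z) _ _ dg
    (filterdiff_linear _ is_linear_fst).
  by apply; apply: locally_filter.
- have := filterdiff_comp g (fun z : C_R_NormedModule => snd z) _ _ dg
    (filterdiff_linear _ is_linear_snd).
  by apply; apply: locally_filter.
Qed.

Lemma expi_pds D (l : freq D) alpha :
  exists c : C, pds alpha (expi l) = fun x => (c * expi l x)%C.
Proof.
elim: alpha => [|i al [c IH]].
  by exists 1; apply: functional_extensionality => x; rewrite /pds /=; ring.
exists (c * (Ci * IZR (l i)))%C.
apply: functional_extensionality => x; rewrite /pds /= -/(pds al _) IH.
have [/is_derive_unique e1 /is_derive_unique e2] := is_derive_Re (expi_line c l i x).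
by rewrite /pd /CDerive e1 e2; case: (Cmult _ _).
Qed.

Lemma expi_continuous D (l : freq D) (c : C) x :
  continuous (fun y : pt D => (c * expi l y)%C) x.
Proof.
pose th (y : pt D) := \big[Rplus/0]_(i < D) (IZR (l i) * y i).
have cth : continuous th x.
  rewrite /th; elim: (index_enum _) => [|i s IH].
    apply: (continuous_ext (fun _ => 0)); last exact: continuous_const.
    by move=> y; rewrite big_nil.
  apply: (continuous_ext (fun y => plus (IZR (l i) * y i)
            (\big[Rplus/0]_(i <- s) (IZR (l i) * y i)))).
    by move=> y; rewrite big_cons.
  apply: continuous_plus IH.
  have sc (k : R) (f : pt D -> R) : continuous f x -> continuous (fun y => k * f y) x.
    exact: (@continuous_scal_r _ R_AbsRing R_NormedModule k f x).
  apply: (sc (IZR (l i)) (fun y : pt D => y i)).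
  move=> P [e He]; exists e => y Hy; apply: He; exact: (Hy i).
have cp (f g : pt D -> R) : continuous f x -> continuous g x ->
  continuous (fun y => (f y, g y) : C) x.
  move=> cf cg P [e He].
  have hf := cf _ (locally_ball (f x) e).
  have hg := cg _ (locally_ball (g x) e).
  have hfg : locally x (fun y => ball (f x) e (f y) /\ ball (g x) e (g y)).
    exact: (@filter_and _ (locally x) _ _ _ hf hg).
  rewrite /filtermap; apply: (@filter_imp _ (locally x) _ _ _ _ hfg) => y [h1 h2].
  by apply: He; split.
case: c => a b.
have cc : continuous (fun y => cos (th y)) x.
  exact: (@continuous_comp _ _ R_UniformSpace th cos x cth (continuous_cos _)).
have cs : continuous (fun y => sin (th y)) x.
  exact: (@continuous_comp _ _ R_UniformSpace th sin x cth (continuous_sin _)).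
have sc (k : R) (f : pt D -> R) : continuous f x -> continuous (fun y => k * f y) x.
  exact: (@continuous_scal_r _ R_AbsRing R_NormedModule k f x).
apply: cp.
- apply: (continuous_minus (V := R_NormedModule)); exact: sc.
- apply: (continuous_plus (V := R_NormedModule)); exact: sc.
Qed.

Lemma expi_smooth D (l : freq D) : smooth (expi l).
Proof.
move=> al x; have [c ->] := expi_pds l al; split.
  exact: expi_continuous.
by move=> i; exists (c * (Ci * IZR (l i)) * expi l x)%C; apply: expi_line.
Qed.

Definition expi_test D (l : freq D) : test D :=
  Test (@expi_periodic D l) (@expi_smooth D l).

Definition opp_freq D (l : freq D) : freq D := fun i => Z.opp (l i).

(* [(2π)^-D <u, e^{-iλ·x}>]; for the distribution defined by a continuous
   function f this is [(2π)^-D ∫ f(x) e^{-iλ·x} dx]. *)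
Definition fourier D (u : distribution D) (l : freq D) : C :=
  (u (expi_test (opp_freq l)) / RtoC ((2 * PI) ^ D))%C.

(** * Sobolev spaces

    [H^s] and its norm only see the Fourier coefficients, so they are defined on
    families [c : freq D -> C]; a distribution [u] belongs to [H^s] when
    [Hs s (fourier u)]. *)

Definition normsq D (l : freq D) : R := \big[Rplus/0]_(i < D) (IZR (l i)) ^ 2.

(* Unordered sum over Z^D of a nonnegative family. *)
Definition nnsum D (a : freq D -> R) : Rbar :=
  Lub_Rbar (fun r => exists s : seq (freq D),
    List.NoDup s /\ r = \big[Rplus/0]_(l <- s) a l).

(* [(1 + |λ|^2)^s] is [<λ>^{2s}]. *)
Definition Hs_sum D (s : R) (c : freq D -> C) : Rbar :=
  nnsum (fun l => Rpower (1 + normsq l) s * (Cmod (c l)) ^ 2).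

Definition Hs D (s : R) (c : freq D -> C) : Prop := is_finite (Hs_sum s c).

(* Meaningful only when [Hs s c] holds, since [real p_infty = 0]. *)
Definition Hs_normsq D (s : R) (c : freq D -> C) : R := real (Hs_sum s c).
Definition Hs_norm D (s : R) (c : freq D -> C) : R := sqrt (Hs_normsq s c).

Definition dist_sub D (u v : distribution D) : distribution D :=
  dist_add u (dist_scal (RtoC (-1)) v).

(* Used only when [v] and the [u t] belong to [H^s]. *)
Definition Hs_cvg D (s : R) (F : (R -> Prop) -> Prop)
    (u : R -> distribution D) (v : distribution D) : Prop :=
  filterlim (fun t => Hs_norm s (fourier (dist_sub (u t) v))) F (locally 0).

Definition C0_Hs D (s : R) (u : R -> distribution D) : Prop :=
  (forall t, 0 < t -> Hs s (fourier (u t))) /\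
  (forall t, 0 < t -> Hs_cvg s (locally t) u (u t)).

Definition C1_Hs D (s : R) (u : R -> distribution D) : Prop :=
  C0_Hs s u /\
  exists u' : R -> distribution D, C0_Hs s u' /\
    forall t, 0 < t ->
      Hs_cvg s (locally' t)
        (fun r => dist_scal (RtoC (/ (r - t))) (dist_sub (u r) (u t))) (u' t).

(* The time-dependent function [f] on (0,∞) x T^D, seen as a curve of
   distributions. *)
Definition curve D (f : R -> pt D -> C) (u : R -> distribution D) : Prop :=
  forall t, 0 < t -> regular (f t) (u t).

Definition tends_to_Hs D (s : R) (f : R -> pt D -> C) (v : distribution D) : Prop :=
  exists u, [/\ curve f u, (forall t, 0 < t -> Hs s (fourier (u t))),
                Hs s (fourier v) & Hs_cvg s (at_right 0) u v].

(** * Kasner backgrounds and the wave equation *)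

Definition kasner D (p : 'I_D -> R) (pphi : R) : Prop :=
  \big[Rplus/0]_(i < D) p i = 1 /\
  \big[Rplus/0]_(i < D) (p i) ^ 2 + 2 * pphi ^ 2 = 1.

Definition nondegenerate D (p : 'I_D -> R) : Prop :=
  ~ exists i : 'I_D, forall j, j <> i -> p j = 0.

(* The time t_{λ*}.  For a non-degenerate background the property below has
   exactly one solution. *)
Definition tstar D (p : 'I_D -> R) (l : freq D) : R :=
  epsilon (inhabits 1) (fun t => 0 < t /\
    (l = (fun _ => Z0) /\ t = 1 \/
     l <> (fun _ => Z0) /\
     \big[Rplus/0]_(i < D) (Rpower t (2 - 2 * p i) * (IZR (l i)) ^ 2) = 1)).

(* log T_*, acting on Fourier coefficients. *)
Definition logT D (p : 'I_D -> R) (c : freq D -> C) : freq D -> C :=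
  fun l => (RtoC (ln (tstar p l)) * c l)%C.

Definition dt D (f : R -> pt D -> C) : R -> pt D -> C :=
  fun t x => CDerive (fun r => f r x) t.

Definition dx D (i : 'I_D) (f : R -> pt D -> C) : R -> pt D -> C :=
  fun t => pd i (f t).

Definition C0_st D (f : R -> pt D -> C) : Prop :=
  forall t x, 0 < t -> continuous (fun z : R * pt D => f z.1 z.2) (t, x).

Definition C1_st D (f : R -> pt D -> C) : Prop :=
  C0_st f /\
  (forall t x, 0 < t ->
     ex_Cderive (fun r => f r x) t /\ forall i, ex_pd i (f t) x) /\
  C0_st (dt f) /\ forall i, C0_st (dx i f).

Definition C2_st D (f : R -> pt D -> C) : Prop :=
  C1_st f /\ C1_st (dt f) /\ forall i, C1_st (dx i f).

(* Classical solutions of the first-order system on (0,∞) x T^D; values at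
   t <= 0 are irrelevant. *)
Definition classical_solution D (p : 'I_D -> R) (phi psi : R -> pt D -> C) : Prop :=
  [/\ forall t, 0 < t -> periodic (phi t) /\ periodic (psi t),
      C2_st phi /\ C1_st psi,
      forall t x, 0 < t -> (RtoC t * dt phi t x)%C = psi t x &
      forall t x, 0 < t -> (RtoC t * dt psi t x)%C =
        \big[Cplus/RtoC 0]_(i < D)
          (RtoC (Rpower t (2 - 2 * p i)) * dx i (dx i phi) t x)%C].

Definition same_solution D (phi psi phi' psi' : R -> pt D -> C) : Prop :=
  forall t x, 0 < t -> phi' t x = phi t x /\ psi' t x = psi t x.

(* There is exactly one pair of functions on (0,∞) x T^D satisfying [P]. *)
Definition exists_unique_solution D
    (P : (R -> pt D -> C) -> (R -> pt D -> C) -> Prop) : Prop :=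
  exists phi psi, P phi psi /\
    forall phi' psi', P phi' psi' -> same_solution phi psi phi' psi'.

Definition cauchy_data D (phi : R -> pt D -> C) (phiC psiC : distribution D) : Prop :=
  regular (phi 1) phiC /\ regular (dt phi 1) psiC.

(* [z = (ψ_∞, φ_∞)], where [φ_∞] is the limit of [φ - log t ψ]. *)
Definition scattering_data D (s : R) (phi psi : R -> pt D -> C)
    (z : dpair D) : Prop :=
  tends_to_Hs s psi z.1 /\
  tends_to_Hs s (fun t x => (phi t x - RtoC (ln t) * psi t x)%C) z.2.

(* (φ, ψ) in C^0(H^{s+1} x H^s) and C^1(H^s x H^{s-1}). *)
Definition sobolev_regular D (s : R) (phi psi : R -> pt D -> C) : Prop :=
  exists u v, [/\ curve phi u, curve psi v, C0_Hs (s + 1) u /\ C0_Hs s v &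
                  C1_Hs s u /\ C1_Hs (s - 1) v].

(** * The Hilbert spaces of Cauchy data and of scattering data *)

Definition HC D (s : R) (z : dpair D) : Prop :=
  Hs (s + 1) (fourier z.1) /\ Hs s (fourier z.2).

Definition HC_norm D (s : R) (z : dpair D) : R :=
  sqrt (Hs_normsq (s + 1) (fourier z.1) + Hs_normsq s (fourier z.2)).

(* Fourier coefficients of [φ + log T_* ψ], for [z = (ψ, φ)]. *)
Definition renormalized D (p : 'I_D -> R) (z : dpair D) : freq D -> C :=
  fun l => (fourier z.2 l + logT p (fourier z.1) l)%C.

Definition Hinf D (p : 'I_D -> R) (s : R) (z : dpair D) : Prop :=
  Hs (s + 1 / 2) (fourier z.1) /\ Hs (s + 1 / 2) (renormalized p z).

Definition Hinf_norm D (p : 'I_D -> R) (s : R) (z : dpair D) : R :=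
  sqrt (Hs_normsq (s + 1 / 2) (fourier z.1)
        + Hs_normsq (s + 1 / 2) (renormalized p z)).

Definition pair_axpy D (a : C) (z w : dpair D) : dpair D :=
  (dist_add (dist_scal a z.1) w.1, dist_add (dist_scal a z.2) w.2).

Definition bounded_linear D (X Y : dpair D -> Prop)
    (nX nY : dpair D -> R) (f : dpair D -> dpair D) : Prop :=
  [/\ forall z, X z -> Y (f z),
      forall a z w, X z -> X w -> f (pair_axpy a z w) = pair_axpy a (f z) (f w) &
      exists K : R, forall z, X z -> nY (f z) <= K * nX z].

(* [f] restricts to an isomorphism from X to Y with inverse [g]; values outside
   X and Y are irrelevant. *)
Definition hilbert_iso D (X Y : dpair D -> Prop)
    (nX nY : dpair D -> R)
    (f g : dpair D -> dpair D) : Prop :=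
  [/\ bounded_linear X Y nX nY f, bounded_linear Y X nY nX g,
      forall z, X z -> g (f z) = z & forall w, Y w -> f (g w) = w].

(* Main.v *)
From HB Require Import structures.
Require Import Defs.
From mathcomp Require Import all_boot.
From Stdlib Require Import Reals Lra Lia ZArith.
From Stdlib Require Import FunctionalExtensionality ClassicalEpsilon.
From Coquelicot Require Import Coquelicot.
From Stdlib Require List.

Set Implicit Arguments.
Unset Strict Implicit.
Unset Printing Implicit Defensive.

Local Open Scope R_scope.

(** In the time tau = log t the Fourier mode of frequency λ solves y' = z,
    z' = - q y with q(tau) = sum_i exp((2 - 2 p_i) tau) λ_i^2.  Non-degeneracy makes
    all exponents positive, so that c q <= q' <= 4 q with c > 0 independent of λ.
    Everything rests on estimates for this equation that are uniform in λ.

    For λ <> 0 the potential equals 1 at exactly one time, T = log t_{λ*} <= 0.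
    Between T and 0 it is at least 1 and the solution oscillates; the adiabatic energy
    sqrt q y^2 + z^2 / sqrt q, corrected by a multiple of y z, is conserved up to a
    constant factor ([wkb_bound]).  Before T the potential is exponentially small and
    the motion is nearly free: z and y - (tau - T) z converge to limits Z and X, and
    z^2 + (y - (tau - T) z)^2 is conserved up to a constant factor ([free_bound],
    [free_limit]).  At T both energies coincide.  Since X = Φ + T Z when Φ is the limit
    of y - tau z, it follows ([mode_asymptotics]) that

      <λ> |y(0)|^2 + <λ>^-1 |z(0)|^2   and   |Z|^2 + |Φ + T Z|^2

    are comparable, uniformly in λ.  Multiplied by <λ>^(2s+1) and summed over λ, this is
    the equivalence of the norms of H_C and H_∞, with log T_* acting as multiplication
    by T.  The map (y(0), z(0)) -> (Z, Φ) is a matrix of determinant 1 by conservation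
    of the Wronskian ([wronskian]), which gives the inverse ([scattering_iso]).

    For s > D/2 + 1 the Fourier coefficients are absolutely summable with two
    derivatives to spare, so that the modes sum to a classical solution
    ([classical_synth]), with the stated Sobolev regularity ([sobolev_synth]).
    Convergence in H^s as t tends to 0 is dominated convergence: the bounds for a mode
    hold up to the limit with the loss of one factor <λ> in the squares
    ([scattering_synth]).  Conversely the coefficients of any classical solution solve
    the mode equations, and its limits are given by the same matrix
    ([classical_modes], [scattering_coefs]); this gives all uniqueness statements, once
    continuous functions ([fourier_unique]) and distributions ([dist_ext]) are known to
    be determined by their Fourier coefficients, and every polynomially bounded family
    of coefficients to come from a distribution ([dist_exists]). *)

(** * Filters, series and big operators over the reals *)

Fact RplusA : associative Rplus. Proof. by move=> x y z; ring. Qed.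
Fact RplusC : commutative Rplus. Proof. by move=> x y; ring. Qed.
Fact Rplus0 : left_id 0 Rplus. Proof. by move=> x; ring. Qed.
HB.instance Definition _ := Monoid.isComLaw.Build R 0 Rplus RplusA RplusC Rplus0.
Fact RmultA : associative Rmult. Proof. by move=> x y z; ring. Qed.
Fact RmultC : commutative Rmult. Proof. by move=> x y; ring. Qed.
Fact Rmult1 : left_id 1 Rmult. Proof. by move=> x; ring. Qed.
HB.instance Definition _ := Monoid.isComLaw.Build R 1 Rmult RmultA RmultC Rmult1.
Fact Rmult0l : left_zero 0 Rmult. Proof. by move=> x; ring. Qed.
Fact Rmult0r : right_zero 0 Rmult. Proof. by move=> x; ring. Qed.
HB.instance Definition _ := Monoid.isMulLaw.Build R 0 Rmult Rmult0l Rmult0r.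
Fact RmultDl : left_distributive Rmult Rplus. Proof. by move=> x y z; ring. Qed.
Fact RmultDr : right_distributive Rmult Rplus. Proof. by move=> x y z; ring. Qed.
HB.instance Definition _ := Monoid.isAddLaw.Build R Rmult Rplus RmultDl RmultDr.

Lemma filterlim_R (T : Type) (F : (T -> Prop) -> Prop) (FF : Filter F) (f : T -> R) l :
  filterlim f F (locally l) <->
  forall eps, 0 < eps -> F (fun y => Rabs (f y - l) < eps).
Proof.
split=> [/filterlim_locally H eps e0|H]; first exact: (H (mkposreal eps e0)).
by apply/filterlim_locally => -[eps e0]; apply: H.
Qed.

Lemma filterlim_Rplus (T : Type) (F : (T -> Prop) -> Prop) (FF : Filter F) (f g : T -> R) a b :
  filterlim f F (locally a) -> filterlim g F (locally b) ->
  filterlim (fun y => f y + g y) F (locally (a + b)).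
Proof. by move=> hf hg; apply: (filterlim_comp_2 _ _ Rplus hf hg); exact: (filterlim_plus (V := R_NormedModule) a b). Qed.

Lemma filterlim_Rscal (T : Type) (F : (T -> Prop) -> Prop) (FF : Filter F) (f : T -> R) a k :
  filterlim f F (locally a) -> filterlim (fun y => k * f y) F (locally (k * a)).
Proof. by move=> hf; apply: (filterlim_comp _ _ _ _ (Rmult k) _ _ _ hf); exact: (filterlim_scal_r (V := R_NormedModule) k a). Qed.

Lemma filterlim_Rmult (T : Type) (F : (T -> Prop) -> Prop) (FF : Filter F) (f g : T -> R) a b :
  filterlim f F (locally a) -> filterlim g F (locally b) ->
  filterlim (fun y => f y * g y) F (locally (a * b)).
Proof. by move=> hf hg; apply: (filterlim_comp_2 _ _ Rmult hf hg); exact: (filterlim_mult (K := R_AbsRing) a b). Qed.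

(** Splitting each series at a rank beyond which the majorant sums to less than
    eps / 3 leaves a finite sum, where the limit is taken term by term. *)
Lemma Tannery (T : Type) (F : (T -> Prop) -> Prop) (FF : Filter F)
    (b : T -> nat -> R) (b0 M : nat -> R) :
  ex_series M -> (forall n, Rabs (b0 n) <= M n) ->
  F (fun y => forall n, Rabs (b y n) <= M n) ->
  (forall n, filterlim (fun y => b y n) F (locally (b0 n))) ->
  filterlim (fun y => Series (b y)) F (locally (Series b0)).
Proof.
move=> exM hb0 hb hlim; apply/filterlim_R => eps e0.
have [N HN] : exists N, Series (fun k => M (N.+1 + k)%coq_nat) < eps / 3.
  have /filterlim_R h := Series_correct _ exM.
  have [N HN] := h (eps / 3) ltac:(lra).
  exists N; have := HN N (le_n _).
  rewrite (@Series_incr_n M N.+1) ?sum_n_Reals /=; [|lia|by []].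
  by move/Rabs_def2; lra.
have tail a : (forall n, Rabs (a n) <= M n) ->
    Rabs (Series a - sum_n a N) < eps / 3.
  move=> ha; rewrite (@Series_incr_n a N.+1) ?sum_n_Reals /=; [|lia|]; last first.
    by apply: (@ex_series_le R_AbsRing R_CompleteNormedModule a M ha).
  set S1 := sum_f_R0 _ _; have E x : S1 + x - S1 = x by ring.
  rewrite E {E S1}.
  have exM' : ex_series (fun k => M (N.+1 + k)%coq_nat) by exact: (proj1 (ex_series_incr_n M N.+1)).
  apply: Rle_lt_trans (HN); apply: (Rle_trans _ _ _ (Series_Rabs _ _)).
    apply: (@ex_series_le R_AbsRing R_CompleteNormedModule _ _ _ exM') => n.
    by rewrite /norm /= /abs /= Rabs_Rabsolu.
  by apply: Series_le exM' => n; split; [apply: Rabs_pos|apply: ha].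
have fin : filterlim (fun y => sum_n (b y) N) F (locally (sum_n b0 N)).
  elim: N {HN tail} => [|N IH].
    by rewrite sum_O; apply: filterlim_ext (hlim 0%nat) => y; rewrite sum_O.
  rewrite sum_Sn; apply: (@filterlim_ext _ _ _ _ _ (fun y => sum_n (b y) N + b y N.+1)).
    by move=> y; rewrite sum_Sn.
  exact: filterlim_Rplus.
move/filterlim_R: fin => /(_ (eps / 3) ltac:(lra)) fin.
apply: (filter_imp _ _ _ (filter_and _ _ hb fin)) => y [h1 h2].
have := tail _ h1; have := tail _ hb0.
move=> /Rabs_def2 t0 /Rabs_def2 t1; move/Rabs_def2: h2 => h2.
by apply: Rabs_def1; lra.
Qed.

Lemma is_series_single (a : nat -> R) N :
  (forall n, n <> N -> a n = 0) -> is_series a (a N).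
Proof.
move=> h; apply: (@filterlim_ext_loc _ _ _ _ _ (fun _ => a N)); last exact: filterlim_const.
exists N => n /leP; elim: n => [|n IH] le.
  by rewrite sum_O; move: le; rewrite leqn0 => /eqP ->.
rewrite sum_Sn; case: (n.+1 =P N) le => [e _|ne le]; last first.
  by rewrite -IH; [rewrite (h n.+1) // /plus /=; lra|rewrite -ltnS ltn_neqAle le andbT eq_sym; apply/eqP].
rewrite -e; have -> : sum_n a n = 0; last by rewrite /plus /=; lra.
have : forall m, (m <= n)%nat -> a m = 0.
  by move=> m lm; apply: h => em; move: lm; rewrite em -e ltnn.
elim: n {IH e} => [|n IH] hz; first by rewrite sum_O hz.
by rewrite sum_Sn IH ?hz // /plus /=; [lra|move=> m lm; apply: hz; apply: leqW].
Qed.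

(** * Unordered sums over the lattice of frequencies *)

(** Frequencies are enumerated by an injective code, so that unordered sums over
    Z^D become ordinary series; numbers outside the image of the code contribute
    0. *)
Definition code D (l : freq D) : nat :=
  pickle ([ffun i => (Z.abs_nat (l i), (0 <=? l i)%Z)] : {ffun 'I_D -> nat * bool}).

Lemma code_inj D : injective (@code D).
Proof.
move=> l m /(pcan_inj pickleK) /ffunP e; apply: functional_extensionality => i.
by have := e i; rewrite !ffunE => -[]; lia.
Qed.

Definition dec D (n : nat) : option (freq D) :=
  match excluded_middle_informative (exists l : freq D, code l = n) with
  | left h => Some (proj1_sig (constructive_indefinite_description _ h))
  | right _ => None
  end.

Lemma dec_code D (l : freq D) : dec D (code l) = Some l.
Proof.
rewrite /dec; case: excluded_middle_informative => [h|[]]; last by exists l.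
by case: constructive_indefinite_description => m /= /code_inj ->.
Qed.

Lemma code_dec D n (l : freq D) : dec D n = Some l -> code l = n.
Proof.
rewrite /dec; case: excluded_middle_informative => // h [<-].
by case: constructive_indefinite_description.
Qed.

Definition seqof D (a : freq D -> R) (n : nat) : R := oapp a 0 (dec D n).
Definition rsum D (a : freq D -> R) : R := Series (seqof a).
Definition summable D (a : freq D -> R) : Prop := ex_series (seqof (fun l => Rabs (a l))).

Lemma seqof_abs D (a : freq D -> R) n : seqof (fun l => Rabs (a l)) n = Rabs (seqof a n).
Proof. by rewrite /seqof; case: (dec D n) => //=; rewrite Rabs_R0. Qed.

Lemma summable_ex D (a : freq D -> R) : summable a -> ex_series (seqof a).
Proof.
move=> h; apply: ex_series_Rabs; apply: ex_series_ext h => n; exact: seqof_abs.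
Qed.

Lemma summable_le D (a M : freq D -> R) :
  (forall l, Rabs (a l) <= M l) -> summable M -> summable a.
Proof.
move=> h sM; apply: (@ex_series_le R_AbsRing R_CompleteNormedModule _ (seqof M)); last exact: summable_ex.
move=> n; rewrite /norm /= /abs /= /seqof; case: (dec D n) => [l|] /=.
  by rewrite Rabs_Rabsolu.
by rewrite Rabs_R0; lra.
Qed.

Lemma summable_abs D (a : freq D -> R) : summable a -> summable (fun l => Rabs (a l)).
Proof. by move=> h; apply: ex_series_ext h => n; congr seqof; apply: functional_extensionality => l; rewrite Rabs_Rabsolu. Qed.

Lemma summable_plus D (a b : freq D -> R) :
  summable a -> summable b -> summable (fun l => a l + b l).
Proof.
move=> sa sb; apply: (@summable_le _ _ (fun l => Rabs (a l) + Rabs (b l))).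
  by move=> l; apply: Rabs_triang.
apply: (ex_series_ext _ _ _ (ex_series_plus _ _ sa sb)) => n.
rewrite /plus /= /seqof; case: (dec D n) => [l|] /=; last by lra.
by rewrite (Rabs_pos_eq (_ + _)) //; apply: Rplus_le_le_0_compat; apply: Rabs_pos.
Qed.

Lemma summable_scal D (a : freq D -> R) k : summable a -> summable (fun l => k * a l).
Proof.
move=> sa; apply: (ex_series_ext _ _ _ (ex_series_scal_l (Rabs k) _ sa)) => n.
by rewrite /seqof; case: (dec D n) => [l|] /=; rewrite ?Rabs_mult // /scal /= /mult /=; lra.
Qed.

Lemma summable_ext D (a b : freq D -> R) : (forall l, a l = b l) -> summable a -> summable b.
Proof. by move=> e; have -> : a = b by apply: functional_extensionality. Qed.

Lemma rsum_ext D (a b : freq D -> R) : (forall l, a l = b l) -> rsum a = rsum b.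
Proof. by move=> e; have -> : a = b by apply: functional_extensionality. Qed.

Lemma rsum_plus D (a b : freq D -> R) : summable a -> summable b ->
  rsum (fun l => a l + b l) = rsum a + rsum b.
Proof.
move=> sa sb; rewrite /rsum -Series_plus; try exact: summable_ex.
by apply: Series_ext => n; rewrite /seqof; case: (dec D n) => //=; lra.
Qed.

Lemma rsum_scal D (a : freq D -> R) k : rsum (fun l => k * a l) = k * rsum a.
Proof.
rewrite /rsum -Series_scal_l.
by apply: Series_ext => n; rewrite /seqof; case: (dec D n) => //=; lra.
Qed.

Lemma rsum_le D (a b : freq D -> R) : summable a -> summable b ->
  (forall l, a l <= b l) -> rsum a <= rsum b.
Proof.
move=> sa sb h.
have : 0 <= rsum (fun l => b l + (-1) * a l); last first.
  by rewrite rsum_plus ?rsum_scal //; [lra|apply: summable_scal].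
have sd := summable_plus sb (summable_scal (-1) sa).
rewrite /rsum -(Rmult_0_l (Series (fun _ => 0))) -Series_scal_l.
apply: Series_le; last exact: summable_ex.
by move=> n; rewrite /seqof; case: (dec D n) => [l|] /=; [have := h l|]; lra.
Qed.

Lemma rsum_ge0 D (a : freq D -> R) : summable a -> (forall l, 0 <= a l) -> 0 <= rsum a.
Proof.
move=> sa h; have := @rsum_le _ (fun l => 0 * a l) a (summable_scal 0 sa) sa.
by rewrite rsum_scal => H; have := H (fun l => ltac:(have := h l; lra)); lra.
Qed.

Lemma rsum_abs D (a : freq D -> R) : summable a -> Rabs (rsum a) <= rsum (fun l => Rabs (a l)).
Proof.
move=> sa; have sb := summable_abs sa.
apply: Rabs_le; split; last by apply: rsum_le => // l; apply: Rle_abs.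
have -> : - rsum (fun l => Rabs (a l)) = (-1) * rsum (fun l => Rabs (a l)) by ring.
rewrite -rsum_scal; apply: rsum_le => //; first exact: summable_scal.
by move=> l; have := Rabs_maj2 (a l); lra.
Qed.

(** The limits of Fourier series and of Sobolev norms below are instances of
    this form of dominated convergence. *)
Lemma Tannery_freq D (T : Type) (F : (T -> Prop) -> Prop) (FF : Filter F)
    (b : T -> freq D -> R) (b0 M : freq D -> R) :
  summable M -> (forall l, Rabs (b0 l) <= M l) ->
  F (fun y => forall l, Rabs (b y l) <= M l) ->
  (forall l, filterlim (fun y => b y l) F (locally (b0 l))) ->
  filterlim (fun y => rsum (b y)) F (locally (rsum b0)).
Proof.
move=> sM h0 h hl; apply: (Tannery _ (summable_ex sM)).
- by move=> n; rewrite /seqof; case: (dec D n) => [l|] //=; rewrite Rabs_R0; lra.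
- apply: filter_imp h => y hy n; rewrite /seqof; case: (dec D n) => [l|] //=; rewrite Rabs_R0; lra.
- by move=> n; rewrite /seqof; case: (dec D n) => [l|] //=; apply: filterlim_const.
Qed.

Definition In_dec D (s : seq (freq D)) (l : freq D) : bool :=
  if excluded_middle_informative (List.In l s) then true else false.

Lemma In_decP D (s : seq (freq D)) l : reflect (List.In l s) (In_dec s l).
Proof. by rewrite /In_dec; case: excluded_middle_informative => h; constructor. Qed.

Lemma rsum_single D (l0 : freq D) (a : freq D -> R) :
  (forall l, l <> l0 -> a l = 0) -> rsum a = a l0 /\ summable a.
Proof.
move=> h; have E b : (forall l, l <> l0 -> b l = 0) -> is_series (seqof b) (b l0).
  move=> hb; have -> : b l0 = seqof b (code l0) by rewrite /seqof dec_code.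
  apply: is_series_single => n ne; rewrite /seqof; case e: (dec D n) => [l|] //=.
  by apply: hb => el; rewrite -(code_dec e) el in ne.
split; first exact: is_series_unique (E a h).
eexists; apply: (E (fun l => Rabs (a l))) => l ne; by rewrite h // Rabs_R0.
Qed.

Lemma rsum_finite D (s : seq (freq D)) (a : freq D -> R) : List.NoDup s ->
  let b := fun l => if In_dec s l then a l else 0 in
  rsum b = \big[Rplus/0]_(l <- s) a l /\ summable b.
Proof.
elim: s => [|x s IH] nd /=.
  rewrite big_nil; have h l : (if In_dec [::] l then a l else 0) = 0 * 0.
    by case: In_decP => //=; lra.
  split.
    by rewrite (rsum_ext h) (@rsum_scal D (fun _ => 0)); ring.
  by apply: (@summable_le _ _ (fun l => if In_dec [::] l then 0 else 0)) => [l|]; [rewrite h; case: ifP; rewrite Rmult_0_l Rabs_R0; lra|apply: (summable_ext _ (rsum_single (l0 := fun _ => Z0) (a := fun _ => 0) _).2) => [l|//]; case: ifP].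
have [nx nds] : ~ List.In x s /\ List.NoDup s by inversion nd.
have [e1 s1] := IH nds.
have hx l : l <> x -> (if excluded_middle_informative (l = x) then a x else 0) = 0.
  by move=> ne; case: excluded_middle_informative.
have [e2 s2] := @rsum_single D x _ hx.
have E l : (if In_dec s l then a l else 0) + (if excluded_middle_informative (l = x) then a x else 0) = (if In_dec (x :: s) l then a l else 0).
  case: excluded_middle_informative => /= [->|ne].
    case: In_decP => // _; case: In_decP => [_|[]]; first lra.
    by left.
  case: In_decP => hi; case: In_decP => hj; rewrite ?Rplus_0_r //; first by case: hj; right.
  by case: hj => // eh; case: ne.
rewrite -(rsum_ext E); split; last by apply: (summable_ext E); apply: summable_plus.
rewrite rsum_plus // e1 e2 big_cons; case: excluded_middle_informative => /= [_|[]//]; ring.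
Qed.

Lemma list_sum_le_rsum D (a : freq D -> R) s : summable a -> (forall l, 0 <= a l) ->
  List.NoDup s -> \big[Rplus/0]_(l <- s) a l <= rsum a.
Proof.
move=> sa h nd; have [<- sb] := rsum_finite a nd.
by apply: rsum_le => // l; case: ifP => //; have := h l; lra.
Qed.

Definition enumer D (N : nat) : seq (freq D) := pmap (dec D) (seq.iota 0 N).

Lemma enumer_nodup D N : List.NoDup (enumer D N).
Proof.
rewrite /enumer; move: 0%nat; elim: N => [|N IH] m; first by constructor.
rewrite [seq.iota m _]/= [pmap _ _]/=; case e: (dec D m) => [l|] //=; constructor => //.
have: forall k t, List.In l (pmap (dec D) (seq.iota k t)) -> (k <= code l)%nat.
  move=> k t; elim: t k => [|t IHt] k //=; case e2: (dec D k) => [l2|] /=.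
    by case=> [<-|/IHt /ltnW //]; rewrite (code_dec e2).
  by move=> /IHt /ltnW.
by move=> H /H; rewrite (code_dec e) ltnn.
Qed.

Lemma enumer_in D (l : freq D) N : (code l < N)%nat -> List.In l (enumer D N).
Proof.
move=> lt; rewrite /enumer.
suff: forall m, (m <= code l)%nat -> (code l < m + N)%nat -> List.In l (pmap (dec D) (seq.iota m N)).
  by apply.
elim: N {lt} => [|N IH] m; first by rewrite addn0 => h1 h2; have := leq_trans h2 h1; rewrite ltnn.
rewrite leq_eqVlt => /orP [/eqP ->|lt] h2 /=; first by rewrite dec_code /=; left.
rewrite -addSnnS in h2.
by case e: (dec D m) => [l2|] /=; [right|]; apply: IH.
Qed.

Lemma enumer_sum D (a : freq D -> R) N :
  sum_n (seqof a) N = \big[Rplus/0]_(l <- enumer D N.+1) a l.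
Proof.
have E m : \big[Rplus/0]_(l <- enumer D m.+1) a l =
           \big[Rplus/0]_(l <- enumer D m) a l + seqof a m.
  rewrite /enumer -addn1 iotaD pmap_cat big_cat /= add0n /seqof.
  by case: (dec D m) => [l|] /=; rewrite ?big_cons big_nil; ring.
elim: N => [|N IH]; first by rewrite sum_O E /enumer /= big_nil Rplus_0_l.
by rewrite sum_Sn IH (E N.+1).
Qed.

Lemma enumer_tail D (a : freq D -> R) : summable a -> (forall l, 0 <= a l) ->
  filterlim (fun N => rsum (fun l => if In_dec (enumer D N) l then 0 else a l))
    eventually (locally 0).
Proof.
move=> sa ha.
have [r0 _] := @rsum_single D (fun _ => Z0) (fun _ => 0) ltac:(by []).
rewrite -[X in locally X]r0; apply: (@Tannery_freq D nat eventually _ _ _ a) => //.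
- by move=> l; rewrite Rabs_R0.
- by exists 0%nat => n _ l; have := ha l; case: ifP => _ h; rewrite ?Rabs_R0 ?Rabs_pos_eq //; lra.
- move=> l; apply: (@filterlim_ext_loc _ _ _ _ _ (fun _ => 0)); last exact: filterlim_const.
  by exists (code l).+1 => n /leP lt; case: In_decP => // -[]; apply: enumer_in.
Qed.

Lemma rsum_tail D (a : freq D -> R) eps : summable a -> (forall l, 0 <= a l) -> 0 < eps ->
  exists s, List.NoDup s /\ rsum (fun l => if In_dec s l then 0 else a l) < eps.
Proof.
move=> sa ha e0; have /filterlim_R H := enumer_tail sa ha.
have [N HN] := H eps e0; exists (enumer D N); split; first exact: enumer_nodup.
by have /Rabs_def2 := HN N (le_n _); lra.
Qed.

(** Bounded finite sums of a nonnegative family are exactly what the supremum in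
    [nnsum] controls; the partial sums of the series are sums over finite sets
    of frequencies. *)
Lemma summable_bounded D (a : freq D -> R) M : (forall l, 0 <= a l) ->
  (forall s, List.NoDup s -> \big[Rplus/0]_(l <- s) a l <= M) ->
  summable a /\ rsum a <= M.
Proof.
move=> ha h; have E : seqof (fun l => Rabs (a l)) = seqof a.
  by congr seqof; apply: functional_extensionality => l; rewrite Rabs_pos_eq.
have sa : summable a.
  rewrite /summable E; have [|n|l Hl] := @ex_finite_lim_seq_incr (sum_n (seqof a)) M.
  - move=> n; rewrite sum_Sn /plus /= /seqof; case: (dec D n.+1) => [l|] /=; last by lra.
    by have := ha l; lra.
  - rewrite enumer_sum; apply: h; exact: enumer_nodup.
  by exists l; apply: Hl.
split=> //; have /filterlim_R H := Series_correct _ (summable_ex sa).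
case: (Rle_lt_dec (rsum a) M) => // lt.
have [N HN] := H (rsum a - M) ltac:(lra).
have := HN N (le_n _); have := h _ (enumer_nodup D N.+1); rewrite -enumer_sum.
have K u : u <= M -> Rabs (u - rsum a) < rsum a - M -> rsum a <= M by move=> ? /Rabs_def2; lra.
exact: K.
Qed.

Lemma nnsum_summable D (a : freq D -> R) : (forall l, 0 <= a l) ->
  (is_finite (nnsum a) <-> summable a) /\ (summable a -> nnsum a = Finite (rsum a)).
Proof.
move=> ha; have [ub lub] := Lub_Rbar_correct (fun r => exists s : seq (freq D),
    List.NoDup s /\ r = \big[Rplus/0]_(l <- s) a l).
rewrite -/(nnsum a) in ub lub.
have E : summable a -> nnsum a = Finite (rsum a).
  move=> sa; apply: Rbar_le_antisym.
    by apply: lub => r [s [nd ->]]; apply: list_sum_le_rsum.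
  case e: (nnsum a) ub => [r| |] ub //.
    apply: (proj2 (@summable_bounded D a r ha _)) => s nd; rewrite -[_ <= r]/(Rbar_le (Finite _) (Finite r)).
    by apply: ub; exists s.
  by have := ub _ (ex_intro _ [::] (conj (List.NoDup_nil _) erefl)).
split=> //; split=> [fin|/E -> //].
apply: (proj1 (@summable_bounded D a (real (nnsum a)) ha _)) => s nd.
rewrite -[_ <= _]/(Rbar_le (Finite _) (Finite _)) fin; by apply: ub; exists s.
Qed.

(** * Complex-valued sums over the frequencies *)

Fact CplusA : associative Cplus. Proof. by move=> x y z; ring. Qed.
Fact CplusC : commutative Cplus. Proof. by move=> x y; ring. Qed.
Fact Cplus0 : left_id (RtoC 0) Cplus. Proof. by move=> x; ring. Qed.
HB.instance Definition _ := Monoid.isComLaw.Build C (RtoC 0) Cplus CplusA CplusC Cplus0.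

Lemma filterlim_C (T : Type) (F : (T -> Prop) -> Prop) (FF : Filter F) (f : T -> C) (z : C) :
  filterlim (fun y => Re (f y)) F (locally (Re z)) ->
  filterlim (fun y => Im (f y)) F (locally (Im z)) ->
  filterlim f F (locally z).
Proof.
move=> h1 h2; apply/filterlim_locally => eps.
have /filterlim_locally/(_ eps) g1 := h1; have /filterlim_locally/(_ eps) g2 := h2.
by apply: (filter_imp _ _ _ (filter_and _ _ g1 g2)) => y [? ?]; split.
Qed.

Lemma filterlim_ReIm (T : Type) (F : (T -> Prop) -> Prop) (FF : Filter F) (f : T -> C) (z : C) :
  filterlim f F (locally z) ->
  filterlim (fun y => Re (f y)) F (locally (Re z)) /\
  filterlim (fun y => Im (f y)) F (locally (Im z)).
Proof.
move/filterlim_locally => h; split; apply/filterlim_locally => eps.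
  by apply: (filter_imp _ _ _ (h eps)) => y [].
by apply: (filter_imp _ _ _ (h eps)) => y [].
Qed.

Lemma Re_le_Cmod z : Rabs (Re z) <= Cmod z.
Proof. by apply: Rle_trans (Rmax_Cmod z); apply: Rmax_l. Qed.
Lemma Im_le_Cmod z : Rabs (Im z) <= Cmod z.
Proof. by apply: Rle_trans (Rmax_Cmod z); apply: Rmax_r. Qed.
Lemma Cmod_le_ReIm z : Cmod z <= Rabs (Re z) + Rabs (Im z).
Proof.
case: z => x y; have -> : (x, y) = ((x : C) + (0, y))%C by rewrite /Cplus /=; congr pair; ring.
apply: Rle_trans (Cmod_triangle _ _) _; rewrite Cmod_R /=.
have -> : (0, y) = (Ci * y)%C by rewrite /Cmult /=; congr pair; ring.
rewrite Cmod_mult Cmod_R Cmod_Ci; apply: Req_le.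
by rewrite Rplus_0_r Rplus_0_l Rmult_1_l.
Qed.

Lemma Cmod2 z : Cmod z ^ 2 = Re z ^ 2 + Im z ^ 2.
Proof. by rewrite /Cmod pow2_sqrt //; apply: Rplus_le_le_0_compat; apply: pow2_ge_0. Qed.

Definition csum D (a : freq D -> C) : C :=
  (rsum (fun l => Re (a l)), rsum (fun l => Im (a l))).
Definition csummable D (a : freq D -> C) : Prop := summable (fun l => Cmod (a l)).

Lemma csummable_Re D (a : freq D -> C) : csummable a -> summable (fun l => Re (a l)).
Proof. by apply: summable_le => l; apply: Re_le_Cmod. Qed.
Lemma csummable_Im D (a : freq D -> C) : csummable a -> summable (fun l => Im (a l)).
Proof. by apply: summable_le => l; apply: Im_le_Cmod. Qed.

Lemma csum_ext D (a b : freq D -> C) : (forall l, a l = b l) -> csum a = csum b.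
Proof. by move=> e; have -> : a = b by apply: functional_extensionality. Qed.

Lemma csummable_le D (a : freq D -> C) M :
  (forall l, Cmod (a l) <= M l) -> summable M -> csummable a.
Proof. by move=> h; apply: summable_le => l; rewrite Rabs_pos_eq //; apply: Cmod_ge_0. Qed.

Lemma csummable_plus D (a b : freq D -> C) : csummable a -> csummable b ->
  csummable (fun l => a l + b l)%C.
Proof.
move=> sa sb; apply: (csummable_le _ (summable_plus sa sb)) => l; exact: Cmod_triangle.
Qed.

Lemma csummable_scal D (a : freq D -> C) k : csummable a -> csummable (fun l => k * a l)%C.
Proof.
move=> sa; apply: (csummable_le _ (summable_scal (Cmod k) sa)) => l.
by rewrite Cmod_mult; lra.
Qed.

Lemma csum_plus D (a b : freq D -> C) : csummable a -> csummable b ->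
  csum (fun l => a l + b l)%C = (csum a + csum b)%C.
Proof.
move=> sa sb; rewrite /csum /Cplus /= !rsum_plus //; by [apply: csummable_Re|apply: csummable_Im].
Qed.

Lemma csum_scal D (a : freq D -> C) k : csummable a ->
  csum (fun l => k * a l)%C = (k * csum a)%C.
Proof.
move=> sa; have sr := csummable_Re sa; have si := csummable_Im sa.
rewrite /csum /Cmult /=; congr pair.
- rewrite (@rsum_ext _ _ (fun l => Re k * Re (a l) + (- Im k) * Im (a l))).
    by rewrite rsum_plus ?rsum_scal; [rewrite /Re /Im; ring| |]; apply: summable_scal.
  by move=> l; rewrite /Re /Im; ring.
- by rewrite rsum_plus ?rsum_scal //; apply: summable_scal.
Qed.

(** Real and imaginary parts are bounded separately, hence the factor 2. *)
Lemma csum_abs D (a : freq D -> C) : csummable a ->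
  Cmod (csum a) <= 2 * rsum (fun l => Cmod (a l)).
Proof.
move=> sa; apply: Rle_trans (Cmod_le_ReIm _) _; rewrite /csum /=.
have b1 : Rabs (rsum (fun l => Re (a l))) <= rsum (fun l => Cmod (a l)).
  apply: Rle_trans (rsum_abs (csummable_Re sa)) _.
  by apply: rsum_le => // [|l]; [apply/summable_abs/csummable_Re|apply: Re_le_Cmod].
have b2 : Rabs (rsum (fun l => Im (a l))) <= rsum (fun l => Cmod (a l)).
  apply: Rle_trans (rsum_abs (csummable_Im sa)) _.
  by apply: rsum_le => // [|l]; [apply/summable_abs/csummable_Im|apply: Im_le_Cmod].
lra.
Qed.

Lemma csum_le D (a : freq D -> C) M : (forall l, Cmod (a l) <= M l) -> summable M ->
  Cmod (csum a) <= 2 * rsum M.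
Proof.
move=> h sM; have sa := csummable_le h sM.
apply: Rle_trans (csum_abs sa) _.
by have := rsum_le sa sM h; lra.
Qed.

Lemma csum_tannery D (T : Type) (F : (T -> Prop) -> Prop) (FF : Filter F)
    (b : T -> freq D -> C) (b0 : freq D -> C) (M : freq D -> R) :
  summable M -> (forall l, Cmod (b0 l) <= M l) ->
  F (fun y => forall l, Cmod (b y l) <= M l) ->
  (forall l, filterlim (fun y => b y l) F (locally (b0 l))) ->
  filterlim (fun y => csum (b y)) F (locally (csum b0)).
Proof.
move=> sM h0 h hl; apply: filterlim_C; rewrite /csum /=; apply: (@Tannery_freq _ _ _ _ _ _ M) => //.
- by move=> l; apply: Rle_trans (Re_le_Cmod _) _.
- by apply: filter_imp h => y hy l; apply: Rle_trans (Re_le_Cmod _) _.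
- by move=> l; case: (filterlim_ReIm FF (hl l)).
- by move=> l; apply: Rle_trans (Im_le_Cmod _) _.
- by apply: filter_imp h => y hy l; apply: Rle_trans (Im_le_Cmod _) _.
- by move=> l; case: (filterlim_ReIm FF (hl l)).
Qed.

Lemma csum_single D (l0 : freq D) (a : freq D -> C) :
  (forall l, l <> l0 -> a l = RtoC 0) -> csum a = a l0.
Proof.
move=> h; rewrite /csum (proj1 (@rsum_single D l0 (fun l => Re (a l)) _)).
  rewrite (proj1 (@rsum_single D l0 (fun l => Im (a l)) _)); first by case: (a l0).
  by move=> l ne; rewrite h.
by move=> l ne; rewrite h.
Qed.

Lemma csum_finite D (s : seq (freq D)) (a : freq D -> C) : List.NoDup s ->
  csum (fun l => if In_dec s l then a l else RtoC 0) = \big[Cplus/RtoC 0]_(l <- s) a l.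
Proof.
move=> nd; have e1 := proj1 (rsum_finite (fun l => Re (a l)) nd).
have e2 := proj1 (rsum_finite (fun l => Im (a l)) nd).
have -> : \big[Cplus/RtoC 0]_(l <- s) a l =
  (\big[Rplus/0]_(l <- s) Re (a l), \big[Rplus/0]_(l <- s) Im (a l)).
  by elim: s {nd e1 e2} => [|x s IH]; rewrite ?big_nil // !big_cons IH.
rewrite -e1 -e2 /csum; congr pair; apply: rsum_ext => l; by case: ifP.
Qed.

Lemma csum_split D (s : seq (freq D)) (a : freq D -> C) : List.NoDup s -> csummable a ->
  csum a = (\big[Cplus/RtoC 0]_(l <- s) a l +
            csum (fun l => if In_dec s l then RtoC 0 else a l))%C.
Proof.
move=> nd sa; rewrite -csum_finite // -csum_plus.
- by apply: csum_ext => l; case: ifP => _; ring.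
- apply: (csummable_le _ sa) => l; case: ifP => _; rewrite ?Cmod_0; [exact: Rle_refl|exact: Cmod_ge_0].
- apply: (csummable_le _ sa) => l; case: ifP => _; rewrite ?Cmod_0; [exact: Cmod_ge_0|exact: Rle_refl].
Qed.

Lemma filterlim_Cplus (T : Type) (F : (T -> Prop) -> Prop) (FF : Filter F) (f g : T -> C) (a b : C) :
  filterlim f F (locally a) -> filterlim g F (locally b) ->
  filterlim (fun y => f y + g y)%C F (locally (a + b)%C).
Proof.
move=> /filterlim_ReIm [f1 f2] /filterlim_ReIm [g1 g2].
by apply: filterlim_C => /=; apply: filterlim_Rplus.
Qed.

Lemma filterlim_Cmult (T : Type) (F : (T -> Prop) -> Prop) (FF : Filter F) (f g : T -> C) (a b : C) :
  filterlim f F (locally a) -> filterlim g F (locally b) ->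
  filterlim (fun y => f y * g y)%C F (locally (a * b)%C).
Proof.
move=> /filterlim_ReIm [f1 f2] /filterlim_ReIm [g1 g2].
apply: filterlim_C => /=; last by apply: filterlim_Rplus; apply: filterlim_Rmult.
have -> : a.1 * b.1 - a.2 * b.2 = a.1 * b.1 + (-1) * (a.2 * b.2) by ring.
apply: (@filterlim_ext _ _ _ _ _ (fun y => (f y).1 * (g y).1 + (-1) * ((f y).2 * (g y).2))).
  by move=> y; ring.
by apply: filterlim_Rplus; [|apply: filterlim_Rscal]; apply: filterlim_Rmult.
Qed.

(** * Summability of powers of the weight <λ>^2 *)

Lemma Rsum_le (I : Type) (s : seq I) (P : pred I) (a b : I -> R) :
  (forall i, P i -> a i <= b i) ->
  \big[Rplus/0]_(i <- s | P i) a i <= \big[Rplus/0]_(i <- s | P i) b i.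
Proof.
move=> h; apply: (big_ind2 (fun x y => x <= y)) => // [|x1 x2 y1 y2 h1 h2]; lra.
Qed.

Lemma Rsum_ge0 (I : Type) (s : seq I) (P : pred I) (a : I -> R) :
  (forall i, P i -> 0 <= a i) -> 0 <= \big[Rplus/0]_(i <- s | P i) a i.
Proof.
move=> h; apply: (big_ind (fun x => 0 <= x)) => // [|x y h1 h2]; lra.
Qed.

Lemma Rsum_scal (I : Type) (s : seq I) (P : pred I) (a : I -> R) k :
  \big[Rplus/0]_(i <- s | P i) (k * a i) = k * \big[Rplus/0]_(i <- s | P i) a i.
Proof. by rewrite big_distrr. Qed.

Lemma Rsum_const n (k : R) : \big[Rplus/0]_(i < n) k = INR n * k.
Proof.
rewrite big_const_ord; elim: n => [|n IH]; first by rewrite /=; ring.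
by rewrite iterS IH S_INR; ring.
Qed.

Lemma Rsum_term (n : nat) (a : 'I_n -> R) (i : 'I_n) : (forall j, 0 <= a j) ->
  a i <= \big[Rplus/0]_(j < n) a j.
Proof.
move=> h; rewrite (bigD1 i) //=.
have K x : 0 <= x -> a i <= a i + x by lra.
by apply: K; apply: Rsum_ge0.
Qed.

Definition wt D (l : freq D) : R := 1 + normsq l.

Lemma normsq_ge0 D (l : freq D) : 0 <= normsq l.
Proof. by apply: Rsum_ge0 => i _; apply: pow2_ge_0. Qed.

Lemma wt_ge1 D (l : freq D) : 1 <= wt l.
Proof. by rewrite /wt; have := normsq_ge0 l; lra. Qed.

Lemma wt_gt0 D (l : freq D) : 0 < wt l.
Proof. by have := wt_ge1 l; lra. Qed.

Lemma coord_le_wt D (l : freq D) i : 1 + IZR (l i) ^ 2 <= wt l.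
Proof.
by rewrite /wt /normsq; have := @Rsum_term D (fun j => IZR (l j) ^ 2) i (fun j => pow2_ge_0 _); lra.
Qed.

Lemma Rpower_gt0 x y : 0 < Rpower x y.
Proof. exact: exp_pos. Qed.

Lemma Rpower_decr a b r : 0 < a -> a <= b -> 0 <= r -> Rpower b (- r) <= Rpower a (- r).
Proof.
move=> a0 ab r0; rewrite !Rpower_Ropp; apply: Rinv_le_contravar; first exact: Rpower_gt0.
exact: Rle_Rpower_l.
Qed.

Lemma wt_Rpower_le D (l : freq D) a b : a <= b -> Rpower (wt l) a <= Rpower (wt l) b.
Proof. by move=> ab; apply: Rle_Rpower => //; apply: wt_ge1. Qed.

(** Compares (1 + n^2)^-rho with the telescoping differences of n^(1 - 2 rho),
    by the mean value theorem. *)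
Lemma p_series_bound rho : 1 / 2 < rho -> exists A, 0 <= A /\ forall N,
  \big[Rplus/0]_(n < N) Rpower (1 + INR n ^ 2) (- rho) <= A.
Proof.
move=> hr; pose b := 2 * rho - 1; have b0 : 0 < b by rewrite /b; lra.
have le1 x : 0 <= x -> Rpower (1 + x ^ 2) (- rho) <= 1.
  move=> x0; have e1 : Rpower 1 (- rho) = 1 by rewrite /Rpower ln_1 Rmult_0_r exp_0.
  by rewrite -[X in _ <= X]e1; apply: Rpower_decr; nra.
have step x : 1 <= x -> Rpower (1 + (x + 1) ^ 2) (- rho) <= / b * (Rpower x (- b) - Rpower (x + 1) (- b)).
  move=> x1.
  have [c [hc1 hc2]] : exists c, Rpower (x + 1) (- b) - Rpower x (- b) =
      (- b * Rpower c (- b - 1)) * (x + 1 - x) /\ x <= c <= x + 1.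
    have [|y hy|c [hc e]] := @MVT_gen (fun y => Rpower y (- b)) x (x + 1) (fun c => - b * Rpower c (- b - 1)).
    - move=> y; rewrite Rmin_left ?Rmax_right; try lra; move=> hy; apply/is_derive_Reals.
      by apply: derivable_pt_lim_power; lra.
    - apply: derivable_continuous_pt; exists (- b * Rpower y (- b - 1)).
      apply: derivable_pt_lim_power; move: hy; rewrite Rmin_left; lra.
    by exists c; split=> //; move: hc; rewrite Rmin_left ?Rmax_right; lra.
  have -> : Rpower x (- b) - Rpower (x + 1) (- b) = b * Rpower c (- b - 1) by lra.
  have -> : / b * (b * Rpower c (- b - 1)) = Rpower c (- b - 1) by field; lra.
  have -> : - b - 1 = - (2 * rho) by rewrite /b; ring.
  apply: (Rle_trans _ (Rpower (x + 1) (- (2 * rho)))).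
    have -> : - (2 * rho) = INR 2 * (- rho) by rewrite /=; ring.
    rewrite -Rpower_mult Rpower_pow; [|lra].
    by apply: Rpower_decr; nra.
  by apply: Rpower_decr; lra.
have ib : 0 < / b by apply: Rinv_0_lt_compat.
exists (2 + / b); split; first by lra.
have main N : \big[Rplus/0]_(n < N.+2) Rpower (1 + INR n ^ 2) (- rho)
    <= 2 + / b * (1 - Rpower (INR N + 1) (- b)).
  elim: N => [|N IH].
    rewrite !big_ord_recl big_ord0 /= Rplus_0_l.
    have -> : Rpower 1 (- b) = 1 by rewrite /Rpower ln_1 Rmult_0_r exp_0.
    by have := le1 0 ltac:(lra); have := le1 1 ltac:(lra) => /=; lra.
  rewrite big_ord_recr [nat_of_ord ord_max]/=; apply: Rle_trans (Rplus_le_compat_r _ _ _ IH) _.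
  have := step (INR N + 1) ltac:(have := pos_INR N; lra).
  by rewrite !S_INR; lra.
move=> N; apply: Rle_trans (_ : \big[Rplus/0]_(n < N.+2) Rpower (1 + INR n ^ 2) (- rho) <= _); last first.
  apply: Rle_trans (main N) _.
  by have := Rpower_gt0 (INR N + 1) (- b); nra.
rewrite 2!big_ord_recr /=.
have := Rpower_gt0 (1 + INR N * (INR N * 1)) (- rho); have := Rpower_gt0 (1 + INR N.+1 * (INR N.+1 * 1)) (- rho).
by rewrite /=; lra.
Qed.

(** Each of the D factors 1 + l_i^2 is at most the weight, so the weight
    dominates their geometric mean. The D-dimensional sum is thereby reduced to
    a product of one-dimensional ones. *)
Lemma wt_prod D r (l : freq D) : (0 < D)%nat -> 0 <= r ->
  Rpower (wt l) (- r) <=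
  \big[Rmult/1]_(i < D) Rpower (1 + INR (Z.abs_nat (l i)) ^ 2) (- (r / INR D)).
Proof.
move=> D0 r0; have dpos : 0 < INR D by apply: lt_0_INR; apply/ltP.
have q0 : 0 <= r / INR D by apply: Rmult_le_pos => //; apply/Rlt_le/Rinv_0_lt_compat.
have -> : Rpower (wt l) (- r) = \big[Rmult/1]_(i < D) Rpower (wt l) (- (r / INR D)).
  rewrite big_const_ord.
  have E n : ssrnat.iter n (Rmult (Rpower (wt l) (- (r / INR D)))) 1 = Rpower (wt l) (INR n * (- (r / INR D))).
    elim: n => [|n IH]; first by rewrite /= Rmult_0_l Rpower_O //; apply: wt_gt0.
    by rewrite iterS IH -Rpower_plus S_INR; congr Rpower; ring.
  by rewrite E; congr Rpower; field; lra.
have H i : 0 <= Rpower (wt l) (- (r / INR D)) <= Rpower (1 + INR (Z.abs_nat (l i)) ^ 2) (- (r / INR D)).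
  split; first exact/Rlt_le/Rpower_gt0.
  have -> : INR (Z.abs_nat (l i)) ^ 2 = IZR (l i) ^ 2.
    by rewrite INR_IZR_INZ Zabs2Nat.id_abs abs_IZR -!Rsqr_pow2 -Rsqr_abs.
  apply: Rpower_decr => //; last exact: coord_le_wt.
  by have := pow2_ge_0 (IZR (l i)); lra.
suff: 0 <= \big[Rmult/1]_(i < D) Rpower (wt l) (- (r / INR D)) <= \big[Rmult/1]_(i < D) Rpower (1 + INR (Z.abs_nat (l i)) ^ 2) (- (r / INR D)) by case.
apply: (big_ind2 (fun x y => 0 <= x <= y)) => // [|x1 x2 y1 y2 [? ?] [? ?]]; first by lra.
by split; [apply: Rmult_le_pos|apply: Rmult_le_compat].
Qed.

Lemma nodup_map_uniq (U : Type) (T : eqType) (f : U -> T) (s : seq U) : List.NoDup s ->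
  (forall x y, List.In x s -> List.In y s -> f x = f y -> x = y) -> uniq [seq f x | x <- s].
Proof.
elim: s => [//|x s IH] nd inj /=.
have [nx nds] : ~ List.In x s /\ List.NoDup s by inversion nd.
rewrite IH //; last by move=> y z hy hz; apply: inj; right.
rewrite andbT; apply/negP => h.
have [y ys e] : exists2 y, List.In y s & f x = f y.
  elim: (s) h => [//|z t IHt] /=; rewrite in_cons => /orP [/eqP ->|/IHt [y yt ->]].
    by exists z => //; left.
  by exists y => //; right.
by apply: nx; rewrite (inj x y) //; [left|right].
Qed.

(** Expanding the D-th power of a one-dimensional sum dominates, by [wt_prod],
    every finite sum over frequencies. *)
Lemma wt_summable D r : (0 < D)%nat -> INR D / 2 < r ->
  summable (fun l : freq D => Rpower (wt l) (- r)).
Proof.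
move=> D0 hr; have dpos : 0 < INR D by apply: lt_0_INR; apply/ltP.
have r0 : 0 <= r by lra.
have [|A [A0 HA]] := @p_series_bound (r / INR D).
  apply: (Rmult_lt_reg_r (INR D)) => //; have -> : r / INR D * INR D = r by field; lra.
  lra.
apply: (proj1 (@summable_bounded D _ ((2 * A) ^ D) _ _)) => [l|s nd]; first exact/Rlt_le/Rpower_gt0.
pose a n := Rpower (1 + INR n ^ 2) (- (r / INR D)).
apply: Rle_trans (Rsum_le _ (fun l _ => wt_prod l D0 r0)) _.
have [B HB] : exists B, forall l, List.In l s -> forall i, (Z.abs_nat (l i) < B)%nat.
  elim: s {nd} => [|x s [B HB]]; first by exists 0%nat.
  exists (maxn B (\max_(i < D) Z.abs_nat (x i)).+1) => l [<-|/HB h] i; rewrite leq_max; last by rewrite h.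
  by rewrite ltnS (leq_bigmax (F := fun i => Z.abs_nat (x i))) orbT.
case: B HB => [|B] HB.
  have -> : s = [::] by case: s {nd} HB => // x s /(_ x (or_introl erefl) (Ordinal D0)).
  by rewrite big_nil; apply: pow_le; lra.
(* A frequency is recorded by the signs and absolute values of its coordinates;
   the two signs account for the factor 2. *)
pose enc (l : freq D) : {ffun 'I_D -> bool * 'I_B.+1} :=
  [ffun i => ((0 <=? l i)%Z, inord (Z.abs_nat (l i)))].
have encE l i : List.In l s -> nat_of_ord (enc l i).2 = Z.abs_nat (l i).
  by move=> h; rewrite ffunE /= inordK //; apply: HB.
have enc_uniq : uniq [seq enc l | l <- s].
  apply: nodup_map_uniq => // x y hx hy e; apply: functional_extensionality => i.
  have := encE x i hx; have := encE y i hy; rewrite e => -> h.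
  by have := congr1 (fun f : {ffun 'I_D -> bool * 'I_B.+1} => (f i).1) e; rewrite !ffunE /=; lia.
pose G (f : {ffun 'I_D -> bool * 'I_B.+1}) := \big[Rmult/1]_(i < D) a (nat_of_ord (f i).2).
have -> : \big[Rplus/0]_(l <- s) \big[Rmult/1]_(i < D) a (Z.abs_nat (l i)) =
          \big[Rplus/0]_(f <- [seq enc l | l <- s]) G f.
  rewrite big_map; elim: s {nd HB enc_uniq} encE => [|x s IH] encE; first by rewrite !big_nil.
  rewrite !big_cons IH; last by move=> l i h; apply: encE; right.
  by congr (_ + _); apply: eq_bigr => i _; rewrite encE //; left.
have G0 f : 0 <= G f.
  apply: (big_ind (fun x => 0 <= x)) => [|x y|i _]; [lra|exact: Rmult_le_pos|exact/Rlt_le/Rpower_gt0].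
apply: (Rle_trans _ (\big[Rplus/0]_f G f)).
  rewrite big_uniq // [X in _ <= X](bigID (mem [seq enc l | l <- s])) /=.
  have K x y : 0 <= y -> x <= x + y by lra.
  by apply: K; apply: Rsum_ge0.
rewrite -(bigA_distr_bigA (fun i (j : bool * 'I_B.+1) => a (nat_of_ord j.2))) big_const_ord.
have -> : \big[Rplus/0]_(j : bool * 'I_B.+1) a (nat_of_ord j.2) = 2 * \big[Rplus/0]_(n < B.+1) a n.
  rewrite -(pair_bigA _ (fun (b : bool) (n : 'I_B.+1) => a n)) /=.
  by rewrite big_bool /=; ring.
have b0 : 0 <= \big[Rplus/0]_(n < B.+1) a n by apply: Rsum_ge0 => i _; exact/Rlt_le/Rpower_gt0.
have hA : \big[Rplus/0]_(n < B.+1) a n <= A := HA B.+1.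
move: b0 hA; set S := \big[Rplus/0]_(n < B.+1) a n => b0 hA.
elim: (D) => [|n IH]; first by rewrite /=; lra.
rewrite iterS; apply: Rmult_le_compat => //; [lra| |lra].
by elim: (n) => [|m IHm]; [rewrite /=; lra|rewrite iterS; apply: Rmult_le_pos; lra].
Qed.

(** * Integration over the torus *)

Definition close_to D (x : pt D) (d : R) (y : pt D) : Prop := forall j, Rabs (y j - x j) < d.

Definition cube D (y : pt D) : Prop := forall j, 0 <= y j <= 2 * PI.

Definition cont D (f : pt D -> R) : Prop := forall x, continuous f x.
Definition ccont D (f : pt D -> C) : Prop := forall x, continuous f x.

Lemma contP D (f : pt D -> R) x : continuous f x <->
  forall eps, 0 < eps -> exists d, 0 < d /\ forall y, close_to x d y -> Rabs (f y - f x) < eps.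
Proof.
split=> [/filterlim_R H eps e0|H].
  by have [d Hd] := H eps e0; exists d; split; [apply: cond_pos|move=> y Hy; apply: Hd].
apply/filterlim_R => eps e0; have [d [d0 Hd]] := H eps e0.
by exists (mkposreal d d0) => y Hy; apply: Hd.
Qed.

Lemma ccont_Re D (f : pt D -> C) : ccont f -> cont (fun x => Re (f x)).
Proof. by move=> h x; case: (filterlim_ReIm _ (h x)). Qed.
Lemma ccont_Im D (f : pt D -> C) : ccont f -> cont (fun x => Im (f x)).
Proof. by move=> h x; case: (filterlim_ReIm _ (h x)). Qed.
Lemma cont_plus D (f g : pt D -> R) : cont f -> cont g -> cont (fun x => f x + g x).
Proof. by move=> h1 h2 x; apply: filterlim_Rplus; [apply: h1|apply: h2]. Qed.
Lemma cont_mult D (f g : pt D -> R) : cont f -> cont g -> cont (fun x => f x * g x).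
Proof. by move=> h1 h2 x; apply: filterlim_Rmult; [apply: h1|apply: h2]. Qed.
Lemma cont_const D (c : R) : cont (fun _ : pt D => c).
Proof. by move=> x; apply: continuous_const. Qed.
Lemma cont_coord D (g : R -> R) (i : 'I_D) : (forall r, continuous g r) -> cont (fun x : pt D => g (x i)).
Proof.
move=> h x P hP; have [d Hd] := h (x i) P hP.
by exists d => y hy; apply: Hd; apply: (hy i).
Qed.

Lemma ccont_mult D (f g : pt D -> C) (hf : ccont f) (hg : ccont g) : ccont (fun x => f x * g x)%C.
Proof. by move=> x; apply: filterlim_Cmult; [apply: hf|apply: hg]. Qed.
Lemma ccont_plus D (f g : pt D -> C) (hf : ccont f) (hg : ccont g) : ccont (fun x => f x + g x)%C.
Proof. by move=> x; apply: filterlim_Cplus; [apply: hf|apply: hg]. Qed.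
Lemma ccont_const D (c : C) : ccont (fun _ : pt D => c).
Proof. by move=> x; apply: continuous_const. Qed.
Lemma ccont_expi D (l : freq D) : ccont (expi l).
Proof. by move=> x; case: (expi_smooth l [::] x). Qed.
Arguments ccont_expi {D} l x.
Arguments ccont_mult {D f g} hf hg x.
Arguments ccont_plus {D f g} hf hg x.
Lemma ccont_sum D (I : Type) (s : seq I) (F : I -> pt D -> C) : (forall l, ccont (F l)) ->
  ccont (fun x => \big[Cplus/RtoC 0]_(l <- s) F l x).
Proof.
move=> h; elim: s => [|l s IH].
  by have -> : (fun x => \big[Cplus/RtoC 0]_(l <- [::]) F l x) = fun=> RtoC 0;
    [apply: functional_extensionality => x; rewrite big_nil|exact: ccont_const].
have -> : (fun x => \big[Cplus/RtoC 0]_(l <- l :: s) F l x) = fun x => (F l x + \big[Cplus/RtoC 0]_(l <- s) F l x)%C.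
  by apply: functional_extensionality => x; rewrite big_cons.
exact: ccont_plus.
Qed.

(** Compactness, in the form used below: if a property P d h holds near each
    point with some radius d, and survives shrinking d, then one radius serves
    the whole interval. *)
Lemma unif_interval (a b : R) (P : R -> R -> Prop) :
  (forall d d' h, 0 < d' -> d' <= d -> P d h -> P d' h) ->
  (forall h, a <= h <= b -> exists d, 0 < d /\ forall h', Rabs (h' - h) < d -> P d h') ->
  exists d, 0 < d /\ forall h, a <= h <= b -> P d h.
Proof.
move=> mono loc.
have H h : exists d : posreal, a <= h <= b -> forall h', Rabs (h' - h) < d -> P d h'.
  case: (classic (a <= h <= b)) => [/loc [d [d0 hd]]|nh]; last by exists (mkposreal 1 Rlt_0_1).
  by exists (mkposreal d d0).
pose delta h := proj1_sig (constructive_indefinite_description _ (H h)).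
have Hd h : a <= h <= b -> forall h', Rabs (h' - h) < delta h -> P (delta h) h'.
  by rewrite /delta; case: constructive_indefinite_description.
have [d Hc] := compactness_value_1d a b delta.
exists d; split; first exact: cond_pos.
move=> h hab; apply: NNPP => nP; apply: (Hc h hab) => -[t [tab [ht le]]].
by apply: nP; apply: (mono _ _ _ (cond_pos d) le); apply: Hd.
Qed.

(** Induction on the coordinates in s: those coordinates range over the full
    interval, the others stay near x. *)
Lemma unif_coords D (P : R -> pt D -> Prop) (s : seq 'I_D) :
  (forall d d' y, 0 < d' -> d' <= d -> P d y -> P d' y) ->
  (forall x, exists d, 0 < d /\ forall y, close_to x d y -> P d y) ->
  forall x, exists d, 0 < d /\ forall y : pt D, (forall j, j \notin s -> Rabs (y j - x j) < d) ->
    (forall j, j \in s -> 0 <= y j <= 2 * PI) -> P d y.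
Proof.
move=> mono loc; elim: s => [|i s IH] x.
  by have [d [d0 hd]] := loc x; exists d; split=> // y hy _; apply: hd => j; apply: hy.
have [|h _|d [d0 Hd]] := @unif_interval 0 (2 * PI) (fun d h => forall y : pt D, y i = h ->
  (forall j, j \notin i :: s -> Rabs (y j - x j) < d) ->
  (forall j, j \in s -> 0 <= y j <= 2 * PI) -> P d y).
- move=> d d' h d'0 le H y yi h1 h2; apply: (mono _ _ _ d'0 le); apply: H => // j nj.
  by apply: Rlt_le_trans le; apply: h1.
- have [d [d0 hd]] := IH (upd x i h); exists d; split=> // h' hh' y yi h1 h2.
  apply: hd => // j nj; rewrite /upd; case: eqP => [->|ne]; first by rewrite yi.
  by apply: h1; rewrite in_cons negb_or nj andbT; apply/eqP.
- exists d; split=> // y h1 h2; apply: (Hd (y i)) => //; first by apply: h2; rewrite in_cons eqxx.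
  by move=> j js; apply: h2; rewrite in_cons js orbT.
Qed.

Lemma unif_cube D (P : R -> pt D -> Prop) :
  (forall d d' y, 0 < d' -> d' <= d -> P d y -> P d' y) ->
  (forall x, exists d, 0 < d /\ forall y, close_to x d y -> P d y) ->
  exists d, 0 < d /\ forall y, cube y -> P d y.
Proof.
move=> mono loc; have [d [d0 H]] := @unif_coords D P (enum 'I_D) mono loc (fun _ => 0).
exists d; split=> // y hy; apply: H => [j|j _]; last exact: hy.
by rewrite mem_enum.
Qed.

Lemma cont_bounded D (f : pt D -> R) : cont f -> exists M, 0 <= M /\ forall y, cube y -> Rabs (f y) <= M.
Proof.
move=> cf; have [|x|d [d0 H]] := @unif_cube D (fun d y => Rabs (f y) <= / d).
- by move=> d d' y d'0 le H; apply: Rle_trans H _; apply: Rinv_le_contravar.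
- have [d [d0 Hd]] := proj1 (contP f x) (cf x) 1 Rlt_0_1.
  pose e := Rmin d (/ (Rabs (f x) + 1)).
  have p : 0 < Rabs (f x) + 1 by have := Rabs_pos (f x); lra.
  have e0 : 0 < e by apply: Rmin_pos => //; apply: Rinv_0_lt_compat.
  exists e; split=> // y hy; apply: (Rle_trans _ (Rabs (f x) + 1)).
    have := Hd y (fun j => Rlt_le_trans _ _ _ (hy j) (Rmin_l _ _)).
    have := Rabs_triang (f y - f x) (f x); have -> : f y - f x + f x = f y by ring.
    lra.
  rewrite -[X in X <= _]Rinv_inv; apply: Rinv_le_contravar => //; exact: Rmin_r.
- by exists (/ d); split=> //; apply/Rlt_le/Rinv_0_lt_compat.
Qed.

Lemma ccont_bounded D (f : pt D -> C) : ccont f -> exists M, 0 <= M /\ forall y, cube y -> Cmod (f y) <= M.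
Proof.
move=> cf; have [M1 [p1 H1]] := cont_bounded (ccont_Re cf); have [M2 [p2 H2]] := cont_bounded (ccont_Im cf).
exists (M1 + M2); split; first lra.
by move=> y hy; apply: Rle_trans (Cmod_le_ReIm _) _; have := H1 y hy; have := H2 y hy; lra.
Qed.

Definition rint D (s : seq 'I_D) (f : pt D -> R) : pt D -> R :=
  foldr (fun i F x => RInt (fun h => F (upd x i h)) 0 (2 * PI)) f s.

Lemma PI2_pos : 0 < 2 * PI. Proof. by have := PI_RGT_0; lra. Qed.

Lemma slice_cont D (f : pt D -> R) i x h : cont f -> continuous (fun h => f (upd x i h)) h.
Proof.
move=> cf P hP; have [d Hd] := cf (upd x i h) P hP; exists d => h' hh'; apply: Hd => j.
by rewrite /upd; case: ifP => _ //; apply: ball_center.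
Qed.

Lemma slice_RInt D (f : pt D -> R) i x a b : cont f -> ex_RInt (fun h => f (upd x i h)) a b.
Proof. by move=> cf; apply: (@ex_RInt_continuous R_CompleteNormedModule) => z _; apply: slice_cont. Qed.

Lemma rint1_cont D (f : pt D -> R) i : cont f -> cont (fun x => RInt (fun h => f (upd x i h)) 0 (2 * PI)).
Proof.
move=> cf x; apply/contP => eps e0; have pi := PI2_pos.
pose e := eps / (2 * PI + 1); have ep : 0 < e by apply: Rdiv_lt_0_compat; lra.
have [|h _|d [d0 Hd]] := @unif_interval 0 (2 * PI) (fun d h => forall y, close_to x d y ->
    Rabs (f (upd y i h) - f (upd x i h)) <= e).
- by move=> d d' h _ le H y hy; apply: H => j; apply: Rlt_le_trans le; apply: hy.
- have [d [d0 Hd]] := proj1 (contP _ _) (cf (upd x i h)) (e / 2) ltac:(lra).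
  exists d; split=> // h' hh' y hy.
  have n1 : close_to (upd x i h) d (upd y i h') by move=> j; rewrite /upd; case: ifP.
  have n2 : close_to (upd x i h) d (upd x i h').
    by move=> j; rewrite /upd; case: ifP => // _; rewrite Rminus_eq_0 Rabs_R0.
  have /Rabs_def2 := Hd _ n1; have /Rabs_def2 := Hd _ n2 => h1 h2.
  by apply: Rabs_le; lra.
- exists d; split=> // y hy; rewrite [_ - _](_ : _ = RInt (fun h => minus (f (upd y i h)) (f (upd x i h))) 0 (2 * PI)); last first.
    by rewrite RInt_minus; try exact: slice_RInt.
  apply: (Rle_lt_trans _ ((2 * PI - 0) * e)).
    apply: abs_RInt_le_const; first lra.
      by apply: (@ex_RInt_minus R_NormedModule); apply: slice_RInt.
    by move=> t ht; apply: Hd.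
  have -> : (2 * PI - 0) * e = eps - e by rewrite /e; field; lra.
  lra.
Qed.

Lemma rint_cont D s (f : pt D -> R) : cont f -> cont (rint s f).
Proof. by move=> cf; elim: s => [//|i s IH] /=; apply: rint1_cont. Qed.

Lemma rint_plus D s (f g : pt D -> R) x : cont f -> cont g ->
  rint s (fun x => f x + g x) x = rint s f x + rint s g x.
Proof.
move=> cf cg; elim: s x => [//|i s IH] x /=.
rewrite (RInt_ext _ (fun h => plus (rint s f (upd x i h)) (rint s g (upd x i h)))); last by move=> h _; apply: IH.
by rewrite RInt_plus //; apply: slice_RInt; apply: rint_cont.
Qed.

Lemma rint_scal D s (f : pt D -> R) k x : cont f -> rint s (fun x => k * f x) x = k * rint s f x.
Proof.
move=> cf; elim: s x => [//|i s IH] x /=.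
rewrite (RInt_ext _ (fun h => scal k (rint s f (upd x i h)))); last by move=> h _; apply: IH.
by rewrite RInt_scal //; apply: slice_RInt; apply: rint_cont.
Qed.

Lemma rint_le D s (f g : pt D -> R) x : cont f -> cont g ->
  (forall y : pt D, (forall j, y j = x j \/ 0 <= y j <= 2 * PI) ->
     (forall j, j \in s -> 0 <= y j <= 2 * PI) -> f y <= g y) ->
  rint s f x <= rint s g x.
Proof.
move=> cf cg; elim: s x => [|i s IH] x h /=; first by apply: h => // j; left.
apply: RInt_le; try by apply: slice_RInt; apply: rint_cont.
  by have := PI2_pos; lra.
move=> t ht; apply: IH => y h1 h2; case: (classic (0 <= y i <= 2 * PI)) => hi.
  apply: h => j; last by rewrite in_cons => /orP [/eqP ->|/h2].
  case: (h1 j); last by right.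
  by rewrite /upd; case: eqP => [->|_]; [right|left].
exfalso; apply: hi; case: (h1 i) => //; rewrite /upd eqxx => ->; lra.
Qed.

Lemma rint_const D (s : seq 'I_D) c x : rint s (fun _ => c) x = (2 * PI) ^ (size s) * c.
Proof.
elim: s x => [|i s IH] x /=; first by ring.
rewrite (RInt_ext _ (fun _ => (2 * PI) ^ size s * c)) => [|t _]; last exact: IH.
by rewrite RInt_const /scal /= /mult /=; ring.
Qed.

(** Integrated coordinates are overwritten, so the base point matters only in
    the others. *)
Lemma rint_base D s (f : pt D -> R) x y : (forall j, j \notin s -> x j = y j) ->
  rint s f x = rint s f y.
Proof.
elim: s x y => [|i s IH] x y h /=; first by congr f; apply: functional_extensionality => j; apply: h.
apply: RInt_ext => t _; apply: IH => j nj; rewrite /upd; case: eqP => // ne.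
by apply: h; rewrite in_cons negb_or nj andbT; apply/eqP.
Qed.

Lemma periodic_RInt (g : R -> R) a : (forall t, continuous g t) -> (forall t, g (t + 2 * PI) = g t) ->
  RInt (fun h => g (h + a)) 0 (2 * PI) = RInt g 0 (2 * PI).
Proof.
move=> cg pg.
have ex u v : ex_RInt g u v by apply: (@ex_RInt_continuous R_CompleteNormedModule) => z _.
have E u v b : RInt (fun h => g (h + b)) u v = RInt g (u + b) (v + b).
  have := @RInt_comp_lin R_CompleteNormedModule g 1 b u v.
  rewrite !Rmult_1_l => <- //.
  by apply: RInt_ext => t _; rewrite /scal /= /mult /= !Rmult_1_l.
rewrite E Rplus_0_l.
have h1 := RInt_Chasles g a 0 (2 * PI) (ex _ _) (ex _ _).
have h2 := RInt_Chasles g a (2 * PI) (2 * PI + a) (ex _ _) (ex _ _).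
have h3 : RInt g (2 * PI) (2 * PI + a) = RInt g 0 a.
  have := E 0 a (2 * PI); rewrite Rplus_0_l (Rplus_comm a) => <-.
  by apply: RInt_ext => t _.
have h4 := opp_RInt_swap g 0 a (ex _ _).
rewrite -h2 -h1 h3 -h4 /plus /opp /=; ring.
Qed.

Definition tshift D (b : pt D) (x : pt D) : pt D := fun j => x j + b j.

Definition rperiodic D (f : pt D -> R) : Prop := forall i x, f (upd x i (x i + 2 * PI)) = f x.

Lemma upd_upd D (x : pt D) i a b : upd (upd x i a) i b = upd x i b.
Proof. by apply: functional_extensionality => j; rewrite /upd; case: ifP => // ->. Qed.

Lemma upd_same D (x : pt D) i : upd x i (x i) = x.
Proof. by apply: functional_extensionality => j; rewrite /upd; case: eqP => [->|]. Qed.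

Lemma upd_comm D (x : pt D) i j a b : i <> j -> upd (upd x i a) j b = upd (upd x j b) i a.
Proof.
move=> ne; apply: functional_extensionality => k; rewrite /upd.
by case: eqP => [->|//]; case: eqP => // e; case: ne.
Qed.

Lemma rint_periodic D s (f : pt D -> R) : rperiodic f -> rperiodic (rint s f).
Proof.
move=> pf; elim: s => [//|i s IH] j x /=.
case: (i =P j) => [->|ne]; first by apply: RInt_ext => t _; rewrite !upd_upd.
apply: RInt_ext => t _; rewrite upd_comm; last by move=> e; apply: ne.
have := IH j (upd x i t); have -> // : upd x i t j = x j.
by rewrite /upd; case: (j =P i) => // e; case: ne.
Qed.

Lemma rint_shift D s (f : pt D -> R) b x : cont f -> rperiodic f ->
  rint s (fun y => f (tshift b y)) x = rint s f (tshift b x).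
Proof.
move=> cf pf; elim: s x => [//|i s IH] x /=.
rewrite (RInt_ext _ (fun h => (fun r => rint s f (upd (tshift b x) i r)) (h + b i))).
  rewrite (@periodic_RInt (fun r => rint s f (upd (tshift b x) i r))) // => t; first by apply: slice_cont; apply: rint_cont.
  by have := rint_periodic s pf i (upd (tshift b x) i t); rewrite upd_upd /upd eqxx.
move=> t _; rewrite IH; congr (rint s f _); apply: functional_extensionality => j.
by rewrite /tshift /upd; case: eqP => [->|].
Qed.

Lemma RInt_pos (g : R -> R) a b c : (forall t, continuous g t) -> (forall t, 0 <= g t) ->
  a < c < b -> 0 < g c -> 0 < RInt g a b.
Proof.
move=> cg g0 hc gc.
have ex u v : ex_RInt g u v by apply: (@ex_RInt_continuous R_CompleteNormedModule) => z _.
have ge u v : u <= v -> 0 <= RInt g u v by move=> uv; apply: RInt_ge_0 => // t _.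
have [d Hd] := proj1 (filterlim_R _ _ _) (cg c) (g c / 2) ltac:(lra).
have d0 := cond_pos d.
pose u := Rmax a (c - d / 2); pose v := Rmin b (c + d / 2).
have hu : a <= u /\ c - d / 2 <= u by split; [apply: Rmax_l|apply: Rmax_r].
have hv : v <= b /\ v <= c + d / 2 by split; [apply: Rmin_l|apply: Rmin_r].
have uc : u < c by apply: Rmax_lub_lt; lra.
have cv : c < v by apply: Rmin_glb_lt; lra.
have h1 := RInt_Chasles g a u b (ex _ _) (ex _ _).
have h2 := RInt_Chasles g u v b (ex _ _) (ex _ _).
have h3 : RInt (fun _ => g c / 2) u v <= RInt g u v.
  apply: RInt_le => //; [lra|apply: ex_RInt_const|].
  move=> t ht; have : ball c d t by apply: Rabs_def1; rewrite /minus /plus /opp /=; lra.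
  by move=> /Hd /Rabs_def2; lra.
rewrite RInt_const /scal /= /mult /= in h3.
have := ge a u ltac:(lra); have := ge v b ltac:(lra); rewrite /plus /= in h1 h2.
have : 0 < (v - u) * (g c / 2) by apply: Rmult_lt_0_compat; lra.
lra.
Qed.

Lemma rint_ge0 D s (f : pt D -> R) x : cont f -> (forall y, 0 <= f y) -> 0 <= rint s f x.
Proof.
move=> cf f0; rewrite -(Rmult_0_r ((2 * PI) ^ size s)) -(rint_const s 0 x).
by apply: rint_le => //; apply: cont_const.
Qed.

Lemma rint_pos D s (f : pt D -> R) x : cont f -> (forall y, 0 <= f y) ->
  (forall j, 0 < x j < 2 * PI) -> 0 < f x -> 0 < rint s f x.
Proof.
move=> cf f0 hx fx; elim: s => [//|i s IH] /=.
apply: (@RInt_pos (fun h => rint s f (upd x i h)) _ _ (x i)) => //; last by rewrite upd_same.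
  by move=> t; apply: slice_cont; apply: rint_cont.
by move=> t; apply: rint_ge0.
Qed.

Lemma tintE D (f : pt D -> C) : ccont f ->
  tint f = (rint (enum 'I_D) (fun x => Re (f x)) (fun _ => 0),
            rint (enum 'I_D) (fun x => Im (f x)) (fun _ => 0)).
Proof.
move=> cf; rewrite /tint; elim: (enum 'I_D) (fun _ => 0) => [|i s IH] x /=; first by case: (f x).
apply: (@is_RInt_unique C_R_CompleteNormedModule); apply: is_RInt_ext => [t _|]; first exact/esym/IH.
apply: is_RInt_fct_extend_pair; apply: RInt_correct; apply: slice_RInt; apply: rint_cont.
  exact: ccont_Re.
exact: ccont_Im.
Qed.

Lemma tint_plus D (f g : pt D -> C) : ccont f -> ccont g ->
  tint (fun x => f x + g x)%C = (tint f + tint g)%C.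
Proof.
move=> cf cg; have [f1 f2] := (ccont_Re cf, ccont_Im cf); have [g1 g2] := (ccont_Re cg, ccont_Im cg).
by rewrite !tintE //; [rewrite /= !rint_plus|exact: ccont_plus].
Qed.

Lemma cont_scal D (c : R) (g : pt D -> R) : cont g -> cont (fun x => c * g x).
Proof. by move=> cg; apply: cont_mult => //; apply: cont_const. Qed.

Lemma ccont_scal D (c : C) (g : pt D -> C) (cg : ccont g) : ccont (fun x => c * g x)%C.
Proof. by apply: ccont_mult => //; apply: ccont_const. Qed.
Arguments ccont_scal {D} c {g} cg x.

Lemma tint_scal D (f : pt D -> C) k : ccont f -> tint (fun x => k * f x)%C = (k * tint f)%C.
Proof.
move=> cf; have [f1 f2] := (ccont_Re cf, ccont_Im cf).
rewrite !tintE //; last exact: ccont_scal.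
rewrite /Cmult /=; congr pair; last first.
  by rewrite rint_plus ?rint_scal //; apply: cont_scal.
have -> : (fun x => k.1 * (f x).1 - k.2 * (f x).2) = (fun x => k.1 * Re (f x) + (- k.2) * Im (f x)).
  by apply: functional_extensionality => x; rewrite /Re /Im; ring.
rewrite rint_plus ?rint_scal //; try exact: cont_scal; ring.
Qed.

Lemma tint_ext D (f g : pt D -> C) : (forall x, f x = g x) -> tint f = tint g.
Proof. by move=> e; have -> : f = g by apply: functional_extensionality. Qed.

Definition vol D : R := (2 * PI) ^ D.

Lemma vol_gt0 D : 0 < vol D.
Proof. by apply: pow_lt; apply: PI2_pos. Qed.

Lemma rint_abs D (f : pt D -> R) M : cont f -> (forall y, cube y -> Rabs (f y) <= M) ->
  Rabs (rint (enum 'I_D) f (fun _ => 0)) <= vol D * M.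
Proof.
move=> cf h; have ci c : cont (fun _ : pt D => c) by apply: cont_const.
have cy (y : pt D) : (forall j, j \in enum 'I_D -> 0 <= y j <= 2 * PI) -> cube y.
  by move=> hy j; apply: hy; rewrite mem_enum.
have E c : rint (enum 'I_D) (fun _ => c) (fun _ => 0) = vol D * c by rewrite rint_const size_enum_ord.
apply: Rabs_le; rewrite -(E M); have -> : - rint (enum 'I_D) (fun _ => M) (fun _ => 0) = rint (enum 'I_D) (fun _ => - M) (fun _ => 0).
  by rewrite !E; ring.
by split; apply: rint_le => // y _ /cy/h hy; have := Rabs_le_between (f y) M; move=> [/(_ hy) [? ?] _].
Qed.

Lemma tint_abs D (f : pt D -> C) M : ccont f -> (forall y, cube y -> Cmod (f y) <= M) ->
  Cmod (tint f) <= 2 * vol D * M.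
Proof.
move=> cf h; rewrite tintE //; apply: Rle_trans (Cmod_le_ReIm _) _ => /=.
have := rint_abs (ccont_Re cf) (fun y hy => Rle_trans _ _ _ (Re_le_Cmod _) (h y hy)).
have := rint_abs (ccont_Im cf) (fun y hy => Rle_trans _ _ _ (Im_le_Cmod _) (h y hy)).
lra.
Qed.

(** For a periodic integrand each one-dimensional integral runs over a full
    period and does not see the translation. *)
Lemma tint_shift D (f : pt D -> C) b : ccont f -> periodic f ->
  tint (fun x => f (tshift b x)) = tint f.
Proof.
move=> cf pf.
have cs : ccont (fun x => f (tshift b x)).
  move=> x P hP; have [d Hd] := cf (tshift b x) P hP; exists d => y hy; apply: Hd => j.
  have := hy j; rewrite /ball /= /AbsRing_ball /= /abs /minus /plus /opp /= /tshift.
  by have -> : y j + b j + - (x j + b j) = y j + - x j by ring.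
rewrite !tintE //.
have p1 : rperiodic (fun x => Re (f x)) by move=> i x; rewrite pf.
have p2 : rperiodic (fun x => Im (f x)) by move=> i x; rewrite pf.
rewrite (@rint_shift D _ (fun x => Re (f x))) //; last exact: ccont_Re.
rewrite (@rint_shift D _ (fun x => Im (f x))) //; last exact: ccont_Im.
by congr pair; apply: rint_base => j; rewrite mem_enum.
Qed.

Lemma tint_sum D (I : Type) (s : seq I) (F : I -> pt D -> C) : (forall l, ccont (F l)) ->
  tint (fun x => \big[Cplus/RtoC 0]_(l <- s) F l x) = \big[Cplus/RtoC 0]_(l <- s) tint (F l).
Proof.
move=> h; elim: s => [|l s IH].
  rewrite big_nil (tint_ext (g := fun _ => (RtoC 0 * RtoC 0)%C)).
    by rewrite tint_scal; [ring|apply: ccont_const].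
  by move=> x; rewrite big_nil; ring.
rewrite big_cons -IH -tint_plus //; last exact: ccont_sum.
by apply: tint_ext => x; rewrite big_cons.
Qed.

Definition joint_cont D (G : R -> pt D -> C) (r0 : R) : Prop :=
  forall x, continuous (fun z : R * pt D => G z.1 z.2) (r0, x).

Lemma joint_cont_slice D (G : R -> pt D -> C) r0 : joint_cont G r0 -> ccont (G r0).
Proof.
move=> h x P hP; have [d Hd] := h x P hP; exists d => y hy; apply: (Hd (r0, y)).
by split=> //; apply: ball_center.
Qed.

(** The difference quotient is a value of G at an intermediate time, and G is
    uniformly close to G r0 on the compact cube. *)
Lemma rint_derive D (F G : R -> pt D -> R) r0 d0 : 0 < d0 ->
  (forall r, Rabs (r - r0) < d0 -> cont (F r)) ->
  (forall r x, Rabs (r - r0) < d0 -> is_derive (fun r => F r x) r (G r x)) ->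
  (forall x, continuous (fun z : R * pt D => G z.1 z.2) (r0, x)) ->
  is_derive (fun r => rint (enum 'I_D) (F r) (fun _ => 0)) r0
            (rint (enum 'I_D) (G r0) (fun _ => 0)).
Proof.
move=> d0p cF dF cG.
have cG0 : cont (G r0).
  move=> x P hP; have [d Hd] := cG x P hP; exists d => y hy; apply: (Hd (r0, y)).
  by split=> //; apply: ball_center.
apply/is_derive_Reals => eps e0.
pose e := eps / (vol D + 1); have v0 := vol_gt0 D.
have ep : 0 < e by apply: Rdiv_lt_0_compat; lra.
have [|x|d [dp Hd]] := @unif_cube D (fun d y => forall r, Rabs (r - r0) < d -> Rabs (G r y - G r0 y) <= e).
- by move=> d d' y _ le H r hr; apply: H; lra.
- have [d Hd] := proj1 (filterlim_R _ _ _) (cG x) (e / 2) ltac:(lra).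
  exists d; split=> [|y hy r hr]; first exact: cond_pos.
  have b1 : ball ((r0, x) : R * pt D) d (r, y) by split.
  have b2 : ball ((r0, x) : R * pt D) d (r0, y) by split => //; apply: ball_center.
  have /= /Rabs_def2 := Hd _ b1; have /= /Rabs_def2 := Hd _ b2 => h1 h2.
  by apply: Rabs_le; lra.
have mp : 0 < Rmin d d0 by apply: Rmin_pos.
exists (mkposreal _ mp) => h hn0 /= hh.
have hd : Rabs h < d by apply: Rlt_le_trans hh (Rmin_l _ _).
have hd0 : Rabs h < d0 by apply: Rlt_le_trans hh (Rmin_r _ _).
have cFh : cont (F (r0 + h)) by apply: cF; have -> : r0 + h - r0 = h by ring.
have cF0 : cont (F r0) by apply: cF; rewrite Rminus_eq_0 Rabs_R0.
rewrite -[X in Rabs X](_ : rint (enum 'I_D) (fun y => / h * (F (r0 + h) y + (-1) * F r0 y) + (-1) * G r0 y) (fun _ => 0) = _); last first.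
  rewrite rint_plus ?rint_scal ?rint_plus ?rint_scal //; try exact: cont_scal.
  - by field.
  - by apply: cont_plus => //; apply: cont_scal.
  - by apply: cont_scal; apply: cont_plus => //; apply: cont_scal.
apply: Rle_lt_trans (@rint_abs D _ e _ _) _.
- by apply: cont_plus; apply: cont_scal => //; apply: cont_plus => //; apply: cont_scal.
- move=> y hy.
  have seg t : Rmin r0 (r0 + h) <= t <= Rmax r0 (r0 + h) -> Rabs (t - r0) <= Rabs h.
    rewrite /Rmin /Rmax; case: Rle_dec => _ ht; [rewrite !Rabs_pos_eq|rewrite !Rabs_left1]; lra.
  have [|t ht|c [hc E]] := @MVT_gen (fun r => F r y) r0 (r0 + h) (fun r => G r y).
  - by move=> t ht; apply: dF; apply: Rle_lt_trans hd0; apply: seg; lra.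
  - apply: derivable_continuous_pt; exists (G t y); apply/is_derive_Reals; apply: dF.
    by apply: Rle_lt_trans hd0; apply: seg.
  have -> : / h * (F (r0 + h) y + -1 * F r0 y) + -1 * G r0 y = G c y - G r0 y.
    have -> : F (r0 + h) y + -1 * F r0 y = G c y * h by lra.
    by field.
  by apply: Hd => //; apply: Rle_lt_trans hd; apply: seg.
have -> : vol D * e = eps - e by rewrite /e; field; lra.
lra.
Qed.

Notation is_Cderive := (@is_derive R_AbsRing C_R_NormedModule).

Lemma is_Cderive_pair (g : R -> C) t (z : C) :
  is_derive (fun r => Re (g r)) t (Re z) -> is_derive (fun r => Im (g r)) t (Im z) ->
  is_Cderive g t z.
Proof.
move=> h1 h2; have := is_derive_pair h1 h2; case: z {h1 h2} => a b /=.
by apply: is_derive_ext => r; case: (g r).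
Qed.

Lemma tint_derive D (F G : R -> pt D -> C) r0 d0 : 0 < d0 ->
  (forall r, Rabs (r - r0) < d0 -> ccont (F r)) ->
  (forall r x, Rabs (r - r0) < d0 -> is_Cderive (fun r => F r x) r (G r x)) ->
  joint_cont G r0 ->
  is_Cderive (fun r => tint (F r)) r0 (tint (G r0)).
Proof.
move=> d0p cF dF cG.
have dp : locally r0 (fun r => Rabs (r - r0) < d0) by exists (mkposreal d0 d0p).
rewrite (tintE (joint_cont_slice cG)).
apply: is_Cderive_pair => /=.
- apply: is_derive_ext_loc (@rint_derive D (fun r x => Re (F r x)) (fun r x => Re (G r x)) r0 d0 d0p _ _ _).
  + by apply: filter_imp dp => r hr; rewrite tintE //; apply: cF.
  + by move=> r hr; apply: ccont_Re; apply: cF.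
  + by move=> r x hr; case: (is_derive_Re (dF r x hr)).
  + by move=> x; case: (filterlim_ReIm _ (cG x)).
- apply: is_derive_ext_loc (@rint_derive D (fun r x => Im (F r x)) (fun r x => Im (G r x)) r0 d0 d0p _ _ _).
  + by apply: filter_imp dp => r hr; rewrite tintE //; apply: cF.
  + by move=> r hr; apply: ccont_Im; apply: cF.
  + by move=> r x hr; case: (is_derive_Re (dF r x hr)).
  + by move=> x; case: (filterlim_ReIm _ (cG x)).
Qed.

(** * Characters and integration by parts *)

Lemma ex_Cderive_is (g : R -> C) t : ex_Cderive g t -> is_Cderive g t (CDerive g t).
Proof.
case=> z dz; have [d1 d2] := is_derive_Re dz.
by rewrite /CDerive (is_derive_unique _ _ _ d1) (is_derive_unique _ _ _ d2); case: (z) dz.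
Qed.

Lemma is_Cderive_unique (g : R -> C) t z : is_Cderive g t z -> CDerive g t = z.
Proof.
move=> dz; have [d1 d2] := is_derive_Re dz.
by rewrite /CDerive (is_derive_unique _ _ _ d1) (is_derive_unique _ _ _ d2); case: (z).
Qed.

Lemma is_Cderive_scal (g : R -> C) t (k z : C) : is_Cderive g t z -> is_Cderive (fun r => k * g r)%C t (k * z)%C.
Proof.
move=> /is_derive_Re [d1 d2]; apply: is_Cderive_pair => /=.
  apply: is_derive_minus; exact: is_derive_scal.
apply: is_derive_plus; exact: is_derive_scal.
Qed.

Lemma is_Cderive_plus (f g : R -> C) t (y z : C) : is_Cderive f t y -> is_Cderive g t z ->
  is_Cderive (fun r => f r + g r)%C t (y + z)%C.
Proof. by move=> h1 h2; apply: (@is_derive_plus R_AbsRing C_R_NormedModule). Qed.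

Lemma is_Cderive_comp (g : R -> C) (u : R -> R) t du (z : C) : is_derive u t du ->
  is_Cderive g (u t) z -> is_Cderive (fun r => g (u r)) t (RtoC du * z)%C.
Proof. by move=> hu hg; have := @is_derive_comp R_AbsRing C_R_NormedModule g u t z du hg hu; rewrite scal_R_Cmult. Qed.

Definition freq0 D : freq D := fun _ => Z0.
Definition add_freq D (l m : freq D) : freq D := fun i => (l i + m i)%Z.
Definition delta D (i : 'I_D) : freq D := fun j => if j == i then 1%Z else 0%Z.

Lemma expi0 D (x : pt D) : expi (@freq0 D) x = RtoC 1.
Proof.
rewrite /expi big1 ?cos_0 ?sin_0 // => i _; rewrite /freq0; ring.
Qed.

Lemma expi_add D (l m : freq D) x : expi (add_freq l m) x = (expi l x * expi m x)%C.
Proof.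
rewrite /expi (eq_bigr (fun i => IZR (l i) * x i + IZR (m i) * x i)).
  by rewrite big_split /= cos_plus sin_plus /Cmult /=; congr pair; ring.
by move=> i _; rewrite plus_IZR; ring.
Qed.

Lemma expi_shift D (l : freq D) b x : expi l (tshift b x) = (expi l b * expi l x)%C.
Proof.
rewrite /expi (eq_bigr (fun i => IZR (l i) * b i + IZR (l i) * x i)).
  by rewrite big_split /= cos_plus sin_plus /Cmult /=; congr pair; ring.
by move=> i _; rewrite /tshift; ring.
Qed.

Lemma opp_freqK D (l : freq D) : opp_freq (opp_freq l) = l.
Proof. by apply: functional_extensionality => i; rewrite /opp_freq; lia. Qed.

Lemma Cmod_expi D (l : freq D) x : Cmod (expi l x) = 1.
Proof. by rewrite /Cmod /expi /= !Rmult_1_r -/(Rsqr _) -/(Rsqr (sin _)) Rplus_comm sin2_cos2 sqrt_1. Qed.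

Lemma big_delta D (i : 'I_D) (a : 'I_D -> R) :
  (forall j, j <> i -> a j = 0) -> \big[Rplus/0]_(j < D) a j = a i.
Proof.
move=> h; rewrite (bigD1 i) //= big1 ?Rplus_0_r // => j /eqP ne; exact: h.
Qed.

Lemma expi_axis D (l : freq D) i r : expi l (upd (fun _ => 0) i r) = (cos (IZR (l i) * r), sin (IZR (l i) * r)).
Proof.
rewrite /expi phase_upd big1 => [|j _]; last by ring.
by have -> : 0 + IZR (l i) * (r - 0) = IZR (l i) * r by ring.
Qed.

Lemma expi_delta D (i : 'I_D) x : expi (delta i) x = (cos (x i), sin (x i)).
Proof.
rewrite /expi; have -> // : \big[Rplus/0]_(j < D) (IZR (delta i j) * x j) = x i.
rewrite (@big_delta D i) /delta; first by rewrite eqxx; ring.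
by move=> j /eqP/negbTE ->; ring.
Qed.

(** Translating by half a period along a coordinate where l does not vanish
    changes the sign of the character but not its integral. *)
Lemma tint_expi_ne0 D (l : freq D) : l <> @freq0 D -> tint (expi l) = RtoC 0.
Proof.
move=> ne; have [i hi] : exists i, l i <> 0%Z.
  apply: NNPP => h; apply: ne; apply: functional_extensionality => i.
  by apply: NNPP => h'; apply: h; exists i.
pose b : pt D := upd (fun _ => 0) i (PI / IZR (l i)).
have := tint_shift b (@ccont_expi D l) (@expi_periodic D l).
rewrite (tint_ext (g := fun x => (expi l b * expi l x)%C)); last by move=> x; apply: expi_shift.
rewrite tint_scal; last exact: ccont_expi.
have -> : expi l b = RtoC (-1).
  rewrite expi_axis; have -> : IZR (l i) * (PI / IZR (l i)) = PI by field; apply: not_0_IZR.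
  by rewrite cos_PI sin_PI.
case: (tint (expi l)) => u v [h1 h2]; rewrite /RtoC; congr pair; lra.
Qed.

Lemma tint_const D (c : C) : tint (fun _ : pt D => c) = (RtoC (vol D) * c)%C.
Proof.
rewrite tintE; last exact: ccont_const.
by rewrite !rint_const size_enum_ord /Cmult /=; case: c => u v; congr pair => /=; rewrite -/(vol D); ring.
Qed.

Lemma tint_expi_expi D (l m : freq D) :
  tint (fun x => expi l x * expi (opp_freq m) x)%C =
  if excluded_middle_informative (l = m) then RtoC (vol D) else RtoC 0.
Proof.
rewrite (tint_ext (g := expi (add_freq l (opp_freq m)))); last by move=> x; rewrite expi_add.
case: excluded_middle_informative => /= [->|ne].
  have -> : add_freq m (opp_freq m) = @freq0 D.
    by apply: functional_extensionality => i; rewrite /add_freq /opp_freq /freq0; lia.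
  rewrite (tint_ext (g := fun _ => RtoC 1)); last exact: expi0.
  by rewrite tint_const; ring.
apply: tint_expi_ne0 => e; apply: ne; apply: functional_extensionality => i.
by have := congr1 (fun f => f i) e; rewrite /add_freq /opp_freq /freq0; lia.
Qed.

(** The integral of a translated product is constant in the translation;
    differentiating this along the i-th axis moves the derivative from f onto
    the character. *)
Lemma tint_pd D (f : pt D -> C) i l : ccont f -> periodic f ->
  (forall x, ex_pd i f x) -> ccont (pd i f) ->
  tint (fun x => pd i f x * expi l x)%C = (- (Ci * IZR (l i)) * tint (fun x => f x * expi l x))%C.
Proof.
move=> cf pf ef cpf.
pose ax r : pt D := upd (fun _ => 0) i r.
have shE r x : tshift (ax r) x = upd x i (x i + r).
  by apply: functional_extensionality => j; rewrite /tshift /ax /upd; case: eqP => [->//|_]; ring.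
pose F r x := (f (tshift (ax r) x) * expi l x)%C.
pose G r x := (pd i f (tshift (ax r) x) * expi l x)%C.
have jsh g : ccont g -> forall r0 x, continuous (fun z : R * pt D => g (tshift (ax z.1) z.2)) (r0, x).
  move=> cg r0 x P hP; have [d Hd] := cg (tshift (ax r0) x) P hP.
  have d2 : 0 < d / 2 by have := cond_pos d; lra.
  exists (mkposreal _ d2) => -[r y] [/= hr hy]; apply: Hd => j.
  have := hy j; rewrite /ball /= /AbsRing_ball /= /abs /minus /plus /opp /= => /Rabs_def2 [h1 h2].
  move: hr; rewrite /ball /= /AbsRing_ball /= /abs /minus /plus /opp /= => /Rabs_def2 [h3 h4].
  by rewrite /tshift /ax /upd; case: ifP => _; apply: Rabs_def1; lra.
have cshift g r : ccont g -> ccont (fun x => g (tshift (ax r) x)).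
  by move=> cg; apply: (@joint_cont_slice D (fun r x => g (tshift (ax r) x)) r) => x; apply: jsh.
have dF r x : is_Cderive (fun r => F r x) r (G r x).
  have -> : G r x = (expi l x * (RtoC 1 * pd i f (upd x i (x i + r))))%C by rewrite /G shE; ring.
  apply: (is_derive_ext (fun r => (expi l x * f (upd x i (x i + r)))%C)).
    by move=> t; rewrite /F shE Cmult_comm.
  apply: is_Cderive_scal; apply: (@is_Cderive_comp (fun h => f (upd x i h)) (fun r => x i + r)).
    by auto_derive => //; ring.
  have := ex_Cderive_is (ef (upd x i (x i + r))).
  rewrite /pd; have -> : upd x i (x i + r) i = x i + r by rewrite /upd eqxx.
  have -> : (fun h => f (upd (upd x i (x i + r)) i h)) = (fun h => f (upd x i h)).
    by apply: functional_extensionality => h; rewrite upd_upd.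
  by [].
have jG : joint_cont G 0.
  move=> x; apply: (@filterlim_Cmult _ (locally ((0, x) : R * pt D)) _ (fun z => pd i f (tshift (ax z.1) z.2)) (fun z => expi l z.2)).
    exact: (jsh (pd i f) cpf 0 x).
  move=> P hP; have [d Hd] := @ccont_expi D l x P hP; exists d => -[r y] [_ hy]; exact: Hd.
have cF r : ccont (F r) by apply: ccont_mult; [apply: cshift|apply: ccont_expi].
have d1 := @tint_derive D F G 0 1 Rlt_0_1 (fun r _ => cF r) (fun r x _ => dF r x) jG.
have E r : tint (F r) = (tint (fun x => f x * expi l x) * (cos (IZR (l i) * - r), sin (IZR (l i) * - r)))%C.
  rewrite -(expi_axis l i (- r)) -/(ax (- r)) Cmult_comm.
  have cfe : ccont (fun x => f x * expi l x)%C by apply: ccont_mult => //; apply: ccont_expi.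
  rewrite -(tint_shift (ax r) cfe); last by move=> j x; rewrite pf expi_periodic.
  rewrite -tint_scal; last exact: (cshift (fun x => f x * expi l x)%C).
  apply: tint_ext => x; rewrite /F expi_shift.
  have e1 : (expi l (ax (- r)%R) * expi l (ax r))%C = RtoC 1.
    rewrite -expi_shift shE /ax upd_upd expi_axis.
    have -> : IZR (l i) * (upd (fun=> 0) i r i + - r) = 0 by rewrite /upd eqxx; ring.
    by rewrite cos_0 sin_0.
  rewrite -[LHS]Cmult_1_l -e1; ring.
have d2 : is_Cderive (fun r => tint (F r)) 0 (tint (fun x => f x * expi l x) * (RtoC 0 + - (Ci * IZR (l i))))%C.
  apply: (is_derive_ext (fun r => (tint (fun x => f x * expi l x) * (cos (IZR (l i) * - r), sin (IZR (l i) * - r)))%C)).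
    by move=> r; rewrite E.
  apply: is_Cderive_scal; apply: is_Cderive_pair => /=; auto_derive => //; rewrite ?Ropp_0 ?Rmult_0_r ?cos_0 ?sin_0; ring.
have e1 := is_Cderive_unique d1; have e2 := is_Cderive_unique d2.
have -> : tint (fun x => pd i f x * expi l x)%C = tint (G 0).
  apply: tint_ext => x; rewrite /G; congr (pd i f _ * _)%C.
  by rewrite shE Rplus_0_r upd_same.
rewrite -e1 e2; ring.
Qed.

(** * Uniqueness of Fourier coefficients *)

(** Membership is stable under multiplication by characters, hence by
    trigonometric polynomials; this is what makes the peaking argument below
    work. *)
Definition annihilated D (f : pt D -> C) : Prop :=
  ccont f /\ forall l, tint (fun x => f x * expi l x)%C = RtoC 0.

Lemma ann_ext D (f g : pt D -> C) : (forall x, f x = g x) -> annihilated f -> annihilated g.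
Proof. by move=> e; have -> : f = g by apply: functional_extensionality. Qed.

Lemma ann_plus D (f g : pt D -> C) : annihilated f -> annihilated g -> annihilated (fun x => f x + g x)%C.
Proof.
move=> [cf hf] [cg hg]; split=> [|l]; first exact: ccont_plus.
rewrite (tint_ext (g := fun x => (f x * expi l x + g x * expi l x)%C)); last by move=> x; ring.
rewrite tint_plus ?hf ?hg; [ring| |]; by apply: ccont_mult => //; apply: ccont_expi.
Qed.

Lemma ann_scal D (f : pt D -> C) k : annihilated f -> annihilated (fun x => k * f x)%C.
Proof.
move=> [cf hf]; split=> [|l]; first exact: ccont_scal.
rewrite (tint_ext (g := fun x => (k * (f x * expi l x))%C)); last by move=> x; ring.
rewrite tint_scal ?hf; first ring; by apply: ccont_mult => //; apply: ccont_expi.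
Qed.

Lemma ann_expi D (f : pt D -> C) m : annihilated f -> annihilated (fun x => f x * expi m x)%C.
Proof.
move=> [cf hf]; split=> [|l]; first by apply: ccont_mult => //; apply: ccont_expi.
by rewrite (tint_ext (g := fun x => (f x * expi (add_freq m l) x)%C)) // => x; rewrite expi_add; ring.
Qed.

Lemma ann_cos D (f : pt D -> C) i : annihilated f -> annihilated (fun x => RtoC (cos (x i)) * f x)%C.
Proof.
move=> af; have h := ann_plus (ann_scal (RtoC (/ 2)) (ann_expi (delta i) af))
                              (ann_scal (RtoC (/ 2)) (ann_expi (opp_freq (delta i)) af)).
apply: ann_ext h => x /=; rewrite expi_delta.
have -> : expi (opp_freq (delta i)) x = (cos (x i), - sin (x i)).
  rewrite /expi (eq_bigr (fun j => (-1) * (IZR (delta i j) * x j))).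
    rewrite Rsum_scal; have := expi_delta i x; rewrite /expi => -[h1 h2].
    by rewrite Ropp_mult_distr_l_reverse Rmult_1_l cos_neg sin_neg h1 h2.
  by move=> j _; rewrite /opp_freq opp_IZR; ring.
by case: (f x) => u v; rewrite /Cmult /Cplus /=; congr pair; field.
Qed.

(** At the centre (PI, ..., PI) of the cube the value is 1 + eta; eta is chosen
    so that values above 1 occur only close to the centre, while everywhere the
    polynomial is at least eta - 1 > -1. *)
Definition peak D (eta : R) (x : pt D) : R :=
  eta + (- / INR D) * \big[Rplus/0]_(i < D) cos (x i).

Lemma ann_peak D (f : pt D -> C) eta : annihilated f -> annihilated (fun x => RtoC (peak eta x) * f x)%C.
Proof.
move=> af.
have H (s : seq 'I_D) : annihilated (fun x => RtoC (\big[Rplus/0]_(i <- s) cos (x i)) * f x)%C.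
  elim: s => [|i s IH].
    by apply: ann_ext (ann_scal (RtoC 0) af) => x; rewrite big_nil.
  apply: ann_ext (ann_plus (ann_cos i af) IH) => x.
  by rewrite big_cons RtoC_plus; ring.
apply: ann_ext (ann_plus (ann_scal (RtoC eta) af) (ann_scal (RtoC (- / INR D)) (H (index_enum 'I_D)))) => x.
rewrite /peak; move: (- / INR D) (\big[Rplus/0]_(i < D) cos (x i)) => k S.
by rewrite RtoC_plus RtoC_mult; ring.
Qed.

Lemma peak_cont D eta : cont (@peak D eta).
Proof.
apply: cont_plus; first exact: cont_const.
apply: cont_scal; elim: (index_enum 'I_D) => [|i s IH].
  have -> : (fun x : pt D => \big[Rplus/0]_(i <- [::]) cos (x i)) = fun=> 0.
    by apply: functional_extensionality => x; rewrite big_nil.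
  exact: cont_const.
have -> : (fun x : pt D => \big[Rplus/0]_(j <- i :: s) cos (x j)) = (fun x => cos (x i) + \big[Rplus/0]_(j <- s) cos (x j)).
  by apply: functional_extensionality => x; rewrite big_cons.
by apply: cont_plus => //; apply: (@cont_coord D cos i) => r; apply: continuous_cos.
Qed.

Lemma peak_near D d eta (y : pt D) : (0 < D)%nat -> 0 < d <= PI -> eta = (1 - cos d) / INR D ->
  cube y -> 1 < peak eta y -> close_to (fun _ => PI) d y.
Proof.
move=> D0 hd -> cy hp; have dpos : 0 < INR D by apply: lt_0_INR; apply/ltP.
move=> j; apply: Rnot_le_lt => hj; move: hp; apply: Rle_not_lt.
rewrite /peak; apply: (Rmult_le_reg_l (INR D)) => //.
have -> : INR D * ((1 - cos d) / INR D + - / INR D * \big[Rplus/0]_(i < D) cos (y i)) =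
  1 - cos d - \big[Rplus/0]_(i < D) cos (y i) by field; lra.
have hc : - cos (y j) <= cos d.
  have -> : - cos (y j) = cos (Rabs (y j - PI)).
    have -> : cos (Rabs (y j - PI)) = cos (y j - PI) by rewrite /Rabs; case: Rcase_abs => _ //; rewrite cos_neg.
    by rewrite cos_minus cos_PI sin_PI; ring.
  have := cy j => hyj.
  have ? := Rabs_pos (y j - PI); have ? : Rabs (y j - PI) <= PI by apply: Rabs_le; lra.
  by apply: cos_decr_1; lra.
have E : \big[Rplus/0]_(i < D) (-1) = - INR D.
  rewrite big_const_ord; elim: (D) => [|n IH]; first by rewrite /=; ring.
  by rewrite iterS IH S_INR; ring.
have : \big[Rplus/0]_(i < D) (-1) <= \big[Rplus/0]_(i < D | i != j) cos (y i) - 1.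
  rewrite (bigD1 j) //= [X in X <= _]Rplus_comm; apply: Rplus_le_compat_r.
  by apply: Rsum_le => i _; have := COS_bound (y i); lra.
rewrite E [X in _ -> _ - X <= _](bigD1 j) //=.
have K S : - INR D <= S - 1 -> 1 - cos d - (cos (y j) + S) <= INR D * 1 by lra.
exact: K.
Qed.

Lemma peak_ge D eta (y : pt D) : (0 < D)%nat -> eta - 1 <= peak eta y.
Proof.
move=> D0; have dpos : 0 < INR D by apply: lt_0_INR; apply/ltP.
have h : \big[Rplus/0]_(i < D) cos (y i) <= INR D.
  apply: (Rle_trans _ (\big[Rplus/0]_(i < D) 1)); first by apply: Rsum_le => i _; have := COS_bound (y i); lra.
  apply: Req_le; rewrite big_const_ord; elim: (D) => [//|n IH].
  by rewrite iterS IH S_INR; ring.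
rewrite /peak; have : / INR D * \big[Rplus/0]_(i < D) cos (y i) <= / INR D * INR D.
  by apply: Rmult_le_compat_l => //; apply/Rlt_le/Rinv_0_lt_compat.
by rewrite Rinv_l; lra.
Qed.

Lemma cont_pow D (f : pt D -> R) n : cont f -> cont (fun x => f x ^ n).
Proof. by move=> cf; elim: n => [|n IH] /=; [exact: cont_const|exact: cont_mult]. Qed.

(** If f did not vanish at the centre, its integral against even powers of
    [peak] would grow geometrically near the centre, where the product is
    positive, and stay bounded elsewhere; but all these integrals are 0. *)
Lemma annihilated_centre D (f : pt D -> C) : (0 < D)%nat -> annihilated f -> f (fun _ => PI) = RtoC 0.
Proof.
move=> D0 af; apply: Cmod_eq_0; apply: NNPP => ne.
set c : pt D := fun _ => PI; set z := f c.
have zp : 0 < Cmod z by have := Cmod_ge_0 z; rewrite /z /c; lra.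
(* Rotate f so that its value at the centre is a positive real. *)
pose h x := Re (Cconj z * f x)%C.
have ch : cont h by apply: ccont_Re; apply: ccont_scal; case: af.
pose e := Cmod z ^ 2 / 2; have e0 : 0 < e by rewrite /e; have := pow_lt _ 2 zp; lra.
have hcE : h c = 2 * e.
  by rewrite /h /e /= -/z /Cconj /=; have := Cmod2 z; rewrite /Re /Im /=; lra.
have [d0 [d0p Hd0]] := proj1 (contP h c) (ch c) e e0.
have PIp := PI_RGT_0.
pose d := Rmin d0 PI; have hd : 0 < d <= PI by split; [apply: Rmin_pos|apply: Rmin_r].
have dpos : 0 < INR D by apply: lt_0_INR; apply/ltP.
pose eta := (1 - cos d) / INR D.
have etap : 0 < eta.
  apply: Rdiv_lt_0_compat => //; have := cos_decreasing_1 0 d ltac:(lra) ltac:(lra) ltac:(lra) ltac:(lra) ltac:(lra).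
  by rewrite cos_0; lra.
have eta2 : eta / 2 <= 1.
  rewrite /eta; have := COS_bound d => hb.
  have D1 : 1 <= INR D by rewrite -[1]/(INR 1); apply: le_INR; apply/leP.
  have : (1 - cos d) / INR D <= 2.
    by apply: (Rmult_le_reg_r (INR D)) => //; rewrite /Rdiv Rmult_assoc Rinv_l; nra.
  lra.
have hpos y : cube y -> 1 < peak eta y -> e < h y.
  move=> cy /(peak_near D0 hd erefl cy) ny.
  have /Rabs_def2 := Hd0 y (fun j => Rlt_le_trans _ _ _ (ny j) (Rmin_l _ _)).
  by rewrite hcE; lra.
have [M [M0 HM]] := cont_bounded ch.
(* A continuous bump, supported where [peak] exceeds 1 + eta / 2. *)
pose b (y : pt D) := Rmax 0 (peak eta y - (1 + eta / 2)).
have cb : cont b.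
  move=> x; have -> : b = fun y => / 2 * ((peak eta y - (1 + eta / 2)) + Rabs (peak eta y - (1 + eta / 2))).
    apply: functional_extensionality => y; rewrite /b /Rmax; case: Rle_dec => h1.
      by rewrite Rabs_pos_eq; lra.
    by rewrite Rabs_left1; lra.
  have cp : cont (fun y : pt D => peak eta y - (1 + eta / 2)).
    apply: cont_plus; [exact: peak_cont|exact: cont_const].
  apply: cont_scal; apply: cont_plus => // x'; apply: (continuous_comp _ Rabs); first exact: cp.
  exact: continuous_Rabs.
have b0 y : 0 <= b y by apply: Rmax_l.
have bc : 0 < b c.
  apply: Rlt_le_trans (Rmax_r _ _); rewrite /peak /c.
  rewrite big_const_ord cos_PI.
  have -> : ssrnat.iter D (Rplus (-1)) 0 = - INR D.
    by elim: (D) => [|n IH]; [rewrite /=; ring|rewrite iterS IH S_INR; ring].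
  have -> : - / INR D * - INR D = 1 by field; lra.
  lra.
have Ib : 0 < rint (enum 'I_D) b (fun _ => 0).
  rewrite (@rint_base _ _ _ _ c) => [|j]; last by rewrite mem_enum.
  by apply: rint_pos => // j; rewrite /c; lra.
have zero n : rint (enum 'I_D) (fun x => h x * peak eta x ^ n) (fun _ => 0) = 0.
  have [cg /(_ (@freq0 D))] : annihilated (fun x => RtoC (peak eta x ^ n) * (Cconj z * f x))%C.
    elim: n => [|n IH].
      by apply: ann_ext (ann_scal (Cconj z) af) => x; rewrite /=; ring.
    by apply: ann_ext (ann_peak eta IH) => x /=; rewrite RtoC_mult; ring.
  rewrite (tint_ext (g := fun x => (RtoC (peak eta x ^ n) * (Cconj z * f x))%C)); last by move=> x; rewrite expi0; ring.
  rewrite tintE // => -[E _]; rewrite -[RHS]E; congr (rint _ _ _).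
  by apply: functional_extensionality => x; rewrite /h /Re /=; ring.
(* Pointwise, the integrand is at least the bump times the geometric factor, up to
   the bounded contribution - M of the region where [peak] is at most 1. *)
have key m : e * (1 + eta / 2) ^ (2 * m)%nat * rint (enum 'I_D) b (fun _ => 0) <= M * vol D.
  have cT : cont (fun x => h x * peak eta x ^ (2 * m)%nat).
    by apply: cont_mult => //; apply: cont_pow; exact: peak_cont.
  have : rint (enum 'I_D) (fun y => (e * (1 + eta / 2) ^ (2 * m)%nat) * b y + - M) (fun _ => 0) <= 0.
    apply: Rle_trans (Req_le _ _ (zero (2 * m)%nat)); apply: rint_le => //.
      by apply: cont_plus; [exact: cont_scal|exact: cont_const].
    move=> y _ cy0; have cy : cube y by move=> j; apply: cy0; rewrite mem_enum.
    have sq : 0 <= peak eta y ^ (2 * m)%nat by rewrite pow_mult; apply: pow_le; apply: pow2_ge_0.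
    have gp : 0 <= (1 + eta / 2) ^ (2 * m)%nat by apply: pow_le; lra.
    have := HM y cy => /Rabs_le_between hM.
    case: (Rlt_le_dec 1 (peak eta y)) => hp.
      have := hpos y cy hp => hy.
      case: (Rle_lt_dec (peak eta y) (1 + eta / 2)) => hq.
        have -> : b y = 0 by rewrite /b Rmax_left //; lra.
        by have : 0 <= h y * peak eta y ^ (2 * m)%nat; [apply: Rmult_le_pos; lra|lra].
      have pw : (1 + eta / 2) ^ (2 * m)%nat <= peak eta y ^ (2 * m)%nat by apply: pow_incr; lra.
      have bl : b y <= 1.
        rewrite /b Rmax_right; last lra.
        have -> : peak eta y - (1 + eta / 2) = peak eta y - 1 - eta / 2 by ring.
        have : peak eta y <= 1 + eta.
          have := @peak_ge D eta y D0; rewrite /peak.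
          have : - INR D <= \big[Rplus/0]_(i < D) cos (y i).
            have -> : - INR D = \big[Rplus/0]_(i < D) (-1).
              by rewrite big_const_ord; elim: (D) => [|n IH]; [rewrite /=; ring|rewrite iterS -IH S_INR; ring].
            by apply: Rsum_le => i _; have := COS_bound (y i); lra.
          move=> hS _; have iD : 0 < / INR D by apply: Rinv_0_lt_compat.
          have : / INR D * - INR D <= / INR D * \big[Rplus/0]_(i < D) cos (y i) by apply: Rmult_le_compat_l; lra.
          have -> : / INR D * - INR D = -1 by field; lra.
          lra.
        lra.
      have : e * (1 + eta / 2) ^ (2 * m)%nat * b y <= e * (1 + eta / 2) ^ (2 * m)%nat * 1.
        by apply: Rmult_le_compat_l => //; apply: Rmult_le_pos; lra.
      have : e * (1 + eta / 2) ^ (2 * m)%nat <= h y * peak eta y ^ (2 * m)%nat.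
        by apply: Rmult_le_compat; lra.
      lra.
    have -> : b y = 0 by rewrite /b Rmax_left //; lra.
    have := @peak_ge D eta y D0 => hge.
    have p1 : peak eta y ^ (2 * m)%nat <= 1.
      rewrite pow_mult -(pow1 m); apply: pow_incr; split; first exact: pow2_ge_0.
      by nra.
    rewrite Rmult_0_r Rplus_0_l; nra.
  rewrite rint_plus ?rint_scal ?rint_const ?size_enum_ord -?/(vol D) //; try exact: cont_const; try exact: cont_scal.
  lra.
have eI : 0 < e * rint (enum 'I_D) b (fun _ => 0) by apply: Rmult_lt_0_compat.
have [N HN] := Pow_x_infinity (1 + eta / 2) ltac:(rewrite Rabs_pos_eq; lra) ((M * vol D + 1) / (e * rint (enum 'I_D) b (fun _ => 0))).
have hN : (N <= 2 * N)%coq_nat by apply/leP; rewrite mul2n -addnn leq_addl.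
have := HN (2 * N)%nat hN.
rewrite Rabs_pos_eq; last by apply: pow_le; lra.
move=> /Rge_le /(Rmult_le_compat_l _ _ _ (Rlt_le _ _ eI)).
set I := rint _ _ _ in eI *; have -> : e * I * ((M * vol D + 1) / (e * I)) = M * vol D + 1 by field; split; nra.
have := key N; rewrite -/I; set P := (1 + eta / 2) ^ _; have -> : e * P * I = e * I * P by ring.
lra.
Qed.

(** Translating the point to the centre of the cube preserves the vanishing of
    all coefficients. *)
Lemma fourier_unique D (f : pt D -> C) : (0 < D)%nat -> ccont f -> periodic f ->
  (forall l, tint (fun x => f x * expi l x)%C = RtoC 0) -> forall x, f x = RtoC 0.
Proof.
move=> D0 cf pf hf a; pose b : pt D := fun j => a j - PI.
have cs : ccont (fun x => f (tshift b x)).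
  move=> x P hP; have [d Hd] := cf (tshift b x) P hP; exists d => y hy; apply: Hd => j.
  have := hy j; rewrite /ball /= /AbsRing_ball /= /abs /minus /plus /opp /= /tshift.
  by have -> : y j + b j + - (x j + b j) = y j + - x j by ring.
have -> : f a = (fun x => f (tshift b x)) (fun _ => PI).
  by congr f; apply: functional_extensionality => j; rewrite /tshift /b; ring.
apply: (@annihilated_centre D (fun x => f (tshift b x))) => //; split=> // l.
have ce : ccont (fun x => f x * expi l x)%C by apply: ccont_mult => //; apply: ccont_expi.
have := tint_shift b ce; rewrite hf.
rewrite (tint_ext (g := fun x => (expi l b * (f (tshift b x) * expi l x))%C)); last first.
  by move=> x; rewrite expi_shift; ring.
rewrite tint_scal; last by apply: ccont_mult => //; apply: ccont_expi.
move=> H; have {}H := H (fun i x => f_equal2 Cmult (pf i x) (@expi_periodic D l i x)).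
apply: Cmod_eq_0; have := congr1 Cmod H; rewrite Cmod_mult Cmod_expi Cmod_0; lra.
Qed.

(** * Fourier coefficients of functions *)

Definition fc D (f : pt D -> C) (l : freq D) : C :=
  (tint (fun x => f x * expi (opp_freq l) x)%C / RtoC (vol D))%C.

Lemma volC_ne0 D : RtoC (vol D) <> RtoC 0.
Proof. by move/RtoC_inj; have := vol_gt0 D; lra. Qed.

Lemma Cdiv_eq0 (a b : C) : b <> RtoC 0 -> (a / b)%C = RtoC 0 -> a = RtoC 0.
Proof. by move=> b0 e; have -> : a = (a / b * b)%C; [field|rewrite e; ring]. Qed.

Lemma fc_plus D (f g : pt D -> C) l : ccont f -> ccont g -> fc (fun x => f x + g x)%C l = (fc f l + fc g l)%C.
Proof.
move=> cf cg; have ce := @ccont_expi D (opp_freq l).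
rewrite /fc (tint_ext (g := fun x => (f x * expi (opp_freq l) x + g x * expi (opp_freq l) x)%C)); last by move=> x; ring.
by rewrite tint_plus; [field; exact: volC_ne0|exact: ccont_mult|exact: ccont_mult].
Qed.

Lemma fc_scal D (f : pt D -> C) k l : ccont f -> fc (fun x => k * f x)%C l = (k * fc f l)%C.
Proof.
move=> cf; have ce := @ccont_expi D (opp_freq l).
rewrite /fc (tint_ext (g := fun x => (k * (f x * expi (opp_freq l) x))%C)); last by move=> x; ring.
by rewrite tint_scal; [field; exact: volC_ne0|exact: ccont_mult].
Qed.

Lemma fc_expi D (l m : freq D) : fc (expi l) m = if excluded_middle_informative (l = m) then RtoC 1 else RtoC 0.
Proof.
rewrite /fc tint_expi_expi; case: excluded_middle_informative => _ /=; field; exact: volC_ne0.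
Qed.

Lemma fc_ext D (f g : pt D -> C) : (0 < D)%nat -> ccont f -> ccont g -> periodic f -> periodic g ->
  (forall l, fc f l = fc g l) -> forall x, f x = g x.
Proof.
move=> D0 cf cg pf pg h x.
have E : (f x + RtoC (-1) * g x)%C = RtoC 0.
  apply: (@fourier_unique D (fun x => f x + RtoC (-1) * g x)%C) => //; first by apply: ccont_plus => //; apply: ccont_scal.
    by move=> i y; rewrite pf pg.
  move=> l; have := fc_plus (opp_freq l) cf (ccont_scal (RtoC (-1)) cg).
  rewrite fc_scal // h /fc opp_freqK => e; apply: (Cdiv_eq0 (@volC_ne0 D)); rewrite e; ring.
by have -> : f x = (f x + RtoC (-1) * g x + g x)%C by [ring]; rewrite E; ring.
Qed.

Lemma fc_pd D (f : pt D -> C) i l : ccont f -> periodic f ->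
  (forall x, ex_pd i f x) -> ccont (pd i f) -> fc (pd i f) l = (Ci * IZR (l i) * fc f l)%C.
Proof.
move=> cf pf ef cpf; rewrite /fc tint_pd // /opp_freq opp_IZR RtoC_opp; field; exact: volC_ne0.
Qed.

Lemma fc_abs D (f : pt D -> C) M l : ccont f -> (forall y, cube y -> Cmod (f y) <= M) -> Cmod (fc f l) <= 2 * M.
Proof.
move=> cf h; have v0 := vol_gt0 D; rewrite /fc Cmod_div; last exact: volC_ne0.
rewrite Cmod_R Rabs_pos_eq; last lra.
apply: (Rmult_le_reg_r (vol D)) => //; rewrite /Rdiv Rmult_assoc Rinv_l ?Rmult_1_r; last lra.
have -> : 2 * M * vol D = 2 * vol D * M by ring.
apply: tint_abs; first by apply: ccont_mult => //; apply: ccont_expi.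
by move=> y cy; rewrite Cmod_mult Cmod_expi Rmult_1_r; apply: h.
Qed.

Definition synth D (c : freq D -> C) (x : pt D) : C := csum (fun l => c l * expi l x)%C.

Lemma Cmod_cexpi D (c : C) (l : freq D) x : Cmod (c * expi l x)%C = Cmod c.
Proof. by rewrite Cmod_mult Cmod_expi Rmult_1_r. Qed.

Lemma csummable_expi D (c : freq D -> C) x : csummable c -> csummable (fun l => c l * expi l x)%C.
Proof. by apply: csummable_le => l; rewrite Cmod_cexpi; apply: Rle_refl. Qed.

Lemma synth_cont D (c : freq D -> C) : csummable c -> ccont (synth c).
Proof.
move=> sc x; apply: (csum_tannery _ sc).
- by move=> l; rewrite Cmod_cexpi; apply: Rle_refl.
- by apply: filter_forall => y l; rewrite Cmod_cexpi; apply: Rle_refl.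
- move=> l; exact: (ccont_scal (c l) (ccont_expi l) x).
Qed.

Lemma synth_periodic D (c : freq D -> C) : periodic (synth c).
Proof. by move=> i x; apply: csum_ext => l; rewrite expi_periodic. Qed.

Lemma synth_le D (c : freq D -> C) x : csummable c -> Cmod (synth c x) <= 2 * rsum (fun l => Cmod (c l)).
Proof. by move=> sc; apply: csum_le => // l; rewrite Cmod_cexpi; apply: Rle_refl. Qed.

(** Removing a finite set of frequencies with small tail, both sides agree on
    the finite part and are small on the rest. *)
Lemma synth_tint D (c : freq D -> C) (g : pt D -> C) : csummable c -> ccont g ->
  tint (fun x => synth c x * g x)%C = csum (fun l => c l * tint (fun x => expi l x * g x))%C.
Proof.
move=> sc cg; have [B [B0 HB]] := ccont_bounded cg.
have v0 := vol_gt0 D.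
have ceg l : ccont (fun x => expi l x * g x)%C by apply: ccont_mult => //; apply: ccont_expi.
have bt l : Cmod (tint (fun x => expi l x * g x)%C) <= 2 * vol D * B.
  by apply: tint_abs => // y cy; rewrite Cmod_mult Cmod_expi Rmult_1_l; apply: HB.
have sct : csummable (fun l => c l * tint (fun x => expi l x * g x))%C.
  apply: (csummable_le _ (summable_scal (2 * vol D * B) sc)) => l.
  by rewrite Cmod_mult Rmult_comm; apply: Rmult_le_compat_r => //; apply: Cmod_ge_0.
have key eps : 0 < eps -> Cmod (tint (fun x => synth c x * g x)%C - csum (fun l => c l * tint (fun x => expi l x * g x)))%C <= 8 * vol D * B * eps.
  move=> e0; have [s [nd hs]] := rsum_tail sc (fun l => Cmod_ge_0 _) e0.
  pose c' l := if In_dec s l then RtoC 0 else c l.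
  have E' : (fun l => Cmod (c' l)) = (fun l => if In_dec s l then 0 else Cmod (c l)).
    by apply: functional_extensionality => l; rewrite /c'; case: ifP; rewrite ?Cmod_0.
  have sc' : csummable c'.
    apply: (csummable_le _ sc) => l; rewrite /c'; case: ifP => _; last exact: Rle_refl.
    by rewrite Cmod_0; apply: Cmod_ge_0.
  have hs' : rsum (fun l => Cmod (c' l)) < eps by rewrite E'.
  have -> : tint (fun x => synth c x * g x)%C =
      (\big[Cplus/RtoC 0]_(l <- s) (c l * tint (fun x => expi l x * g x)) + tint (fun x => synth c' x * g x))%C.
    rewrite (eq_bigr (fun l => tint (fun x => c l * (expi l x * g x))%C)); last by move=> l _; rewrite tint_scal.
    rewrite -tint_sum; last by move=> l; apply: ccont_scal.
    rewrite -tint_plus.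
    - apply: tint_ext => x; rewrite /synth (csum_split nd (csummable_expi x sc)) Cmult_plus_distr_r; congr (_ + _ * _)%C.
        by elim: (s) => [|m t IH]; [rewrite !big_nil; ring|rewrite !big_cons -IH; ring].
      by apply: csum_ext => l; rewrite /c'; case: ifP => _ //; ring.
    - by apply: (@ccont_sum D _ s (fun l x => c l * (expi l x * g x))%C) => l; apply: ccont_scal.
    - by apply: ccont_mult => //; apply: synth_cont.
  rewrite (csum_split nd sct).
  set A := \big[_/_]_(_ <- _) _; set U := tint _; set V := csum _.
  have -> : (A + U - (A + V))%C = (U + - V)%C by ring.
  apply: Rle_trans (Cmod_triangle _ _) _; rewrite Cmod_opp.
  have hU : Cmod U <= 2 * vol D * (2 * eps * B).
    apply: tint_abs; first by apply: ccont_mult => //; apply: synth_cont.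
    move=> y cy; rewrite Cmod_mult; apply: Rmult_le_compat; try exact: Cmod_ge_0; last exact: HB.
    by apply: Rle_trans (synth_le _ sc') _; lra.
  have hV : Cmod V <= 2 * (2 * vol D * B * eps).
    apply: (Rle_trans _ (2 * rsum (fun l => 2 * vol D * B * Cmod (c' l)))).
      apply: csum_le; last by apply: summable_scal.
      move=> l; rewrite /c'; case: ifP => _; first by rewrite !Cmod_0; lra.
      by rewrite Cmod_mult Rmult_comm; apply: Rmult_le_compat_r => //; apply: Cmod_ge_0.
    rewrite rsum_scal; apply: Rmult_le_compat_l; first lra.
    by apply: Rmult_le_compat_l; [apply: Rmult_le_pos; lra|lra].
  by lra.
set A := tint _ in key *; set V := csum _ in key *.
have -> : A = (A - V + V)%C by ring.
suff -> : (A - V)%C = RtoC 0 by ring.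
apply: Cmod_eq_0; apply: Rle_antisym; last exact: Cmod_ge_0.
apply: le_epsilon => e e0; rewrite Rplus_0_l.
have p : 0 < 8 * vol D * B + 1 by have : 0 <= vol D * B; [apply: Rmult_le_pos; lra|lra].
apply: Rle_trans (key (e / (8 * vol D * B + 1)) _) _; first exact: Rdiv_lt_0_compat.
have -> : 8 * vol D * B * (e / (8 * vol D * B + 1)) = e - e / (8 * vol D * B + 1) by field; lra.
have := Rdiv_lt_0_compat _ _ e0 p; lra.
Qed.

Lemma fc_synth D (c : freq D -> C) l : csummable c -> fc (synth c) l = c l.
Proof.
move=> sc; rewrite /fc synth_tint //; last exact: ccont_expi.
rewrite (@csum_single D l) => [|m ne]; rewrite tint_expi_expi.
  by case: excluded_middle_informative => //= _; field; exact: volC_ne0.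
by case: excluded_middle_informative => //= _; ring.
Qed.

(** * Decay of the coefficients of smooth functions *)

Lemma CDerive_ext f g t : (forall r, f r = g r) -> CDerive f t = CDerive g t.
Proof. by move=> e; have -> : f = g by apply: functional_extensionality. Qed.

Lemma Derive_per (g : R -> R) t a : (forall r, g (r + a) = g r) -> Derive g (t + a) = Derive g t.
Proof.
move=> pg; rewrite /Derive; congr real; apply: Lim_ext => h; congr (_ / _).
by rewrite pg; have -> : t + a + h = t + h + a by [ring]; rewrite pg.
Qed.

Lemma pd_periodic D i (f : pt D -> C) (pf : periodic f) : periodic (pd i f).
Proof.
move=> j x; rewrite /pd; case: (i =P j) => [<-|ne].
  have E : (fun h => f (upd (upd x i (x i + 2 * PI)) i h)) = (fun h => f (upd x i h)).
    by apply: functional_extensionality => h; rewrite upd_upd.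
  have per h : f (upd x i (h + 2 * PI)) = f (upd x i h).
    by have := pf i (upd x i h); rewrite upd_upd {2}/upd eqxx.
  rewrite E {2}/upd eqxx /CDerive; congr pair; apply: Derive_per => r; by rewrite per.
have -> : upd x j (x j + 2 * PI) i = x i by rewrite /upd; case: eqP.
apply: CDerive_ext => h; rewrite upd_comm; last by move=> e; apply: ne.
have := pf j (upd x i h); have -> // : upd x i h j = x j.
by rewrite /upd; case: eqP => // e; case: ne.
Qed.

Lemma pds_periodic D al (f : pt D -> C) (pf : periodic f) : periodic (pds al f).
Proof. by elim: al => [//|i al IH]; apply: pd_periodic. Qed.

Arguments pds_periodic {D} al {f} pf i x.

Lemma smooth_cont D (f : pt D -> C) al (sf : smooth f) : ccont (pds al f).
Proof. by move=> x; case: (sf al x). Qed.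
Arguments smooth_cont {D f} al sf x.

Lemma smooth_ex D (f : pt D -> C) al i x (sf : smooth f) : ex_pd i (pds al f) x.
Proof. by case: (sf al x). Qed.
Arguments smooth_ex {D f} al i x sf.

Lemma pds_cat D (f : pt D -> C) al be : pds al (pds be f) = pds (al ++ be) f.
Proof. by rewrite /pds foldr_cat. Qed.

Lemma smooth_pds D (f : pt D -> C) be (sf : smooth f) : smooth (pds be f).
Proof. by move=> al x; rewrite pds_cat; apply: sf. Qed.
Arguments smooth_pds {D f} be sf alpha x.

Lemma pd_axpy D i (f g : pt D -> C) k x : ex_pd i f x -> ex_pd i g x ->
  pd i (fun x => k * f x + g x)%C x = (k * pd i f x + pd i g x)%C /\
  ex_pd i (fun x => k * f x + g x)%C x.
Proof.
move=> /ex_Cderive_is ef /ex_Cderive_is eg; have d := is_Cderive_plus (is_Cderive_scal k ef) eg.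
by split; [apply: is_Cderive_unique|eexists; apply: d].
Qed.

Lemma pds_axpy D al (f g : pt D -> C) k : smooth f -> smooth g ->
  pds al (fun x => k * f x + g x)%C = (fun x => k * pds al f x + pds al g x)%C.
Proof.
move=> sf sg; elim: al => [//|i al IH]; rewrite /= -/(pds al _) IH.
by apply: functional_extensionality => x; case: (pd_axpy k (smooth_ex al i x sf) (smooth_ex al i x sg)).
Qed.

Lemma smooth_axpy D (f g : pt D -> C) k : smooth f -> smooth g -> smooth (fun x => k * f x + g x)%C.
Proof.
move=> sf sg al x; rewrite pds_axpy //; split.
  exact: (ccont_plus (ccont_scal k (smooth_cont al sf)) (smooth_cont al sg) x).
by move=> i; case: (pd_axpy k (smooth_ex al i x sf) (smooth_ex al i x sg)).
Qed.

Lemma periodic_axpy D (f g : pt D -> C) k : periodic f -> periodic g -> periodic (fun x => k * f x + g x)%C.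
Proof. by move=> pf pg i x; rewrite pf pg. Qed.

Definition test_axpy D (k : C) (f g : test D) : test D :=
  Test (periodic_axpy k (test_periodic f) (test_periodic g))
       (smooth_axpy k (test_smooth f) (test_smooth g)).

Lemma abs_coord_wt D (l : freq D) i : Rabs (IZR (l i)) <= wt l.
Proof.
have := coord_le_wt l i; have := pow2_ge_0 (Rabs (IZR (l i)) - 1).
by have := pow2_abs (IZR (l i)); nra.
Qed.

Lemma fc_pds_le D (f : pt D -> C) al l : smooth f -> periodic f ->
  Cmod (fc (pds al f) l) <= wt l ^ size al * Cmod (fc f l).
Proof.
move=> sf pf; elim: al => [|i al IH]; first by rewrite /= Rmult_1_l; apply: Rle_refl.
have := @fc_pd D (pds al f) i l (smooth_cont al sf) (pds_periodic al pf)
  (fun x => smooth_ex al i x sf) (smooth_cont (i :: al) sf).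
rewrite [pds (i :: al) f]/= -/(pds al f) => ->.
rewrite 2!Cmod_mult Cmod_Ci Cmod_R Rmult_1_l /= Rmult_assoc.
by apply: Rmult_le_compat => //; [exact: Rabs_pos|exact: Cmod_ge_0|exact: abs_coord_wt].
Qed.

(** Two derivatives along each axis produce l_i^2; adding the D axes and the
    function itself produces one power of the weight, at the cost of a factor 1
    + D. *)
Lemma fc_decay D N (f : pt D -> C) M l : smooth f -> periodic f ->
  (forall al x, (size al <= 2 * N)%nat -> cube x -> Cmod (pds al f x) <= M) ->
  wt l ^ N * Cmod (fc f l) <= 2 * (1 + INR D) ^ N * M.
Proof.
elim: N f => [|N IH] f sf pf h.
  rewrite /= !Rmult_1_r Rmult_1_l; apply: fc_abs; first exact: (smooth_cont [::] sf).
  by move=> y cy; apply: (h [::]).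
have c0 : ccont f := smooth_cont [::] sf.
have c1 i : ccont (pd i f) := smooth_cont [:: i] sf.
have c2 i : ccont (pd i (pd i f)) := smooth_cont [:: i; i] sf.
have E i : fc (pds [:: i; i] f) l = (- RtoC (IZR (l i) ^ 2) * fc f l)%C.
  rewrite /= (@fc_pd D (pd i f) i l (c1 i) (@pd_periodic D i f pf) (fun x => smooth_ex [:: i] i x sf) (c2 i)).
  rewrite (@fc_pd D f i l c0 pf (fun x => smooth_ex [::] i x sf) (c1 i)).
  have -> : (Ci * IZR (l i) * (Ci * IZR (l i) * fc f l))%C = ((Ci * Ci) * (IZR (l i) * IZR (l i)) * fc f l)%C by ring.
  rewrite -RtoC_mult; have -> : IZR (l i) * IZR (l i) = IZR (l i) ^ 2 by ring.
  by congr (_ * _)%C; rewrite /Cmult /Copp /=; congr pair; ring.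
have H i : wt l ^ N * (IZR (l i) ^ 2 * Cmod (fc f l)) <= 2 * (1 + INR D) ^ N * M.
  have := IH (pds [:: i; i] f) (smooth_pds _ sf) (pds_periodic _ pf).
  rewrite E Cmod_mult Cmod_opp Cmod_R Rabs_pos_eq; last exact: pow2_ge_0.
  apply => al x hal cx; rewrite pds_cat; apply: h => //; rewrite size_cat /= mulnS addnC.
  by rewrite leq_add2l.
have H0 : wt l ^ N * Cmod (fc f l) <= 2 * (1 + INR D) ^ N * M.
  apply: IH => // al x hal cx; apply: h => //; apply: leq_trans hal _.
  by rewrite leq_mul2l leqW.
have -> : wt l ^ N.+1 * Cmod (fc f l) = wt l ^ N * Cmod (fc f l) + \big[Rplus/0]_(i < D) (wt l ^ N * (IZR (l i) ^ 2 * Cmod (fc f l))).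
  rewrite Rsum_scal -big_distrl /= -/(normsq l) {1}/wt; ring.
have : \big[Rplus/0]_(i < D) (wt l ^ N * (IZR (l i) ^ 2 * Cmod (fc f l))) <= INR D * (2 * (1 + INR D) ^ N * M).
  apply: (Rle_trans _ (\big[Rplus/0]_(i < D) (2 * (1 + INR D) ^ N * M))); first exact: Rsum_le.
  by rewrite Rsum_const; apply: Rle_refl.
rewrite /=; lra.
Qed.

(** * Distributions are determined by their Fourier coefficients *)

Lemma wt_pow_summable D N (c : freq D -> C) K : (0 < D)%nat ->
  (forall l, wt l ^ (N + D) * Cmod (c l) <= K) -> summable (fun l => wt l ^ N * Cmod (c l)).
Proof.
move=> D0 h; have dpos : 0 < INR D by apply: lt_0_INR; apply/ltP.
apply: (summable_le _ (summable_scal K (wt_summable D0 (r := INR D) _))) => [l|]; last lra.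
have w0 := wt_gt0 l; rewrite Rabs_pos_eq; last first.
  by apply: Rmult_le_pos; [apply: pow_le; lra|exact: Cmod_ge_0].
have wD : 0 < wt l ^ D by apply: pow_lt.
rewrite Rpower_Ropp Rpower_pow //; apply: (Rmult_le_reg_r (wt l ^ D)) => //.
have -> : K * / wt l ^ D * wt l ^ D = K by field; lra.
by apply: Rle_trans (h l); rewrite pow_add; lra.
Qed.

Lemma smooth_bounded D (f : pt D -> C) N : smooth f -> periodic f ->
  exists M, forall al x, (size al <= N)%nat -> cube x -> Cmod (pds al f x) <= M.
Proof.
move=> sf pf.
have H (S : seq (seq 'I_D)) : exists M, forall al x, al \in S -> cube x -> Cmod (pds al f x) <= M.
  elim: S => [|a S [M HM]]; first by exists 0.
  have [B [_ HB]] := ccont_bounded (smooth_cont a sf).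
  exists (Rmax B M) => al x; rewrite in_cons => /orP [/eqP ->|h] cx.
    by apply: Rle_trans (HB x cx) (Rmax_l _ _).
  by apply: Rle_trans (HM al x h cx) (Rmax_r _ _).
pose enumN n : seq (seq 'I_D) := [seq val t | t : n.-tuple 'I_D].
have [M HM] := H (flatten [seq enumN n | n <- seq.iota 0 N.+1]).
exists M => al x hal; apply: HM; apply/flatten_mapP; exists (size al); first by rewrite mem_iota.
by apply/mapP; exists (in_tuple al) => //; rewrite mem_enum.
Qed.

Lemma fc_rapid D N (f : pt D -> C) : smooth f -> periodic f ->
  exists K, forall l, wt l ^ N * Cmod (fc f l) <= K.
Proof.
move=> sf pf; have [M HM] := smooth_bounded (2 * N) sf pf.
by exists (2 * (1 + INR D) ^ N * M) => l; apply: fc_decay.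
Qed.

Lemma fc_smooth_summable D N (f : pt D -> C) : (0 < D)%nat -> smooth f -> periodic f ->
  summable (fun l => wt l ^ N * Cmod (fc f l)).
Proof. by move=> D0 sf pf; have [K HK] := fc_rapid (N + D) sf pf; apply: (wt_pow_summable D0 HK). Qed.

(** A smooth function is the sum of its Fourier series, hence the seminorms that
    test continuity of a distribution are controlled by weighted sums of Fourier
    coefficients. *)
Lemma pds_fc_bound D (f : pt D -> C) N al x : (0 < D)%nat -> smooth f -> periodic f ->
  (size al <= N)%nat -> Cmod (pds al f x) <= 2 * rsum (fun l => wt l ^ N * Cmod (fc f l)).
Proof.
move=> D0 sf pf hal.
have sg := smooth_pds al sf; have pg := pds_periodic al pf.
have le l : Cmod (fc (pds al f) l) <= wt l ^ N * Cmod (fc f l).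
  apply: Rle_trans (fc_pds_le al l sf pf) _; apply: Rmult_le_compat_r; first exact: Cmod_ge_0.
  by apply: Rle_pow; [exact: wt_ge1|apply/leP].
have sm := fc_smooth_summable N D0 sf pf.
have sc : csummable (fc (pds al f)) := csummable_le le sm.
have -> : pds al f x = synth (fc (pds al f)) x.
  apply: fc_ext => //; [exact: (smooth_cont [::] sg)|exact: synth_cont|exact: synth_periodic|].
  by move=> l; rewrite fc_synth.
apply: Rle_trans (synth_le x sc) _; apply: Rmult_le_compat_l; first lra.
exact: rsum_le.
Qed.

Lemma dist_axpy D (u : distribution D) k (f g : test D) : u (test_axpy k f g) = (k * u f + u g)%C.
Proof. by apply: dist_linear. Qed.

(** Evaluating a distribution on a partial Fourier sum of a test function only
    uses its Fourier coefficients; the remainder h has the remaining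
    coefficients. *)
Lemma test_tail D (g : test D) (s : seq (freq D)) : List.NoDup s -> exists h : test D,
  (forall u : distribution D, u g = (\big[Cplus/RtoC 0]_(l <- s) (fc g l * u (expi_test l)) + u h)%C) /\
  forall l, fc h l = if In_dec s l then RtoC 0 else fc g l.
Proof.
elim: s => [|m s IH] nd.
  exists g; split=> [u|l]; first by rewrite big_nil; ring.
  by case: In_decP.
have [nm nds] : ~ List.In m s /\ List.NoDup s by inversion nd.
have [h [H1 H2]] := IH nds; exists (test_axpy (- fc g m)%C (expi_test m) h); split=> [u|l].
  by rewrite H1 dist_axpy big_cons; ring.
rewrite /= fc_plus ?fc_scal ?fc_expi ?H2; last first.
- exact: (smooth_cont [::] (test_smooth h)).
- exact/ccont_scal/ccont_expi.
- exact: ccont_expi.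
case: excluded_middle_informative => /= [<-|ne].
  case: In_decP => [h1|_]; first by case: nm.
  by case: In_decP => [_|[]]; [ring|left].
case: In_decP => h1; case: In_decP => h2; try ring; first by case: h2; right.
by case: h2 => // e; case: ne.
Qed.

Lemma dist_eq_of_tests D (u v : distribution D) : (forall g, u g = v g) -> u = v.
Proof.
case: u v => [u lu cu] [v lv cv] /= /functional_extensionality e; move: lu cu; rewrite e => lu cu.
congr Dist; exact: Classical_Prop.proof_irrelevance.
Qed.

(** The two distributions agree on partial Fourier sums of a test function, and
    the remainder tends to 0 in every seminorm by [pds_fc_bound]. *)
Lemma dist_ext D (u v : distribution D) : (0 < D)%nat ->
  (forall l, fourier u l = fourier v l) -> u = v.
Proof.
move=> D0 e; apply: dist_eq_of_tests => g.
have ex l : u (expi_test l) = v (expi_test l).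
  have := e (opp_freq l); rewrite /fourier opp_freqK -/(vol D) => h.
  have -> : u (expi_test l) = (u (expi_test l) / RtoC (vol D) * RtoC (vol D))%C by field; exact: volC_ne0.
  by rewrite h; field; exact: volC_ne0.
have [N1 [K1 H1]] := dist_cont u; have [N2 [K2 H2]] := dist_cont v.
pose N := maxn N1 N2.
have sm := fc_smooth_summable N D0 (test_smooth g) (test_periodic g).
have nn l : 0 <= wt l ^ N * Cmod (fc g l).
  by apply: Rmult_le_pos; [apply: pow_le; have := wt_gt0 l; lra|exact: Cmod_ge_0].
have key eps : 0 < eps -> Cmod (u g - v g)%C <= (Rabs K1 + Rabs K2) * (2 * eps).
  move=> e0; have [s [nd hs]] := rsum_tail sm nn e0.
  have [h [hu hf]] := test_tail g nd.
  have -> : (u g - v g)%C = (u h + - v h)%C.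
    by rewrite (hu u) (hu v) (eq_bigr (fun l => fc g l * v (expi_test l))%C); [ring|move=> l _; rewrite ex].
  pose M := 2 * rsum (fun l => wt l ^ N * Cmod (fc h l)).
  have Ms : M <= 2 * eps.
    rewrite /M; apply: Rmult_le_compat_l; first lra.
    rewrite (rsum_ext (b := fun l => if In_dec s l then 0 else wt l ^ N * Cmod (fc g l))); first lra.
    by move=> l; rewrite hf; case: ifP => _ //; rewrite Cmod_0 Rmult_0_r.
  have HM al x : (size al <= N)%nat -> Cmod (pds al h x) <= M.
    by move=> hal; apply: pds_fc_bound => //; [apply: test_smooth|apply: test_periodic].
  have M0 : 0 <= M by apply: Rle_trans (Cmod_ge_0 _) (HM [::] (fun _ => 0) (leq0n _)).
  have b1 : Cmod (u h) <= K1 * M by apply: H1 => al x le; apply: HM; rewrite leq_max le.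
  have b2 : Cmod (v h) <= K2 * M by apply: H2 => al x le; apply: HM; rewrite leq_max le orbT.
  apply: Rle_trans (Cmod_triangle _ _) _; rewrite Cmod_opp.
  have := Rle_abs K1; have := Rle_abs K2; have := Rabs_pos K1; have := Rabs_pos K2; nra.
have -> : u g = (u g - v g + v g)%C by ring.
suff -> : (u g - v g)%C = RtoC 0 by ring.
apply: Cmod_eq_0; apply: Rle_antisym; last exact: Cmod_ge_0.
apply: le_epsilon => eps e0; rewrite Rplus_0_l.
pose S := 2 * (Rabs K1 + Rabs K2) + 1; have Sp : 0 < S by rewrite /S; have := Rabs_pos K1; have := Rabs_pos K2; lra.
apply: Rle_trans (key (eps / S) (Rdiv_lt_0_compat _ _ e0 Sp)) _.
have -> : (Rabs K1 + Rabs K2) * (2 * (eps / S)) = eps - eps / S by rewrite /S; field; rewrite /S in Sp; lra.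
by have := Rdiv_lt_0_compat _ _ e0 Sp; lra.
Qed.

(** * Distributions defined by functions and by coefficients *)

Lemma regular_fourier D (f : pt D -> C) (u : distribution D) l : regular f u -> fourier u l = fc f l.
Proof. by move=> r; rewrite /fourier /fc r. Qed.

Lemma regular_exists D (f : pt D -> C) : ccont f -> exists u, regular f u.
Proof.
move=> cf; have [B [B0 HB]] := ccont_bounded cf.
have lin (a : C) (h1 h2 h3 : test D) : (forall x, h3 x = (a * h1 x + h2 x)%C) ->
  tint (fun x => f x * h3 x)%C = (a * tint (fun x => f x * h1 x) + tint (fun x => f x * h2 x))%C.
  move=> e; have c1 := ccont_mult cf (smooth_cont [::] (test_smooth h1)).
  have c2 := ccont_mult cf (smooth_cont [::] (test_smooth h2)).
  rewrite -tint_scal // -tint_plus //; last exact: ccont_scal.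
  by apply: tint_ext => x; rewrite e; ring.
have ct : exists (N : nat) (K : R), forall (h : test D) (M : R),
    (forall alpha x, (size alpha <= N)%nat -> Cmod (pds alpha h x) <= M) ->
    Cmod (tint (fun x => f x * h x)%C) <= K * M.
  exists 0%nat, (2 * vol D * B) => h M HM; rewrite Rmult_assoc.
  apply: tint_abs; first exact: (ccont_mult cf (smooth_cont [::] (test_smooth h))).
  move=> y cy; rewrite Cmod_mult; apply: Rmult_le_compat; try exact: Cmod_ge_0; first exact: HB.
  exact: (HM [::]).
by exists (Dist lin ct).
Qed.

(** The coefficients determine the distribution, so they need only be compared
    with those of the distribution that f defines. *)
Lemma regular_of_fourier D (f : pt D -> C) (u : distribution D) : (0 < D)%nat -> ccont f ->
  (forall l, fourier u l = fc f l) -> regular f u.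
Proof.
move=> D0 cf h; have [v hv] := regular_exists cf.
by have -> : u = v by apply: dist_ext => // l; rewrite h (regular_fourier l hv).
Qed.

Definition poly_bounded D (c : freq D -> C) : Prop :=
  exists (N : nat) (K : R), forall l, Cmod (c l) <= K * wt l ^ N.

(** The distribution is the pairing by Fourier coefficients: the decay of the
    coefficients of a test function beats any polynomial growth, with a constant
    that involves finitely many derivatives. *)
Lemma dist_exists D (c : freq D -> C) : (0 < D)%nat -> poly_bounded c ->
  exists u : distribution D, forall l, fourier u l = c l.
Proof.
move=> D0 [N [K HK]].
pose T l (g : pt D -> C) := tint (fun x => expi l x * g x)%C.
pose N' := (N + D)%nat.
have v0 := vol_gt0 D.
have TE l g : T l g = (RtoC (vol D) * fc g (opp_freq l))%C.
  rewrite /T /fc opp_freqK (tint_ext (g := fun x => (g x * expi l x)%C)); last by move=> x; ring.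
  by field; exact: volC_ne0.
have wo (l : freq D) : wt (opp_freq l) = wt l.
  by rewrite /wt /normsq; congr (_ + _); apply: eq_bigr => i _; rewrite /opp_freq opp_IZR; ring.
have K0 : 0 <= K.
  have := Rle_trans _ _ _ (Cmod_ge_0 _) (HK (@freq0 D)).
  have : 0 < wt (@freq0 D) ^ N by apply: pow_lt; exact: wt_gt0.
  by move=> p q; apply: (Rmult_le_reg_r (wt (@freq0 D) ^ N)) => //; lra.
pose B := K * (vol D * (2 * (1 + INR D) ^ N')).
have term (g : test D) M l : (forall al x, (size al <= 2 * N')%nat -> Cmod (pds al g x) <= M) ->
    Cmod (c l * T l g)%C <= B * M * Rpower (wt l) (- INR D).
  move=> HM; have := fc_decay (opp_freq l) (test_smooth g) (test_periodic g) (fun al x h _ => HM al x h).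
  rewrite -/N' wo TE 2!Cmod_mult Cmod_R Rabs_pos_eq; last lra.
  have w0 := wt_gt0 l; have wD : 0 < wt l ^ D by apply: pow_lt.
  have wN : 0 < wt l ^ N by apply: pow_lt.
  rewrite Rpower_Ropp Rpower_pow // {1}/N' pow_add => h.
  apply: (Rmult_le_reg_r (wt l ^ D)) => //.
  have -> : B * M * / wt l ^ D * wt l ^ D = K * vol D * (2 * (1 + INR D) ^ N' * M) by rewrite /B; field; lra.
  apply: Rle_trans (_ : K * vol D * (wt l ^ N * wt l ^ D * Cmod (fc g (opp_freq l))) <= _); last first.
    by apply: Rmult_le_compat_l => //; apply: Rmult_le_pos; lra.
  have := HK l; have := Cmod_ge_0 (fc g (opp_freq l)); set F := Cmod (fc _ _); set c' := Cmod _ => F0 hc.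
  have -> : c' * (vol D * F) * wt l ^ D = c' * (vol D * F * wt l ^ D) by ring.
  have -> : K * vol D * (wt l ^ N * wt l ^ D * F) = K * wt l ^ N * (vol D * F * wt l ^ D) by ring.
  by apply: Rmult_le_compat_r => //; apply: Rmult_le_pos; [apply: Rmult_le_pos|]; lra.
have sW : summable (fun l : freq D => Rpower (wt l) (- INR D)).
  by apply: wt_summable => //; have : 0 < INR D; [apply: lt_0_INR; apply/ltP|lra].
have bd (g : test D) : exists M, forall al x, (size al <= 2 * N')%nat -> Cmod (pds al g x) <= M.
  eexists => al x hal; exact: (pds_fc_bound x D0 (test_smooth g) (test_periodic g) hal).
have st (g : test D) : csummable (fun l => c l * T l g)%C.
  have [M HM] := bd g.
  exact: (csummable_le (fun l => term g M l HM) (summable_scal _ sW)).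
have cg (g : test D) : ccont g := smooth_cont [::] (test_smooth g).
have lin (a : C) (h1 h2 h3 : test D) : (forall x, h3 x = (a * h1 x + h2 x)%C) ->
  csum (fun l => c l * T l h3)%C = (a * csum (fun l => c l * T l h1) + csum (fun l => c l * T l h2))%C.
  move=> e; rewrite -csum_scal // -csum_plus //; last exact: csummable_scal.
  apply: csum_ext => l; have -> : T l h3 = (a * T l h1 + T l h2)%C; last by ring.
  have cc (h : test D) := ccont_mult (ccont_expi l) (cg h).
  rewrite /T -tint_scal // -tint_plus //; last exact: ccont_scal.
  by apply: tint_ext => x; rewrite e; ring.
have ct : exists (N : nat) (K : R), forall (h : test D) (M : R),
    (forall alpha x, (size alpha <= N)%nat -> Cmod (pds alpha h x) <= M) ->
    Cmod (csum (fun l => c l * T l h)%C) <= K * M.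
  exists (2 * N')%nat, (2 * B * rsum (fun l : freq D => Rpower (wt l) (- INR D))) => h M HM.
  apply: Rle_trans (csum_le (fun l => term h M l HM) (summable_scal _ sW)) _.
  rewrite rsum_scal; lra.
exists (Dist lin ct) => l; rewrite /fourier /= (@csum_single D l) => [|m ne].
  rewrite TE fc_expi; case: excluded_middle_informative => //= _.
  by rewrite -/(vol D); field; exact: volC_ne0.
rewrite TE fc_expi; case: excluded_middle_informative => //= [e|_]; last by ring.
by case: ne; rewrite -(opp_freqK m) -e opp_freqK.
Qed.

(** Any distribution serves as the default value, taken when no distribution has
    these coefficients. *)
Definition dist_of D (c : freq D -> C) : distribution D :=
  epsilon (inhabits (proj1_sig (constructive_indefinite_description _ (regular_exists (@ccont_const D (RtoC 0))))))
    (fun u => forall l, fourier u l = c l).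

Lemma dist_ofP D (c : freq D -> C) l : (0 < D)%nat -> poly_bounded c -> fourier (dist_of c) l = c l.
Proof. by move=> D0 pb; apply: (epsilon_spec _ _ (dist_exists D0 pb)). Qed.

(** * Linear second-order equations: existence and Gronwall bounds *)

Lemma deriv_quot (f : R -> R) t l :
  is_derive f t l <-> filterlim (fun h => (f (t + h) - f t) / h) (locally' 0) (locally l).
Proof.
rewrite is_derive_Reals; split=> [H|/filterlim_R H].
  apply/filterlim_R => eps e0; have [d Hd] := H eps e0.
  exists d => h hh hn; apply: Hd => //.
  by move: hh; rewrite /ball /= /AbsRing_ball /= /abs /minus /plus /opp /= Ropp_0 Rplus_0_r.
move=> eps e0; have [d Hd] := H eps e0; exists d => h hn hh; apply: Hd => //.
by rewrite /ball /= /AbsRing_ball /= /abs /minus /plus /opp /= Ropp_0 Rplus_0_r.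
Qed.

Lemma mono_deriv (f f' : R -> R) a b : a <= b ->
  (forall t, a <= t <= b -> is_derive f t (f' t)) -> (forall t, a <= t <= b -> 0 <= f' t) -> f a <= f b.
Proof.
move=> ab df f0; have [|t ht|c [hc e]] := @MVT_gen f a b f'.
- by rewrite Rmin_left // Rmax_right // => t ht; apply: df; lra.
- by move: ht; rewrite Rmin_left // Rmax_right // => ht; apply: derivable_continuous_pt; exists (f' t); apply/is_derive_Reals/df.
- move: hc; rewrite Rmin_left // Rmax_right // => hc.
  by have := f0 c hc => h; have : 0 <= f' c * (b - a); [apply: Rmult_le_pos; lra|lra].
Qed.

(** Both directions are needed, since energies are compared forwards and
    backwards in time: f exp(-w) decreases and f exp(w) increases. *)
Lemma gronwall (f f' w w' : R -> R) a b : a <= b ->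
  (forall t, a <= t <= b -> is_derive f t (f' t)) ->
  (forall t, a <= t <= b -> is_derive w t (w' t)) ->
  (forall t, a <= t <= b -> Rabs (f' t) <= w' t * f t) ->
  f b <= exp (w b - w a) * f a /\ f a <= exp (w b - w a) * f b.
Proof.
move=> ab df dw h.
have e1 u t : exp (u - t) = exp u * / exp t by rewrite /Rminus exp_plus exp_Ropp.
split.
- have := @mono_deriv (fun t => - (f t * exp (- w t))) (fun t => - (f' t * exp (- w t) + f t * (- w' t * exp (- w t)))) a b ab.
  move=> H; have {}H : - (f a * exp (- w a)) <= - (f b * exp (- w b)).
    apply: H => t ht; last first.
      by have := exp_pos (- w t); have /Rabs_le_between := h t ht; nra.
    apply: is_derive_opp; apply: is_derive_mult; [exact: df| |by move=> *; apply: Rmult_comm].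
    apply: (is_derive_comp exp (fun t => - w t)); first exact: is_derive_exp.
    exact/is_derive_opp/dw.
  rewrite e1; have pb := exp_pos (w b); rewrite !exp_Ropp in H.
  apply: (Rmult_le_reg_r (/ exp (w b))); first exact: Rinv_0_lt_compat.
  have -> : exp (w b) * / exp (w a) * f a * / exp (w b) = f a * / exp (w a) by field; split; apply: Rgt_not_eq; apply: exp_pos.
  lra.
- have := @mono_deriv (fun t => f t * exp (w t)) (fun t => f' t * exp (w t) + f t * (w' t * exp (w t))) a b ab.
  move=> H; have {}H : f a * exp (w a) <= f b * exp (w b).
    apply: H => t ht; last first.
      by have := exp_pos (w t); have /Rabs_le_between := h t ht; nra.
    apply: is_derive_mult; [exact: df| |by move=> *; apply: Rmult_comm].
    apply: (is_derive_comp exp w); first exact: is_derive_exp.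
    exact: dw.
  rewrite e1; have pa := exp_pos (w a).
  apply: (Rmult_le_reg_r (exp (w a))) => //.
  have -> : exp (w b) * / exp (w a) * f b * exp (w a) = f b * exp (w b) by field; lra.
  lra.
Qed.

Lemma exp_mono u v : u <= v -> exp u <= exp v.
Proof. by case/Rle_lt_or_eq_dec => [/exp_increasing|->]; lra. Qed.

Lemma exp_quad u : 0 <= u -> 1 + u ^ 2 / 4 <= exp u.
Proof.
move=> u0; have -> : u = u / 2 + u / 2 by field.
by rewrite exp_plus; have := exp_ineq1_le (u / 2); nra.
Qed.

Lemma Series_derive (f f' : nat -> R -> R) (M : nat -> R) t0 d : 0 < d -> ex_series M ->
  (forall n t, Rabs (t - t0) < d -> is_derive (f n) t (f' n t)) ->
  (forall n t, Rabs (t - t0) < d -> Rabs (f' n t) <= M n) ->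
  (forall t, Rabs (t - t0) < d -> ex_series (fun n => f n t)) ->
  is_derive (fun t => Series (fun n => f n t)) t0 (Series (fun n => f' n t0)).
Proof.
move=> d0 sM df bf' exf; apply/deriv_quot.
have z0 : Rabs (t0 - t0) < d by rewrite Rminus_eq_0 Rabs_R0.
have nb : locally' 0 (fun h => Rabs h < d /\ h <> 0).
  exists (mkposreal d d0) => h hh hn; split=> //.
  by move: hh; rewrite /ball /= /AbsRing_ball /= /abs /minus /plus /opp /= Ropp_0 Rplus_0_r.
apply: (filterlim_ext_loc (fun h => Series (fun n => (f n (t0 + h) - f n t0) / h))).
  apply: filter_imp nb => h [hd hn].
  have hh : Rabs (t0 + h - t0) < d by have -> : t0 + h - t0 = h by ring.
  rewrite -Series_minus; [|exact: exf|exact: exf].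
  rewrite /Rdiv Rmult_comm -Series_scal_l; apply: Series_ext => n; ring.
apply: (Tannery _ sM) => [n| |n].
- exact: bf'.
- apply: filter_imp nb => h [hd hn] n.
  have [|t ht|c [hc e]] := @MVT_gen (f n) t0 (t0 + h) (f' n).
  + move=> t ht; apply: df; move: ht; rewrite /Rmin /Rmax; case: Rle_dec => _ ht; move/Rabs_def2: hd => hd; apply: Rabs_def1; lra.
  + apply: derivable_continuous_pt; exists (f' n t); apply/is_derive_Reals/df.
    move: ht; rewrite /Rmin /Rmax; case: Rle_dec => _ ht; move/Rabs_def2: hd => hd; apply: Rabs_def1; lra.
  + have -> : (f n (t0 + h) - f n t0) / h = f' n c by rewrite e; field.
    apply: bf'; move: hc; rewrite /Rmin /Rmax; case: Rle_dec => _ hc; move/Rabs_def2: hd => hd; apply: Rabs_def1; lra.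
- by apply/deriv_quot; apply: df.
Qed.

(** The first-order form of y'' = - q y. With tau = log t, each Fourier mode of
    the wave equation is of this kind. *)
Definition ode_sol (q y z : R -> R) : Prop :=
  forall t, is_derive y t (z t) /\ is_derive z t (- q t * y t).

(** The n-th term of the Picard series (not its partial sum), so that the
    solution is the sum of these functions; [dpicard] is its derivative. *)
Fixpoint picard (q : R -> R) (a b : R) (n : nat) : R -> R :=
  match n with
  | 0%nat => fun t => a + b * t
  | S m => fun t => RInt (fun s => RInt (fun r => - q r * picard q a b m r) 0 s) 0 t
  end.
Definition dpicard (q : R -> R) (a b : R) (n : nat) : R -> R :=
  match n with
  | 0%nat => fun _ => b
  | S m => fun s => RInt (fun r => - q r * picard q a b m r) 0 s
  end.

Lemma RInt_deriv (f : R -> R) t : (forall r, continuous f r) -> is_derive (fun t => RInt f 0 t) t (f t).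
Proof.
move=> cf; apply: (is_derive_RInt f (fun t => RInt f 0 t) 0); last exact: cf.
apply: filter_forall => r; apply: RInt_correct.
by apply: (@ex_RInt_continuous R_CompleteNormedModule) => s _.
Qed.

Lemma deriv_cont (f : R -> R) t l : is_derive f t l -> continuous f t.
Proof. by move=> h; apply: ex_derive_continuous; exists l. Qed.

Lemma picard_deriv q a b n : (forall r, continuous q r) ->
  forall t, is_derive (picard q a b n) t (dpicard q a b n t) /\
            is_derive (dpicard q a b n.+1) t (- q t * picard q a b n t).
Proof.
move=> cq.
have step m : (forall t, is_derive (picard q a b m) t (dpicard q a b m t)) ->
    forall t, is_derive (dpicard q a b m.+1) t (- q t * picard q a b m t).
  move=> dm t; apply: (@RInt_deriv (fun r => - q r * picard q a b m r)) => r.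
  by apply: filterlim_Rmult; [apply: (continuous_opp q)|apply: deriv_cont (dm r)].
have H : forall t, is_derive (picard q a b n) t (dpicard q a b n t).
  elim: n => [|n IH] t; first by rewrite /=; auto_derive => //; ring.
  by apply: (@RInt_deriv (dpicard q a b n.+1)) => r; apply: deriv_cont (step n IH r).
by move=> t; split; [apply: H|apply: step].
Qed.

Lemma cosh_ge1 t : 1 <= cosh t.
Proof.
rewrite /cosh exp_Ropp; have p := exp_pos t.
have : 0 <= (exp t - 1) ^ 2 * / exp t by apply: Rmult_le_pos; [apply: pow2_ge_0|apply/Rlt_le/Rinv_0_lt_compat].
have -> : (exp t - 1) ^ 2 * / exp t = exp t + / exp t - 2 by field; lra.
lra.
Qed.

Lemma sinh_le_cosh t : Rabs (sinh t) <= cosh t.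
Proof. by rewrite /sinh /cosh; have := exp_pos t; have := exp_pos (- t); move=> *; apply: Rabs_le; lra. Qed.

Lemma cosh_le t T : Rabs t <= T -> cosh t <= 2 * cosh T.
Proof.
move=> h; rewrite /cosh; have h1 : exp t <= exp T by apply: exp_mono; have := Rle_abs t; lra.
have h2 : exp (- t) <= exp T by apply: exp_mono; have := Rabs_maj2 t; lra.
have := exp_pos (- T); lra.
Qed.

(** Weighting by cosh (mu t) turns one integration into a factor 1 / mu on both
    half-lines at once. *)
Lemma integral_bound (f f' : R -> R) B mu T : 0 < mu -> 0 <= B -> f 0 = 0 ->
  (forall t, is_derive f t (f' t)) -> (forall t, Rabs t <= T -> Rabs (f' t) <= B * cosh (mu * t)) ->
  forall t, Rabs t <= T -> Rabs (f t) <= B / mu * cosh (mu * t).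
Proof.
move=> m0 B0 f0 df hb t hT.
have dg k s : is_derive (fun t => B / mu * sinh (mu * t) + k * f t) s (B * cosh (mu * s) + k * f' s).
  apply: is_derive_plus; last exact: is_derive_scal.
  have -> : B * cosh (mu * s) = scal (B / mu) (scal mu (cosh (mu * s))).
    by rewrite /scal /= /mult /=; field; lra.
  apply: is_derive_scal; apply: (is_derive_comp sinh (fun t => mu * t)).
    exact/is_derive_Reals/derivable_pt_lim_sinh.
  by auto_derive => //; ring.
have s0 k : B / mu * sinh (mu * 0) + k * f 0 = 0 by rewrite Rmult_0_r sinh_0 f0; ring.
have nn k s : Rabs k = 1 -> Rabs s <= T -> 0 <= B * cosh (mu * s) + k * f' s.
  move=> hk /hb h; have : Rabs (k * f' s) <= B * cosh (mu * s) by rewrite Rabs_mult hk Rmult_1_l.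
  by move/Rabs_le_between; lra.
have m1 : Rabs 1 = 1 by rewrite Rabs_R1.
have m2 : Rabs (-1) = 1 by rewrite Rabs_Ropp Rabs_R1.
apply: Rle_trans (_ : Rabs (B / mu * sinh (mu * t)) <= _); last first.
  rewrite Rabs_mult Rabs_pos_eq; last by apply: Rdiv_le_0_compat.
  by apply: Rmult_le_compat_l; [apply: Rdiv_le_0_compat|apply: sinh_le_cosh].
move/Rabs_le_between: hT => hT.
case: (Rle_lt_dec 0 t) => t0.
- have h k : Rabs k = 1 -> 0 <= B / mu * sinh (mu * t) + k * f t.
    move=> hk; rewrite -(s0 k); apply: (mono_deriv t0 (fun s _ => dg k s)) => s hs.
    by apply: nn => //; apply: Rabs_le; lra.
  by have := h 1 m1; have := h (-1) m2 => h1 h2; rewrite [X in _ <= X]Rabs_pos_eq; [apply: Rabs_le|]; lra.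
- have h k : Rabs k = 1 -> B / mu * sinh (mu * t) + k * f t <= 0.
    move=> hk; rewrite -(s0 k); apply: (mono_deriv (Rlt_le _ _ t0) (fun s _ => dg k s)) => s hs.
    by apply: nn => //; apply: Rabs_le; lra.
  by have := h 1 m1; have := h (-1) m2 => h1 h2; rewrite [X in _ <= X]Rabs_left1; [apply: Rabs_le|]; lra.
Qed.

(** In the norm weighted by cosh (mu t) with mu = 2 Q + 2 each of the two
    integrations gains at least a factor 1 / 2. *)
Lemma picard_bound q a b T Q : (forall r, continuous q r) -> 0 <= T -> 0 <= Q ->
  (forall t, Rabs t <= T -> Rabs (q t) <= Q) ->
  exists K, forall n t, Rabs t <= T ->
    Rabs (picard q a b n t) <= K * (/ 2) ^ n /\ Rabs (dpicard q a b n t) <= K * (/ 2) ^ n.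
Proof.
move=> cq T0 Q0 hQ; pose mu := 2 * Q + 2; pose A := Rabs a + Rabs b * (T + 1).
have A0 : 0 <= A by rewrite /A; have := Rabs_pos a; have := Rabs_pos b; nra.
have mu0 : 0 < mu by rewrite /mu; lra.
have H n t : Rabs t <= T -> Rabs (picard q a b n t) <= A * (/ 2) ^ n * cosh (mu * t) /\
                            Rabs (dpicard q a b n t) <= A * (/ 2) ^ n * cosh (mu * t).
  elim: n t => [|n IH].
    move=> t ht; rewrite /= Rmult_1_r.
    have c1 := cosh_ge1 (mu * t); have pa := Rabs_pos a; have pb := Rabs_pos b; have pt := Rabs_pos t.
    have h1 : Rabs (a + b * t) <= A.
      apply: Rle_trans (Rabs_triang _ _) _; rewrite Rabs_mult /A; nra.
    have h2 : Rabs b <= A by rewrite /A; nra.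
    by split; nra.
  have B0 : 0 <= A * (/ 2) ^ n by apply: Rmult_le_pos => //; apply: pow_le; lra.
  have d1 t : Rabs t <= T -> Rabs (dpicard q a b n.+1 t) <= A * (/ 2) ^ n.+1 * cosh (mu * t).
    move=> ht; have := @integral_bound (dpicard q a b n.+1) (fun t => - q t * picard q a b n t) (Q * (A * (/ 2) ^ n)) mu T.
    move=> I; apply: Rle_trans (I _ _ _ _ _ t ht) _ => //.
    - exact: Rmult_le_pos.
    - by rewrite /= RInt_point.
    - by move=> s; case: (picard_deriv a b n cq s).
    - move=> s hs; rewrite Rabs_mult Rabs_Ropp Rmult_assoc.
      by apply: Rmult_le_compat; try exact: Rabs_pos; [apply: hQ|case: (IH s hs)].
    - apply: Rmult_le_compat_r; first by have := cosh_ge1 (mu * t); lra.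
      apply: (Rmult_le_reg_r mu) => //; rewrite /Rdiv Rmult_assoc Rinv_l /=; last lra.
      by rewrite /mu; nra.
  move=> t ht; split; last exact: d1.
  have := @integral_bound (picard q a b n.+1) (dpicard q a b n.+1) (A * (/ 2) ^ n.+1) mu T.
  move=> I; apply: Rle_trans (I _ _ _ _ _ t ht) _ => //.
  - by apply: Rmult_le_pos => //; apply: pow_le; lra.
  - by rewrite /= RInt_point.
  - by move=> s; case: (picard_deriv a b n.+1 cq s).
  - apply: Rmult_le_compat_r; first by have := cosh_ge1 (mu * t); lra.
    have p : 0 <= A * (/ 2) ^ n.+1 by apply: Rmult_le_pos => //; apply: pow_le; lra.
    apply: (Rmult_le_reg_r mu) => //; rewrite /Rdiv Rmult_assoc Rinv_l; last lra.
    by rewrite /mu; nra.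
exists (A * (2 * cosh (mu * T))) => n t ht; have [h1 h2] := H n t ht.
have hc : cosh (mu * t) <= 2 * cosh (mu * T).
  apply: cosh_le; rewrite Rabs_mult Rabs_pos_eq; last lra.
  by apply: Rmult_le_compat_l; lra.
have p : 0 <= A * (/ 2) ^ n by apply: Rmult_le_pos => //; apply: pow_le; lra.
have : A * (/ 2) ^ n * cosh (mu * t) <= A * (/ 2) ^ n * (2 * cosh (mu * T)) by apply: Rmult_le_compat_l.
by split; nra.
Qed.

Lemma ode_exists q a b : (forall r, continuous q r) ->
  (forall T, 0 <= T -> exists Q, 0 <= Q /\ forall t, Rabs t <= T -> Rabs (q t) <= Q) ->
  exists y z, [/\ ode_sol q y z, y 0 = a & z 0 = b].
Proof.
move=> cq bq.
pose y t := Series (fun n => picard q a b n t); pose z t := Series (fun n => dpicard q a b n t).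
have loc t0 : exists M, ex_series M /\ forall n t, Rabs (t - t0) < 1 ->
    Rabs (picard q a b n t) <= M n /\ Rabs (dpicard q a b n t) <= M n.
  have T0 : 0 <= Rabs t0 + 1 by have := Rabs_pos t0; lra.
  have [Q [Q0 hQ]] := bq _ T0; have [K HK] := picard_bound a b cq T0 Q0 hQ.
  exists (fun n => K * (/ 2) ^ n); split.
    by apply: ex_series_scal_l; apply: ex_series_geom; rewrite Rabs_pos_eq; lra.
  move=> n t ht; apply: HK; have := Rabs_triang (t - t0) t0.
  by have -> : t - t0 + t0 = t by [ring]; lra.
have ex (f : nat -> R) M : ex_series M -> (forall n, Rabs (f n) <= M n) -> ex_series f.
  by move=> sM h; apply: (@ex_series_le R_AbsRing R_CompleteNormedModule f M h).
have self t : Rabs (t - t) < 1 by rewrite Rminus_eq_0 Rabs_R0; lra.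
exists y, z; split; last first.
- rewrite /z -[RHS](@is_series_unique (fun n => dpicard q a b n 0) (dpicard q a b 0 0)) //.
  by apply: is_series_single => -[|n] // _; rewrite /= RInt_point.
- rewrite /y (@is_series_unique (fun n => picard q a b n 0) (picard q a b 0 0)); first by rewrite /=; ring.
  by apply: is_series_single => -[|n] // _; rewrite /= RInt_point.
move=> t; have [M [sM HM]] := loc t; split.
  apply: (@Series_derive (picard q a b) (dpicard q a b) M t 1 Rlt_0_1 sM).
  - by move=> n s _; case: (picard_deriv a b n cq s).
  - by move=> n s hs; case: (HM n s hs).
  - by move=> s hs; apply: (ex _ M sM) => n; case: (HM n s hs).
pose d2 (n : nat) s := if n is m.+1 then - q s * picard q a b m s else 0.
have exy s : Rabs (s - t) < 1 -> ex_series (fun n => picard q a b n s).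
  by move=> hs; apply: (ex _ M sM) => n; case: (HM n s hs).
have -> : - q t * y t = Series (fun n => d2 n t).
  rewrite Series_incr_1 /=.
    by rewrite Rplus_0_l -Series_scal_l.
  by apply/ex_series_incr_1; apply: ex_series_scal_l; apply: exy.
have [Q [Q0 hQ]] := bq (Rabs t + 1) ltac:(have := Rabs_pos t; lra).
apply: (@Series_derive (dpicard q a b) d2 (fun n => if n is m.+1 then Q * M m else 0) t 1 Rlt_0_1).
- by apply/ex_series_incr_1; apply: ex_series_scal_l.
- move=> [|n] s hs; last by case: (picard_deriv a b n cq s).
  by rewrite /=; auto_derive.
- move=> [|n] s hs /=; first by rewrite Rabs_R0; lra.
  rewrite Rabs_mult Rabs_Ropp; apply: Rmult_le_compat; try exact: Rabs_pos; last by case: (HM n s hs).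
  by apply: hQ; have := Rabs_triang (s - t) t; have -> : s - t + t = s by [ring]; lra.
- by move=> s hs; apply: (ex _ M sM) => n; case: (HM n s hs).
Qed.

(** * Energies for exponentially growing potentials *)

(** Here q1 and q2 are the first two derivatives of q. The constants 4 and 16
    come from the exponents 2 - 2 p_i of a Kasner background, which lie in (0,
    4]. *)
Record potential (c : R) (q q1 q2 : R -> R) : Prop := Potential {
  pot_d1 : forall t, is_derive q t (q1 t);
  pot_d2 : forall t, is_derive q1 t (q2 t);
  pot_ge0 : forall t, 0 <= q t;
  pot_b1 : forall t, c * q t <= q1 t <= 4 * q t;
  pot_b2 : forall t, 0 <= q2 t <= 16 * q t }.

Lemma pot_cont c q q1 q2 : potential c q q1 q2 -> forall t, continuous q t.
Proof. by move=> P t; apply: deriv_cont (pot_d1 P t). Qed.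

Lemma pot_growth c q q1 q2 s t : 0 < c -> potential c q q1 q2 -> s <= t ->
  q s <= exp (c * (s - t)) * q t.
Proof.
move=> c0 P st.
have : q s * exp (- c * s) <= q t * exp (- c * t).
  apply: (@mono_deriv (fun t => q t * exp (- c * t)) (fun t => q1 t * exp (- c * t) + q t * (- c * exp (- c * t)))) => // r _.
    apply: is_derive_mult; [exact: pot_d1 P r| |by move=> *; apply: Rmult_comm].
    by auto_derive => //; ring.
  by have := exp_pos (- c * r); have := pot_b1 P r; nra.
have -> : exp (c * (s - t)) = exp (- c * t) * / exp (- c * s).
  by rewrite -exp_Ropp -exp_plus; congr exp; ring.
have p := exp_pos (- c * s) => h; apply: (Rmult_le_reg_r (exp (- c * s))) => //.
have -> : exp (- c * t) * / exp (- c * s) * q t * exp (- c * s) = q t * exp (- c * t) by field; lra.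
exact: h.
Qed.

Lemma pot_mono c q q1 q2 s t : 0 < c -> potential c q q1 q2 -> s <= t -> q s <= q t.
Proof.
move=> c0 P st; apply: Rle_trans (pot_growth c0 P st) _.
have : exp (c * (s - t)) <= exp 0 by apply: exp_mono; nra.
by rewrite exp_0; have := pot_ge0 P t; nra.
Qed.

Lemma pot_ode_exists c q q1 q2 a b : 0 < c -> potential c q q1 q2 ->
  exists y z, [/\ ode_sol q y z, y 0 = a & z 0 = b].
Proof.
move=> c0 P; apply: ode_exists; first exact: pot_cont P.
move=> T T0; exists (q T); split; first exact: pot_ge0 P T.
move=> t /Rabs_le_between ht; rewrite Rabs_pos_eq; last exact: pot_ge0 P t.
by apply: (pot_mono c0 P); lra.
Qed.

Lemma is_derive_Rmult (f g : R -> R) t df dg : is_derive f t df -> is_derive g t dg ->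
  is_derive (fun t => f t * g t) t (df * g t + f t * dg).
Proof. by move=> h1 h2; apply: is_derive_mult => // *; apply: Rmult_comm. Qed.

Lemma is_derive_Rplus (f g : R -> R) t df dg : is_derive f t df -> is_derive g t dg ->
  is_derive (fun t => f t + g t) t (df + dg).
Proof. exact: is_derive_plus. Qed.

Lemma is_derive_eq (f : R -> R) (t l l' : R) : is_derive f t l -> l = l' -> is_derive f t l'.
Proof. by move=> h <-. Qed.

Definition energy (q y z : R -> R) (t : R) : R := (1 + q t) * y t ^ 2 + z t ^ 2.

(** A crude bound for all times: the logarithmic derivative of the energy is at
    most 5. It gives uniqueness and the convergence of the Fourier series of
    solutions. *)
Lemma energy_bound c q q1 q2 y z t : 0 < c -> potential c q q1 q2 -> ode_sol q y z ->
  energy q y z t <= exp (5 * Rabs t) * energy q y z 0.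
Proof.
move=> c0 P S.
have dE s : is_derive (energy q y z) s (q1 s * y s ^ 2 + 2 * y s * z s).
  have [dy dz] := S s; have dq := pot_d1 P s.
  apply: (is_derive_ext (fun t => (1 + q t) * (y t * y t) + z t * z t)); first by move=> r; change ((1 + q r) * (y r * y r) + z r * z r = (1 + q r) * y r ^ 2 + z r ^ 2); ring.
  apply: is_derive_eq.
    apply: is_derive_Rplus; apply: is_derive_Rmult; try apply: is_derive_Rmult; try exact: dy; try exact: dz.
    by apply: is_derive_Rplus dq; apply: is_derive_const.
  by rewrite /zero /=; ring.
have bE s : Rabs (q1 s * y s ^ 2 + 2 * y s * z s) <= 5 * energy q y z s.
  rewrite /energy; have q0 := pot_ge0 P s; have [b1 b2] := pot_b1 P s.
  have cq0 : 0 <= q1 s by nra.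
  have y2 := pow2_ge_0 (y s); have z2 := pow2_ge_0 (z s).
  have h1 : q1 s * y s ^ 2 <= 4 * q s * y s ^ 2 by apply: Rmult_le_compat_r.
  have h2 : 0 <= q1 s * y s ^ 2 by apply: Rmult_le_pos.
  by apply: Rabs_le; split; nra.
have dw s : is_derive (fun t => 5 * t) s 5 by auto_derive => //; ring.
case: (Rle_lt_dec 0 t) => ht.
  have [h _] := @gronwall _ _ _ (fun _ => 5) 0 t ht (fun s _ => dE s) (fun s _ => dw s) (fun s _ => bE s).
  by move: h; rewrite Rabs_pos_eq // Rmult_0_r Rminus_0_r.
have [_ h] := @gronwall _ _ _ (fun _ => 5) t 0 (Rlt_le _ _ ht) (fun s _ => dE s) (fun s _ => dw s) (fun s _ => bE s).
move: h; rewrite Rabs_left //.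
by have -> : 5 * 0 - 5 * t = 5 * - t by ring.
Qed.

(** The adiabatic energy in the oscillating regime q >= 1. *)
Definition wkb (q y z : R -> R) (t : R) : R := sqrt (q t) * y t ^ 2 + / sqrt (q t) * z t ^ 2.

(** Up to the turning time back from 0 the adiabatic energy changes by at most a
    constant factor. Its derivative contains the term q1 / (2 q) (sqrt q y^2 -
    z^2 / sqrt q), which is not small compared with the energy; adding a
    multiple of y z cancels it, and the remaining error is O(1 / sqrt q) times
    the energy. This is integrable, as q grows exponentially, uniformly in the
    value of q at the ends. *)
Lemma wkb_bound c q q1 q2 y z a b : 0 < c -> potential c q q1 q2 -> ode_sol q y z ->
  a <= b -> 1 <= q a ->
  wkb q y z b <= 3 * exp (20 / c) * wkb q y z a /\ wkb q y z a <= 3 * exp (20 / c) * wkb q y z b.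
Proof.
move=> c0 P S ab qa.
have q1' t : a <= t -> 1 <= q t by move=> /(pot_mono c0 P); lra.
pose si t := / sqrt (q t); pose m t := q1 t / (2 * q t); pose m1 t := q2 t / (2 * q t) - 2 * m t ^ 2.
have rp t : a <= t -> 1 <= sqrt (q t) by move=> /q1' h; rewrite -sqrt_1; apply: sqrt_le_1_alt.
have rr t : a <= t -> sqrt (q t) * sqrt (q t) = q t by move=> /q1' h; apply: sqrt_sqrt; lra.
have sp t : a <= t -> 0 < si t <= 1.
  move=> /rp h; split; first by apply: Rinv_0_lt_compat; lra.
  by rewrite -Rinv_1; apply: Rinv_le_contravar; lra.
have dr t : a <= t -> is_derive (fun t => sqrt (q t)) t (m t * sqrt (q t)).
  move=> ht; have qt := q1' t ht.
  have -> : m t * sqrt (q t) = q1 t / (2 * sqrt (q t)) :> R.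
    by rewrite /m -{1}(rr t ht); field; have := rp t ht; lra.
  by apply: is_derive_sqrt; [exact: pot_d1 P t|lra].
have ds t : a <= t -> is_derive si t (- m t * si t).
  move=> ht; apply: is_derive_eq; first by apply: is_derive_inv; [exact: dr|have := rp t ht; lra].
  by rewrite /si /=; field; have := rp t ht; lra.
have dm t : a <= t -> is_derive m t (m1 t).
  move=> ht; have qt := q1' t ht.
  have dq := pot_d1 P t; have dq1 := pot_d2 P t.
  apply: is_derive_eq; first by apply: is_derive_div; [exact: dq1|apply: is_derive_scal; exact: dq|lra].
  by rewrite /m1 /m /=; field; lra.
(* m = q1 / (2 q) is the logarithmic derivative of sqrt q. *)
pose F t := sqrt (q t) * (y t * y t) + si t * (z t * z t) + m t * si t * (y t * z t) + y t * y t + si t * si t * (z t * z t).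
pose dF t := (m1 t - m t ^ 2) * si t * (y t * z t) - 2 * m t * (si t * si t) * z t ^ 2.
have isF t : a <= t -> is_derive F t (dF t).
  move=> ht; have [dy dz] := S t; have dr' := dr t ht; have ds' := ds t ht; have dm' := dm t ht.
  apply: is_derive_eq.
    have dyy := is_derive_Rmult dy dy; have dzz := is_derive_Rmult dz dz; have dyz := is_derive_Rmult dy dz.
    have d1 := is_derive_Rmult dr' dyy; have d2 := is_derive_Rmult ds' dzz.
    have d3 := is_derive_Rmult (is_derive_Rmult dm' ds') dyz.
    have d4 := is_derive_Rmult (is_derive_Rmult ds' ds') dzz.
    exact: (is_derive_Rplus (is_derive_Rplus (is_derive_Rplus (is_derive_Rplus d1 d2) d3) dyy) d4).
  have := rp t ht; have := rr t ht; rewrite /dF /si; move: (sqrt (q t)) => r <- r1; field; lra.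
have mb t : a <= t -> c / 2 <= m t <= 2.
  move=> /q1' qt; have [b1 b2] := pot_b1 P t.
  by split; apply: (Rmult_le_reg_r (2 * q t)); try lra; rewrite /m /Rdiv ?Rmult_assoc ?Rinv_l; lra.
have m1b t : a <= t -> Rabs (m1 t - m t ^ 2) <= 12.
  move=> ht; have := mb t ht; have qt := q1' t ht; have [b1 b2] := pot_b2 P t => hm.
  have : 0 <= q2 t / (2 * q t) <= 8.
    by split; apply: (Rmult_le_reg_r (2 * q t)); try lra; rewrite /Rdiv ?Rmult_assoc ?Rinv_l; lra.
  by rewrite /m1 => h; apply: Rabs_le; nra.
(* F is comparable with the adiabatic energy: the added terms y^2 and z^2 / q
   outweigh the multiple of y z, whose coefficient is at most 2 / sqrt q. *)
have cmp t : a <= t -> wkb q y z t <= F t <= 3 * wkb q y z t.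
  move=> ht; have := mb t ht; have := sp t ht; have h1 := rp t ht; rewrite /wkb /F -/(si t).
  have e1 : si t * sqrt (q t) = 1 by rewrite /si; field; lra.
  set s := si t in e1 *; set r := sqrt (q t) in e1 h1 *; move: (m t) (y t) (z t) => M Y Z hs hM.
  have E2 : Y * Y = s * (r * (Y * Y)) by rewrite -Rmult_assoc e1; ring.
  have p1 := pow2_ge_0 (Y + s * Z); have p2 := pow2_ge_0 (Y - s * Z).
  have Y2 := pow2_ge_0 Y; have Z2 := pow2_ge_0 (s * Z).
  have k1 : Rabs (M * s * (Y * Z)) <= Y * Y + s * s * (Z * Z).
    have : Rabs (s * Z * Y) <= (Y * Y + s * s * (Z * Z)) / 2 by apply: Rabs_le; nra.
    have -> : M * s * (Y * Z) = M * (s * Z * Y) by ring.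
    rewrite (Rabs_mult M) (Rabs_pos_eq M); last lra.
    by have := Rabs_pos (s * Z * Y); nra.
  move/Rabs_le_between: k1 => k1.
  have k2 : s * s * (Z * Z) <= s * Z ^ 2 by have := pow2_ge_0 Z; nra.
  have k3 : Y * Y <= r * Y ^ 2 by nra.
  have -> : s * (Z * Z) = s * Z ^ 2 by ring.
  have -> : r * (Y * Y) = r * Y ^ 2 by ring.
  by split; lra.
have bF t : a <= t -> Rabs (dF t) <= 20 / c * (m t * si t) * F t.
  move=> ht; have [c1 _] := cmp t ht; have hm := mb t ht; have hs := sp t ht; have h1 := rp t ht.
  apply: Rle_trans (_ : 10 * si t * wkb q y z t <= _); last first.
    have h10 : 10 * si t <= 20 / c * (m t * si t).
      apply: (Rmult_le_reg_r c) => //; have -> : 20 / c * (m t * si t) * c = 20 * m t * si t by field; lra.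
      by nra.
    have w0 : 0 <= wkb q y z t.
      by rewrite /wkb -/(si t); have := pow2_ge_0 (y t); have := pow2_ge_0 (z t); nra.
    by apply: Rmult_le_compat; lra.
  rewrite /dF /wkb -/(si t); have e1 : si t * sqrt (q t) = 1 by rewrite /si; field; lra.
  have := m1b t ht; move: (m1 t - m t ^ 2) => N hN.
  set s := si t in e1 hs *; set r := sqrt (q t) in e1 h1 *; move: hm; move: (m t) (y t) (z t) => M Y Z hM.
  have k1 : 2 * Rabs (Y * Z) <= r * Y ^ 2 + s * Z ^ 2.
    have p1 : 0 <= r * (Y + s * Z) ^ 2 by apply: Rmult_le_pos; [lra|apply: pow2_ge_0].
    have p2 : 0 <= r * (Y - s * Z) ^ 2 by apply: Rmult_le_pos; [lra|apply: pow2_ge_0].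
    have e2 : r * (Y + s * Z) ^ 2 = r * Y ^ 2 + 2 * (s * r) * (Y * Z) + (s * r) * s * Z ^ 2 by ring.
    have e3 : r * (Y - s * Z) ^ 2 = r * Y ^ 2 - 2 * (s * r) * (Y * Z) + (s * r) * s * Z ^ 2 by ring.
    rewrite e2 e1 in p1; rewrite e3 e1 in p2.
    by rewrite /Rabs; case: Rcase_abs => _; lra.
  have rY : 0 <= r * Y ^ 2 by apply: Rmult_le_pos; [lra|apply: pow2_ge_0].
  have sZ : 0 <= s * Z ^ 2 by apply: Rmult_le_pos; [lra|apply: pow2_ge_0].
  have k2 : Rabs (N * s * (Y * Z)) <= s * (6 * (r * Y ^ 2 + s * Z ^ 2)).
    rewrite !Rabs_mult (Rabs_pos_eq s); last lra.
    have -> : Rabs N * s * (Rabs Y * Rabs Z) = s * (Rabs N * Rabs (Y * Z)) by rewrite Rabs_mult; ring.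
    apply: Rmult_le_compat_l; first lra.
    by have := Rabs_pos (Y * Z); have := Rabs_pos N; nra.
  have k3 : 0 <= 2 * M * (s * s) * Z ^ 2 <= s * (4 * (s * Z ^ 2)).
    have -> : 2 * M * (s * s) * Z ^ 2 = s * (2 * M * (s * Z ^ 2)) by ring.
    by split; [apply: Rmult_le_pos|apply: Rmult_le_compat_l]; nra.
  move/Rabs_le_between: k2 => k2.
  have k4 : 0 <= s * (r * Y ^ 2) by apply: Rmult_le_pos; lra.
  by apply: Rabs_le; split; lra.
(* Gronwall's weight: 1 / sqrt q decreases at the rate m / sqrt q with m >= c / 2. *)
have dw t : a <= t -> is_derive (fun t => - (20 / c) * si t) t (20 / c * (m t * si t)).
  move=> ht; apply: is_derive_eq; first by apply: is_derive_scal; apply: ds.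
  by ring.
have [g1 g2] := @gronwall F dF (fun t => - (20 / c) * si t) (fun t => 20 / c * (m t * si t)) a b ab
  (fun t ht => isF t (proj1 ht)) (fun t ht => dw t (proj1 ht)) (fun t ht => bF t (proj1 ht)).
have ew : exp (- (20 / c) * si b - - (20 / c) * si a) <= exp (20 / c).
  apply: exp_mono; have := sp a (Rle_refl a); have := sp b ab.
  have : 0 < 20 / c by apply: Rdiv_lt_0_compat; lra.
  by nra.
have w0 t : a <= t -> 0 <= wkb q y z t.
  by move=> /sp hs; rewrite /wkb -/(si t); have := sqrt_pos (q t); have := pow2_ge_0 (y t); have := pow2_ge_0 (z t); nra.
have [ca1 ca2] := cmp a (Rle_refl a); have [cb1 cb2] := cmp b ab.
have wa := w0 a (Rle_refl a); have wb := w0 b ab; have ep := exp_pos (20 / c).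
have fin x u v w : 0 < x -> x <= exp (20 / c) -> 0 <= u -> w <= x * v -> v <= 3 * u -> w <= 3 * exp (20 / c) * u.
  move=> x0 hx u0 hw hv; have : x * v <= x * (3 * u) by apply: Rmult_le_compat_l; lra.
  have : x * (3 * u) <= exp (20 / c) * (3 * u) by apply: Rmult_le_compat_r; lra.
  lra.
have xp := exp_pos (- (20 / c) * si b - - (20 / c) * si a).
by split; [apply: (fin _ _ (F a) _ xp ew wa)|apply: (fin _ _ (F b) _ xp ew wb)]; lra.
Qed.

(** For q = 0 the two squares are conserved: z is constant and y - (t - ts) z is
    the position at the time ts. *)
Definition free_energy (ts : R) (y z : R -> R) (t : R) : R := z t ^ 2 + (y t - (t - ts) * z t) ^ 2.

(** Each factor 1 + s^2 is absorbed by exp (c s / 4); the inequality exp u >= 1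
    + u^2 / 4 provides the constant. *)
Lemma exp_decay_poly c s : 0 < c -> s <= 0 ->
  (1 + s ^ 2) ^ 2 * exp (c * s) <= (1 + 64 / c ^ 2) ^ 2 * exp (c / 2 * s).
Proof.
move=> c0 s0; have h := exp_quad (u := - (c / 4 * s)) ltac:(nra).
have e1 : exp (c * s) = exp (c / 2 * s) * (exp (c / 4 * s) * exp (c / 4 * s)).
  by rewrite -!exp_plus; congr exp; field.
have e2 : exp (c / 4 * s) * exp (- (c / 4 * s)) = 1 by rewrite -exp_plus Rplus_opp_r exp_0.
have p1 := exp_pos (c / 4 * s); have p2 := exp_pos (c / 2 * s).
have c2 : 0 < c ^ 2 by apply: pow_lt.
have k : (1 + s ^ 2) * exp (c / 4 * s) <= 1 + 64 / c ^ 2.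
  have s2 := pow2_ge_0 s.
  have k0 : s ^ 2 <= 64 / c ^ 2 * exp (- (c / 4 * s)).
    have -> : s ^ 2 = 64 / c ^ 2 * ((- (c / 4 * s)) ^ 2 / 4) by field; lra.
    by apply: Rmult_le_compat_l; [apply/Rlt_le/Rdiv_lt_0_compat; lra|lra].
  have k1 : exp (c / 4 * s) <= 1 by rewrite -exp_0; apply: exp_mono; nra.
  have k2 : s ^ 2 * exp (c / 4 * s) <= 64 / c ^ 2 * exp (- (c / 4 * s)) * exp (c / 4 * s) by apply: Rmult_le_compat_r; lra.
  have k3 : 64 / c ^ 2 * exp (- (c / 4 * s)) * exp (c / 4 * s) = 64 / c ^ 2 by rewrite Rmult_assoc [X in _ * X = _]Rmult_comm e2; ring.
  lra.
rewrite e1; have -> : (1 + s ^ 2) ^ 2 * (exp (c / 2 * s) * (exp (c / 4 * s) * exp (c / 4 * s))) = ((1 + s ^ 2) * exp (c / 4 * s)) ^ 2 * exp (c / 2 * s) by ring.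
apply: Rmult_le_compat_r; first lra; apply: pow_incr; split=> //.
by apply: Rmult_le_pos; have := pow2_ge_0 s; lra.
Qed.

Definition freeK (c : R) : R := exp (2 * (1 + 64 / c ^ 2) ^ 2 / c).

(** Before the turning time q decays exponentially backwards, so that even after
    multiplication by (t - ts)^2 the perturbation of the free motion is
    integrable, with a bound depending on c only. *)
Lemma free_bound c q q1 q2 y z ts t : 0 < c -> potential c q q1 q2 -> ode_sol q y z ->
  q ts = 1 -> t <= ts ->
  free_energy ts y z ts <= freeK c * free_energy ts y z t /\
  free_energy ts y z t <= freeK c * free_energy ts y z ts.
Proof.
move=> c0 P S qts tts.
pose B := (1 + 64 / c ^ 2) ^ 2.
pose dG t := 2 * q t * y t * ((t - ts) * (y t - (t - ts) * z t) - z t).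
have isG s : is_derive (free_energy ts y z) s (dG s).
  have [dy dz] := S s.
  have dl : is_derive (fun t => t - ts) s 1 by auto_derive => //; ring.
  have dx : is_derive (fun t => y t + (-1) * ((t - ts) * z t)) s ((s - ts) * q s * y s).
    apply: is_derive_eq.
      apply: is_derive_Rplus; [exact: dy|apply: is_derive_scal; apply: is_derive_Rmult; [exact: dl|exact: dz]].
    by rewrite /=; ring.
  apply: (is_derive_ext (fun t => z t * z t + (y t + (-1) * ((t - ts) * z t)) * (y t + (-1) * ((t - ts) * z t)))).
    move=> r; change (z r * z r + (y r + (-1) * ((r - ts) * z r)) * (y r + (-1) * ((r - ts) * z r)) = z r ^ 2 + (y r - (r - ts) * z r) ^ 2); ring.
  apply: is_derive_eq.
    by apply: is_derive_Rplus; apply: is_derive_Rmult; first [exact: dz|exact: dx].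
  by rewrite /dG /=; ring.
have bG s : s <= ts -> Rabs (dG s) <= B * exp (c / 2 * (s - ts)) * free_energy ts y z s.
  move=> hs; have := pot_growth c0 P hs; rewrite qts Rmult_1_r => qb.
  have q0 := pot_ge0 P s.
  have dec := @exp_decay_poly c (s - ts) c0 ltac:(lra).
  rewrite /dG /free_energy; set Z := z s; set X := y s - (s - ts) * Z; set g := s - ts in qb dec *.
  have -> : y s = X + g * Z by rewrite /X /g; ring.
  have g2 := pow2_ge_0 g.
  (* Cauchy-Schwarz for the free integrals, with sum of squares 1 + g^2. *)
  have id : (X + g * Z) ^ 2 + (g * X - Z) ^ 2 = (1 + g ^ 2) * (Z ^ 2 + X ^ 2) by ring.
  have k1 : 2 * Rabs ((X + g * Z) * (g * X - Z)) <= (1 + g ^ 2) * (Z ^ 2 + X ^ 2).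
    rewrite -id; have := pow2_ge_0 (X + g * Z + (g * X - Z)); have := pow2_ge_0 (X + g * Z - (g * X - Z)).
    by rewrite /Rabs; case: Rcase_abs => _; nra.
  have -> : 2 * q s * (X + g * Z) * (g * X - Z) = q s * (2 * ((X + g * Z) * (g * X - Z))) by ring.
  rewrite !Rabs_mult (Rabs_pos_eq (q s)) // (Rabs_pos_eq 2); last lra.
  rewrite -Rabs_mult; have G0 : 0 <= Z ^ 2 + X ^ 2 by have := pow2_ge_0 Z; have := pow2_ge_0 X; lra.
  apply: Rle_trans (_ : exp (c * g) * ((1 + g ^ 2) * (Z ^ 2 + X ^ 2)) <= _).
    by apply: Rmult_le_compat => //; apply: Rmult_le_pos; [lra|exact: Rabs_pos].
  rewrite -Rmult_assoc; apply: Rmult_le_compat_r => //; apply: Rle_trans dec.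
  have := exp_pos (c * g); have : 1 + g ^ 2 <= (1 + g ^ 2) ^ 2 by nra.
  by rewrite [exp _ * _]Rmult_comm => h1 h2; apply: Rmult_le_compat_r; lra.
have dw s : is_derive (fun t => 2 * B / c * exp (c / 2 * (t - ts))) s (B * exp (c / 2 * (s - ts))).
  by auto_derive => //; rewrite /Rminus; field; lra.
have [g1 g2] := @gronwall _ _ _ _ t ts tts (fun s _ => isG s) (fun s _ => dw s) (fun s hs => bG s (proj2 hs)).
have ew : exp (2 * B / c * exp (c / 2 * (ts - ts)) - 2 * B / c * exp (c / 2 * (t - ts))) <= freeK c.
  apply: exp_mono; rewrite Rminus_eq_0 Rmult_0_r exp_0 /B.
  have : 0 <= 2 * B / c by apply: Rdiv_le_0_compat => //; rewrite /B; have := pow2_ge_0 (1 + 64 / c ^ 2); lra.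
  by have := exp_pos (c / 2 * (t - ts)); rewrite /B; nra.
have G0 s : 0 <= free_energy ts y z s.
  by rewrite /free_energy; have := pow2_ge_0 (z s); have := pow2_ge_0 (y s - (s - ts) * z s); lra.
by split; [apply: Rle_trans g1 _|apply: Rle_trans g2 _]; apply: Rmult_le_compat_r.
Qed.

(** An exponentially small derivative at minus infinity makes the function
    Cauchy there. *)
Lemma limit_minfty (f f' : R -> R) A k ts : 0 < k -> 0 <= A ->
  (forall t, is_derive f t (f' t)) -> (forall t, t <= ts -> Rabs (f' t) <= A * exp (k * (t - ts))) ->
  exists l : R, filterlim f (Rbar_locally m_infty) (locally l).
Proof.
move=> k0 A0 df bf.
have dE e s : is_derive (fun t => A / k * exp (k * (t - ts)) + e * f t) s (A * exp (k * (s - ts)) + e * f' s).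
  apply: is_derive_Rplus; last exact: is_derive_scal.
  by auto_derive => //; rewrite /Rminus; field; lra.
have inc e u v : Rabs e = 1 -> u <= v -> v <= ts ->
    A / k * exp (k * (u - ts)) + e * f u <= A / k * exp (k * (v - ts)) + e * f v.
  move=> he uv vts; apply: (mono_deriv uv (fun s _ => dE e s)) => s hs.
  have := bf s ltac:(lra) => h; have : Rabs (e * f' s) <= A * exp (k * (s - ts)) by rewrite Rabs_mult he Rmult_1_l.
  by move/Rabs_le_between; lra.
have m1 : Rabs 1 = 1 by rewrite Rabs_R1.
have m2 : Rabs (-1) = 1 by rewrite Rabs_Ropp Rabs_R1.
have Ak : 0 <= A / k by apply: Rdiv_le_0_compat.
apply: (proj1 (filterlim_locally_cauchy (U := R_CompleteSpace) f)) => eps.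
have e0 := cond_pos eps.
pose T := Rmin ts (ts + ln (eps / (A / k + 1)) / k).
exists (fun t => t < T); split; first by exists T.
have key u v : u <= v -> v < T -> Rabs (f v - f u) < eps.
  move=> uv vT; have vts : v <= ts by apply: Rlt_le; apply: Rlt_le_trans vT (Rmin_l _ _).
  have := inc 1 u v m1 uv vts; have := inc (-1) u v m2 uv vts => i1 i2.
  have q0 : 0 < eps / (A / k + 1) by apply: Rdiv_lt_0_compat; lra.
  have : exp (k * (v - ts)) < eps / (A / k + 1).
    rewrite -[X in _ < X]exp_ln //; apply: exp_increasing.
    have := Rlt_le_trans _ _ _ vT (Rmin_r _ _) => h.
    apply: (Rmult_lt_reg_r (/ k)); first exact: Rinv_0_lt_compat.
    have -> : k * (v - ts) * / k = v - ts by field; lra.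
    by move: h; rewrite /Rdiv; lra.
  move=> he; have pv := exp_pos (k * (v - ts)); have pu := exp_pos (k * (u - ts)).
  have : A / k * exp (k * (v - ts)) < eps.
    apply: Rle_lt_trans (_ : A / k * (eps / (A / k + 1)) < _); first by apply: Rmult_le_compat_l; lra.
    have -> : A / k * (eps / (A / k + 1)) = eps - eps / (A / k + 1) by field; lra.
    lra.
  have : 0 <= A / k * exp (k * (u - ts)) by apply: Rmult_le_pos; lra.
  by move=> *; apply: Rabs_def1; lra.
move=> u v uT vT; rewrite /ball /= /AbsRing_ball /= /abs /minus /plus /opp /=.
case: (Rle_lt_dec u v) => h; first exact: key.
by rewrite -Rabs_Ropp; have -> : - (f v + - f u) = f u - f v by [ring]; apply: key => //; lra.
Qed.

Lemma abs_le_sq x M : 0 <= M -> x ^ 2 <= M ^ 2 -> Rabs x <= M.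
Proof.
move=> M0 h; rewrite -(Rabs_pos_eq M) //; apply: Rsqr_le_abs_0; rewrite /Rsqr; lra.
Qed.

(** The two free integrals have derivatives - q y and (t - ts) q y, which are
    exponentially small since y grows at most linearly. *)
Lemma free_limit c q q1 q2 y z ts : 0 < c -> potential c q q1 q2 -> ode_sol q y z -> q ts = 1 ->
  exists Z X : R, filterlim z (Rbar_locally m_infty) (locally Z) /\
    filterlim (fun t => y t - (t - ts) * z t) (Rbar_locally m_infty) (locally X).
Proof.
move=> c0 P S qts.
pose L := 1 + freeK c * free_energy ts y z ts.
pose B := (1 + 64 / c ^ 2) ^ 2.
have B0 : 0 <= B by apply: pow2_ge_0.
have G0 s : 0 <= free_energy ts y z s.
  by rewrite /free_energy; have := pow2_ge_0 (z s); have := pow2_ge_0 (y s - (s - ts) * z s); lra.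
have L1 : 1 <= L by rewrite /L; have : 0 <= freeK c * free_energy ts y z ts; [apply: Rmult_le_pos => //; apply/Rlt_le/exp_pos|lra].
have yb t : t <= ts -> Rabs (y t) <= (1 + (t - ts) ^ 2) * L.
  move=> ht; have [_ h] := free_bound c0 P S qts ht.
  have g2 := pow2_ge_0 (t - ts).
  have p : 1 <= (1 + (t - ts) ^ 2) * L by nra.
  apply: abs_le_sq; first lra.
  have id : y t ^ 2 + ((t - ts) * (y t - (t - ts) * z t) - z t) ^ 2 = (1 + (t - ts) ^ 2) * free_energy ts y z t.
    by rewrite /free_energy; ring.
  have hL : free_energy ts y z t <= L by rewrite /L; lra.
  have := pow2_ge_0 ((t - ts) * (y t - (t - ts) * z t) - z t) => g3.
  have : (1 + (t - ts) ^ 2) * free_energy ts y z t <= (1 + (t - ts) ^ 2) * L by apply: Rmult_le_compat_l; lra.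
  by nra.
have qy t : t <= ts -> (1 + (t - ts) ^ 2) * (q t * Rabs (y t)) <= B * L * exp (c / 2 * (t - ts)).
  move=> ht; have := pot_growth c0 P ht; rewrite qts Rmult_1_r => qb.
  have dec := @exp_decay_poly c (t - ts) c0 ltac:(lra); have g2 := pow2_ge_0 (t - ts).
  apply: Rle_trans (_ : (1 + (t - ts) ^ 2) * (exp (c * (t - ts)) * ((1 + (t - ts) ^ 2) * L)) <= _).
    apply: Rmult_le_compat_l; first lra.
    by apply: Rmult_le_compat; [exact: pot_ge0 P t|exact: Rabs_pos|exact: qb|exact: yb].
  have -> : (1 + (t - ts) ^ 2) * (exp (c * (t - ts)) * ((1 + (t - ts) ^ 2) * L)) = (1 + (t - ts) ^ 2) ^ 2 * exp (c * (t - ts)) * L by ring.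
  have -> : B * L * exp (c / 2 * (t - ts)) = B * exp (c / 2 * (t - ts)) * L by ring.
  by apply: Rmult_le_compat_r; [lra|exact: dec].
have qy0 t : 0 <= q t * Rabs (y t) by apply: Rmult_le_pos; [exact: pot_ge0 P t|exact: Rabs_pos].
have BL : 0 <= B * L by apply: Rmult_le_pos; lra.
have c2 : 0 < c / 2 by lra.
have [Z HZ] : exists Z : R, filterlim z (Rbar_locally m_infty) (locally Z).
  apply: (@limit_minfty z (fun t => - q t * y t) (B * L) (c / 2) ts c2 BL) => t; first by case: (S t).
  move=> ht; rewrite Rabs_mult Rabs_Ropp (Rabs_pos_eq (q t)); last exact: pot_ge0 P t.
  by have := qy t ht; have := qy0 t; have := pow2_ge_0 (t - ts); nra.
have [X HX] : exists X : R, filterlim (fun t => y t - (t - ts) * z t) (Rbar_locally m_infty) (locally X).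
  apply: (@limit_minfty _ (fun t => (t - ts) * (q t * y t)) (B * L) (c / 2) ts c2 BL) => t.
    have [dy dz] := S t.
    have dl : is_derive (fun t => t - ts) t 1 by auto_derive => //; ring.
    apply: is_derive_eq.
      apply: is_derive_minus; [exact: dy|apply: is_derive_Rmult; [exact: dl|exact: dz]].
    by rewrite /minus /plus /opp /=; ring.
  move=> ht; rewrite Rabs_mult Rabs_mult (Rabs_pos_eq (q t)); last exact: pot_ge0 P t.
  have ab : Rabs (t - ts) <= 1 + (t - ts) ^ 2.
    by apply: abs_le_sq; have := pow2_ge_0 (t - ts); nra.
  apply: Rle_trans (qy t ht); apply: Rmult_le_compat_r => //.
by exists Z, X.
Qed.

(** * Scattering of a single mode *)

Lemma pot_uniq c q q1 q2 y z y' z' : 0 < c -> potential c q q1 q2 ->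
  ode_sol q y z -> ode_sol q y' z' -> y 0 = y' 0 -> z 0 = z' 0 ->
  forall t, y t = y' t /\ z t = z' t.
Proof.
move=> c0 P S S' ey ez t.
have SD : ode_sol q (fun t => y t - y' t) (fun t => z t - z' t).
  move=> s; have [dy dz] := S s; have [dy' dz'] := S' s; split; first exact: is_derive_minus.
  by apply: is_derive_eq; [apply: is_derive_minus; [exact: dz|exact: dz']|rewrite /minus /plus /opp /=; ring].
have := energy_bound t c0 P SD; rewrite /energy ey ez !Rminus_eq_0 => h.
have q0 := pot_ge0 P t; have y2 := pow2_ge_0 (y t - y' t); have z2 := pow2_ge_0 (z t - z' t).
have e0 : (1 + q 0) * 0 ^ 2 + 0 ^ 2 = 0 by ring.
rewrite e0 Rmult_0_r in h.
have qy : 0 <= q t * (y t - y' t) ^ 2 by apply: Rmult_le_pos.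
have sq x : x ^ 2 = 0 -> x = 0 by move=> e; apply: (@Rsqr_eq_0 x); rewrite Rsqr_pow2.
have hy : y t - y' t = 0 by apply: sq; lra.
have hz : z t - z' t = 0 by apply: sq; lra.
by split; lra.
Qed.

Lemma pot_growth_lower c q q1 q2 s t : potential c q q1 q2 -> s <= t ->
  q t <= exp (4 * (t - s)) * q s.
Proof.
move=> P st.
have : - (q s * exp (- 4 * s)) <= - (q t * exp (- 4 * t)).
  apply: (@mono_deriv (fun t => - (q t * exp (- 4 * t))) (fun t => - (q1 t * exp (- 4 * t) + q t * (- 4 * exp (- 4 * t))))) => // r _.
    apply: is_derive_opp; apply: is_derive_Rmult; first exact: pot_d1 P r.
    by auto_derive => //; ring.
  by have := exp_pos (- 4 * r); have := pot_b1 P r; nra.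
have -> : exp (4 * (t - s)) = exp (- 4 * s) * / exp (- 4 * t).
  by rewrite -exp_Ropp -exp_plus; congr exp; ring.
have p := exp_pos (- 4 * t) => h; apply: (Rmult_le_reg_r (exp (- 4 * t))) => //.
have -> : exp (- 4 * s) * / exp (- 4 * t) * q s * exp (- 4 * t) = q s * exp (- 4 * s) by field; lra.
lra.
Qed.

Lemma filterlim_unique_R (T : Type) (F : (T -> Prop) -> Prop) (FF : ProperFilter F) (f : T -> R) (a b : R) :
  filterlim f F (locally a) -> filterlim f F (locally b) -> a = b.
Proof. by move=> h1 h2; apply: (@filterlim_locally_unique T R_AbsRing R_NormedModule F _ f a b h1 h2). Qed.

Lemma filterlim_le_R (T : Type) (F : (T -> Prop) -> Prop) (FF : ProperFilter F) (f : T -> R) (a b : R) :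
  filterlim f F (locally a) -> F (fun t => f t <= b) -> a <= b.
Proof.
move=> h1 h2.
exact: (@filterlim_le T F _ f (fun _ => b) (Finite a) (Finite b) h2 h1 (filterlim_const b)).
Qed.

Lemma filterlim_ge_R (T : Type) (F : (T -> Prop) -> Prop) (FF : ProperFilter F) (f : T -> R) (a b : R) :
  filterlim f F (locally a) -> F (fun t => b <= f t) -> b <= a.
Proof.
move=> h1 h2.
exact: (@filterlim_le T F _ (fun _ => b) f (Finite b) (Finite a) h2 (filterlim_const b) h1).
Qed.

(** The data at time 0, with J = <λ>, are compared with the asymptotic data (Z,
    Phi) at time minus infinity, T being the logarithm of the turning time. The
    combination Phi + T Z is the limit of the free position y - (t - T) z, that
    is the asymptotic position seen from the turning time; it is the
    renormalised quantity φ_∞ + log T_* ψ_∞. The last two fields are uniform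
    bounds up to the limit, for dominated convergence; they lose one factor J.
    *)
Record mode_estimates (K J T : R) (y z : R -> R) (Z Phi : R) : Prop := ModeEst {
  me_limZ : filterlim z (Rbar_locally m_infty) (locally Z);
  me_limP : filterlim (fun t => y t - t * z t) (Rbar_locally m_infty) (locally Phi);
  me_down : Z ^ 2 + (Phi + T * Z) ^ 2 <= K * (J * y 0 ^ 2 + / J * z 0 ^ 2);
  me_up : J * y 0 ^ 2 + / J * z 0 ^ 2 <= K * (Z ^ 2 + (Phi + T * Z) ^ 2);
  me_z : forall t, t <= 0 -> z t ^ 2 <= K * J * (Z ^ 2 + (Phi + T * Z) ^ 2);
  me_y : forall t, t <= 0 -> (y t - t * z t) ^ 2 <= K * J * (Z ^ 2 + (Phi + T * Z) ^ 2) }.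

(** Used with r = exp (- c t / 2): the square of a logarithmic time is absorbed
    by the exponential growth of sqrt q. *)
Lemma sq_decay c t r : 0 < c -> 0 <= r -> t <= 0 -> exp (- (c / 2 * t)) <= r -> t ^ 2 <= 16 / c ^ 2 * r.
Proof.
move=> c0 r0 t0 h; have := exp_quad (u := - (c / 2 * t)) ltac:(nra) => h2.
have c2 : 0 < c ^ 2 by apply: pow_lt.
have -> : t ^ 2 = 16 / c ^ 2 * ((- (c / 2 * t)) ^ 2 / 4) by field; lra.
by apply: Rmult_le_compat_l; [apply/Rlt_le/Rdiv_lt_0_compat|]; lra.
Qed.

(** Going down from 0 to the turning time ts the adiabatic energy is conserved
    up to constants, at ts it equals the free energy since q ts = 1, and from
    there the free energy is conserved up to constants. At time 0 the adiabatic
    energy is J y^2 + z^2 / J up to a factor 2, and its limit is Z^2 + (Phi + ts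
    Z)^2. All constants depend on c only. *)
Lemma mode_asymptotics c : 0 < c -> exists K, 1 <= K /\ forall q q1 q2 ts y z,
  potential c q q1 q2 -> q ts = 1 -> 1 <= q 0 -> ode_sol q y z ->
  (exists Z Phi, mode_estimates K (sqrt (1 + q 0)) ts y z Z Phi) /\ ts ^ 2 <= K * sqrt (1 + q 0).
Proof.
move=> c0; pose W := 3 * exp (20 / c); pose B := freeK c; pose A := 16 / c ^ 2.
have W1 : 1 <= W.
  have := exp_mono (u := 0) (v := 20 / c) ltac:(apply: Rdiv_le_0_compat; lra); rewrite exp_0 /W; lra.
have B1 : 1 <= B.
  rewrite -exp_0 /B /freeK; apply: exp_mono; apply: Rdiv_le_0_compat => //.
  by have := pow2_ge_0 (1 + 64 / c ^ 2); lra.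
have A0 : 0 <= A by apply: Rdiv_le_0_compat; [lra|apply: pow_lt].
have WB : 1 <= W * B by nra.
have WBB : 1 <= W * B * B by nra.
pose K := 4 * (1 + A) * (W * B * B).
have AWBB : 0 <= A * (W * B * B) by apply: Rmult_le_pos; lra.
have K1 : 4 * (W * B * B) <= K by rewrite /K; lra.
have K2 : 4 * (W * B) <= K by apply: Rle_trans K1; nra.
have K3 : 4 * A <= K by rewrite /K; nra.
exists K; split; first lra.
move=> q q1 q2 ts y z P qts q0 S.
have ts0 : ts <= 0.
  apply: Rnot_lt_le => h; have := pot_growth c0 P (Rlt_le _ _ h); rewrite qts Rmult_1_r.
  have : exp (c * (0 - ts)) < exp 0 by apply: exp_increasing; nra.
  by rewrite exp_0; lra.
set J := sqrt (1 + q 0); set r0 := sqrt (q 0).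
have r01 : 1 <= r0 by rewrite -sqrt_1; apply: sqrt_le_1_alt.
have r0J : r0 <= J by apply: sqrt_le_1_alt; lra.
have J1 : 1 <= J by lra.
have Jr : J <= 2 * r0.
  have e1 : J * J = 1 + q 0 by apply: sqrt_sqrt; lra.
  have e2 : r0 * r0 = q 0 by apply: sqrt_sqrt; lra.
  by nra.
have rg t : t <= 0 -> sqrt (q t) <= exp (c / 2 * t) * r0.
  move=> ht; have e : exp (c * (t - 0)) = exp (c / 2 * t) * exp (c / 2 * t).
    by rewrite -exp_plus; congr exp; field.
  rewrite -(sqrt_square (exp (c / 2 * t))); last by apply/Rlt_le/exp_pos.
  rewrite -e -sqrt_mult; [|by apply/Rlt_le/exp_pos|lra].
  by apply: sqrt_le_1_alt; apply: (pot_growth c0 P).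
have iexp t : exp (- (c / 2 * t)) * exp (c / 2 * t) = 1 by rewrite -exp_plus Rplus_opp_l exp_0.
have ts2 : ts ^ 2 <= A * J.
  apply: (sq_decay c0) => //; first lra.
  have := rg ts ts0; rewrite qts sqrt_1 => h.
  have := iexp ts; have := exp_pos (- (c / 2 * ts)); nra.
split; last by nra.
have [Z [X [HZ HX]]] := free_limit c0 P S qts.
pose G := free_energy ts y z; pose Gi := Z ^ 2 + X ^ 2.
have G0 s : 0 <= G s by rewrite /G /free_energy; have := pow2_ge_0 (z s); have := pow2_ge_0 (y s - (s - ts) * z s); lra.
have limG : filterlim G (Rbar_locally m_infty) (locally Gi).
  apply: (@filterlim_ext _ _ _ _ _ (fun t => z t * z t + (y t - (t - ts) * z t) * (y t - (t - ts) * z t))).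
    by move=> t; rewrite /G /free_energy; ring.
  have -> : Gi = Z * Z + X * X by rewrite /Gi; ring.
  by apply: filterlim_Rplus; apply: filterlim_Rmult.
have ev : Rbar_locally m_infty (fun t => t <= ts) by exists ts => t /Rlt_le.
have Gi1 : G ts <= B * Gi.
  have hl : filterlim (fun t => B * G t) (Rbar_locally m_infty) (locally (B * Gi)) by apply: filterlim_Rscal.
  by apply: (filterlim_ge_R _ hl); apply: filter_imp ev => t /(free_bound c0 P S qts) [].
have Gi2 : Gi <= B * G ts.
  by apply: (filterlim_le_R _ limG); apply: filter_imp ev => t /(free_bound c0 P S qts) [].
have Gi0 : 0 <= Gi by rewrite /Gi; have := pow2_ge_0 Z; have := pow2_ge_0 X; lra.
have ETs : wkb q y z ts = G ts.
  by rewrite /wkb /G /free_energy qts sqrt_1 Rinv_1; ring.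
have [w1 w2] := wkb_bound c0 P S ts0 ltac:(lra).
rewrite -/W ETs in w1 w2.
have E0 : wkb q y z 0 = r0 * y 0 ^ 2 + / r0 * z 0 ^ 2 by [].
have y02 := pow2_ge_0 (y 0); have z02 := pow2_ge_0 (z 0).
have ir : / J <= / r0 by apply: Rinv_le_contravar; lra.
have iJ : / r0 <= 2 * / J.
  have -> : 2 * / J = / (J / 2) by field; lra.
  by apply: Rinv_le_contravar; lra.
have iJ0 : 0 < / J by apply: Rinv_0_lt_compat; lra.
have N1 : wkb q y z 0 <= 2 * (J * y 0 ^ 2 + / J * z 0 ^ 2).
  rewrite E0; have := Rmult_le_compat_r _ _ _ y02 r0J; have := Rmult_le_compat_r _ _ _ z02 iJ.
  by have : 0 <= J * y 0 ^ 2; [apply: Rmult_le_pos|]; lra.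
have N2 : J * y 0 ^ 2 + / J * z 0 ^ 2 <= 2 * wkb q y z 0.
  rewrite E0; have := Rmult_le_compat_r _ _ _ y02 Jr; have := Rmult_le_compat_r _ _ _ z02 ir.
  by have : 0 <= / r0 * z 0 ^ 2; [apply: Rmult_le_pos|]; lra.
have hi t : ts <= t -> wkb q y z t <= W * B * Gi.
  move=> ht; have [h1 _] := wkb_bound c0 P S ht ltac:(lra).
  rewrite -/W ETs in h1; apply: Rle_trans h1 _; rewrite Rmult_assoc.
  by apply: Rmult_le_compat_l; lra.
have lo t : t <= ts -> G t <= B * B * Gi.
  move=> ht; have [_ h1] := free_bound c0 P S qts ht; apply: Rle_trans h1 _.
  by rewrite (Rmult_assoc B B); apply: (Rmult_le_compat_l B (G ts) (B * Gi)); lra.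
have BBG : B * B * Gi <= W * B * B * Gi.
  by apply: Rmult_le_compat_r => //; nra.
have WBG : W * B * Gi <= W * B * B * Gi by apply: Rmult_le_compat_r => //; nra.
have JG : 0 <= J * Gi by apply: Rmult_le_pos; lra.
have WG0 : 0 <= W * B * B * Gi by apply: Rmult_le_pos; lra.
have WGJ : W * B * B * Gi <= W * B * B * (J * Gi) by apply: Rmult_le_compat_l; nra.
have KJ : K * J * Gi = 4 * (W * B * B * (J * Gi)) + 4 * A * (W * B * B * (J * Gi)) by rewrite /K; ring.
have AW : 0 <= A * (W * B * B * (J * Gi)) by apply: Rmult_le_pos; lra.
have EP : (X - ts * Z) + ts * Z = X by ring.
exists Z, (X - ts * Z); split; rewrite ?EP -/Gi -?/J.
- exact: HZ.
- have -> : X - ts * Z = X + (- ts) * Z by ring.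
  apply: (@filterlim_ext _ _ _ _ _ (fun t => (y t - (t - ts) * z t) + (- ts) * z t)); first by move=> t; ring.
  by apply: filterlim_Rplus => //; apply: filterlim_Rscal.
- apply: Rle_trans Gi2 _; apply: Rle_trans (_ : B * (W * (2 * (J * y 0 ^ 2 + / J * z 0 ^ 2))) <= _).
    by apply: Rmult_le_compat_l; [lra|apply: Rle_trans w2 _; apply: Rmult_le_compat_l; lra].
  have : 0 <= J * y 0 ^ 2 + / J * z 0 ^ 2 by apply: Rplus_le_le_0_compat; apply: Rmult_le_pos; lra.
  by move=> n0; have := Rmult_le_compat_r _ _ _ n0 K2; nra.
- apply: Rle_trans N2 _; apply: Rle_trans (_ : 2 * (W * B * Gi) <= _).
    by apply: Rmult_le_compat_l; [lra|apply: hi].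
  by have := Rmult_le_compat_r _ _ _ Gi0 K2; have : 0 <= W * B * Gi by [apply: Rmult_le_pos; lra]; lra.
- move=> t ht; rewrite KJ; case: (Rle_lt_dec t ts) => h.
    have := lo t h; rewrite /G /free_energy; have := pow2_ge_0 (y t - (t - ts) * z t); lra.
  have := hi t (Rlt_le _ _ h); rewrite /wkb => hw.
  have rt : sqrt (q t) <= J by apply: Rle_trans r0J; apply: sqrt_le_1_alt; apply: (pot_mono c0 P).
  have rt1 : 1 <= sqrt (q t) by rewrite -sqrt_1; apply: sqrt_le_1_alt; rewrite -qts; apply: (pot_mono c0 P); lra.
  have z2 := pow2_ge_0 (z t); have y2 := pow2_ge_0 (y t).
  have zz : z t ^ 2 = sqrt (q t) * (/ sqrt (q t) * z t ^ 2) by field; lra.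
  have k0 : 0 <= / sqrt (q t) * z t ^ 2 by apply: Rmult_le_pos => //; apply/Rlt_le/Rinv_0_lt_compat; lra.
  have k1 : / sqrt (q t) * z t ^ 2 <= W * B * B * Gi.
    by have : 0 <= sqrt (q t) * y t ^ 2; [apply: Rmult_le_pos|]; lra.
  rewrite zz; have : sqrt (q t) * (/ sqrt (q t) * z t ^ 2) <= J * (W * B * B * Gi) by apply: Rmult_le_compat; lra.
  lra.
- move=> t ht; rewrite KJ; case: (Rle_lt_dec t ts) => h.
    have := lo t h; rewrite /G /free_energy.
    have -> : y t - t * z t = (y t - (t - ts) * z t) + (- ts) * z t by ring.
    set x := y t - (t - ts) * z t; have x2 := pow2_ge_0 x; have z2 := pow2_ge_0 (z t) => hg.
    have s1 : (x + - ts * z t) ^ 2 <= 2 * x ^ 2 + 2 * (ts ^ 2 * z t ^ 2) by have := pow2_ge_0 (x - - ts * z t); nra.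
    have s2 : ts ^ 2 * z t ^ 2 <= A * J * (W * B * B * Gi).
      by apply: Rmult_le_compat => //; [apply: pow2_ge_0|lra].
    have s3 : A * J * (W * B * B * Gi) = A * (W * B * B * (J * Gi)) by ring.
    lra.
  have := hi t (Rlt_le _ _ h); rewrite /wkb => hw.
  have rt1 : 1 <= sqrt (q t) by rewrite -sqrt_1; apply: sqrt_le_1_alt; rewrite -qts; apply: (pot_mono c0 P); lra.
  have z2 := pow2_ge_0 (z t); have y2 := pow2_ge_0 (y t).
  have k0 : 0 <= / sqrt (q t) * z t ^ 2 by apply: Rmult_le_pos => //; apply/Rlt_le/Rinv_0_lt_compat; lra.
  have k1 : / sqrt (q t) * z t ^ 2 <= W * B * B * Gi.
    by have : 0 <= sqrt (q t) * y t ^ 2; [apply: Rmult_le_pos|]; lra.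
  have k2 : y t ^ 2 <= W * B * B * Gi.
    by have : y t ^ 2 <= sqrt (q t) * y t ^ 2; [nra|lra].
  have s1 : (y t - t * z t) ^ 2 <= 2 * y t ^ 2 + 2 * (t ^ 2 * z t ^ 2) by have := pow2_ge_0 (y t + t * z t); nra.
  have t2 : t ^ 2 <= A * exp (- (c / 2 * t)) by apply: (sq_decay c0) => //; [apply/Rlt_le/exp_pos|lra].
  have s2 : t ^ 2 * z t ^ 2 <= A * (W * B * B * (J * Gi)).
    have -> : t ^ 2 * z t ^ 2 = t ^ 2 * sqrt (q t) * (/ sqrt (q t) * z t ^ 2) by field; lra.
    have -> : A * (W * B * B * (J * Gi)) = A * J * (W * B * B * Gi) by ring.
    apply: Rmult_le_compat => //; first by apply: Rmult_le_pos; [apply: pow2_ge_0|lra].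
    apply: Rle_trans (_ : A * exp (- (c / 2 * t)) * (exp (c / 2 * t) * r0) <= _).
      by apply: Rmult_le_compat => //; [apply: pow2_ge_0|lra|apply: rg].
    have -> : A * exp (- (c / 2 * t)) * (exp (c / 2 * t) * r0) = A * (exp (- (c / 2 * t)) * exp (c / 2 * t)) * r0 by ring.
    by rewrite iexp Rmult_1_r; apply: Rmult_le_compat_l.
  lra.
Qed.

(** * The modes of a Kasner background *)

Definition expo D (p : 'I_D -> R) (i : 'I_D) : R := 2 - 2 * p i.

(** The k-th derivative, in the time tau = log t, of the symbol of the spatial
    operator. *)
Definition symb D (p : 'I_D -> R) (l : freq D) (k : nat) (t : R) : R :=
  \big[Rplus/0]_(i < D) (expo p i ^ k * exp (expo p i * t) * IZR (l i) ^ 2).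
Notation qf p l := (symb p l 0).

Lemma Rmin_list (I : finType) (a : I -> R) : (forall i, 0 < a i) -> exists c, 0 < c /\ forall i, c <= a i.
Proof.
move=> h; have H (s : seq I) : exists c, 0 < c /\ forall i, i \in s -> c <= a i.
  elim: s => [|j s [c [c0 hc]]]; first by exists 1; split=> //; lra.
  exists (Rmin (a j) c); split; first exact: Rmin_pos.
  move=> i; rewrite in_cons => /orP [/eqP ->|hi]; first exact: Rmin_l.
  by apply: Rle_trans (Rmin_r _ _) (hc i hi).
by have [c [c0 hc]] := H (enum I); exists c; split=> // i; apply: hc; rewrite mem_enum.
Qed.

(** The two Kasner relations force |p_i| <= 1, and p_i = 1 forces all other
    exponents to vanish; non-degeneracy excludes this. *)
Lemma kasner_expo D (p : 'I_D -> R) pphi : kasner p pphi -> nondegenerate p ->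
  exists c, 0 < c /\ forall i, c <= expo p i <= 4.
Proof.
move=> [k1 k2] nd.
have hp i : p i ^ 2 + \big[Rplus/0]_(j < D | j != i) p j ^ 2 <= 1.
  have K S : p i ^ 2 + S + 2 * pphi ^ 2 = 1 -> p i ^ 2 + S <= 1 by have := pow2_ge_0 pphi; lra.
  by apply: K; rewrite -[RHS]k2 [in RHS](bigD1 i).
have s0 i : 0 <= \big[Rplus/0]_(j < D | j != i) p j ^ 2 by apply: Rsum_ge0 => j _; apply: pow2_ge_0.
have pb i : -1 <= p i <= 1 by have := hp i; have := s0 i; split; nra.
have e0 i : 0 < expo p i.
  have [_ h] := pb i; rewrite /expo; case: (Rle_lt_or_eq_dec _ _ h) => [|e]; first lra.
  exfalso; apply: nd; exists i => j /eqP ne; have := hp i; rewrite e (bigD1 j) //.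
  have : 0 <= \big[Rplus/0]_(k < D | (k != i) && (k != j)) p k ^ 2 by apply: Rsum_ge0 => k _; apply: pow2_ge_0.
  have K S : 0 <= S -> 1 ^ 2 + (p j ^ 2 + S) <= 1 -> p j = 0.
    by move=> S0 hS; apply: (@Rsqr_eq_0 (p j)); rewrite Rsqr_pow2; have := pow2_ge_0 (p j); lra.
  exact: K.
have [c [c0 hc]] := Rmin_list e0; exists c; split=> // i; split=> //.
by rewrite /expo; have := pb i; lra.
Qed.

Lemma is_derive_Rsum (I : Type) (s : seq I) (f : I -> R -> R) (df : I -> R) t :
  (forall i, is_derive (f i) t (df i)) ->
  is_derive (fun t => \big[Rplus/0]_(i <- s) f i t) t (\big[Rplus/0]_(i <- s) df i).
Proof.
move=> h; elim: s => [|i s IH].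
  rewrite big_nil; apply: (is_derive_ext (fun _ => 0)); last exact: is_derive_const.
  by move=> r; rewrite big_nil.
rewrite big_cons; apply: (is_derive_ext (fun t => f i t + \big[Rplus/0]_(j <- s) f j t)).
  by move=> r; rewrite big_cons.
exact: is_derive_Rplus.
Qed.

Lemma symb_deriv D (p : 'I_D -> R) l k t : is_derive (symb p l k) t (symb p l k.+1 t).
Proof.
apply: is_derive_Rsum => i; auto_derive => //; rewrite /=; ring.
Qed.

Lemma symb_potential D (p : 'I_D -> R) l c : 0 < c -> (forall i, c <= expo p i <= 4) ->
  potential c (qf p l) (symb p l 1) (symb p l 2).
Proof.
move=> c0 hc.
have nn i t : 0 <= exp (expo p i * t) * IZR (l i) ^ 2.
  by apply: Rmult_le_pos; [apply/Rlt_le/exp_pos|apply: pow2_ge_0].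
split=> [t|t|t|t|t]; try exact: symb_deriv.
- by apply: Rsum_ge0 => i _; have := nn i t; rewrite /=; lra.
- rewrite /symb -!Rsum_scal; split; apply: Rsum_le => i _; have := nn i t; have := hc i;
    rewrite /=; move: (exp (expo p i * t)) (IZR (l i)) (expo p i) => E L a; rewrite ?Rmult_1_r ?Rmult_1_l => ha hE; nra.
- rewrite /symb -Rsum_scal; split; [apply: Rsum_ge0|apply: Rsum_le] => i _; have := nn i t; have := hc i;
    rewrite /=; set a := expo p i; set E := exp (a * t); set L := IZR (l i); rewrite ?Rmult_1_r ?Rmult_1_l => ha hE.
    have -> : a * a * E * (L * L) = (a * a) * (E * (L * L)) by ring.
    by apply: Rmult_le_pos => //; nra.
  have -> : a * a * E * (L * L) = (a * a) * (E * (L * L)) by ring.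
  by apply: Rmult_le_compat_r => //; nra.
Qed.

Lemma symb_0 D (p : 'I_D -> R) l : qf p l 0 = normsq l.
Proof. by apply: eq_bigr => i _; rewrite Rmult_0_r exp_0 /=; ring. Qed.

Lemma normsq_ge1 D (l : freq D) : l <> @freq0 D -> 1 <= normsq l.
Proof.
move=> ne; have [i hi] : exists i, l i <> 0%Z.
  apply: NNPP => h; apply: ne; apply: functional_extensionality => i.
  by apply: NNPP => h'; apply: h; exists i.
apply: Rle_trans (@Rsum_term D (fun j => IZR (l j) ^ 2) i (fun j => pow2_ge_0 _)) => /=.
have : (1 <= l i * l i)%Z by nia.
by move=> /IZR_le; rewrite mult_IZR; lra.
Qed.

Lemma normsq_freq0 D : normsq (@freq0 D) = 0.
Proof. by rewrite /normsq big1 // => i _; rewrite /freq0 /=; ring. Qed.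

Definition turn D (p : 'I_D -> R) (l : freq D) : R := ln (tstar p l).

(** The symbol is increasing in time, exponentially small at minus infinity and
    at least 1 at time 0 when l <> 0; the intermediate value theorem gives the
    turning time. *)
Lemma turn_spec D (p : 'I_D -> R) l c : 0 < c -> (forall i, c <= expo p i <= 4) ->
  (l = @freq0 D /\ turn p l = 0) \/ (l <> @freq0 D /\ qf p l (turn p l) = 1).
Proof.
move=> c0 hc; have P := symb_potential l c0 hc.
have [] : 0 < tstar p l /\ (l = (fun _ => Z0) /\ tstar p l = 1 \/
   l <> (fun _ => Z0) /\ \big[Rplus/0]_(i < D) (Rpower (tstar p l) (2 - 2 * p i) * (IZR (l i)) ^ 2) = 1).
  apply: (epsilon_spec (inhabits 1) (fun t => 0 < t /\ (l = (fun _ => Z0) /\ t = 1 \/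
   l <> (fun _ => Z0) /\ \big[Rplus/0]_(i < D) (Rpower t (2 - 2 * p i) * (IZR (l i)) ^ 2) = 1))).
  case: (classic (l = @freq0 D)) => [->|ne]; first by exists 1; split; [lra|left].
  have q0 : 1 <= qf p l 0 by rewrite symb_0; apply: normsq_ge1.
  (* By the growth of the symbol, a time at which it is at most 1. *)
  pose b := - ln (qf p l 0 + 1) / c.
  have qb : qf p l b <= 1.
    have lpos : 0 < ln (qf p l 0 + 1) by have := ln_increasing 1 (qf p l 0 + 1) ltac:(lra) ltac:(lra); rewrite ln_1.
    have b0 : b <= 0.
      by rewrite /b /Rdiv; have : 0 < / c; [apply: Rinv_0_lt_compat|]; nra.
    apply: Rle_trans (pot_growth c0 P b0) _.
    have -> : c * (b - 0) = - ln (qf p l 0 + 1) by rewrite /b; field; lra.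
    rewrite exp_Ropp exp_ln; last lra.
    apply: (Rmult_le_reg_l (qf p l 0 + 1)); first lra.
    by rewrite -Rmult_assoc Rinv_r; lra.
  have cq : continuity (qf p l).
    by move=> t; apply: (proj2 (continuity_pt_filterlim _ _)); apply: (pot_cont P).
  have [|t [_ ht]] := IVT_gen (qf p l) b 0 1 cq.
    by split; [apply: Rle_trans (Rmin_l _ _) qb|apply: Rle_trans q0 (Rmax_r _ _)].
  exists (exp t); split; first exact: exp_pos.
  right; split=> //; rewrite -[RHS]ht /symb; apply: eq_bigr => i _.
  by rewrite /Rpower ln_exp /expo /=; ring.
move=> tp [[-> e]|[ne e]]; [left|right]; split=> //; first by rewrite /turn e ln_1.
by rewrite -[RHS]e /symb; apply: eq_bigr => i _; rewrite /turn /Rpower /expo /=; ring.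
Qed.

Definition jap D (l : freq D) : R := sqrt (wt l).

Lemma jap_ge1 D (l : freq D) : 1 <= jap l.
Proof. by rewrite /jap -sqrt_1; apply: sqrt_le_1_alt; apply: wt_ge1. Qed.

Lemma jap_sq D (l : freq D) : jap l * jap l = wt l.
Proof. by apply: sqrt_sqrt; apply/Rlt_le/wt_gt0. Qed.

Lemma symb_freq0 D (p : 'I_D -> R) k t : symb p (@freq0 D) k t = 0.
Proof. by apply: big1 => i _; rewrite /freq0 /=; ring. Qed.

(** For l = 0 the potential vanishes and the solution is exactly free, with
    turning time 0; all other frequencies fall under [mode_asymptotics]. *)
Lemma modes_asymptotics D (p : 'I_D -> R) c : 0 < c -> (forall i, c <= expo p i <= 4) ->
  exists K, 1 <= K /\ forall l, turn p l ^ 2 <= K * jap l /\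
    forall y z, ode_sol (qf p l) y z ->
      exists Z Phi, mode_estimates K (jap l) (turn p l) y z Z Phi.
Proof.
move=> c0 hc; have [K [K1 HK]] := mode_asymptotics c0.
exists K; split=> // l; have P := symb_potential l c0 hc; have J1 := jap_ge1 l.
case: (turn_spec l c0 hc) => [[e et]|[ne et]]; last first.
  have q0 : 1 <= qf p l 0 by rewrite symb_0; apply: normsq_ge1.
  have eJ : sqrt (1 + qf p l 0) = jap l by rewrite symb_0.
  have [y0 [z0 [S0 _ _]]] := pot_ode_exists 0 0 c0 P.
  rewrite -eJ; split; first by case: (HK _ _ _ _ _ _ P et q0 S0).
  by move=> y z S; case: (HK _ _ _ _ _ _ P et q0 S).
rewrite et; split; first by have : 0 <= K * jap l; [apply: Rmult_le_pos|]; lra.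
move=> y z S; exists (z 0), (y 0).
have J0 : jap l = 1 by rewrite /jap /wt e normsq_freq0 Rplus_0_r sqrt_1.
have S1 : ode_sol (qf p l) (fun t => y 0 + z 0 * t) (fun _ => z 0).
  move=> t; split; first by auto_derive => //; ring.
  by rewrite e symb_freq0 Ropp_0 Rmult_0_l; apply: is_derive_const.
have e0 : y 0 = y 0 + z 0 * 0 by ring.
have E t := pot_uniq c0 P S S1 e0 erefl t.
have y2 := pow2_ge_0 (y 0); have z2 := pow2_ge_0 (z 0).
have n0 : 0 <= (K - 1) * (y 0 ^ 2 + z 0 ^ 2) by apply: Rmult_le_pos; lra.
rewrite J0; split.
- by apply: (@filterlim_ext _ _ _ _ _ (fun _ => z 0)); [move=> t; case: (E t)|apply: filterlim_const].
- apply: (@filterlim_ext _ _ _ _ _ (fun _ => y 0)); last exact: filterlim_const.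
  by move=> t; case: (E t) => -> ->; ring.
- by rewrite Rinv_1; lra.
- by rewrite Rinv_1; lra.
- by move=> t _; case: (E t) => _ ->; lra.
- move=> t _; case: (E t) => -> ->; have -> : y 0 + z 0 * t - t * z 0 = y 0 by ring.
  lra.
Qed.

(** * Complex modes and their scattering matrix *)

Definition growth D (p : 'I_D -> R) (c : R) : Prop := 0 < c /\ forall i, c <= expo p i <= 4.

(** The real solution with data (a, b) at tau = 0. The complex modes are
    combinations of the two solutions with data (1, 0) and (0, 1), and the
    scattering matrix has the limits of these two as its columns. *)
Definition basis D (p : 'I_D -> R) (l : freq D) (a b : R) : (R -> R) * (R -> R) :=
  epsilon (inhabits (fun _ => 0, fun _ => 0))
    (fun s => [/\ ode_sol (qf p l) s.1 s.2, s.1 0 = a & s.2 0 = b]).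
Definition basis_Z D (p : 'I_D -> R) (l : freq D) (a b : R) : R :=
  epsilon (inhabits 0) (fun Z => filterlim (basis p l a b).2 (Rbar_locally m_infty) (locally Z)).
Definition basis_P D (p : 'I_D -> R) (l : freq D) (a b : R) : R :=
  epsilon (inhabits 0) (fun P => filterlim (fun t => (basis p l a b).1 t - t * (basis p l a b).2 t)
    (Rbar_locally m_infty) (locally P)).

Notation u0 p l := (basis p l 1 0).1.
Notation v0 p l := (basis p l 1 0).2.
Notation u1 p l := (basis p l 0 1).1.
Notation v1 p l := (basis p l 0 1).2.
Notation Z0 p l := (basis_Z p l 1 0).
Notation Z1 p l := (basis_Z p l 0 1).
Notation P0 p l := (basis_P p l 1 0).
Notation P1 p l := (basis_P p l 0 1).

Definition mphi D (p : 'I_D -> R) (l : freq D) (a b : C) (t : R) : C := (a * RtoC (u0 p l t) + b * RtoC (u1 p l t))%C.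
Definition mpsi D (p : 'I_D -> R) (l : freq D) (a b : C) (t : R) : C := (a * RtoC (v0 p l t) + b * RtoC (v1 p l t))%C.
Definition outZ D (p : 'I_D -> R) (l : freq D) (a b : C) : C := (a * RtoC (Z0 p l) + b * RtoC (Z1 p l))%C.
Definition outP D (p : 'I_D -> R) (l : freq D) (a b : C) : C := (a * RtoC (P0 p l) + b * RtoC (P1 p l))%C.
Definition inA D (p : 'I_D -> R) (l : freq D) (Z P : C) : C := (RtoC (Z1 p l) * P - RtoC (P1 p l) * Z)%C.
Definition inB D (p : 'I_D -> R) (l : freq D) (Z P : C) : C := (RtoC (P0 p l) * Z - RtoC (Z0 p l) * P)%C.

Definition csol D (p : 'I_D -> R) (l : freq D) (phi psi : R -> C) : Prop :=
  ode_sol (qf p l) (fun t => Re (phi t)) (fun t => Re (psi t)) /\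
  ode_sol (qf p l) (fun t => Im (phi t)) (fun t => Im (psi t)).

Lemma basis_spec D (p : 'I_D -> R) c (l : freq D) a b : growth p c ->
  [/\ ode_sol (qf p l) (basis p l a b).1 (basis p l a b).2, (basis p l a b).1 0 = a & (basis p l a b).2 0 = b].
Proof.
move=> [c0 hc]; apply: (epsilon_spec (inhabits (fun _ => 0, fun _ => 0))
  (fun s : (R -> R) * (R -> R) => [/\ ode_sol (qf p l) s.1 s.2, s.1 0 = a & s.2 0 = b])).
by have [y [z [h1 h2 h3]]] := pot_ode_exists a b c0 (symb_potential l c0 hc); exists (y, z).
Qed.

Lemma basis_lim D (p : 'I_D -> R) c (l : freq D) a b : growth p c ->
  filterlim (basis p l a b).2 (Rbar_locally m_infty) (locally (basis_Z p l a b)) /\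
  filterlim (fun t => (basis p l a b).1 t - t * (basis p l a b).2 t)
    (Rbar_locally m_infty) (locally (basis_P p l a b)).
Proof.
move=> gr; have [c0 hc] := gr; have [S _ _] := basis_spec l a b gr.
have [K [_ /(_ l) [_ HK]]] := modes_asymptotics c0 hc.
have [Z [P est]] := HK _ _ S.
split.
  apply: (epsilon_spec (inhabits 0) (fun Z => filterlim (basis p l a b).2 (Rbar_locally m_infty) (locally Z))).
  by exists Z; exact: me_limZ est.
apply: (epsilon_spec (inhabits 0) (fun P => filterlim (fun t => (basis p l a b).1 t - t * (basis p l a b).2 t)
    (Rbar_locally m_infty) (locally P))).
by exists P; exact: me_limP est.
Qed.

Lemma ode_lin q (y z y' z' : R -> R) a b : ode_sol q y z -> ode_sol q y' z' ->
  ode_sol q (fun t => a * y t + b * y' t) (fun t => a * z t + b * z' t).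
Proof.
move=> S S' t; have [dy dz] := S t; have [dy' dz'] := S' t; split.
  by apply: is_derive_Rplus; apply: is_derive_scal.
apply: is_derive_eq; first by apply: is_derive_Rplus; apply: is_derive_scal; [exact: dz|exact: dz'].
ring.
Qed.

Lemma Re_lin (a b : C) (x y : R) : Re (a * RtoC x + b * RtoC y)%C = Re a * x + Re b * y.
Proof. by rewrite /Re /=; ring. Qed.
Lemma Im_lin (a b : C) (x y : R) : Im (a * RtoC x + b * RtoC y)%C = Im a * x + Im b * y.
Proof. by rewrite /Im /=; ring. Qed.

Lemma ode_ext q y z y' z' : (forall t, y t = y' t) -> (forall t, z t = z' t) ->
  ode_sol q y z -> ode_sol q y' z'.
Proof. by move=> /functional_extensionality -> /functional_extensionality ->. Qed.

Lemma mode_csol D (p : 'I_D -> R) c (l : freq D) a b : growth p c -> csol p l (mphi p l a b) (mpsi p l a b).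
Proof.
move=> gr; have [S0 _ _] := basis_spec l 1 0 gr; have [S1 _ _] := basis_spec l 0 1 gr.
split.
- by apply: ode_ext (ode_lin (Re a) (Re b) S0 S1) => t; rewrite Re_lin.
- by apply: ode_ext (ode_lin (Im a) (Im b) S0 S1) => t; rewrite Im_lin.
Qed.

Lemma mode_init D (p : 'I_D -> R) c (l : freq D) a b : growth p c -> mphi p l a b 0 = a /\ mpsi p l a b 0 = b.
Proof.
move=> gr; have [_ e1 e2] := basis_spec l 1 0 gr; have [_ e3 e4] := basis_spec l 0 1 gr.
by rewrite /mphi /mpsi e1 e2 e3 e4; split; ring.
Qed.

Lemma csol_uniq D (p : 'I_D -> R) c (l : freq D) phi psi : growth p c -> csol p l phi psi ->
  forall t, phi t = mphi p l (phi 0) (psi 0) t /\ psi t = mpsi p l (phi 0) (psi 0) t.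
Proof.
move=> gr [SR SI] t; have [c0 hc] := gr; have P := symb_potential l c0 hc.
have [MR MI] := mode_csol l (phi 0) (psi 0) gr; have [e1 e2] := mode_init l (phi 0) (psi 0) gr.
have [r1 r2] := pot_uniq c0 P SR MR (f_equal Re (esym e1)) (f_equal Re (esym e2)) t.
have [i1 i2] := pot_uniq c0 P SI MI (f_equal Im (esym e1)) (f_equal Im (esym e2)) t.
split.
  by rewrite [LHS]surjective_pairing [RHS]surjective_pairing; congr pair; [exact: r1|exact: i1].
by rewrite [LHS]surjective_pairing [RHS]surjective_pairing; congr pair; [exact: r2|exact: i2].
Qed.

Lemma filterlim_lin (a b : C) (f g : R -> R) (x y : R) (F : (R -> Prop) -> Prop) (FF : Filter F) :
  filterlim f F (locally x) -> filterlim g F (locally y) ->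
  filterlim (fun t => a * RtoC (f t) + b * RtoC (g t))%C F (locally (a * RtoC x + b * RtoC y)%C).
Proof.
move=> hf hg; apply: filterlim_C.
  rewrite Re_lin; apply: (@filterlim_ext _ _ _ _ _ (fun t => Re a * f t + Re b * g t)); first by move=> t; rewrite Re_lin.
  by apply: filterlim_Rplus; apply: filterlim_Rscal.
rewrite Im_lin; apply: (@filterlim_ext _ _ _ _ _ (fun t => Im a * f t + Im b * g t)); first by move=> t; rewrite Im_lin.
by apply: filterlim_Rplus; apply: filterlim_Rscal.
Qed.

Lemma mode_lim D (p : 'I_D -> R) c (l : freq D) a b : growth p c ->
  filterlim (mpsi p l a b) (Rbar_locally m_infty) (locally (outZ p l a b)) /\
  filterlim (fun t => mphi p l a b t - RtoC t * mpsi p l a b t)%C (Rbar_locally m_infty) (locally (outP p l a b)).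
Proof.
move=> gr; have [z0 p0] := basis_lim l 1 0 gr; have [z1 p1] := basis_lim l 0 1 gr.
split; first exact: filterlim_lin.
apply: (@filterlim_ext _ _ _ _ _ (fun t => a * RtoC (u0 p l t - t * v0 p l t) + b * RtoC (u1 p l t - t * v1 p l t))%C).
  by move=> t; rewrite /mphi /mpsi !RtoC_minus !RtoC_mult; ring.
exact: filterlim_lin.
Qed.

(** The Wronskian of the two basic solutions is constant and equals 1 at time 0.
    It can be written with y - t z in place of y, so it passes to the limit: the
    scattering matrix has determinant 1, with inverse [inA], [inB]. *)
Lemma wronskian D (p : 'I_D -> R) c (l : freq D) : growth p c -> P0 p l * Z1 p l - Z0 p l * P1 p l = 1.
Proof.
move=> gr; have [S0 a0 b0] := basis_spec l 1 0 gr; have [S1 a1 b1] := basis_spec l 0 1 gr.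
pose w t := u0 p l t * v1 p l t + (-1) * (v0 p l t * u1 p l t).
have dw t : is_derive w t 0.
  have [dy dz] := S0 t; have [dy' dz'] := S1 t.
  apply: is_derive_eq.
    apply: is_derive_Rplus; [apply: is_derive_Rmult; [exact: dy|exact: dz']|].
    by apply: is_derive_scal; apply: is_derive_Rmult; [exact: dz|exact: dy'].
  by rewrite /=; ring.
have w1 t : w t = 1.
  have w00 : w 0 = 1 by rewrite /w a0 b0 a1 b1; ring.
  have dw' s : is_derive (fun t => - w t) s 0 by apply: is_derive_eq; [apply: is_derive_opp; exact: dw|rewrite /opp /=; ring].
  case: (Rle_lt_dec 0 t) => ht.
    have := mono_deriv ht (fun s _ => dw s) (fun s _ => Rle_refl 0).
    have := mono_deriv ht (fun s _ => dw' s) (fun s _ => Rle_refl 0); lra.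
  have := mono_deriv (Rlt_le _ _ ht) (fun s _ => dw s) (fun s _ => Rle_refl 0).
  have := mono_deriv (Rlt_le _ _ ht) (fun s _ => dw' s) (fun s _ => Rle_refl 0); lra.
have [z0 p0] := basis_lim l 1 0 gr; have [z1 p1] := basis_lim l 0 1 gr.
have -> : P0 p l * Z1 p l - Z0 p l * P1 p l = P0 p l * Z1 p l + (-1) * (Z0 p l * P1 p l) by ring.
apply: (@filterlim_unique_R R (Rbar_locally m_infty) _ w).
  apply: (@filterlim_ext _ _ _ _ _ (fun t => (u0 p l t - t * v0 p l t) * v1 p l t + (-1) * (v0 p l t * (u1 p l t - t * v1 p l t)))).
    by move=> t; rewrite /w; ring.
  by apply: filterlim_Rplus; [|apply: filterlim_Rscal]; apply: filterlim_Rmult.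
by apply: (@filterlim_ext _ _ _ _ _ (fun _ => 1)); [move=> t; rewrite w1|apply: filterlim_const].
Qed.

Lemma out_in D (p : 'I_D -> R) c (l : freq D) Z P : growth p c -> outZ p l (inA p l Z P) (inB p l Z P) = Z /\ outP p l (inA p l Z P) (inB p l Z P) = P.
Proof.
move=> gr; have := f_equal RtoC (wronskian l gr).
rewrite /outZ /outP /inA /inB RtoC_minus !RtoC_mult.
move: (RtoC (P0 p l)) (RtoC (P1 p l)) (RtoC (Z0 p l)) (RtoC (Z1 p l)) => p0 p1 z0 z1 e; split.
  by have -> : ((z1 * P - p1 * Z) * z0 + (p0 * Z - z0 * P) * z1)%C = ((p0 * z1 - z0 * p1) * Z)%C by [ring]; rewrite e; ring.
by have -> : ((z1 * P - p1 * Z) * p0 + (p0 * Z - z0 * P) * p1)%C = ((p0 * z1 - z0 * p1) * P)%C by [ring]; rewrite e; ring.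
Qed.

Lemma in_out D (p : 'I_D -> R) c (l : freq D) a b : growth p c -> inA p l (outZ p l a b) (outP p l a b) = a /\ inB p l (outZ p l a b) (outP p l a b) = b.
Proof.
move=> gr; have := f_equal RtoC (wronskian l gr).
rewrite /outZ /outP /inA /inB RtoC_minus !RtoC_mult.
move: (RtoC (P0 p l)) (RtoC (P1 p l)) (RtoC (Z0 p l)) (RtoC (Z1 p l)) => p0 p1 z0 z1 e; split.
  by have -> : (z1 * (a * p0 + b * p1) - p1 * (a * z0 + b * z1))%C = ((p0 * z1 - z0 * p1) * a)%C by [ring]; rewrite e; ring.
by have -> : (p0 * (a * z0 + b * z1) - z0 * (a * p0 + b * p1))%C = ((p0 * z1 - z0 * p1) * b)%C by [ring]; rewrite e; ring.
Qed.

Definition cauchy_size D (l : freq D) (a b : C) : R := jap l * Cmod a ^ 2 + / jap l * Cmod b ^ 2.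
Definition out_size D (p : 'I_D -> R) (l : freq D) (Z P : C) : R := Cmod Z ^ 2 + Cmod (P + RtoC (turn p l) * Z)%C ^ 2.

Record mode_bounds D (p : 'I_D -> R) (K : R) (l : freq D) (a b : C) : Prop := ModeBounds {
  mb_down : out_size p l (outZ p l a b) (outP p l a b) <= K * cauchy_size l a b;
  mb_up : cauchy_size l a b <= K * out_size p l (outZ p l a b) (outP p l a b);
  mb_psi : forall t, t <= 0 -> Cmod (mpsi p l a b t) ^ 2 <= K * jap l * out_size p l (outZ p l a b) (outP p l a b);
  mb_phi : forall t, t <= 0 -> Cmod (mphi p l a b t - RtoC t * mpsi p l a b t)%C ^ 2 <=
                               K * jap l * out_size p l (outZ p l a b) (outP p l a b) }.

(** The quantities involved are sums of squares of real and imaginary parts, so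
    the real estimates add up. *)
Lemma modes_bounds D (p : 'I_D -> R) c : growth p c -> exists K, 1 <= K /\ forall l,
  turn p l ^ 2 <= K * jap l /\ forall a b, mode_bounds p K l a b.
Proof.
move=> gr; have [c0 hc] := gr; have [K [K1 HK]] := modes_asymptotics c0 hc.
exists K; split=> // l; have [h1 h2] := HK l; split=> // a b.
have [SR SI] := mode_csol l a b gr; have [e1 e2] := mode_init l a b gr.
have [lz lp] := mode_lim l a b gr.
have [lzR lzI] := filterlim_ReIm _ lz; have [lpR lpI] := filterlim_ReIm _ lp.
have [Z [P ER]] := h2 _ _ SR; have [Z' [P' EI]] := h2 _ _ SI.
have re t : Re (mphi p l a b t - RtoC t * mpsi p l a b t)%C = Re (mphi p l a b t) - t * Re (mpsi p l a b t) by rewrite /Re /=; ring.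
have im t : Im (mphi p l a b t - RtoC t * mpsi p l a b t)%C = Im (mphi p l a b t) - t * Im (mpsi p l a b t) by rewrite /Im /=; ring.
have eZ : Z = Re (outZ p l a b) := @filterlim_unique_R R (Rbar_locally m_infty) _ _ _ _ (me_limZ ER) lzR.
have eZ' : Z' = Im (outZ p l a b) := @filterlim_unique_R R (Rbar_locally m_infty) _ _ _ _ (me_limZ EI) lzI.
have eP : P = Re (outP p l a b).
  apply: filterlim_unique_R (me_limP ER) _; apply: filterlim_ext lpR; exact: re.
have eP' : P' = Im (outP p l a b).
  apply: filterlim_unique_R (me_limP EI) _; apply: filterlim_ext lpI; exact: im.
have eG : out_size p l (outZ p l a b) (outP p l a b) =
  (Z ^ 2 + (P + turn p l * Z) ^ 2) + (Z' ^ 2 + (P' + turn p l * Z') ^ 2).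
  rewrite /out_size !Cmod2 eZ eZ' eP eP'.
  have -> : Re (outP p l a b + RtoC (turn p l) * outZ p l a b)%C = Re (outP p l a b) + turn p l * Re (outZ p l a b) by rewrite /Re /=; ring.
  have -> : Im (outP p l a b + RtoC (turn p l) * outZ p l a b)%C = Im (outP p l a b) + turn p l * Im (outZ p l a b) by rewrite /Im /=; ring.
  ring.
have eN : cauchy_size l a b = (jap l * Re a ^ 2 + / jap l * Re b ^ 2) + (jap l * Im a ^ 2 + / jap l * Im b ^ 2).
  by rewrite /cauchy_size !Cmod2; ring.
have dR := me_down ER; have uR := me_up ER; have dI := me_down EI; have uI := me_up EI.
rewrite e1 e2 in dR uR dI uI.
split.
- rewrite eG eN; lra.
- rewrite eG eN; lra.
- by move=> t ht; rewrite eG Cmod2; have := me_z ER ht; have := me_z EI ht; lra.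
- by move=> t ht; rewrite eG Cmod2 re im; have := me_y ER ht; have := me_y EI ht; lra.
Qed.

(** Passing between the time 0 and the time t costs an exponential factor that
    is the same for all frequencies. *)
Lemma symb_le D (p : 'I_D -> R) c (l : freq D) t : growth p c -> qf p l t <= exp (4 * Rabs t) * normsq l /\
  wt l <= exp (4 * Rabs t) * (1 + qf p l t).
Proof.
move=> [c0 hc]; have P := symb_potential l c0 hc; rewrite /wt -(symb_0 p l).
have e1 : 1 <= exp (4 * Rabs t) by rewrite -exp_0; apply: exp_mono; have := Rabs_pos t; lra.
case: (Rle_lt_dec 0 t) => ht.
  have := pot_growth_lower P ht; have := pot_mono c0 P ht; rewrite Rminus_0_r Rabs_pos_eq //.
  by rewrite Rabs_pos_eq // in e1; move=> h1 h2; split; [lra|nra].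
have := pot_growth_lower P (Rlt_le _ _ ht); have := pot_mono c0 P (Rlt_le _ _ ht).
rewrite Rabs_left // in e1 *; have -> : 4 * (0 - t) = 4 * - t by ring.
by move=> h1 h2; split; [nra|lra].
Qed.

Lemma mode_energy D (p : 'I_D -> R) c (l : freq D) a b t : growth p c ->
  wt l * Cmod (mphi p l a b t) ^ 2 + Cmod (mpsi p l a b t) ^ 2 <=
  exp (9 * Rabs t) * (wt l * Cmod a ^ 2 + Cmod b ^ 2).
Proof.
move=> gr; have [c0 hc] := gr; have P := symb_potential l c0 hc.
have [SR SI] := mode_csol l a b gr; have [e1 e2] := mode_init l a b gr.
have hR := energy_bound t c0 P SR; have hI := energy_bound t c0 P SI.
have [_ hw] := symb_le l t gr.
rewrite /energy e1 e2 symb_0 -/(wt l) in hR hI.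
have -> : exp (9 * Rabs t) = exp (4 * Rabs t) * exp (5 * Rabs t) by rewrite -exp_plus; congr exp; ring.
have x1 : 1 <= exp (4 * Rabs t) by rewrite -exp_0; apply: exp_mono; have := Rabs_pos t; lra.
apply: Rle_trans (_ : exp (4 * Rabs t) * ((1 + qf p l t) * Cmod (mphi p l a b t) ^ 2 + Cmod (mpsi p l a b t) ^ 2) <= _).
  have := Rmult_le_compat_r _ _ _ (pow2_ge_0 (Cmod (mphi p l a b t))) hw.
  have := pow2_ge_0 (Cmod (mpsi p l a b t)); nra.
rewrite Rmult_assoc; apply: Rmult_le_compat_l; first lra.
by rewrite !Cmod2; lra.
Qed.

(** * Sobolev norms *)

Definition hw D (s : R) (c : freq D -> C) (l : freq D) : R := Rpower (wt l) s * Cmod (c l) ^ 2.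

Lemma hw_ge0 D s (c : freq D -> C) l : 0 <= hw s c l.
Proof. by apply: Rmult_le_pos; [apply/Rlt_le/Rpower_gt0|apply: pow2_ge_0]. Qed.

Lemma HsE D s (c : freq D -> C) : Hs s c <-> summable (hw s c).
Proof. exact: (proj1 (nnsum_summable (hw_ge0 s c))). Qed.

Lemma Hs_normsqE D s (c : freq D -> C) : Hs s c -> Hs_normsq s c = rsum (hw s c).
Proof. by move=> /HsE h; rewrite /Hs_normsq /Hs_sum (proj2 (nnsum_summable (hw_ge0 s c)) h). Qed.

Lemma Hs_dom D s (c : freq D -> C) M : (forall l, hw s c l <= M l) -> summable M ->
  Hs s c /\ Hs_normsq s c <= rsum M.
Proof.
move=> h sM; have sc : summable (hw s c).
  by apply: (summable_le _ sM) => l; rewrite Rabs_pos_eq //; apply: hw_ge0.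
have hs := proj2 (HsE s c) sc; split=> //.
by rewrite Hs_normsqE //; apply: rsum_le.
Qed.

Lemma fourier_sub D (u v : distribution D) l : fourier (dist_sub u v) l = (fourier u l - fourier v l)%C.
Proof. by rewrite /fourier /dist_sub /=; field; exact: volC_ne0. Qed.

Lemma fourier_scal D k (u : distribution D) l : fourier (dist_scal k u) l = (k * fourier u l)%C.
Proof. by rewrite /fourier /=; field; exact: volC_ne0. Qed.

Lemma fourier_add D (u v : distribution D) l : fourier (dist_add u v) l = (fourier u l + fourier v l)%C.
Proof. by rewrite /fourier /=; field; exact: volC_ne0. Qed.

Lemma Cmod2_plus (a b : C) : Cmod (a + b)%C ^ 2 <= 2 * (Cmod a ^ 2 + Cmod b ^ 2).
Proof.
have := Cmod_triangle a b; have := Cmod_ge_0 (a + b)%C; move: (Cmod _) (Cmod a) (Cmod b) => x y z.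
by have := pow2_ge_0 (y - z); nra.
Qed.

Lemma Cmod2_minus (a b : C) : Cmod (a - b)%C ^ 2 <= 2 * (Cmod a ^ 2 + Cmod b ^ 2).
Proof. by have := Cmod2_plus a (- b)%C; rewrite Cmod_opp. Qed.

Lemma Hs_sub D s (u v : distribution D) : Hs s (fourier u) -> Hs s (fourier v) -> Hs s (fourier (dist_sub u v)).
Proof.
move=> /HsE su /HsE sv; apply: (proj1 (@Hs_dom D s _ (fun l => 2 * (hw s (fourier u) l + hw s (fourier v) l)) _ _)).
  move=> l; rewrite /hw fourier_sub; have := Cmod2_minus (fourier u l) (fourier v l).
  by have := Rpower_gt0 (wt l) s; nra.
by apply: summable_scal; apply: summable_plus.
Qed.

Lemma filterlim_Cmod0 (T : Type) (F : (T -> Prop) -> Prop) (FF : Filter F) (f : T -> C) (z : C) :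
  filterlim f F (locally z) <-> filterlim (fun t => Cmod (f t - z)%C) F (locally 0).
Proof.
split=> [/filterlim_ReIm [h1 h2]|/filterlim_R H].
  apply/filterlim_R => eps e0.
  have g1 := proj1 (filterlim_R _ _ _) h1 (eps / 2) ltac:(lra).
  have g2 := proj1 (filterlim_R _ _ _) h2 (eps / 2) ltac:(lra).
  apply: (filter_imp _ _ _ (filter_and _ _ g1 g2)) => t [k1 k2].
  rewrite Rminus_0_r Rabs_pos_eq; last exact: Cmod_ge_0.
  apply: Rle_lt_trans (Cmod_le_ReIm _) _.
  have -> : Re (f t - z)%C = Re (f t) - Re z by [].
  have -> : Im (f t - z)%C = Im (f t) - Im z by [].
  lra.
by apply: filterlim_C; apply/filterlim_R => eps e0; apply: filter_imp (H eps e0) => t;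
  rewrite Rminus_0_r Rabs_pos_eq; try exact: Cmod_ge_0; apply: Rle_lt_trans;
  [exact: (Re_le_Cmod (f t - z)%C)|exact: (Im_le_Cmod (f t - z)%C)].
Qed.

(** Dominated convergence in the sum that defines the norm: convergence of each
    coefficient suffices when the weighted squares have a summable bound. *)
Lemma Hs_cvg_of_coefs D s (F : (R -> Prop) -> Prop) (FF : Filter F) (u : R -> distribution D) v M :
  summable M -> F (fun t => forall l, Rpower (wt l) s * Cmod (fourier (u t) l - fourier v l)%C ^ 2 <= M l) ->
  (forall l, filterlim (fun t => fourier (u t) l) F (locally (fourier v l))) ->
  Hs_cvg s F u v.
Proof.
move=> sM hM hl; rewrite /Hs_cvg.
have E t l : hw s (fourier (dist_sub (u t) v)) l = Rpower (wt l) s * Cmod (fourier (u t) l - fourier v l)%C ^ 2.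
  by rewrite /hw fourier_sub.
have [r0 _] := @rsum_single D (@freq0 D) (fun _ => 0) ltac:(by []).
have lim : filterlim (fun t => rsum (hw s (fourier (dist_sub (u t) v)))) F (locally 0).
  rewrite -[X in locally X]r0; apply: (@Tannery_freq D R F FF _ _ (fun l => Rabs (M l))).
  - exact: summable_abs.
  - by move=> l; rewrite Rabs_R0; apply: Rabs_pos.
  - apply: filter_imp hM => t h l; rewrite Rabs_pos_eq; last exact: hw_ge0.
    by rewrite E; apply: Rle_trans (h l) (Rle_abs _).
  - move=> l; have /filterlim_Cmod0 h0 := hl l.
    apply: (@filterlim_ext _ _ _ _ _ (fun t => Rpower (wt l) s * (Cmod (fourier (u t) l - fourier v l)%C * Cmod (fourier (u t) l - fourier v l)%C))).
      by move=> t; rewrite E; ring.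
    have -> : 0 = Rpower (wt l) s * (0 * 0) by ring.
    by apply: filterlim_Rscal; apply: filterlim_Rmult.
apply/filterlim_R => eps e0.
have g := proj1 (filterlim_R _ _ _) lim (eps ^ 2) ltac:(apply: pow_lt; lra).
apply: (filter_imp _ _ _ (filter_and _ _ hM g)) => t [hb].
have hs : Hs s (fourier (dist_sub (u t) v)).
  by apply: (proj1 (@Hs_dom D s _ M _ sM)) => l; rewrite E; apply: hb.
rewrite Rminus_0_r => /Rabs_def2 [h1 _].
rewrite Rminus_0_r Rabs_pos_eq; last exact: sqrt_pos.
rewrite /Hs_norm Hs_normsqE // -(sqrt_pow2 eps); last lra.
apply: sqrt_lt_1_alt; split=> //.
by apply: rsum_ge0; [apply/HsE|apply: hw_ge0].
Qed.

Lemma hw_le_norm D s (c : freq D -> C) l : Hs s c -> hw s c l <= Hs_norm s c ^ 2.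
Proof.
move=> h; have sc := proj1 (HsE s c) h.
have n0 : 0 <= rsum (hw s c) by apply: rsum_ge0; [|apply: hw_ge0].
rewrite /Hs_norm Hs_normsqE // pow2_sqrt //.
have := list_sum_le_rsum (s := [:: l]) sc (hw_ge0 s c); rewrite big_cons big_nil Rplus_0_r; apply.
by constructor=> //; constructor.
Qed.

(** Each weighted coefficient is bounded by the norm, so limits in H^s can be
    read off coefficient by coefficient. *)
Lemma Hs_cvg_coefs D s (F : (R -> Prop) -> Prop) (FF : Filter F) (u : R -> distribution D) v :
  F (fun t => Hs s (fourier (u t))) -> Hs s (fourier v) -> Hs_cvg s F u v ->
  forall l, filterlim (fun t => fourier (u t) l) F (locally (fourier v l)).
Proof.
move=> hu hv /filterlim_R H l; apply/filterlim_Cmod0/filterlim_R => eps e0.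
have w0 := Rpower_gt0 (wt l) s.
have d0 : 0 < eps * sqrt (Rpower (wt l) s) by apply: Rmult_lt_0_compat => //; apply: sqrt_lt_R0.
apply: (filter_imp _ _ _ (filter_and _ _ hu (H _ d0))) => t [ht].
have hs := Hs_sub ht hv.
rewrite !Rminus_0_r (Rabs_pos_eq (Hs_norm _ _)); last exact: sqrt_pos.
rewrite Rabs_pos_eq; last exact: Cmod_ge_0.
have := hw_le_norm l hs; rewrite /hw fourier_sub.
set x := Cmod _; set n := Hs_norm _ _ => h1 h2.
have x0 : 0 <= x by apply: Cmod_ge_0.
have n0 : 0 <= n by apply: sqrt_pos.
apply: Rnot_le_lt => le.
have : n ^ 2 < Rpower (wt l) s * eps ^ 2.
  have -> : Rpower (wt l) s * eps ^ 2 = (eps * sqrt (Rpower (wt l) s)) ^ 2.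
    by rewrite Rpow_mult_distr pow2_sqrt; [ring|lra].
  by nra.
have : Rpower (wt l) s * eps ^ 2 <= Rpower (wt l) s * x ^ 2 by apply: Rmult_le_compat_l; [lra|apply: pow_incr; lra].
lra.
Qed.

(** A single term of the convergent sum is bounded by the sum, so the
    coefficients grow at most polynomially. *)
Lemma Hs_poly D s (c : freq D -> C) : Hs s c -> poly_bounded c.
Proof.
move=> h; have [n hn] : exists n : nat, - s <= INR n.
  case: (Rle_lt_dec (- s) 0) => hs; first by exists 0%nat.
  by exists (Z.to_nat (up (- s))); rewrite INR_IZR_INZ Z2Nat.id; have [h1 h2] := archimed (- s);
    [lra|apply: le_IZR; lra].
exists n, (1 + Hs_norm s c ^ 2) => l.
have w0 := Rpower_gt0 (wt l) s; have w1 := wt_ge1 l.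
have pn : wt l ^ n * Rpower (wt l) s = Rpower (wt l) (INR n + s) by rewrite Rpower_plus Rpower_pow //; lra.
have p1 : 1 <= Rpower (wt l) (INR n + s).
  rewrite -(Rpower_O (wt l)); last lra.
  by apply: Rle_Rpower => //; lra.
have := hw_le_norm l h; rewrite /hw; set N := Hs_norm _ _; set x := Cmod _ => hx.
have x0 : 0 <= x by apply: Cmod_ge_0.
have wn : 1 <= wt l ^ n by apply: pow_R1_Rle.
have : x ^ 2 <= N ^ 2 * wt l ^ n.
  apply: Rle_trans (_ : wt l ^ n * (Rpower (wt l) s * x ^ 2) <= _).
    by rewrite -Rmult_assoc pn; have := pow2_ge_0 x; nra.
  by rewrite Rmult_comm; apply: Rmult_le_compat_r; lra.
have := pow2_ge_0 (x - 1); nra.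
Qed.

Lemma Hs_dist_of D s (c : freq D -> C) l : (0 < D)%nat -> Hs s c -> fourier (dist_of c) l = c l.
Proof. by move=> D0 h; apply: dist_ofP => //; apply: Hs_poly h. Qed.

(** * Regularity of curves in Sobolev spaces *)

(** Domination by a summable family, locally uniformly in t on (0, oo); this is
    the hypothesis under which Fourier series depending on time may be
    differentiated and converge in H^s. *)
Definition ldom D (B : R -> freq D -> R) : Prop :=
  forall t0, 0 < t0 -> exists M, summable M /\ locally t0 (fun t => forall l, B t l <= M l).

Lemma ldom_le D (B B' : R -> freq D -> R) : (forall t l, 0 < t -> B t l <= B' t l) -> ldom B' -> ldom B.
Proof.
move=> h hB t0 t0p; have [M [sM HM]] := hB t0 t0p; exists M; split=> //.
have pos : locally t0 (fun t => 0 < t) by apply: (open_gt 0).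
by apply: (filter_imp _ _ _ (filter_and _ _ pos HM)) => t [tp ht] l; apply: Rle_trans (h t l tp) (ht l).
Qed.

Lemma ldom_at D (B : R -> freq D -> R) t : 0 < t -> ldom B -> exists M, summable M /\ forall l, B t l <= M l.
Proof. by move=> tp /(_ t tp) [M [sM /locally_singleton h]]; exists M. Qed.

Lemma C0_Hs_of_coefs D s (A : freq D -> R -> C) : (0 < D)%nat ->
  (forall l t, 0 < t -> continuous (A l) t) ->
  ldom (fun t l => hw s (fun l => A l t) l) ->
  C0_Hs s (fun t => dist_of (fun l => A l t)).
Proof.
move=> D0 cA dA.
have hs t : 0 < t -> Hs s (fun l => A l t).
  by move=> tp; have [M [sM HM]] := ldom_at tp dA; apply: (proj1 (Hs_dom HM sM)).
have E t : 0 < t -> fourier (dist_of (fun l => A l t)) = fun l => A l t.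
  by move=> tp; apply: functional_extensionality => l; apply: (Hs_dist_of l D0 (hs t tp)).
split=> t tp; first by rewrite E //; apply: hs.
have [M [sM HM]] := dA t tp.
have pos : locally t (fun r => 0 < r) by apply: (open_gt 0).
apply: (@Hs_cvg_of_coefs D s (locally t) _ _ _ (fun l => 4 * M l)); first exact: summable_scal.
  have Mt := locally_singleton _ _ HM.
  apply: (filter_imp _ _ _ (filter_and _ _ pos HM)) => r [rp hr] l; rewrite !E //.
  have := Cmod2_minus (A l r) (A l t); have := hr l; have := Mt l; rewrite /hw.
  by have := Rpower_gt0 (wt l) s; nra.
move=> l; rewrite E //; apply: (@filterlim_ext_loc _ _ _ _ _ (A l)); last exact: cA.
by apply: filter_imp pos => r rp; rewrite E.
Qed.

(** The mean value theorem holds only for the real and imaginary parts, at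
    different intermediate times. *)
Lemma Cdiff_quot (g g' : R -> C) t r m : r <> t ->
  (forall w, Rmin t r <= w <= Rmax t r -> is_Cderive g w (g' w) /\ Cmod (g' w) ^ 2 <= m) ->
  Cmod (RtoC (/ (r - t)) * (g r - g t))%C ^ 2 <= 2 * m.
Proof.
move=> ne h.
have part (f f' : R -> R) : (forall w, Rmin t r <= w <= Rmax t r -> is_derive f w (f' w) /\ f' w ^ 2 <= m) ->
    (/ (r - t) * (f r - f t)) ^ 2 <= m.
  move=> hf; have [|w wb|w [wb e]] := @MVT_gen f t r f'.
  - by move=> w wb; case: (hf w ltac:(lra)).
  - by apply: derivable_continuous_pt; exists (f' w); apply/is_derive_Reals; case: (hf w wb).
  - by have -> : / (r - t) * (f r - f t) = f' w; [rewrite e; field; lra|case: (hf w wb)].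
rewrite Cmod2.
have -> : Re (RtoC (/ (r - t)) * (g r - g t))%C = / (r - t) * (Re (g r) - Re (g t)) by rewrite /Re /=; ring.
have -> : Im (RtoC (/ (r - t)) * (g r - g t))%C = / (r - t) * (Im (g r) - Im (g t)) by rewrite /Im /=; ring.
have h1 := part (fun w => Re (g w)) (fun w => Re (g' w)).
have h2 := part (fun w => Im (g w)) (fun w => Im (g' w)).
apply: Rle_trans (Rplus_le_compat _ _ _ _ (h1 _) (h2 _)) _; last lra.
- move=> w wb; have [dg b] := h w wb; split; first by case: (is_derive_Re dg).
  by move: b; rewrite Cmod2; have := pow2_ge_0 (Im (g' w)); lra.
- move=> w wb; have [dg b] := h w wb; split; first by case: (is_derive_Re dg).
  by move: b; rewrite Cmod2; have := pow2_ge_0 (Re (g' w)); lra.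
Qed.

Lemma is_Cderive_cont (g : R -> C) t z : is_Cderive g t z -> continuous g t.
Proof. by move=> h; apply: (@ex_derive_continuous R_AbsRing C_R_NormedModule); exists z. Qed.

Lemma is_Cderive_quot (g : R -> C) t z : is_Cderive g t z ->
  filterlim (fun r => RtoC (/ (r - t)) * (g r - g t))%C (locally' t) (locally z).
Proof.
move=> /is_derive_Re [d1 d2].
have part (f : R -> R) l : is_derive f t l -> filterlim (fun r => / (r - t) * (f r - f t)) (locally' t) (locally l).
  move/is_derive_Reals => H; apply/filterlim_R => eps e0; have [d Hd] := H eps e0.
  exists d => r hr ne.
  have := Hd (r - t) ltac:(lra) hr; have -> : t + (r - t) = r by ring.
  by rewrite /Rdiv Rmult_comm.
apply: filterlim_C.
  apply: (@filterlim_ext _ _ _ _ _ (fun r => / (r - t) * (Re (g r) - Re (g t)))); last exact: part.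
  by move=> r; rewrite /Re /=; ring.
apply: (@filterlim_ext _ _ _ _ _ (fun r => / (r - t) * (Im (g r) - Im (g t)))); last exact: part.
by move=> r; rewrite /Im /=; ring.
Qed.

Lemma C1_Hs_of_coefs D s (A A' : freq D -> R -> C) : (0 < D)%nat ->
  (forall l t, 0 < t -> is_Cderive (A l) t (A' l t)) ->
  (forall l t, 0 < t -> continuous (A' l) t) ->
  ldom (fun t l => hw s (fun l => A l t) l) -> ldom (fun t l => hw s (fun l => A' l t) l) ->
  C1_Hs s (fun t => dist_of (fun l => A l t)).
Proof.
move=> D0 dA cA' hA hA'; split.
  by apply: C0_Hs_of_coefs => // l t tp; apply: is_Cderive_cont (dA l t tp).
have c1 := C0_Hs_of_coefs D0 cA' hA'.
exists (fun t => dist_of (fun l => A' l t)); split=> // t tp.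
have E (B : freq D -> R -> C) r : ldom (fun t l => hw s (fun l => B l t) l) -> 0 < r ->
    fourier (dist_of (fun l => B l r)) = fun l => B l r.
  move=> hB rp; apply: functional_extensionality => l; apply: (Hs_dist_of (s := s) l D0).
  by have [M [sM HM]] := ldom_at rp hB; apply: (proj1 (Hs_dom HM sM)).
have [M [sM [d Hd]]] := hA' t tp.
pose e := Rmin d (t / 2); have e0 : 0 < e by apply: Rmin_pos; [exact: cond_pos|lra].
have near_e r : Rabs (r - t) < e -> 0 < r /\ forall l, hw s (fun l => A' l r) l <= M l.
  move=> hr; split; first by have := Rlt_le_trans _ _ _ hr (Rmin_r _ _); move/Rabs_def2; lra.
  by apply: Hd; apply: Rlt_le_trans hr (Rmin_l _ _).
have loc : locally' t (fun r => r <> t /\ Rabs (r - t) < e).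
  by exists (mkposreal e e0) => r hr ne; split.
apply: (@Hs_cvg_of_coefs D s (locally' t) _ _ _ (fun l => 6 * M l)); first exact: summable_scal.
  apply: filter_imp loc => r [ne hr] l; have [rp _] := near_e r hr.
  rewrite fourier_scal fourier_sub !E //.
  have w0 := Rpower_gt0 (wt l) s.
  have bq : Cmod (RtoC (/ (r - t)) * (A l r - A l t))%C ^ 2 <= 2 * (M l * / Rpower (wt l) s).
    apply: (@Cdiff_quot (A l) (A' l)) => // w wb.
    have [wp HM] : 0 < w /\ forall l, hw s (fun l => A' l w) l <= M l.
      apply: near_e; apply: Rle_lt_trans hr; move: wb; rewrite /Rmin /Rmax.
      by case: Rle_dec => _ wb; [rewrite !Rabs_pos_eq|rewrite !Rabs_left1]; lra.
    split; first exact: dA.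
    apply: (Rmult_le_reg_l (Rpower (wt l) s)) => //.
    have -> : Rpower (wt l) s * (M l * / Rpower (wt l) s) = M l by field; lra.
    exact: HM.
  have [_ Mt] := near_e t ltac:(rewrite Rminus_eq_0 Rabs_R0; lra).
  have := Mt l; rewrite /hw => ht.
  apply: Rle_trans (_ : Rpower (wt l) s * (2 * (2 * (M l * / Rpower (wt l) s) + Cmod (A' l t) ^ 2)) <= _).
    apply: Rmult_le_compat_l; first lra.
    by apply: Rle_trans (Cmod2_minus _ _) _; lra.
  have -> : Rpower (wt l) s * (2 * (2 * (M l * / Rpower (wt l) s) + Cmod (A' l t) ^ 2)) = 4 * M l + 2 * (Rpower (wt l) s * Cmod (A' l t) ^ 2) by field; lra.
  lra.
move=> l; rewrite E //.
apply: (@filterlim_ext_loc _ _ _ _ _ (fun r => RtoC (/ (r - t)) * (A l r - A l t))%C); last exact/is_Cderive_quot/dA.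
by apply: filter_imp loc => r [_ hr]; have [rp _] := near_e r hr; rewrite fourier_scal fourier_sub !E.
Qed.

(** * Fourier series depending on time *)

Definition fld D (A : freq D -> R -> C) (t : R) : pt D -> C := synth (fun l => A l t).

Lemma rsum_derive D (f f' : freq D -> R -> R) (M : freq D -> R) t0 d : 0 < d -> summable M ->
  (forall l t, Rabs (t - t0) < d -> is_derive (f l) t (f' l t)) ->
  (forall l t, Rabs (t - t0) < d -> Rabs (f' l t) <= M l) ->
  (forall t, Rabs (t - t0) < d -> summable (fun l => f l t)) ->
  is_derive (fun t => rsum (fun l => f l t)) t0 (rsum (fun l => f' l t0)).
Proof.
move=> d0 sM df bf sf.
apply: (@Series_derive (fun n t => seqof (fun l => f l t) n) (fun n t => seqof (fun l => f' l t) n) (seqof M) t0 d d0 (summable_ex sM)).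
- move=> n t ht; rewrite /seqof; case: (dec D n) => [l|] /=; first exact: df.
  by apply: is_derive_const.
- by move=> n t ht; rewrite /seqof; case: (dec D n) => [l|] /=; [exact: bf|rewrite Rabs_R0; apply: Rle_refl].
- by move=> t ht; apply: summable_ex; apply: sf.
Qed.

Lemma csum_derive D (f f' : freq D -> R -> C) (M : freq D -> R) t0 d : 0 < d -> summable M ->
  (forall l t, Rabs (t - t0) < d -> is_Cderive (f l) t (f' l t)) ->
  (forall l t, Rabs (t - t0) < d -> Cmod (f' l t) <= M l) ->
  (forall t, Rabs (t - t0) < d -> csummable (fun l => f l t)) ->
  is_Cderive (fun t => csum (fun l => f l t)) t0 (csum (fun l => f' l t0)).
Proof.
move=> d0 sM df bf sf; apply: is_Cderive_pair.
- apply: (@rsum_derive D (fun l t => Re (f l t)) (fun l t => Re (f' l t)) M t0 d) => //.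
  + by move=> l t ht; case: (is_derive_Re (df l t ht)).
  + by move=> l t ht; apply: Rle_trans (Re_le_Cmod _) (bf l t ht).
  + by move=> t ht; apply: csummable_Re; apply: sf.
- apply: (@rsum_derive D (fun l t => Im (f l t)) (fun l t => Im (f' l t)) M t0 d) => //.
  + by move=> l t ht; case: (is_derive_Re (df l t ht)).
  + by move=> l t ht; apply: Rle_trans (Im_le_Cmod _) (bf l t ht).
  + by move=> t ht; apply: csummable_Im; apply: sf.
Qed.

Lemma ldom_csummable D (A : freq D -> R -> C) t : 0 < t -> ldom (fun t l => Cmod (A l t)) -> csummable (fun l => A l t).
Proof. by move=> tp h; have [M [sM HM]] := ldom_at tp h; apply: csummable_le sM. Qed.

Lemma fld_C0 D (A : freq D -> R -> C) : (forall l t, 0 < t -> continuous (A l) t) ->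
  ldom (fun t l => Cmod (A l t)) -> C0_st (fld A).
Proof.
move=> cA dA t x tp; have [M [sM HM]] := dA t tp.
have Mt := locally_singleton _ _ HM.
apply: (@csum_tannery D _ (locally ((t, x) : R * pt D)) _ (fun z l => A l z.1 * expi l z.2)%C (fun l => A l t * expi l x)%C M) => //.
- by move=> l; rewrite Cmod_cexpi.
- by case: HM => d Hd; exists d => -[r y] [/= hr _] l; rewrite Cmod_cexpi; apply: Hd.
- move=> l; apply: (@filterlim_Cmult _ (locally ((t, x) : R * pt D)) _ (fun z => A l z.1) (fun z => expi l z.2)).
    by move=> P /(cA l t tp) [d Hd]; exists d => -[r y] [hr _]; apply: Hd.
  by move=> P /(ccont_expi l x) [d Hd]; exists d => -[r y] [_ hy]; apply: Hd.
Qed.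

Lemma fld_dt D (A A' : freq D -> R -> C) : (forall l t, 0 < t -> is_Cderive (A l) t (A' l t)) ->
  ldom (fun t l => Cmod (A l t)) -> ldom (fun t l => Cmod (A' l t)) ->
  forall t x, 0 < t -> is_Cderive (fun r => fld A r x) t (fld A' t x).
Proof.
move=> dA hA hA' t x tp; have [M [sM [d Hd]]] := hA' t tp.
pose e := Rmin d t; have e0 : 0 < e by apply: Rmin_pos; [exact: cond_pos|].
have ep r : Rabs (r - t) < e -> 0 < r by move=> hr; have := Rlt_le_trans _ _ _ hr (Rmin_r _ _); move/Rabs_def2; lra.
apply: (@csum_derive D (fun l r => A l r * expi l x)%C (fun l r => A' l r * expi l x)%C M t e) => //.
- move=> l r hr; have := is_Cderive_scal (expi l x) (dA l r (ep r hr)).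
  by rewrite Cmult_comm; apply: is_derive_ext => w; rewrite Cmult_comm.
- by move=> l r hr; rewrite Cmod_cexpi; apply: Hd; apply: Rlt_le_trans hr (Rmin_l _ _).
- by move=> r hr; apply: csummable_expi; apply: (ldom_csummable (ep r hr) hA).
Qed.

Lemma synth_pd D (c : freq D -> C) i x : csummable c -> csummable (fun l => Ci * IZR (l i) * c l)%C ->
  is_Cderive (fun h => synth c (upd x i h)) (x i) (synth (fun l => Ci * IZR (l i) * c l)%C x).
Proof.
move=> sc sc'.
have := @csum_derive D (fun l h => c l * expi l (upd x i h))%C (fun l h => Ci * IZR (l i) * c l * expi l (upd x i h))%C
  (fun l => Cmod (Ci * IZR (l i) * c l)%C) (x i) 1 Rlt_0_1 sc'.
rewrite upd_same; apply.
- move=> l t _; have := expi_line (c l) l i (upd x i t); have -> : upd x i t i = t by rewrite /upd eqxx.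
  have -> : (c l * (Ci * IZR (l i)) * expi l (upd x i t))%C = (Ci * IZR (l i) * c l * expi l (upd x i t))%C by ring.
  by apply: is_derive_ext => h; rewrite upd_upd.
- by move=> l t _; rewrite Cmod_cexpi; apply: Rle_refl.
- by move=> t _; apply: csummable_expi.
Qed.

Lemma coord_le_jap D (l : freq D) i : Rabs (IZR (l i)) <= jap l.
Proof.
rewrite -(Rabs_pos_eq (jap l)); last by have := jap_ge1 l; lra.
by apply: Rsqr_le_abs_0; rewrite /Rsqr jap_sq; have := coord_le_wt l i; lra.
Qed.

Lemma ldom_jap D (A : freq D -> R -> C) : ldom (fun t l => jap l * Cmod (A l t)) -> ldom (fun t l => Cmod (A l t)).
Proof.
apply: ldom_le => t l _; have := jap_ge1 l; have := Cmod_ge_0 (A l t); nra.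
Qed.

Lemma ldom_coord D (A : freq D -> R -> C) i : ldom (fun t l => jap l * Cmod (A l t)) ->
  ldom (fun t l => Cmod (Ci * IZR (l i) * A l t)%C).
Proof.
apply: ldom_le => t l _; rewrite !Cmod_mult Cmod_Ci Cmod_R Rmult_1_l.
by apply: Rmult_le_compat_r; [exact: Cmod_ge_0|exact: coord_le_jap].
Qed.

Lemma C0_st_ext D (f g : R -> pt D -> C) : (forall t x, 0 < t -> f t x = g t x) -> C0_st f -> C0_st g.
Proof.
move=> e cf t x tp; apply: (continuous_ext_loc _ (fun z : R * pt D => f z.1 z.2)); last exact: cf.
exists (mkposreal t tp) => -[r y] [/= hr _]; apply: e; move: hr.
by rewrite /ball /= /AbsRing_ball /= /abs /minus /plus /opp /= => /Rabs_def2; lra.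
Qed.

Lemma pos_locally t : 0 < t -> locally t (fun r => 0 < r).
Proof. by move=> tp; apply: (open_gt 0). Qed.

Lemma C1_st_ext D (f g : R -> pt D -> C) : (forall t x, 0 < t -> f t x = g t x) -> C1_st f -> C1_st g.
Proof.
move=> e [c0 [ex [ct cx]]].
have es t : 0 < t -> f t = g t by move=> tp; apply: functional_extensionality => x; apply: e.
split; first exact: C0_st_ext c0.
have dtE t x : 0 < t -> is_Cderive (fun r => g r x) t (dt f t x).
  move=> tp; have [h _] := ex t x tp.
  apply: (is_derive_ext_loc (fun r => f r x)); last exact: ex_Cderive_is h.
  by apply: filter_imp (pos_locally tp) => r rp; apply: e.
split; last split.
- move=> t x tp; split; first by exists (dt f t x); apply: dtE.
  by rewrite -es //; case: (ex t x tp).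
- by apply: C0_st_ext ct => t x tp; rewrite /dt (is_Cderive_unique (dtE t x tp)).
- by move=> i; apply: C0_st_ext (cx i) => t x tp; rewrite /dx es.
Qed.

Lemma fld_dtE D (A A' : freq D -> R -> C) : (forall l t, 0 < t -> is_Cderive (A l) t (A' l t)) ->
  ldom (fun t l => Cmod (A l t)) -> ldom (fun t l => Cmod (A' l t)) ->
  forall t x, 0 < t -> dt (fld A) t x = fld A' t x.
Proof. by move=> dA hA hA' t x tp; apply: is_Cderive_unique; apply: fld_dt. Qed.

Lemma fld_dxE D (A : freq D -> R -> C) i : ldom (fun t l => jap l * Cmod (A l t)) ->
  forall t x, 0 < t -> dx i (fld A) t x = fld (fun l t => Ci * IZR (l i) * A l t)%C t x.
Proof.
move=> hA t x tp; apply: is_Cderive_unique; apply: synth_pd.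
  exact: (ldom_csummable tp (ldom_jap hA)).
exact: (ldom_csummable tp (ldom_coord i hA)).
Qed.

Lemma continuous_Cscal (g : R -> C) k t : continuous g t -> continuous (fun r => k * g r)%C t.
Proof. by move=> h; apply: filterlim_Cmult => //; apply: filterlim_const. Qed.

Lemma fld_C1 D (A A' : freq D -> R -> C) :
  (forall l t, 0 < t -> is_Cderive (A l) t (A' l t)) -> (forall l t, 0 < t -> continuous (A' l) t) ->
  ldom (fun t l => jap l * Cmod (A l t)) -> ldom (fun t l => Cmod (A' l t)) -> C1_st (fld A).
Proof.
move=> dA cA' hA hA'; have hA0 := ldom_jap hA.
have cA l t : 0 < t -> continuous (A l) t by move=> tp; apply: is_Cderive_cont (dA l t tp).
split; first exact: fld_C0.
split; last split.
- move=> t x tp; split; first by exists (fld A' t x); apply: fld_dt.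
  move=> i; exists (fld (fun l t => Ci * IZR (l i) * A l t)%C t x); apply: synth_pd.
    exact: (ldom_csummable tp hA0).
  exact: (ldom_csummable tp (ldom_coord i hA)).
- apply: (@C0_st_ext D (fld A')); last exact: fld_C0.
  by move=> t x tp; rewrite (fld_dtE dA hA0 hA').
- move=> i; apply: (@C0_st_ext D (fld (fun l t => Ci * IZR (l i) * A l t)%C)).
    by move=> t x tp; rewrite (fld_dxE i hA).
  apply: fld_C0; last exact: ldom_coord.
  by move=> l t tp; apply: continuous_Cscal; apply: cA.
Qed.

Lemma fld_fc D (A : freq D -> R -> C) t l : 0 < t -> ldom (fun t l => Cmod (A l t)) -> fc (fld A t) l = A l t.
Proof. by move=> tp hA; apply: fc_synth; apply: (ldom_csummable tp hA). Qed.

(** * Fourier coefficients of classical solutions *)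

Lemma C0_st_ccont D (f : R -> pt D -> C) t : 0 < t -> C0_st f -> ccont (f t).
Proof. by move=> tp cf; apply: joint_cont_slice => x; apply: cf. Qed.

Lemma fc_sum D (I : Type) (s : seq I) (f : I -> pt D -> C) l : (forall i, ccont (f i)) ->
  fc (fun x => \big[Cplus/RtoC 0]_(i <- s) f i x) l = \big[Cplus/RtoC 0]_(i <- s) fc (f i) l.
Proof.
move=> cf; elim: s => [|i s IH].
  rewrite big_nil; have -> : (fun x : pt D => \big[Cplus/RtoC 0]_(i <- [::]) f i x) = (fun x => (RtoC 0 * RtoC 0)%C).
    by apply: functional_extensionality => x; rewrite big_nil; ring.
  by rewrite fc_scal; [ring|apply: ccont_const].
rewrite big_cons -IH -fc_plus //; last exact: ccont_sum.
by congr fc; apply: functional_extensionality => x; rewrite big_cons.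
Qed.

Lemma Csum_real (I : Type) (s : seq I) (a : I -> R) (z : C) :
  \big[Cplus/RtoC 0]_(i <- s) (RtoC (a i) * z)%C = (RtoC (\big[Rplus/0]_(i <- s) a i) * z)%C.
Proof.
elim: s => [|i s IH]; first by rewrite !big_nil; ring.
by rewrite !big_cons IH RtoC_plus; ring.
Qed.

Lemma fc_derive D (F G : R -> pt D -> C) r l : 0 < r -> C0_st F -> C0_st G ->
  (forall t x, 0 < t -> is_Cderive (fun t => F t x) t (G t x)) ->
  is_Cderive (fun t => fc (F t) l) r (fc (G r) l).
Proof.
move=> rp cF cG dF.
have pos t : Rabs (t - r) < r -> 0 < t by move/Rabs_def2; lra.
have := @tint_derive D (fun t x => F t x * expi (opp_freq l) x)%C (fun t x => G t x * expi (opp_freq l) x)%C r r rp.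
move=> H; rewrite /fc /Cdiv Cmult_comm.
apply: (is_derive_ext (fun t => (/ RtoC (vol D) * tint (fun x => F t x * expi (opp_freq l) x))%C)).
  by move=> t; rewrite Cmult_comm.
apply: is_Cderive_scal; apply: H.
- by move=> t /pos tp; apply: ccont_mult; [exact: C0_st_ccont|exact: ccont_expi].
- move=> t x /pos tp; have := is_Cderive_scal (expi (opp_freq l) x) (dF t x tp).
  by rewrite Cmult_comm; apply: is_derive_ext => w; rewrite Cmult_comm.
- move=> x; apply: (@filterlim_Cmult _ (locally ((r, x) : R * pt D)) _ (fun z => G z.1 z.2) (fun z => expi (opp_freq l) z.2)).
    exact: cG.
  by move=> P /(ccont_expi (opp_freq l) x) [d Hd]; exists d => -[t y] [_ hy]; apply: Hd.
Qed.

(** Taking Fourier coefficients turns t d/dt into d/dtau and each second space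
    derivative into - l_i^2; this is where the regularity and periodicity of a
    classical solution are used. *)
Lemma classical_csol D (p : 'I_D -> R) phi psi l : classical_solution p phi psi ->
  csol p l (fun tau => fc (phi (exp tau)) l) (fun tau => fc (psi (exp tau)) l).
Proof.
move=> [per [[[c0 [e0 [ct cx]]] [_ c2x]] [d0 [f0 [dct _]]]] eq1 eq2].
have dexp tau : is_derive exp tau (exp tau) by apply: is_derive_exp.
have D1 tau : is_Cderive (fun tau => fc (phi (exp tau)) l) tau (fc (psi (exp tau)) l).
  have tp := exp_pos tau.
  (* The factor exp tau of the chain rule is the t of t d/dt. *)
  have -> : fc (psi (exp tau)) l = (RtoC (exp tau) * fc (dt phi (exp tau)) l)%C.
    rewrite -fc_scal; last exact: C0_st_ccont.
    by congr fc; apply: functional_extensionality => x; rewrite eq1.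
  apply: (@is_Cderive_comp (fun t => fc (phi t) l) exp) => //; apply: fc_derive => // t x ht.
  by apply: ex_Cderive_is; case: (e0 t x ht).
have D2 tau : is_Cderive (fun tau => fc (psi (exp tau)) l) tau (RtoC (- qf p l tau) * fc (phi (exp tau)) l)%C.
  have tp := exp_pos tau; set t := exp tau in tp *.
  have [pphi _] := per t tp.
  have cphi : ccont (phi t) by apply: C0_st_ccont.
  have cdx i : ccont (dx i phi t) by apply: C0_st_ccont (cx i).
  have cddx i : ccont (dx i (dx i phi) t) by have [_ [_ [_ h]]] := c2x i; apply: C0_st_ccont (h i).
  have -> : (RtoC (- qf p l tau) * fc (phi t) l)%C = (RtoC t * fc (dt psi t) l)%C.
    rewrite -[RHS]fc_scal; last exact: C0_st_ccont.
    have -> : (fun x => RtoC t * dt psi t x)%C = (fun x => \big[Cplus/RtoC 0]_(i < D)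
          (RtoC (Rpower t (2 - 2 * p i)) * dx i (dx i phi) t x)%C).
      by apply: functional_extensionality => x; rewrite eq2.
    rewrite fc_sum; last by move=> i; apply: ccont_scal.
    rewrite (eq_bigr (fun i => RtoC ((-1) * (expo p i ^ 0 * exp (expo p i * tau) * IZR (l i) ^ 2)) * fc (phi t) l)%C).
      by rewrite Csum_real Rsum_scal -/(symb p l 0 tau); congr (RtoC _ * _)%C; ring.
    move=> i _; rewrite fc_scal //.
    have -> : dx i (dx i phi) t = pd i (pd i (phi t)) by [].
    rewrite (@fc_pd D (pd i (phi t)) i l (cdx i) (@pd_periodic D i (phi t) pphi) _ (cddx i)); last first.
      by move=> x; have [_ [h _]] := c2x i; have [_ h2] := h t x tp; apply: h2.
    rewrite (@fc_pd D (phi t) i l cphi pphi _ (cdx i)); last by move=> x; have [_ h2] := e0 t x tp; apply: h2.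
    have -> : Rpower t (2 - 2 * p i) = exp (expo p i * tau) by rewrite /Rpower /t ln_exp.
    rewrite !RtoC_mult !RtoC_pow.
    have -> : (Ci * IZR (l i) * (Ci * IZR (l i) * fc (phi t) l))%C = ((Ci * Ci) * (IZR (l i) * IZR (l i)) * fc (phi t) l)%C by ring.
    have -> : (Ci * Ci)%C = RtoC (-1) by rewrite /Cmult /=; rewrite /RtoC; congr pair; ring.
    by rewrite /=; ring.
  apply: (@is_Cderive_comp (fun t => fc (psi t) l) exp) => //; apply: fc_derive => // r x hr.
  by apply: ex_Cderive_is; case: (f0 r x hr).
split=> tau; have [r1 i1] := is_derive_Re (D1 tau); have [r2 i2] := is_derive_Re (D2 tau); split=> //.
  by apply: is_derive_eq r2 _; rewrite /Re /=; ring.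
by apply: is_derive_eq i2 _; rewrite /Im /=; ring.
Qed.

(** A mode is determined by its data at tau = 0, that is at t = 1. *)
Lemma classical_modes D (p : 'I_D -> R) c phi psi l t : growth p c -> classical_solution p phi psi -> 0 < t ->
  fc (phi t) l = mphi p l (fc (phi 1) l) (fc (psi 1) l) (ln t) /\
  fc (psi t) l = mpsi p l (fc (phi 1) l) (fc (psi 1) l) (ln t).
Proof.
move=> gr cs tp; have := csol_uniq gr (classical_csol l cs) (ln t).
by rewrite exp_ln // exp_0.
Qed.

Lemma classical_determined D (p : 'I_D -> R) c phi psi phi' psi' : (0 < D)%nat -> growth p c ->
  classical_solution p phi psi -> classical_solution p phi' psi' ->
  (forall l, fc (phi 1) l = fc (phi' 1) l) -> (forall l, fc (psi 1) l = fc (psi' 1) l) ->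
  same_solution phi psi phi' psi'.
Proof.
move=> D0 gr cs cs' e1 e2 t x tp.
have [per [[[c0 _] _] [d0 _]] _ _] := cs; have [per' [[[c0' _] _] [d0' _]] _ _] := cs'.
have [p1 p2] := per t tp; have [p1' p2'] := per' t tp.
split; apply: fc_ext => //; try exact: C0_st_ccont.
  by move=> l; rewrite (proj1 (classical_modes l gr cs tp)) (proj1 (classical_modes l gr cs' tp)) e1 e2.
by move=> l; rewrite (proj2 (classical_modes l gr cs tp)) (proj2 (classical_modes l gr cs' tp)) e1 e2.
Qed.

Lemma at_right_pos : at_right 0 (fun t => 0 < t).
Proof. by exists (mkposreal 1 Rlt_0_1). Qed.

Lemma tends_to_coefs D s (f : R -> pt D -> C) v (g : freq D -> R -> C) l z :
  tends_to_Hs s f v -> (forall t, 0 < t -> fc (f t) l = g l (ln t)) ->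
  filterlim (g l) (Rbar_locally m_infty) (locally z) -> fourier v l = z.
Proof.
move=> [u [cu hu hv cvg]] e lim.
have h1 : filterlim (fun t => fourier (u t) l) (at_right 0) (locally (fourier v l)).
  by apply: (@Hs_cvg_coefs D s (at_right 0) _ u v _ hv cvg); apply: filter_imp at_right_pos => t; apply: hu.
have h2 : filterlim (fun t => fourier (u t) l) (at_right 0) (locally z).
  apply: (@filterlim_ext_loc _ _ _ _ _ (fun t => g l (ln t))).
    by apply: filter_imp at_right_pos => t tp; rewrite (regular_fourier l (cu t tp)) e.
  exact: filterlim_comp is_lim_ln_0 lim.
have [a1 b1] := filterlim_ReIm _ h1; have [a2 b2] := filterlim_ReIm _ h2.
have ea := @filterlim_unique_R R (at_right 0) _ _ _ _ a1 a2.
have eb := @filterlim_unique_R R (at_right 0) _ _ _ _ b1 b2.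
rewrite [LHS]surjective_pairing [RHS]surjective_pairing; congr pair; [exact: ea|exact: eb].
Qed.

(** The limits in H^s are limits of each coefficient, and these are given by the
    scattering matrix. Uniqueness of the scattering data, and of the solution
    with given scattering data, follow from this. *)
Lemma scattering_coefs D (p : 'I_D -> R) c s phi psi z l : growth p c ->
  classical_solution p phi psi -> scattering_data s phi psi z ->
  fourier z.1 l = outZ p l (fc (phi 1) l) (fc (psi 1) l) /\
  fourier z.2 l = outP p l (fc (phi 1) l) (fc (psi 1) l).
Proof.
move=> gr cs [s1 s2]; have [l1 l2] := mode_lim l (fc (phi 1) l) (fc (psi 1) l) gr.
have [per [[[c0 _] _] [d0 _]] _ _] := cs.
split.
  apply: (@tends_to_coefs D s psi z.1 (fun l tau => mpsi p l (fc (phi 1) l) (fc (psi 1) l) tau) l _ s1) => // t tp.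
  by case: (classical_modes l gr cs tp).
apply: (@tends_to_coefs D s _ z.2 (fun l tau => mphi p l (fc (phi 1) l) (fc (psi 1) l) tau - RtoC tau * mpsi p l (fc (phi 1) l) (fc (psi 1) l) tau)%C l _ s2) => // t tp.
have [<- <-] := classical_modes l gr cs tp.
have -> : (fun x => phi t x - RtoC (ln t) * psi t x)%C = (fun x => phi t x + RtoC (- ln t) * psi t x)%C.
  by apply: functional_extensionality => x; rewrite RtoC_opp; ring.
by rewrite fc_plus ?fc_scal; [rewrite RtoC_opp; ring|exact: C0_st_ccont|exact: C0_st_ccont|apply: ccont_scal; exact: C0_st_ccont].
Qed.

(** * Solutions with prescribed modes *)

Lemma ldom_cont D (g : R -> R) (M : freq D -> R) : (forall t, 0 < t -> continuous g t) ->
  summable M -> (forall l, 0 <= M l) -> ldom (fun t l => g t * M l).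
Proof.
move=> cg sM M0 t0 t0p; exists (fun l => (Rabs (g t0) + 1) * M l); split; first exact: summable_scal.
have /filterlim_R H := cg t0 t0p; apply: filter_imp (H 1 Rlt_0_1) => t /Rabs_def2 ht l.
by apply: Rmult_le_compat_r => //; have := Rle_abs (g t0); lra.
Qed.

Lemma ln_cont t : 0 < t -> continuous ln t.
Proof. by move=> tp; apply: deriv_cont (is_derive_ln _ tp). Qed.

(** Dominates the factor exp (9 |tau|) of [mode_energy] at tau = log t. *)
Definition grow (t : R) : R := exp (9 * Rabs (ln t)).

Lemma grow_cont t : 0 < t -> continuous grow t.
Proof.
move=> tp; apply: (continuous_comp (fun t => 9 * Rabs (ln t)) exp); last exact: continuous_exp.
apply: filterlim_Rscal; apply: (continuous_comp ln Rabs); [exact: ln_cont|exact: continuous_Rabs].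
Qed.

Lemma grow_ge1 t : 1 <= grow t.
Proof. by rewrite -exp_0; apply: exp_mono; have := Rabs_pos (ln t); lra. Qed.

Lemma inv_cont t : 0 < t -> continuous Rinv t.
Proof. by move=> tp; apply: continuous_Rinv; lra. Qed.

Definition data_size D (l : freq D) (a b : C) : R := wt l * Cmod a ^ 2 + Cmod b ^ 2.

Lemma data_size_ge0 D (l : freq D) a b : 0 <= data_size l a b.
Proof.
by rewrite /data_size; have := wt_gt0 l; have := pow2_ge_0 (Cmod a); have := pow2_ge_0 (Cmod b); nra.
Qed.

Lemma data_sizeE D (l : freq D) a b : data_size l a b = jap l * cauchy_size l a b.
Proof. by rewrite /data_size /cauchy_size -jap_sq; field; have := jap_ge1 l; lra. Qed.

(** The coefficients of φ, of ψ and of their time derivatives for the solution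
    with data (a, b) at t = 1. *)
Definition kphi D (p : 'I_D -> R) (a b : freq D -> C) (l : freq D) (t : R) : C := mphi p l (a l) (b l) (ln t).
Definition kpsi D (p : 'I_D -> R) (a b : freq D -> C) (l : freq D) (t : R) : C := mpsi p l (a l) (b l) (ln t).
Definition dkphi D (p : 'I_D -> R) (a b : freq D -> C) (l : freq D) (t : R) : C :=
  (RtoC (/ t) * kpsi p a b l t)%C.
Definition dkpsi D (p : 'I_D -> R) (a b : freq D -> C) (l : freq D) (t : R) : C :=
  (RtoC (/ t * - qf p l (ln t)) * kphi p a b l t)%C.

Lemma kphi_deriv D (p : 'I_D -> R) c a b l t : growth p c -> 0 < t -> is_Cderive (kphi p a b l) t (dkphi p a b l t).
Proof.
move=> gr tp; have [SR SI] := mode_csol l (a l) (b l) gr.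
have [r1 _] := SR (ln t); have [i1 _] := SI (ln t).
by apply: (@is_Cderive_comp (mphi p l (a l) (b l)) ln t (/ t)); [exact: is_derive_ln|exact: is_Cderive_pair].
Qed.

Lemma kpsi_deriv D (p : 'I_D -> R) c a b l t : growth p c -> 0 < t -> is_Cderive (kpsi p a b l) t (dkpsi p a b l t).
Proof.
move=> gr tp; have [SR SI] := mode_csol l (a l) (b l) gr.
have [_ r1] := SR (ln t); have [_ i1] := SI (ln t).
have -> : dkpsi p a b l t = (RtoC (/ t) * (RtoC (- qf p l (ln t)) * kphi p a b l t))%C by rewrite /dkpsi RtoC_mult; ring.
apply: (@is_Cderive_comp (mpsi p l (a l) (b l)) ln t (/ t)); first exact: is_derive_ln.
by apply: is_Cderive_pair; [apply: is_derive_eq r1 _|apply: is_derive_eq i1 _]; rewrite /kphi /Re /Im /=; ring.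
Qed.

Definition cauchy_summable D (s : R) (a b : freq D -> C) : Prop :=
  summable (fun l => Rpower (wt l) s * data_size l (a l) (b l)).

(** Half the sum of these two terms is at least their geometric mean. The first
    is summable by assumption, the second because s - 1 > D / 2; so square-
    summability of the data gives absolute summability of the coefficients, with
    two derivatives to spare for φ and one for ψ. *)
Definition coef_majorant D (s : R) (a b : freq D -> C) (l : freq D) : R :=
  Rpower (wt l) s * data_size l (a l) (b l) + Rpower (wt l) (1 - s).

Lemma coef_majorant_ge0 D s (a b : freq D -> C) l : 0 <= coef_majorant s a b l.
Proof.
rewrite /coef_majorant; have := Rpower_gt0 (wt l) s; have := Rpower_gt0 (wt l) (1 - s).
have := data_size_ge0 l (a l) (b l); nra.
Qed.

Lemma coef_majorant_summable D s (a b : freq D -> C) : (0 < D)%nat -> INR D / 2 + 1 < s ->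
  cauchy_summable s a b -> summable (coef_majorant s a b).
Proof.
move=> D0 hs sab; apply: summable_plus => //; have -> : 1 - s = - (s - 1) by ring.
by apply: wt_summable => //; lra.
Qed.

Lemma coef_majorant_sq D s (a b : freq D -> C) l : wt l * data_size l (a l) (b l) <= coef_majorant s a b l ^ 2.
Proof.
have n0 := data_size_ge0 l (a l) (b l); have p1 := Rpower_gt0 (wt l) s; have p2 := Rpower_gt0 (wt l) (1 - s).
have e : Rpower (wt l) s * Rpower (wt l) (1 - s) = wt l.
  by rewrite -Rpower_plus; have -> : s + (1 - s) = 1 by [ring]; rewrite Rpower_1 //; exact: wt_gt0.
rewrite /coef_majorant -{1}e; move: (Rpower _ s) (Rpower _ (1 - s)) (data_size _ _ _) p1 p2 n0 => x y n x0 y0 n0.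
have := pow2_ge_0 (x * n); have := pow2_ge_0 y; nra.
Qed.

Lemma kenergy D (p : 'I_D -> R) c (a b : freq D -> C) l t (gr : growth p c) : wt l * Cmod (kphi p a b l t) ^ 2 + Cmod (kpsi p a b l t) ^ 2 <= grow t * data_size l (a l) (b l).
Proof. exact: (mode_energy l (a l) (b l) (ln t) gr). Qed.

Lemma kphi_le D (p : 'I_D -> R) c s (a b : freq D -> C) l t (gr : growth p c) : wt l * Cmod (kphi p a b l t) <= grow t * coef_majorant s a b l.
Proof.
have w0 := wt_gt0 l; have g1 := grow_ge1 t; have m0 := coef_majorant_ge0 s a b l.
have gm : 0 <= grow t * coef_majorant s a b l by apply: Rmult_le_pos; lra.
rewrite -(Rabs_pos_eq (wt l * _)); last by apply: Rmult_le_pos; [lra|exact: Cmod_ge_0].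
apply: abs_le_sq => //; have := kenergy a b l t gr; have := coef_majorant_sq s a b l.
have := pow2_ge_0 (Cmod (kpsi p a b l t)); have n0 := data_size_ge0 l (a l) (b l).
move: (Cmod _) (Cmod _) (data_size _ _ _) (coef_majorant _ _ _ _) n0 m0 gm => y z n m n0 m0 gm z2 h1 h2.
have h3 : wt l * (wt l * y ^ 2) <= wt l * (grow t * n) by apply: Rmult_le_compat_l; lra.
have h4 : grow t * (wt l * n) <= grow t * m ^ 2 by apply: Rmult_le_compat_l; lra.
have h5 : grow t * m ^ 2 <= grow t * (grow t * m ^ 2).
  by have := pow2_ge_0 m; have : 0 <= grow t * m ^ 2; [apply: Rmult_le_pos; [lra|apply: pow2_ge_0]|]; nra.
have -> : (wt l * y) ^ 2 = wt l * (wt l * y ^ 2) by ring.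
have -> : (grow t * m) ^ 2 = grow t * (grow t * m ^ 2) by ring.
lra.
Qed.

Lemma kpsi_le D (p : 'I_D -> R) c s (a b : freq D -> C) l t (gr : growth p c) : jap l * Cmod (kpsi p a b l t) <= grow t * coef_majorant s a b l.
Proof.
have w0 := wt_gt0 l; have g1 := grow_ge1 t; have m0 := coef_majorant_ge0 s a b l; have J1 := jap_ge1 l.
have gm : 0 <= grow t * coef_majorant s a b l by apply: Rmult_le_pos; lra.
rewrite -(Rabs_pos_eq (jap l * _)); last by apply: Rmult_le_pos; [lra|exact: Cmod_ge_0].
apply: abs_le_sq => //; have := kenergy a b l t gr; have := coef_majorant_sq s a b l.
have := pow2_ge_0 (Cmod (kphi p a b l t)); have n0 := data_size_ge0 l (a l) (b l).
have -> : (jap l * Cmod (kpsi p a b l t)) ^ 2 = wt l * Cmod (kpsi p a b l t) ^ 2 by rewrite -jap_sq; ring.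
move: (Cmod _) (Cmod _) (data_size _ _ _) (coef_majorant _ _ _ _) n0 m0 gm => y z n m n0 m0 gm y2 h1 h2.
have wz : 0 <= wt l * z ^ 2 by apply: Rmult_le_pos; lra.
have h3 : wt l * y ^ 2 <= wt l * (grow t * n) by apply: Rmult_le_compat_l; lra.
have h4 : grow t * (wt l * n) <= grow t * m ^ 2 by apply: Rmult_le_compat_l; lra.
have h5 : grow t * m ^ 2 <= grow t * (grow t * m ^ 2).
  by have := pow2_ge_0 m; have : 0 <= grow t * m ^ 2; [apply: Rmult_le_pos; [lra|apply: pow2_ge_0]|]; nra.
have -> : (grow t * m) ^ 2 = grow t * (grow t * m ^ 2) by ring.
lra.
Qed.

Lemma symb_grow D (p : 'I_D -> R) c (l : freq D) t (gr : growth p c) : 0 <= qf p l (ln t) <= grow t * wt l.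
Proof.
have [c0 hc] := gr; have [h1 _] := symb_le l (ln t) gr; have q0 := pot_ge0 (symb_potential l c0 hc) (ln t).
split=> //; apply: Rle_trans h1 _; apply: Rmult_le_compat; try exact: normsq_ge0.
- by apply/Rlt_le/exp_pos.
- by apply: exp_mono; have := Rabs_pos (ln t); lra.
- by rewrite /wt; lra.
Qed.

Lemma dkphi_le D (p : 'I_D -> R) c s (a b : freq D -> C) l t (gr : growth p c) : 0 < t ->
  jap l * Cmod (dkphi p a b l t) <= / t * grow t * coef_majorant s a b l.
Proof.
move=> tp; have it : 0 < / t by apply: Rinv_0_lt_compat.
rewrite Cmod_mult Cmod_R Rabs_pos_eq; last lra.
by have := kpsi_le s a b l t gr; nra.
Qed.

Lemma dkpsi_le D (p : 'I_D -> R) c s (a b : freq D -> C) l t (gr : growth p c) : 0 < t ->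
  Cmod (dkpsi p a b l t) <= / t * (grow t * grow t) * coef_majorant s a b l.
Proof.
move=> tp; have it : 0 < / t by apply: Rinv_0_lt_compat.
have [q0 q1] := symb_grow l t gr.
rewrite Cmod_mult Cmod_R Rabs_mult Rabs_Ropp (Rabs_pos_eq (/ t)); last lra.
rewrite (Rabs_pos_eq (qf p l (ln t))) // !Rmult_assoc; apply: Rmult_le_compat_l; first lra.
have := kphi_le s a b l t gr; have := Cmod_ge_0 (kphi p a b l t); have := grow_ge1 t.
move: (Cmod _) (coef_majorant _ _ _ _) (qf p l (ln t)) (grow t) q0 q1 => x m q g q0 q1 g1 x0 h.
have : q * x <= g * wt l * x by apply: Rmult_le_compat_r.
have : g * (wt l * x) <= g * (g * m) by apply: Rmult_le_compat_l; lra.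
lra.
Qed.

(** The majorant above allows two derivatives of φ in space, one space and one
    time derivative, or two time derivatives to be taken term by term; the
    equations then hold because they hold for each mode. *)
Lemma classical_synth D (p : 'I_D -> R) c s (a b : freq D -> C) : (0 < D)%nat -> growth p c ->
  INR D / 2 + 1 < s -> cauchy_summable s a b ->
  classical_solution p (fld (kphi p a b)) (fld (kpsi p a b)).
Proof.
move=> D0 gr hs sab.
have sM := coef_majorant_summable D0 hs sab; have M0 := coef_majorant_ge0 s a b.
have dA l t : 0 < t -> is_Cderive (kphi p a b l) t (dkphi p a b l t) by apply: kphi_deriv gr.
have dB l t : 0 < t -> is_Cderive (kpsi p a b l) t (dkpsi p a b l t) by apply: kpsi_deriv gr.
have cA l t : 0 < t -> continuous (kphi p a b l) t by move=> tp; apply: is_Cderive_cont (dA l t tp).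
have cB l t : 0 < t -> continuous (kpsi p a b l) t by move=> tp; apply: is_Cderive_cont (dB l t tp).
have dR t : 0 < t -> is_Cderive (fun t => RtoC (/ t)) t (RtoC (- / t ^ 2)).
  by move=> tp; apply: is_Cderive_pair => /=; auto_derive; try lra; field; lra.
have cR t : 0 < t -> continuous (fun t => RtoC (/ t)) t by move=> tp; apply: is_Cderive_cont (dR t tp).
have cq l t : 0 < t -> continuous (fun t => RtoC (/ t * - qf p l (ln t))) t.
  move=> tp; apply: filterlim_C => /=; last exact: filterlim_const.
  apply: filterlim_Rmult; first exact: inv_cont.
  have [c0 hc] := gr; apply: (continuous_opp (fun t => qf p l (ln t))).
  by apply: (continuous_comp ln (qf p l)); [exact: ln_cont|apply: pot_cont (symb_potential l c0 hc) _].
have cdB l t : 0 < t -> continuous (dkpsi p a b l) t.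
  by move=> tp; apply: filterlim_Cmult; [exact: cq|exact: cA].
have cdA l t : 0 < t -> continuous (dkphi p a b l) t.
  by move=> tp; apply: filterlim_Cmult; [exact: cR|exact: cB].
have dom (g : R -> R) : (forall t, 0 < t -> continuous g t) -> ldom (fun t l => g t * coef_majorant s a b l).
  by move=> cg; apply: ldom_cont.
have cm (g h : R -> R) : (forall t, 0 < t -> continuous g t) -> (forall t, 0 < t -> continuous h t) ->
    forall t, 0 < t -> continuous (fun t => g t * h t) t.
  by move=> cg ch t tp; apply: filterlim_Rmult; [exact: cg|exact: ch].
have cgg := cm _ _ grow_cont grow_cont; have cig := cm _ _ inv_cont grow_cont.
have cigg := cm _ _ inv_cont cgg.
have g1 := dom _ grow_cont; have gi := dom _ cig; have gg := dom _ cigg.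
have gi2 := dom _ (cm _ _ inv_cont cig); have ggi := dom _ (cm _ _ inv_cont cigg).
have WA : ldom (fun t l => wt l * Cmod (kphi p a b l t)) by apply: ldom_le g1 => t l _; apply: kphi_le gr.
have JA : ldom (fun t l => jap l * Cmod (kphi p a b l t)).
  apply: ldom_le WA => t l _; apply: Rmult_le_compat_r; first exact: Cmod_ge_0.
  by rewrite -jap_sq; have := jap_ge1 l; nra.
have JB : ldom (fun t l => jap l * Cmod (kpsi p a b l t)) by apply: ldom_le g1 => t l _; apply: kpsi_le gr.
have JdA : ldom (fun t l => jap l * Cmod (dkphi p a b l t)) by apply: ldom_le gi => t l tp; apply: dkphi_le gr tp.
have dBd : ldom (fun t l => Cmod (dkpsi p a b l t)) by apply: ldom_le gg => t l tp; apply: dkpsi_le gr tp.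
have eq1 t x : 0 < t -> fld (dkphi p a b) t x = (RtoC (/ t) * fld (kpsi p a b) t x)%C.
  move=> tp; rewrite /fld /synth -csum_scal; last exact/csummable_expi/(ldom_csummable tp (ldom_jap JB)).
  by apply: csum_ext => l; rewrite /dkphi; ring.
(* The derivative of [dkphi], for the second time derivative of φ. *)
pose ddA l t := (RtoC (/ t) * dkpsi p a b l t + RtoC (- / t ^ 2) * kpsi p a b l t)%C.
have ddAd l t : 0 < t -> is_Cderive (dkphi p a b l) t (ddA l t).
  move=> tp; have [r1 i1] := is_derive_Re (dB l t tp).
  have di : is_derive Rinv t (- / t ^ 2) by auto_derive; try lra; field; lra.
  apply: is_Cderive_pair.
    apply: (is_derive_ext (fun t => / t * Re (kpsi p a b l t))); first by move=> r; rewrite /dkphi /Re /=; ring.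
    by apply: is_derive_eq; [apply: is_derive_Rmult; [exact: di|exact: r1]|rewrite /ddA /Re /=; ring].
  apply: (is_derive_ext (fun t => / t * Im (kpsi p a b l t))); first by move=> r; rewrite /dkphi /Im /=; ring.
  by apply: is_derive_eq; [apply: is_derive_Rmult; [exact: di|exact: i1]|rewrite /ddA /Im /=; ring].
have cddA l t : 0 < t -> continuous (ddA l) t.
  move=> tp; apply: filterlim_Cplus; apply: filterlim_Cmult; [exact: cR|exact: cdB| |exact: cB].
  apply: filterlim_C => /=; last exact: filterlim_const.
  have -> : - / (t * (t * 1)) = (-1) * (/ t * / t) by field; lra.
  apply: (@filterlim_ext_loc _ _ _ _ _ (fun t => (-1) * (/ t * / t))).
    by apply: filter_imp (pos_locally tp) => r rp; field; lra.
  by apply: filterlim_Rscal; apply: filterlim_Rmult; exact: inv_cont.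
have ddAb : ldom (fun t l => Cmod (ddA l t)).
  have lp (B1 B2 : R -> freq D -> R) : ldom B1 -> ldom B2 -> ldom (fun t l => B1 t l + B2 t l).
    move=> h1 h2 t tp; have [M1 [s1 H1]] := h1 t tp; have [M2 [s2 H2]] := h2 t tp.
    exists (fun l => M1 l + M2 l); split; first exact: summable_plus.
    by apply: (filter_imp _ _ _ (filter_and _ _ H1 H2)) => r [k1 k2] l; apply: Rplus_le_compat.
  apply: ldom_le (lp _ _ ggi gi2) => t l tp; have it : 0 < / t by apply: Rinv_0_lt_compat.
  apply: Rle_trans (Cmod_triangle _ _) _; apply: Rplus_le_compat; rewrite Cmod_mult Cmod_R.
    rewrite Rabs_pos_eq ?Rmult_assoc; last lra; apply: Rmult_le_compat_l; first lra.
    by have := dkpsi_le s a b l gr tp; rewrite !Rmult_assoc.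
  have -> : Rabs (- / t ^ 2) = / t * / t.
    rewrite Rabs_Ropp Rabs_pos_eq; first by field; lra.
    by apply/Rlt_le/Rinv_0_lt_compat/pow_lt.
  rewrite !Rmult_assoc; apply: Rmult_le_compat_l; first lra; apply: Rmult_le_compat_l; first lra.
  by have := kpsi_le s a b l t gr; have := jap_ge1 l; have := Cmod_ge_0 (kpsi p a b l t); nra.
have phi1 : C1_st (fld (kphi p a b)) := fld_C1 dA cdA JA (ldom_jap JdA).
have psi1 : C1_st (fld (kpsi p a b)) := fld_C1 dB cdB JB dBd.
have dphi1 : C1_st (dt (fld (kphi p a b))).
  apply: (@C1_st_ext D (fld (dkphi p a b))); last exact: (fld_C1 ddAd cddA JdA ddAb).
  by move=> t x tp; rewrite (fld_dtE dA (ldom_jap JA) (ldom_jap JdA)).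
have jc (E : freq D -> R -> C) i t l : jap l * Cmod (Ci * IZR (l i) * E l t)%C <= wt l * Cmod (E l t).
  rewrite !Cmod_mult Cmod_Ci Cmod_R Rmult_1_l -jap_sq Rmult_assoc.
  apply: Rmult_le_compat_l; first by have := jap_ge1 l; lra.
  by apply: Rmult_le_compat_r; [exact: Cmod_ge_0|exact: coord_le_jap].
have jx i : ldom (fun t l => jap l * Cmod (Ci * IZR (l i) * kphi p a b l t)%C).
  by apply: ldom_le WA => t l _; apply: jc.
have xphi1 i : C1_st (dx i (fld (kphi p a b))).
  apply: (@C1_st_ext D (fld (fun l t => Ci * IZR (l i) * kphi p a b l t)%C)).
    by move=> t x tp; rewrite (fld_dxE i JA).
  apply: (@fld_C1 D _ (fun l t => Ci * IZR (l i) * dkphi p a b l t)%C) => //.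
  - by move=> l t tp; apply: is_Cderive_scal; apply: dA.
  - by move=> l t tp; apply: continuous_Cscal; apply: cdA.
  - exact: ldom_coord.
split.
- by move=> t _; split; apply: synth_periodic.
- by split.
- move=> t x tp; rewrite (fld_dtE dA (ldom_jap JA) (ldom_jap JdA)) // eq1 //.
  by rewrite Cmult_assoc -RtoC_mult Rinv_r ?Cmult_1_l //; lra.
- move=> t x tp; rewrite (fld_dtE dB (ldom_jap JB) dBd) //.
  have dxx i : dx i (dx i (fld (kphi p a b))) t x = fld (fun l t => Ci * IZR (l i) * (Ci * IZR (l i) * kphi p a b l t))%C t x.
    rewrite -(fld_dxE i (jx i) x tp) /dx; congr (pd i _ x); apply: functional_extensionality => y.
    exact: (fld_dxE i JA y tp).
  rewrite (eq_bigr (fun i => RtoC (Rpower t (2 - 2 * p i)) * fld (fun l t => Ci * IZR (l i) * (Ci * IZR (l i) * kphi p a b l t)) t x)%C); last by move=> i _; rewrite dxx.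
  have sxx i : csummable (fun l => Ci * IZR (l i) * (Ci * IZR (l i) * kphi p a b l t))%C.
    exact: (ldom_csummable tp (ldom_coord i (jx i))).
  pose qS (S : seq 'I_D) (l : freq D) := \big[Rplus/0]_(i <- S) (Rpower t (2 - 2 * p i) * IZR (l i) ^ 2).
  have sumE (S : seq 'I_D) : \big[Cplus/RtoC 0]_(i <- S) (RtoC (Rpower t (2 - 2 * p i)) * fld (fun l t => Ci * IZR (l i) * (Ci * IZR (l i) * kphi p a b l t)) t x)%C
      = csum (fun l => RtoC (- qS S l) * kphi p a b l t * expi l x)%C
      /\ csummable (fun l => RtoC (- qS S l) * kphi p a b l t * expi l x)%C.
    elim: S => [|i S [IH1 IH2]].
      have z l : (RtoC (- qS [::] l) * kphi p a b l t * expi l x)%C = RtoC 0.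
        by rewrite /qS big_nil Ropp_0; ring.
      split; first by rewrite big_nil (@csum_single D (@freq0 D)) // => l _; apply: z.
      apply: (summable_ext (a := fun _ => 0)) => [l|]; first by rewrite z Cmod_0.
      exact: (proj2 (@rsum_single D (@freq0 D) (fun _ => 0) (fun _ _ => erefl))).
    have e l : (RtoC (- qS (i :: S) l) * kphi p a b l t * expi l x)%C =
      (RtoC (Rpower t (2 - 2 * p i)) * (Ci * IZR (l i) * (Ci * IZR (l i) * kphi p a b l t) * expi l x) +
       RtoC (- qS S l) * kphi p a b l t * expi l x)%C.
      rewrite /qS big_cons !RtoC_opp RtoC_plus RtoC_mult RtoC_pow.
      have -> : (Ci * IZR (l i) * (Ci * IZR (l i) * kphi p a b l t))%C = ((Ci * Ci) * (IZR (l i) * IZR (l i)) * kphi p a b l t)%C by ring.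
      have -> : (Ci * Ci)%C = (- RtoC 1)%C by rewrite /Cmult /Copp /RtoC /=; congr pair; ring.
      by rewrite /=; ring.
    have sx := csummable_expi x (sxx i).
    split.
      rewrite big_cons IH1 /fld /synth -csum_scal // -csum_plus //; last exact: csummable_scal.
      by apply: csum_ext => l; rewrite e.
    apply: (summable_ext (a := fun l => Cmod (RtoC (Rpower t (2 - 2 * p i)) * (Ci * IZR (l i) * (Ci * IZR (l i) * kphi p a b l t) * expi l x) +
       RtoC (- qS S l) * kphi p a b l t * expi l x)%C)).
      by move=> l; rewrite e.
    exact: (csummable_plus (csummable_scal _ sx) IH2).
  rewrite (proj1 (sumE _)) /fld /synth -csum_scal; last exact/csummable_expi/(ldom_csummable tp dBd).
  apply: csum_ext => l; rewrite /dkpsi.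
  have -> : qS (index_enum 'I_D) l = qf p l (ln t).
    by apply: eq_bigr => i _; rewrite /Rpower /expo /=; ring.
  rewrite !Cmult_assoc -RtoC_mult.
  have -> : t * (/ t * - qf p l (ln t)) = - qf p l (ln t) by field; lra.
  by [].
Qed.

Lemma fld_modes D (p : 'I_D -> R) c s (a b : freq D -> C) t l : (0 < D)%nat -> growth p c ->
  INR D / 2 + 1 < s -> cauchy_summable s a b -> 0 < t ->
  fc (fld (kphi p a b) t) l = kphi p a b l t /\ fc (fld (kpsi p a b) t) l = kpsi p a b l t.
Proof.
move=> D0 gr hs sab tp.
have sM := coef_majorant_summable D0 hs sab; have M0 := coef_majorant_ge0 s a b.
split; apply: fld_fc => //; apply: ldom_le (ldom_cont grow_cont sM M0) => r k _.
  have := kphi_le s a b k r gr.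
  by have := wt_ge1 k; have := Cmod_ge_0 (kphi p a b k r); nra.
have := kpsi_le s a b k r gr.
by have := jap_ge1 k; have := Cmod_ge_0 (kpsi p a b k r); nra.
Qed.

Lemma Hs_exponent_le D s r (c : freq D -> C) l : s <= r -> hw s c l <= hw r c l.
Proof. by move=> sr; apply: Rmult_le_compat_r; [apply: pow2_ge_0|apply: wt_Rpower_le]. Qed.

Lemma Rpower_wt_succ D (l : freq D) s : Rpower (wt l) (s + 1) = Rpower (wt l) s * wt l.
Proof. by rewrite Rpower_plus Rpower_1 //; apply: wt_gt0. Qed.

Lemma Rpower_wt_half D (l : freq D) s : Rpower (wt l) (s + 1 / 2) = Rpower (wt l) s * jap l.
Proof.
rewrite Rpower_plus; have -> : 1 / 2 = / 2 by field.
by rewrite Rpower_sqrt //; apply: wt_gt0.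
Qed.

Definition data_weight D s (a b : freq D -> C) (l : freq D) : R := Rpower (wt l) s * data_size l (a l) (b l).

Lemma data_weightE D s (a b : freq D -> C) l : data_weight s a b l = hw (s + 1) a l + hw s b l.
Proof. by rewrite /data_weight /hw /data_size Rpower_wt_succ; ring. Qed.

Lemma data_weight_ge0 D s (a b : freq D -> C) l : 0 <= data_weight s a b l.
Proof. by apply: Rmult_le_pos; [apply/Rlt_le/Rpower_gt0|apply: data_size_ge0]. Qed.

Lemma cauchy_summableE D s (a b : freq D -> C) : cauchy_summable s a b <-> Hs (s + 1) a /\ Hs s b.
Proof.
split=> [h|[/HsE h1 /HsE h2]].
  split; apply: (proj1 (@Hs_dom D _ _ _ _ h)) => l; rewrite -/(data_weight s a b l) data_weightE.
    by have := hw_ge0 s b l; lra.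
  by have := hw_ge0 (s + 1) a l; lra.
by apply: (summable_ext _ (summable_plus h1 h2)) => l; rewrite -data_weightE.
Qed.

Lemma kphi_hw D (p : 'I_D -> R) c s (a b : freq D -> C) t l : growth p c ->
  hw (s + 1) (fun l => kphi p a b l t) l <= grow t * data_weight s a b l.
Proof.
move=> gr; rewrite /hw /data_weight Rpower_wt_succ.
have := kenergy a b l t gr; have := Rpower_gt0 (wt l) s; have := pow2_ge_0 (Cmod (kpsi p a b l t)); nra.
Qed.

Lemma kpsi_hw D (p : 'I_D -> R) c s (a b : freq D -> C) t l : growth p c ->
  hw s (fun l => kpsi p a b l t) l <= grow t * data_weight s a b l.
Proof.
move=> gr; rewrite /hw /data_weight; have := kenergy a b l t gr; have := Rpower_gt0 (wt l) s => p0 e.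
have : 0 <= wt l * Cmod (kphi p a b l t) ^ 2 by apply: Rmult_le_pos; [exact/Rlt_le/wt_gt0|exact: pow2_ge_0].
nra.
Qed.

(** The energy bound [kenergy] controls the weighted squares of the coefficients
    and of their time derivatives locally uniformly in time, so continuity and
    differentiability hold by dominated convergence. *)
Lemma sobolev_synth D (p : 'I_D -> R) c s (a b : freq D -> C) : (0 < D)%nat -> growth p c ->
  INR D / 2 + 1 < s -> cauchy_summable s a b ->
  [/\ curve (fld (kphi p a b)) (fun t => dist_of (fun l => kphi p a b l t)),
      curve (fld (kpsi p a b)) (fun t => dist_of (fun l => kpsi p a b l t)),
      C0_Hs (s + 1) (fun t => dist_of (fun l => kphi p a b l t)) /\
      C0_Hs s (fun t => dist_of (fun l => kpsi p a b l t)) &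
      C1_Hs s (fun t => dist_of (fun l => kphi p a b l t)) /\
      C1_Hs (s - 1) (fun t => dist_of (fun l => kpsi p a b l t))].
Proof.
move=> D0 gr hs sab.
have cs := classical_synth D0 gr hs sab.
have [per [[[c0 _] _] [d0 _]] _ _] := cs.
have sM := coef_majorant_summable D0 hs sab; have M0 := coef_majorant_ge0 s a b.
have dA l t : 0 < t -> is_Cderive (kphi p a b l) t (dkphi p a b l t) by apply: kphi_deriv gr.
have dB l t : 0 < t -> is_Cderive (kpsi p a b l) t (dkpsi p a b l t) by apply: kpsi_deriv gr.
have cA l t : 0 < t -> continuous (kphi p a b l) t by move=> tp; apply: is_Cderive_cont (dA l t tp).
have cB l t : 0 < t -> continuous (kpsi p a b l) t by move=> tp; apply: is_Cderive_cont (dB l t tp).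
have cm (g h : R -> R) : (forall t, 0 < t -> continuous g t) -> (forall t, 0 < t -> continuous h t) ->
    forall t, 0 < t -> continuous (fun t => g t * h t) t.
  by move=> cg ch t tp; apply: filterlim_Rmult; [exact: cg|exact: ch].
have cR t : 0 < t -> continuous (fun t => RtoC (/ t)) t.
  by move=> tp; apply: filterlim_C => /=; [exact: inv_cont|exact: filterlim_const].
have cdA l t : 0 < t -> continuous (dkphi p a b l) t.
  by move=> tp; apply: filterlim_Cmult; [exact: cR|exact: cB].
have cdB l t : 0 < t -> continuous (dkpsi p a b l) t.
  move=> tp; apply: filterlim_Cmult; last exact: cA.
  apply: filterlim_C => /=; last exact: filterlim_const.
  apply: filterlim_Rmult; first exact: inv_cont.
  have [c1 hc] := gr; apply: (continuous_opp (fun t => qf p l (ln t))).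
  by apply: (continuous_comp ln (qf p l)); [exact: ln_cont|apply: pot_cont (symb_potential l c1 hc) _].
have en l t := kenergy a b l t gr.
have w0 (l : freq D) := wt_gt0 l.
have domN (g : R -> R) : (forall t, 0 < t -> continuous g t) -> ldom (fun t l => g t * data_weight s a b l).
  by move=> cg; apply: ldom_cont => // l; apply: data_weight_ge0.
have cii := cm _ _ inv_cont inv_cont.
have hA : ldom (fun t l => hw (s + 1) (fun l => kphi p a b l t) l).
  by apply: ldom_le (domN _ grow_cont) => t l _; apply: kphi_hw gr.
have hB : ldom (fun t l => hw s (fun l => kpsi p a b l t) l).
  by apply: ldom_le (domN _ grow_cont) => t l _; apply: kpsi_hw gr.
have hA' : ldom (fun t l => hw s (fun l => kphi p a b l t) l).
  by apply: ldom_le hA => t l _; apply: Hs_exponent_le; lra.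
have hB' : ldom (fun t l => hw (s - 1) (fun l => kpsi p a b l t) l).
  by apply: ldom_le hB => t l _; apply: Hs_exponent_le; lra.
have hdA : ldom (fun t l => hw s (fun l => dkphi p a b l t) l).
  apply: ldom_le (domN _ (cm _ _ cii grow_cont)) => t l tp; rewrite /hw /data_weight /dkphi Cmod_mult Cmod_R Rpow_mult_distr pow2_abs.
  have -> : Rpower (wt l) s * ((/ t) ^ 2 * Cmod (kpsi p a b l t) ^ 2) = / t * / t * (Rpower (wt l) s * Cmod (kpsi p a b l t) ^ 2) by ring.
  rewrite !Rmult_assoc; have it : 0 < / t by apply: Rinv_0_lt_compat.
  apply: Rmult_le_compat_l; first lra; apply: Rmult_le_compat_l; first lra.
  have := en l t; have := Rpower_gt0 (wt l) s => p0 e.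
  have : 0 <= wt l * Cmod (kphi p a b l t) ^ 2 by apply: Rmult_le_pos; [exact/Rlt_le|exact: pow2_ge_0].
  nra.
have hdB : ldom (fun t l => hw (s - 1) (fun l => dkpsi p a b l t) l).
  apply: ldom_le (domN _ (cm _ _ cii (cm _ _ (cm _ _ grow_cont grow_cont) grow_cont))) => t l tp.
  rewrite /hw /data_weight /dkpsi Cmod_mult Cmod_R Rpow_mult_distr pow2_abs.
  have [q0 q1] := symb_grow l t gr; have g1 := grow_ge1 t.
  have it : 0 < / t by apply: Rinv_0_lt_compat.
  have eW : Rpower (wt l) s = Rpower (wt l) (s - 1) * wt l by rewrite -Rpower_wt_succ; congr Rpower; ring.
  rewrite eW; have := en l t; have := Rpower_gt0 (wt l) (s - 1).
  have := data_size_ge0 l (a l) (b l); have := pow2_ge_0 (Cmod (kpsi p a b l t)); have := pow2_ge_0 (Cmod (kphi p a b l t)).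
  move=> y2 z2 n0 p0 e; set P := Rpower _ _ in p0 *; set Y := Cmod (kphi _ _ _ _ _) ^ 2 in y2 e *.
  set q := qf p l (ln t) in q0 q1 *; set g := grow t in q1 g1 e *; set n := data_size _ _ _ in n0 e *.
  have W0 := w0 l; set W := wt l in q1 e W0 *.
  have k1 : q * q * Y <= g * W * (g * W) * Y by apply: Rmult_le_compat_r => //; apply: Rmult_le_compat.
  have k2 : g * g * W * (W * Y) <= g * g * W * (g * n).
    by apply: Rmult_le_compat_l; [apply: Rmult_le_pos; nra|lra].
  have -> : P * ((/ t * - q) ^ 2 * Y) = / t * / t * P * (q * q * Y) by ring.
  have -> : / t * / t * (g * g * g) * (P * W * n) = / t * / t * P * (g * g * W * (g * n)) by ring.
  by apply: Rmult_le_compat_l; [apply: Rmult_le_pos; nra|lra].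
have reg (f : R -> pt D -> C) (K : freq D -> R -> C) r : C0_st f -> (forall t l, 0 < t -> fc (f t) l = K l t) ->
    ldom (fun t l => hw r (fun l => K l t) l) -> curve f (fun t => dist_of (fun l => K l t)).
  move=> cf e hK t tp; apply: regular_of_fourier => //; first exact: C0_st_ccont.
  move=> l; rewrite e //; apply: (Hs_dist_of (s := r)) => //.
  by have [M [sm HM]] := ldom_at tp hK; apply: (proj1 (Hs_dom HM sm)).
split.
- by apply: (reg _ _ (s + 1)) => // t l tp; case: (fld_modes l D0 gr hs sab tp).
- by apply: (reg _ _ s) => // t l tp; case: (fld_modes l D0 gr hs sab tp).
- by split; apply: C0_Hs_of_coefs.
- by split; [apply: C1_Hs_of_coefs dA cdA hA' hdA|apply: C1_Hs_of_coefs dB cdB hB' hdB].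
Qed.

(** * The scattering map in Sobolev spaces *)

Lemma data_weight_half D s (a b : C) (l : freq D) :
  Rpower (wt l) (s + 1 / 2) * cauchy_size l a b = Rpower (wt l) s * data_size l a b.
Proof. by rewrite Rpower_wt_half data_sizeE; ring. Qed.

(** The weight of the scattering data of a mode in the norm of H_∞, as
    [data_weight] is that of the Cauchy data in the norm of H_C. *)
Definition out_weight D (p : 'I_D -> R) s (Z P : freq D -> C) (l : freq D) : R :=
  Rpower (wt l) (s + 1 / 2) * out_size p l (Z l) (P l).

Lemma out_weightE D (p : 'I_D -> R) s (Z P : freq D -> C) l :
  out_weight p s Z P l = hw (s + 1 / 2) Z l + hw (s + 1 / 2) (fun l => P l + logT p Z l)%C l.
Proof. by rewrite /out_weight /out_size /hw /logT /turn; ring. Qed.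

Lemma out_weight_ge0 D (p : 'I_D -> R) s (Z P : freq D -> C) l : 0 <= out_weight p s Z P l.
Proof. by rewrite out_weightE; have := hw_ge0 (s + 1 / 2) Z l; have := hw_ge0 (s + 1 / 2) (fun l => P l + logT p Z l)%C l; lra. Qed.

Lemma out_weight_summable D (p : 'I_D -> R) s (Z P : freq D -> C) :
  summable (out_weight p s Z P) <-> Hs (s + 1 / 2) Z /\ Hs (s + 1 / 2) (fun l => P l + logT p Z l)%C.
Proof.
split=> [h|[/HsE h1 /HsE h2]].
  split; apply: (proj1 (@Hs_dom D _ _ _ _ h)) => l; rewrite out_weightE.
    by have := hw_ge0 (s + 1 / 2) (fun l => P l + logT p Z l)%C l; lra.
  by have := hw_ge0 (s + 1 / 2) Z l; lra.
by apply: (summable_ext _ (summable_plus h1 h2)) => l; rewrite out_weightE.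
Qed.

(** This pointwise bound and [out_weight_up] are the whole content of the
    isomorphism between the two Hilbert spaces. *)
Lemma out_weight_down D (p : 'I_D -> R) K s (a b : freq D -> C) l : mode_bounds p K l (a l) (b l) ->
  out_weight p s (fun l => outZ p l (a l) (b l)) (fun l => outP p l (a l) (b l)) l <= K * data_weight s a b l.
Proof.
move=> mb; have := mb_down mb; rewrite /out_weight /data_weight -data_weight_half.
by have := Rpower_gt0 (wt l) (s + 1 / 2); nra.
Qed.

Lemma out_weight_up D (p : 'I_D -> R) K s (a b : freq D -> C) l : mode_bounds p K l (a l) (b l) ->
  data_weight s a b l <= K * out_weight p s (fun l => outZ p l (a l) (b l)) (fun l => outP p l (a l) (b l)) l.
Proof.
move=> mb; have := mb_up mb; rewrite /out_weight /data_weight -data_weight_half.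
by have := Rpower_gt0 (wt l) (s + 1 / 2); nra.
Qed.

(** Membership in H_∞ puts ψ_∞ and φ_∞ + log T_* ψ_∞ in H^(s + 1/2); as |log
    t_*|^2 is at most a multiple of <λ>, the multiplier costs at most half a
    derivative and φ_∞ itself lies in H^s. *)
Lemma out_Hs D (p : 'I_D -> R) K s (Z P : freq D -> C) : 1 <= K ->
  (forall l, turn p l ^ 2 <= K * jap l) -> summable (out_weight p s Z P) ->
  (forall l, hw s Z l <= 4 * K * out_weight p s Z P l) /\ (forall l, hw s P l <= 4 * K * out_weight p s Z P l).
Proof.
move=> K1 hT sO.
have E l : out_weight p s Z P l = Rpower (wt l) s * (jap l * out_size p l (Z l) (P l)) by rewrite /out_weight Rpower_wt_half; ring.
have F l X : 4 * K * (Rpower (wt l) s * X) = Rpower (wt l) s * (4 * K * X) by ring.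
split=> l; rewrite E /hw F; (apply: Rmult_le_compat_l; first exact/Rlt_le/Rpower_gt0);
  have J1 := jap_ge1 l; rewrite /out_size.
  set x := Cmod (Z l) ^ 2; set y := Cmod _ ^ 2; have x0 : 0 <= x by apply: pow2_ge_0.
  have y0 : 0 <= y by apply: pow2_ge_0.
  have : 1 * (x + y) <= jap l * (x + y) by apply: Rmult_le_compat_r; lra.
  have : 1 * (jap l * (x + y)) <= K * (jap l * (x + y)) by apply: Rmult_le_compat_r; [apply: Rmult_le_pos|]; lra.
  have : 0 <= jap l * (x + y) by apply: Rmult_le_pos; lra.
  lra.
have -> : P l = (P l + RtoC (turn p l) * Z l + RtoC (- turn p l) * Z l)%C by rewrite RtoC_opp; ring.
apply: Rle_trans (Cmod2_plus _ _) _; rewrite [Cmod (RtoC (- _) * _)%C]Cmod_mult Cmod_R Rpow_mult_distr pow2_abs.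
have -> : (- turn p l) ^ 2 = turn p l ^ 2 by ring.
have -> : (P l + RtoC (turn p l) * Z l + RtoC (- turn p l) * Z l + RtoC (turn p l) * Z l)%C = (P l + RtoC (turn p l) * Z l)%C by rewrite RtoC_opp; ring.
set x := Cmod (Z l) ^ 2; set y := Cmod _ ^ 2; have x0 : 0 <= x by apply: pow2_ge_0.
have y0 : 0 <= y by apply: pow2_ge_0.
have h1 : turn p l ^ 2 * x <= K * jap l * x by apply: Rmult_le_compat_r.
have KJ : 1 <= K * jap l by nra.
have h2 : 1 * y <= K * jap l * y by apply: Rmult_le_compat_r.
have h3 : 0 <= K * jap l * x by apply: Rmult_le_pos; lra.
lra.
Qed.

(** Mode by mode the limits exist by [mode_lim]; the uniform bounds up to t = 0
    of [mode_bounds] lose one factor <λ>, which is the half derivative between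
    H^(s + 1/2) and H^s, and provide the domination. *)
Lemma scattering_synth D (p : 'I_D -> R) c s (a b : freq D -> C) : (0 < D)%nat -> growth p c ->
  INR D / 2 + 1 < s -> cauchy_summable s a b ->
  scattering_data s (fld (kphi p a b)) (fld (kpsi p a b))
    (dist_of (fun l => outZ p l (a l) (b l)), dist_of (fun l => outP p l (a l) (b l))).
Proof.
move=> D0 gr hs sab; have [K [K1 HK]] := modes_bounds gr.
have [cphi cpsi [[hphi _] [hpsi _]] _] := sobolev_synth D0 gr hs sab.
have cs := classical_synth D0 gr hs sab; have [per [[[c0 _] _] [d0 _]] _ _] := cs.
pose Z l := outZ p l (a l) (b l); pose P l := outP p l (a l) (b l).
have od l : out_weight p s Z P l <= K * data_weight s a b l by apply: out_weight_down; case: (HK l) => _; apply.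
have sW : summable (data_weight s a b) by exact: sab.
have sO : summable (out_weight p s Z P).
  by apply: (summable_le _ (summable_scal K sW)) => l; rewrite Rabs_pos_eq //; apply: out_weight_ge0.
have [hZ hP] := out_Hs K1 (fun l => proj1 (HK l)) sO.
have HZ : Hs s Z := proj1 (Hs_dom hZ (summable_scal _ sO)).
have HP : Hs s P := proj1 (Hs_dom hP (summable_scal _ sO)).
have fZ l : fourier (dist_of Z) l = Z l by apply: (Hs_dist_of l D0 HZ).
have fP l : fourier (dist_of P) l = P l by apply: (Hs_dist_of l D0 HP).
have EZ : fourier (dist_of Z) = Z by apply: functional_extensionality.
have EP : fourier (dist_of P) = P by apply: functional_extensionality.
have small : at_right 0 (fun t => 0 < t /\ ln t <= 0).
  exists (mkposreal 1 Rlt_0_1) => t ht tp; split=> //.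
  move: ht; rewrite /ball /= /AbsRing_ball /= /abs /minus /plus /opp /= => /Rabs_def2 ht.
  by rewrite -ln_1; apply: ln_le; lra.
have Eo l : Rpower (wt l) s * (jap l * out_size p l (Z l) (P l)) = out_weight p s Z P l.
  by rewrite /out_weight Rpower_wt_half; ring.
have Cs r (A : freq D -> R -> C) (Y : freq D -> C) (v : distribution D) :
    (forall l, fourier v l = Y l) -> (forall t, 0 < t -> forall l, fourier (dist_of (fun l => A l t)) l = A l t) ->
    (forall l, hw r Y l <= 4 * K * out_weight p s Z P l) ->
    (forall t l, 0 < t -> ln t <= 0 -> Rpower (wt l) r * Cmod (A l t) ^ 2 <= K * out_weight p s Z P l) ->
    (forall l, filterlim (fun t => A l t) (at_right 0) (locally (Y l))) ->
    Hs_cvg r (at_right 0) (fun t => dist_of (fun l => A l t)) v.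
  move=> ev eA hY hA lim.
  apply: (@Hs_cvg_of_coefs D r (at_right 0) _ _ _ (fun l => 10 * K * out_weight p s Z P l)); first exact: summable_scal.
    apply: filter_imp small => t [tp lt0] l; rewrite eA // ev.
    have := Cmod2_minus (A l t) (Y l); have := hA t l tp lt0; have := hY l; rewrite /hw.
    by have := Rpower_gt0 (wt l) r; nra.
  move=> l; rewrite ev; apply: (@filterlim_ext_loc _ _ _ _ _ (fun t => A l t)); last exact: lim.
  by apply: filter_imp small => t [tp _]; rewrite eA.
have Kp (x y z w : R) : 0 <= w -> x <= y * z -> w * x <= y * (w * z) by nra.
have HB t : Hs s (fun l => kpsi p a b l t).
  by apply: (proj1 (@Hs_dom D s _ (fun l => grow t * data_weight s a b l) _ (summable_scal _ sW))) => l; apply: kpsi_hw gr.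
have HA t : Hs s (fun l => kphi p a b l t).
  apply: (proj1 (@Hs_dom D s _ (fun l => grow t * data_weight s a b l) _ (summable_scal _ sW))) => l.
  by apply: Rle_trans (kphi_hw s a b t l gr); apply: Hs_exponent_le; lra.
pose E l t := (kphi p a b l t - RtoC (ln t) * kpsi p a b l t)%C.
have HE t : Hs s (fun l => E l t).
  apply: (proj1 (@Hs_dom D s _ (fun l => 2 * (hw s (fun l => kphi p a b l t) l + ln t ^ 2 * hw s (fun l => kpsi p a b l t) l)) _ _)).
    move=> l; rewrite /hw /E; have := Cmod2_minus (kphi p a b l t) (RtoC (ln t) * kpsi p a b l t)%C.
    rewrite [Cmod (RtoC _ * _)%C]Cmod_mult Cmod_R Rpow_mult_distr pow2_abs.
    by have := Rpower_gt0 (wt l) s; nra.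
  by apply: summable_scal; apply: summable_plus; [exact/HsE|apply: summable_scal; exact/HsE].
split; rewrite /=.
- exists (fun t => dist_of (fun l => kpsi p a b l t)); split=> //.
  + by rewrite EZ.
  apply: (Cs s (kpsi p a b) Z) => //.
  + by move=> t tp l; apply: (Hs_dist_of l D0 (HB t)).
  + move=> t l tp lt0; rewrite -Eo; apply: Kp; first exact/Rlt_le/Rpower_gt0.
    by rewrite -Rmult_assoc; apply: (mb_psi (proj2 (HK l) (a l) (b l)) lt0).
  + by move=> l; apply: (filterlim_comp _ _ _ ln _ _ _ _ is_lim_ln_0); case: (mode_lim l (a l) (b l) gr).
- exists (fun t => dist_of (fun l => E l t)); split=> //.
  + move=> t tp; have cA : ccont (fld (kphi p a b) t) by apply: C0_st_ccont.
    have cB : ccont (fld (kpsi p a b) t) by apply: C0_st_ccont.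
    have [pA pB] := per t tp.
    have e0 : (fun x => fld (kphi p a b) t x - RtoC (ln t) * fld (kpsi p a b) t x)%C =
              (fun x => fld (kphi p a b) t x + RtoC (- ln t) * fld (kpsi p a b) t x)%C.
      by apply: functional_extensionality => x; rewrite RtoC_opp; ring.
    rewrite e0; apply: regular_of_fourier => //.
    * by apply: ccont_plus => //; apply: ccont_scal.
    * move=> l; rewrite (Hs_dist_of l D0 (HE t)) fc_plus ?fc_scal //; last by apply: ccont_scal.
      by have [-> ->] := fld_modes l D0 gr hs sab tp; rewrite /E RtoC_opp; ring.
  + by move=> t tp; rewrite (_ : fourier (dist_of _) = (fun l => E l t)) //;
      apply: functional_extensionality => l; apply: (Hs_dist_of l D0 (HE t)).
  + by rewrite EP.
  apply: (Cs s E P) => //.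
  + by move=> t tp l; apply: (Hs_dist_of l D0 (HE t)).
  + move=> t l tp lt0; rewrite -Eo; apply: Kp; first exact/Rlt_le/Rpower_gt0.
    by rewrite -Rmult_assoc; apply: (mb_phi (proj2 (HK l) (a l) (b l)) lt0).
  + by move=> l; case: (mode_lim l (a l) (b l) gr) => _ h; apply: (filterlim_comp _ _ _ ln _ _ _ _ is_lim_ln_0 h).
Qed.

(** * The Hilbert space isomorphism *)

Lemma cauchy_HC D s (a b : freq D -> C) : (0 < D)%nat -> cauchy_summable s a b ->
  HC s (dist_of a, dist_of b) /\ fourier (dist_of a) = a /\ fourier (dist_of b) = b.
Proof.
move=> D0 /cauchy_summableE [ha hb].
have ea : fourier (dist_of a) = a by apply: functional_extensionality => l; apply: (Hs_dist_of l D0 ha).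
have eb : fourier (dist_of b) = b by apply: functional_extensionality => l; apply: (Hs_dist_of l D0 hb).
by rewrite /HC /= ea eb.
Qed.

(** Mode by mode, the scattering matrix and its inverse. *)
Definition sdown D (p : 'I_D -> R) (c : dpair D) : dpair D :=
  (dist_of (fun l => outZ p l (fourier c.1 l) (fourier c.2 l)),
   dist_of (fun l => outP p l (fourier c.1 l) (fourier c.2 l))).
Definition sup D (p : 'I_D -> R) (z : dpair D) : dpair D :=
  (dist_of (fun l => inA p l (fourier z.1 l) (fourier z.2 l)),
   dist_of (fun l => inB p l (fourier z.1 l) (fourier z.2 l))).

Lemma dpair_ext D (z w : dpair D) : (0 < D)%nat -> (forall l, fourier z.1 l = fourier w.1 l) ->
  (forall l, fourier z.2 l = fourier w.2 l) -> z = w.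
Proof.
by case: z w => [z1 z2] [w1 w2] D0 /= e1 e2; congr pair; apply: dist_ext.
Qed.

Lemma Hinf_out_weight D (p : 'I_D -> R) s (z : dpair D) :
  Hinf p s z <-> summable (out_weight p s (fourier z.1) (fourier z.2)).
Proof. by split=> h; apply/out_weight_summable. Qed.

Lemma HC_data_weight D s (c : dpair D) : HC s c <-> summable (data_weight s (fourier c.1) (fourier c.2)).
Proof. by split=> /cauchy_summableE. Qed.

Lemma HC_normE D s (c : dpair D) : HC s c ->
  HC_norm s c = sqrt (rsum (data_weight s (fourier c.1) (fourier c.2))).
Proof.
move=> [h1 h2]; rewrite /HC_norm !Hs_normsqE // -rsum_plus; try exact/HsE.
by congr sqrt; apply: rsum_ext => l; rewrite data_weightE.
Qed.

Lemma Hinf_normE D (p : 'I_D -> R) s (z : dpair D) : Hinf p s z ->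
  Hinf_norm p s z = sqrt (rsum (out_weight p s (fourier z.1) (fourier z.2))).
Proof.
move=> [h1 h2]; rewrite /Hinf_norm !Hs_normsqE // -rsum_plus; try exact/HsE.
by congr sqrt; apply: rsum_ext => l; rewrite out_weightE.
Qed.

Lemma sdown_fourier D (p : 'I_D -> R) c s (w : dpair D) : (0 < D)%nat -> growth p c -> HC s w ->
  [/\ forall l, fourier (sdown p w).1 l = outZ p l (fourier w.1 l) (fourier w.2 l),
      forall l, fourier (sdown p w).2 l = outP p l (fourier w.1 l) (fourier w.2 l) &
      Hinf p s (sdown p w)].
Proof.
move=> D0 gr hw1; have [K [K1 HK]] := modes_bounds gr.
have sW := proj1 (HC_data_weight s w) hw1.
set Z := fun l => outZ p l (fourier w.1 l) (fourier w.2 l); set P := fun l => outP p l (fourier w.1 l) (fourier w.2 l).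
have sO : summable (out_weight p s Z P).
  apply: (summable_le _ (summable_scal K sW)) => l; rewrite Rabs_pos_eq; last exact: out_weight_ge0.
  by apply: out_weight_down; case: (HK l) => _; apply.
have [hZ hP] := out_Hs K1 (fun l => proj1 (HK l)) sO.
have HZ : Hs s Z := proj1 (Hs_dom hZ (summable_scal _ sO)).
have HP : Hs s P := proj1 (Hs_dom hP (summable_scal _ sO)).
have e1 l : fourier (sdown p w).1 l = Z l by apply: (Hs_dist_of l D0 HZ).
have e2 l : fourier (sdown p w).2 l = P l by apply: (Hs_dist_of l D0 HP).
split=> //; apply/Hinf_out_weight; apply: (summable_ext _ sO) => l.
by rewrite /out_weight e1 e2.
Qed.

Lemma sup_fourier D (p : 'I_D -> R) c s (z : dpair D) : (0 < D)%nat -> growth p c -> Hinf p s z ->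
  [/\ forall l, fourier (sup p z).1 l = inA p l (fourier z.1 l) (fourier z.2 l),
      forall l, fourier (sup p z).2 l = inB p l (fourier z.1 l) (fourier z.2 l) &
      HC s (sup p z)].
Proof.
move=> D0 gr hz; have [K [K1 HK]] := modes_bounds gr.
have sO := proj1 (Hinf_out_weight p s z) hz.
set a := fun l => inA p l (fourier z.1 l) (fourier z.2 l); set b := fun l => inB p l (fourier z.1 l) (fourier z.2 l).
have sW : cauchy_summable s a b.
  apply: (summable_le _ (summable_scal K sO)) => l; rewrite Rabs_pos_eq; last exact: data_weight_ge0.
  have := @out_weight_up D p K s a b l (proj2 (HK l) _ _); rewrite /out_weight /a /b.
  by have [-> ->] := out_in l (fourier z.1 l) (fourier z.2 l) gr.
have [h [e1 e2]] := cauchy_HC D0 sW.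
by split=> // l; [rewrite -[LHS]/(fourier (dist_of a) l) e1|rewrite -[LHS]/(fourier (dist_of b) l) e2].
Qed.

Lemma Hs_lin D s k (c d e : freq D -> C) : Hs s c -> Hs s d ->
  (forall l, e l = k * c l + d l)%C -> Hs s e.
Proof.
move=> /HsE sc /HsE sd h.
apply: (proj1 (@Hs_dom D s e (fun l => 2 * (Cmod k ^ 2 * hw s c l + hw s d l)) _ _)).
  move=> l; rewrite /hw h; have := Cmod2_plus (k * c l)%C (d l).
  rewrite [Cmod (k * _)%C]Cmod_mult Rpow_mult_distr.
  by have := Rpower_gt0 (wt l) s; nra.
by apply: summable_scal; apply: summable_plus => //; apply: summable_scal.
Qed.

Lemma Hs_axpy D s k (u v : distribution D) : Hs s (fourier u) -> Hs s (fourier v) ->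
  Hs s (fourier (dist_add (dist_scal k u) v)).
Proof. by move=> hu hv; apply: (Hs_lin hu hv) => l; rewrite fourier_add fourier_scal. Qed.

(** The scattering matrix of each mode is bounded in both directions, uniformly
    in the frequency, for the weights of the two norms; it is invertible with
    the inverse used in [sup]. *)
Lemma scattering_iso D (p : 'I_D -> R) c s : (0 < D)%nat -> growth p c ->
  hilbert_iso (HC s) (Hinf p s) (HC_norm s) (Hinf_norm p s) (sdown p) (sup p).
Proof.
move=> D0 gr; have [K [K1 HK]] := modes_bounds gr.
have HCax a (z w : dpair D) : HC s z -> HC s w -> HC s (pair_axpy a z w).
  by move=> [z1 z2] [w1 w2]; split; apply: Hs_axpy.
have Hiax a (z w : dpair D) : Hinf p s z -> Hinf p s w -> Hinf p s (pair_axpy a z w).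
  move=> [z1 z2] [w1 w2]; split; first exact: Hs_axpy.
  apply: (@Hs_lin D _ a _ _ _ z2 w2) => l.
  by rewrite /renormalized /logT /= !fourier_add !fourier_scal; ring.
split.
- split.
  + by move=> w hw1; case: (sdown_fourier D0 gr hw1).
  + move=> a z w hz hw1; have [e1 e2 _] := sdown_fourier D0 gr (HCax a z w hz hw1).
    have [z1 z2 _] := sdown_fourier D0 gr hz; have [w1 w2 _] := sdown_fourier D0 gr hw1.
    apply: dpair_ext => // l; first by rewrite e1 /= !fourier_add !fourier_scal z1 w1 /outZ; ring.
    by rewrite e2 /= !fourier_add !fourier_scal z2 w2 /outP; ring.
  + exists (sqrt K) => w hw1; have [e1 e2 hd] := sdown_fourier D0 gr hw1.
    rewrite (HC_normE hw1) (Hinf_normE hd) -sqrt_mult_alt; last lra.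
    rewrite -rsum_scal; apply: sqrt_le_1_alt; apply: rsum_le.
    * exact/Hinf_out_weight.
    * by apply: summable_scal; apply/HC_data_weight.
    * by move=> l; rewrite {1}/out_weight e1 e2; apply: out_weight_down; case: (HK l) => _; apply.
- split.
  + by move=> z hz; case: (sup_fourier D0 gr hz).
  + move=> a z w hz hw1; have [e1 e2 _] := sup_fourier D0 gr (Hiax a z w hz hw1).
    have [z1 z2 _] := sup_fourier D0 gr hz; have [w1 w2 _] := sup_fourier D0 gr hw1.
    apply: dpair_ext => // l; first by rewrite e1 /= !fourier_add !fourier_scal z1 w1 /inA; ring.
    by rewrite e2 /= !fourier_add !fourier_scal z2 w2 /inB; ring.
  + exists (sqrt K) => z hz; have [e1 e2 hd] := sup_fourier D0 gr hz.
    rewrite (HC_normE hd) (Hinf_normE hz) -sqrt_mult_alt; last lra.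
    rewrite -rsum_scal; apply: sqrt_le_1_alt; apply: rsum_le.
    * exact/HC_data_weight.
    * by apply: summable_scal; apply/Hinf_out_weight.
    * move=> l; have := @out_weight_up D p K s (fourier (sup p z).1) (fourier (sup p z).2) l (proj2 (HK l) _ _).
      by rewrite /out_weight e1 e2; have [-> ->] := out_in l (fourier z.1 l) (fourier z.2 l) gr.
- move=> w hw1; have [e1 e2 hd] := sdown_fourier D0 gr hw1; have [z1 z2 _] := sup_fourier D0 gr hd.
  by apply: dpair_ext => // l; rewrite ?z1 ?z2 e1 e2; case: (in_out l (fourier w.1 l) (fourier w.2 l) gr).
- move=> z hz; have [z1 z2 hd] := sup_fourier D0 gr hz; have [e1 e2 _] := sdown_fourier D0 gr hd.
  by apply: dpair_ext => // l; rewrite ?e1 ?e2 z1 z2; case: (out_in l (fourier z.1 l) (fourier z.2 l) gr).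
Qed.

(** At t = 1 the first equation reads dt φ = ψ, so the Cauchy data are the
    values of φ and ψ there. *)
Lemma classical_cauchy D (p : 'I_D -> R) phi psi phiC psiC : (0 < D)%nat -> classical_solution p phi psi ->
  cauchy_data phi phiC psiC <-> (forall l, fourier phiC l = fc (phi 1) l) /\ (forall l, fourier psiC l = fc (psi 1) l).
Proof.
move=> D0 [per [[[c0 [e0 [ct cx]]] _] [d0 _]] eq1 _].
have E : dt phi 1 = psi 1.
  by apply: functional_extensionality => x; rewrite -eq1 ?Cmult_1_l //; lra.
rewrite /cauchy_data E; split=> -[h1 h2]; split.
- by move=> l; apply: regular_fourier.
- by move=> l; apply: regular_fourier.
- by apply: regular_of_fourier => //; apply: C0_st_ccont => //; lra.
- by apply: regular_of_fourier => //; apply: C0_st_ccont => //; lra.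
Qed.

Lemma solution_exists D (p : 'I_D -> R) c s (w : dpair D) : (0 < D)%nat -> growth p c ->
  INR D / 2 + 1 < s -> HC s w -> exists phi psi,
  [/\ classical_solution p phi psi, sobolev_regular s phi psi, cauchy_data phi w.1 w.2 &
      scattering_data s phi psi (sdown p w)].
Proof.
move=> D0 gr hs /cauchy_summableE sW; set a := fourier w.1 in sW *; set b := fourier w.2 in sW *.
have cs := classical_synth D0 gr hs sW.
exists (fld (kphi p a b)), (fld (kpsi p a b)); split=> //.
- exists (fun t => dist_of (fun l => kphi p a b l t)), (fun t => dist_of (fun l => kpsi p a b l t)).
  exact: (sobolev_synth D0 gr hs sW).
- apply/(classical_cauchy _ _ D0 cs).
  have e l := fld_modes l D0 gr hs sW Rlt_0_1.
  by split=> l; have [e1 e2] := e l; rewrite ?e1 ?e2 /kphi /kpsi ln_1; case: (mode_init l (a l) (b l) gr) => m1 m2; rewrite ?m1 ?m2.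
- exact: (scattering_synth D0 gr hs sW).
Qed.

Theorem theorem1p3 (D : nat) (p : 'I_D -> R) (pphi : R)
    (hD : (0 < D)%nat) (hK : kasner p pphi) (hnd : nondegenerate p) :
  (* (i) *)
  (forall (s : R) (phiC psiC : distribution D),
     INR D / 2 + 1 < s ->
     Hs (s + 1) (fourier phiC) -> Hs s (fourier psiC) ->
     exists phi psi : R -> pt D -> C,
       (classical_solution p phi psi /\ cauchy_data phi phiC psiC) /\
       (forall phi' psi',
          classical_solution p phi' psi' -> cauchy_data phi' phiC psiC ->
          same_solution phi psi phi' psi') /\
       exists z : dpair D,
         (scattering_data s phi psi z /\
          forall z', scattering_data s phi psi z' -> z' = z) /\
         Hinf p s z)
  /\
  (* (ii) *)
  (forall (s : R) (z : dpair D),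
     INR D / 2 + 1 < s -> Hinf p s z ->
     exists_unique_solution (fun phi psi : R -> pt D -> C =>
       [/\ classical_solution p phi psi,
           sobolev_regular s phi psi &
           scattering_data s phi psi z]))
  /\
  (* (iii) *)
  (forall s : R,
     exists Sdown Sup : dpair D -> dpair D,
       [/\ hilbert_iso (HC s) (Hinf p s) (HC_norm s) (Hinf_norm p s) Sdown Sup,
           (forall (s' : R) (c z : dpair D) (phi psi : R -> pt D -> C),
              INR D / 2 + 1 < s' -> HC s' c -> HC s c ->
              classical_solution p phi psi -> cauchy_data phi c.1 c.2 ->
              scattering_data s' phi psi z -> Sdown c = z) &
           (forall (s' : R) (z : dpair D) (phi psi : R -> pt D -> C),
              INR D / 2 + 1 < s' -> Hinf p s' z -> Hinf p s z ->
              classical_solution p phi psi -> sobolev_regular s' phi psi ->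
              scattering_data s' phi psi z ->
              regular (phi 1) (Sup z).1 /\ regular (psi 1) (Sup z).2)]).
Proof.
have [c gr] : exists c, growth p c := kasner_expo hK hnd.
have P1 : 0 < 1 := Rlt_0_1.
split; [|split].
- move=> s phiC psiC hs h1 h2.
  have hw1 : HC s (phiC, psiC) by split.
  have [phi [psi [cs sr cd sd]]] := solution_exists hD gr hs hw1.
  exists phi, psi; split=> //; split.
    move=> phi' psi' cs' cd'.
    have [a1 a2] := proj1 (classical_cauchy phiC psiC hD cs) cd; have [b1 b2] := proj1 (classical_cauchy phiC psiC hD cs') cd'.
    by apply: (classical_determined hD gr cs cs') => l; rewrite -?a1 -?a2 ?b1 ?b2.
  exists (sdown p (phiC, psiC)); split; last by case: (sdown_fourier hD gr hw1).
  split=> // z' sd'; apply: dpair_ext => // l; have [a1 a2] := scattering_coefs l gr cs sd;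
    have [b1 b2] := scattering_coefs l gr cs sd'; [by rewrite a1 b1|by rewrite a2 b2].
- move=> s z hs hz; have [_ _ hw1] := sup_fourier hD gr hz.
  have [phi [psi [cs sr cd sd]]] := solution_exists hD gr hs hw1.
  have [_ _ _ inv] := @scattering_iso D p c s hD gr.
  rewrite (inv z hz) in sd.
  exists phi, psi; split=> // phi' psi' [cs' _ sd'].
  apply: (classical_determined hD gr cs cs') => l; have [a1 a2] := scattering_coefs l gr cs sd;
    have [b1 b2] := scattering_coefs l gr cs' sd'.
    have [<- _] := in_out l (fc (phi 1) l) (fc (psi 1) l) gr; have [<- _] := in_out l (fc (phi' 1) l) (fc (psi' 1) l) gr.
    by rewrite -a1 -a2 -b1 -b2.
  have [_ <-] := in_out l (fc (phi 1) l) (fc (psi 1) l) gr; have [_ <-] := in_out l (fc (phi' 1) l) (fc (psi' 1) l) gr.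
  by rewrite -a1 -a2 -b1 -b2.
- move=> s; exists (sdown p), (sup p); split; first exact: scattering_iso gr.
  + move=> s' w z phi psi _ _ hw1 cs cd sd; have [e1 e2 _] := sdown_fourier hD gr hw1.
    have [a1 a2] := proj1 (classical_cauchy w.1 w.2 hD cs) cd.
    by apply: dpair_ext => // l; have [b1 b2] := scattering_coefs l gr cs sd; rewrite ?e1 ?e2 a1 a2 ?b1 ?b2.
  + move=> s' z phi psi _ _ hz cs _ sd; have [e1 e2 _] := sup_fourier hD gr hz.
    have [per [[[c0 _] _] [d0 _]] _ _] := cs.
    by split; apply: regular_of_fourier => //; (try exact: C0_st_ccont) => l;
      have [b1 b2] := scattering_coefs l gr cs sd; rewrite ?e1 ?e2 b1 b2; case: (in_out l (fc (phi 1) l) (fc (psi 1) l) gr).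
Qed.
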